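(* Let $n\in\{1,2\}$, $b,\kappa>0$ and $\gamma\in\mathbb{R}\setminus\{0\}$. Assume $(\widetilde u_0,\widetilde u_1)\in (H^1)^n\times (L^2)^n$ with $\widetilde u_0,\widetilde u_1$ rotation-free, and $(\widetilde\theta_0,\widetilde\theta_1)\in L^2\times (L^2\cap L^1)$. Let $(\widetilde u,\widetilde\theta)$ be the solution of the thermoelastic system of type II $$\begin{cases} \widetilde u_{tt}-b^2\Delta \widetilde u+\gamma\nabla\widetilde\theta=0,\\ \widetilde\theta_{tt}-\kappa\Delta\widetilde\theta+\gamma\,\mathrm{div}\,\widetilde u_{tt}=0,\\ (\widetilde u,\widetilde u_t)(0,x)=(\widetilde u_0,\widetilde u_1)(x),\quad (\widetilde\theta,\widetilde\theta_t)(0,x)=(\widetilde\theta_0,\widetilde\theta_1)(x),\end{cases}\qquad x\in\mathbb{R}^n,\ t>0.$$ Then the temperature difference $\widetilde\theta$ exists globally in time with $\widetilde\theta\in\mathcal{C}([0,+\infty),L^2)$, and it satisfies, for all $t>0$, $$\|\widetilde\theta(t,\cdot)\|_{L^2}\lesssim \mathcal{E}_n(1+t)\left(\|(\widetilde u_0,\widetilde u_1)\|_{(H^1)^n\times(L^2)^n}+\|(\widetilde\theta_0,\widetilde\theta_1)\|_{L^2\times(L^2\cap L^1)}\right).$$ Furthermore, if $n=2$ assume $(\alpha_0-\alpha_2)^2(\alpha_1-\alpha_2)>2(\alpha_0+\alpha_2)^2(\alpha_1+\alpha_2)$ or $(\alpha_0+\alpha_2)^2(\alpha_1+\alpha_2)>2(\alpha_0-\alpha_2)^2(\alpha_1-\alpha_2)$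 (no restriction if $n=1$), and assume additionally $\widetilde\theta_1\in L^{1,1}$. Then, provided that $P_{\widetilde\theta_1}\neq0$, $$\|\widetilde\theta(t,\cdot)\|_{L^2}\gtrsim \mathcal{E}_n(1+t)\,|P_{\widetilde\theta_1}|\quad\text{for large time } t\gg1.$$
   Context: All function spaces are over $\mathbb{R}^n$; $\widetilde u(t,x)\in\mathbb{R}^n$, $\widetilde\theta(t,x)\in\mathbb{R}$. $L^{1,1}:=\{f\in L^1:\ \|(1+|x|)f\|_{L^1}<+\infty\}$. Fourier transform: $\widehat f(\xi)=\int_{\mathbb{R}^n}e^{-ix\cdot\xi}f(x)\,dx$ (extended to $L^2$). For integrable $f$, $P_f:=\int_{\mathbb{R}^n}f(x)\,dx$. A vector field $w=(w^1,\dots,w^n)$ is rotation-free if $\partial_jw^k=\partial_kw^j$ in the sense of distributions for all $j,k$ (equivalently $\widehat w(\xi)$ is parallel to $\xi$ for a.e. $\xi$; automatic if $n=1$). The solution is understood via the partial Fourier transform: for a.e. $\xi$, the Fourier transforms $(U,\Theta)(t,\xi)$ of $(\widetilde u,\widetilde\theta)$ solve the linear ODE system $U_{tt}+b^2|\xi|^2U+i\gamma\xi\Theta=0$, $\Theta_{tt}+\kappa|\xi|^2\Theta+i\gamma\xi\cdot U_{tt}=0$ with initial values given by the Fourier transforms of the data. Constants: $\alpha_0:=b^2-\kappa-\gamma^2$, $\alpha_1:=b^2+\kappa+\gamma^2$, $\alpha_2:=\sqrt{\alpha_1^2-4b^2\kappa}$. Rate function (for $n\leqslant2$): $\mathcal{E}_1(1+t):=(1+t)^{\frac12}$,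 $\mathcal{E}_2(1+t):=[\ln(e+t)]^{\frac12}$. $f\lesssim g$ means $f\leqslant Cg$ with a constant $C>0$ independent of $t$ and of the initial data; $\gtrsim$ is analogous. ''For large time $t\gg1$'' means for all $t\geqslant T$ with some $T$ that may depend on the data. *)

(* Defs.v *)
From HB Require Import structures.
From mathcomp Require Import all_boot all_order all_algebra.
From mathcomp Require Import complex.
From mathcomp Require Import all_classical all_reals all_analysis.

Set Implicit Arguments.
Unset Strict Implicit.
Unset Printing Implicit Defensive.

Import Order.TTheory GRing.Theory Num.Theory.
Import numFieldNormedType.Exports.

Local Open Scope classical_set_scope.
Local Open Scope ring_scope.
Local Open Scope complex_scope.

(* R^n is 'rV[R]_n. Its sigma-algebra is generated by the coordinates, i.e. it
   is the Borel sigma-algebra. *)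
Definition rV_display : measure_display. Proof. exact: default_measure_display. Qed.

Section measurable_rV.
Context (R : realType) (n : nat).

Definition rV_coord (i : 'I_n) (x : 'rV[R]_n) : measurableTypeR R := x ord0 i.

Let rV_set0 : g_sigma_preimage rV_coord set0.
Proof. exact: sigma_algebra0. Qed.

Let rV_setC A : g_sigma_preimage rV_coord A -> g_sigma_preimage rV_coord (~` A).
Proof. exact: sigma_algebraC. Qed.

Let rV_bigcup (F : _^nat) : (forall i, g_sigma_preimage rV_coord (F i)) ->
  g_sigma_preimage rV_coord (\bigcup_i (F i)).
Proof. exact: sigma_algebra_bigcup. Qed.

HB.instance Definition _ := @isMeasurable.Build rV_display
  'rV[R]_n (g_sigma_preimage rV_coord) rV_set0 rV_setC rV_bigcup.

Lemma measurable_rV_coord (i : 'I_n) : measurable_fun [set: 'rV[R]_n] (rV_coord i).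
Proof.
move=> _ Y mY; rewrite setTI; apply: sub_sigma_algebra => /=.
rewrite -bigcup_seq/=; exists i => /=; first by rewrite mem_index_enum.
by exists Y => //; rewrite setTI.
Qed.

Lemma measurable_fun_rVP d (T : measurableType d) (f : T -> 'rV[R]_n) :
  (forall i, measurable_fun [set: T] (rV_coord i \o f)) ->
  measurable_fun [set: T] f.
Proof.
move=> mf _ A mA; rewrite setTI.
have : preimage_set_system [set: T] f (g_sigma_preimage rV_coord) (f @^-1` A).
  by exists A => //; rewrite setTI.
rewrite -g_sigma_preimage_comp; apply: smallest_sub.
  exact: sigma_algebra_measurable.
rewrite -bigcup_seq; apply: bigcup_sub => i _ B [C mC <-].
exact: mf.
Qed.

End measurable_rV.

(* Lebesgue measure on R^n, by recursion on n: the image of the product measure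
   on R x R^n under (s, x) |-> (s, x_1, ..., x_n). *)
Section lebesgue_rV.
Context (R : realType).

Definition rV_cons (n : nat) (p : (measurableTypeR R * 'rV[R]_n)%type) : 'rV[R]_n.+1 :=
  row_mx (p.1 : R)%:M p.2 : 'rV[R]_(1 + n).

Lemma rV_consE0 n p : @rV_cons n p ord0 ord0 = p.1.
Proof.
have -> : (ord0 : 'I_n.+1) = lshift n (ord0 : 'I_1) by exact/val_inj.
by apply: etrans (row_mxEl _ _ _ _) _; rewrite mxE eqxx mulr1n.
Qed.

Lemma rV_consES n p (i : 'I_n) : @rV_cons n p ord0 (lift ord0 i) = p.2 ord0 i.
Proof.
have -> : lift ord0 i = rshift 1 i by exact/val_inj.
exact: row_mxEr.
Qed.

Lemma measurable_rV_cons n : measurable_fun setT (@rV_cons n).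
Proof.
apply: measurable_fun_rVP => i.
have [j ->|->] := unliftP ord0 i.
  rewrite (_ : _ \o _ = rV_coord j \o snd); last first.
    by apply/funext => p; exact: rV_consES.
  apply: measurableT_comp; first exact: measurable_rV_coord.
  exact: measurable_snd.
rewrite (_ : _ \o _ = fst); first exact: measurable_fst.
by apply/funext => p; exact: rV_consE0.
Qed.

Definition rV_uncons (n : nat) (x : 'rV[R]_n.+1) : measurableTypeR R * 'rV[R]_n :=
  (rV_coord ord0 x, \row_i x ord0 (lift ord0 i)).

Lemma rV_consK n : cancel (@rV_cons n) (@rV_uncons n).
Proof.
move=> [s x]; rewrite /rV_uncons /rV_coord rV_consE0; congr pair.
by apply/rowP => i; rewrite mxE rV_consES.
Qed.

Lemma measurable_rV_uncons n : measurable_fun setT (@rV_uncons n).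
Proof.
apply/measurable_fun_pairP; split.
  exact: (measurable_rV_coord (ord0 : 'I_n.+1)).
apply: measurable_fun_rVP => i.
rewrite (_ : _ \o _ = rV_coord (lift ord0 i)); first exact: measurable_rV_coord.
by apply/funext => x; rewrite /rV_coord /= mxE.
Qed.

Section step.
Context (n : nat) (mu : {sigma_finite_measure set 'rV[R]_n -> \bar R}).

Definition lebesgue_rV_step : set 'rV[R]_n.+1 -> \bar R :=
  pushforward (@lebesgue_measure R \x mu)%E (@rV_cons n).

Let step0 : lebesgue_rV_step set0 = 0%E.
Proof. by rewrite /lebesgue_rV_step /pushforward preimage_set0 measure0. Qed.

Let step_ge0 A : (0 <= lebesgue_rV_step A)%E.
Proof. by rewrite /lebesgue_rV_step /pushforward measure_ge0. Qed.

Let step_sigma_additive : semi_sigma_additive lebesgue_rV_step.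
Proof.
have mE B : measurable B -> measurable (@rV_cons n @^-1` B).
  by move=> mB; rewrite -[X in measurable X]setTI; exact: measurable_rV_cons.
move=> F mF tF mUF; rewrite /lebesgue_rV_step /pushforward preimage_bigcup.
apply: measure_semi_sigma_additive.
- by move=> k; exact: mE.
- apply/trivIsetP => /= i j _ _ ij; rewrite -preimage_setI.
  by move/trivIsetP : tF => /(_ _ _ _ _ ij) ->//; rewrite preimage_set0.
- by rewrite -preimage_bigcup; exact: mE.
Qed.

HB.instance Definition _ := isMeasure.Build _ _ _ lebesgue_rV_step
  step0 step_ge0 step_sigma_additive.

Let step_sigma_finite : sigma_finite setT lebesgue_rV_step.
Proof.
have /sigma_finiteP[F [TF ndF Foo]] := sigma_finiteT (@lebesgue_measure R).
have /sigma_finiteP[G [TG ndG Goo]] := sigma_finiteT mu.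
exists (fun k => @rV_uncons n @^-1` (F k `*` G k)).
  rewrite -preimage_bigcup (_ : \bigcup_i _ = setT) ?preimage_setT//.
  rewrite -setXTT TF TG predeqE => -[x y]; split.
    by move=> [k _ []/= ? ?]; split; exists k.
  move=> [/= [k _ Fkx] [l _ Gly]]; exists (maxn k l) => //; split.
  - by move: x Fkx; exact/subsetPset/ndF/leq_maxl.
  - by move: y Gly; exact/subsetPset/ndG/leq_maxr.
move=> k; have [mF Fk] := Foo k; have [mG Gk] := Goo k; split.
  rewrite -[X in measurable X]setTI; apply: measurable_rV_uncons => //.
  exact: measurableX.
rewrite /lebesgue_rV_step /pushforward -comp_preimage.
rewrite (_ : _ \o _ = id); last by apply/funext; exact: rV_consK.
by rewrite preimage_id product_measure1E// lte_mul_pinfty// ge0_fin_numE.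
Qed.

HB.instance Definition _ := Measure_isSigmaFinite.Build _ _ _ lebesgue_rV_step
  step_sigma_finite.

End step.

Fixpoint lebesgue_rV (n : nat) : {sigma_finite_measure set 'rV[R]_n -> \bar R} :=
  match n with
  | 0 => \d_(0 : 'rV[R]_0)
  | m.+1 => lebesgue_rV_step (lebesgue_rV m)
  end.

Lemma lebesgue_rV_box (n : nat) (A : 'I_n -> set (measurableTypeR R)) :
  (forall i, measurable (A i)) ->
  lebesgue_rV n [set x : 'rV[R]_n | forall i, A i (x ord0 i)] =
  (\prod_(i < n) lebesgue_measure (A i))%E.
Proof.
elim: n A => [|n IH] A mA.
  rewrite big_ord0 /= diracE mem_set//.
  by case.
rewrite big_ord_recl.
transitivity ((@lebesgue_measure R \x lebesgue_rV n)%E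
    (A ord0 `*` [set x : 'rV[R]_n | forall i, A (lift ord0 i) (x ord0 i)])).
  congr ((@lebesgue_measure R \x lebesgue_rV n)%E _).
  apply/seteqP; split => -[s x] /=.
    move=> H; split; first by have := H ord0; rewrite rV_consE0.
    by move=> i; have := H (lift ord0 i); rewrite rV_consES.
  move=> [As Ax] i; have [j ->|->] := unliftP ord0 i.
    by rewrite rV_consES; exact: Ax.
  by rewrite rV_consE0.
rewrite product_measure1E //; last first.
  rewrite (_ : [set _ | _] = \bigcap_(i in [set: 'I_n])
     (rV_coord i @^-1` (A (lift ord0 i)))); last first.
    by apply/seteqP; split => x /= H i => [_|]; exact: H.
  apply: fin_bigcap_measurable => [|i _]; first exact: finite_finset.
  by rewrite -[X in measurable X]setTI; exact: measurable_rV_coord.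
by congr (_ * _)%E; apply: IH.
Qed.

End lebesgue_rV.

Section function_spaces.
Context (R : realType) (n : nat).
Local Notation E := 'rV[R]_n.
Local Notation mu := (lebesgue_rV R n).
Implicit Types (f g phi : E -> R) (w : E -> E) (x xi : E).

Definition dotrV x xi : R := \sum_(j < n) x ord0 j * xi ord0 j.

Definition enorm x : R := Num.sqrt (dotrV x x).

Definition component w (k : 'I_n) : E -> R := fun x => w x ord0 k.

Definition partial (j : 'I_n) f : E -> R := fun x => 'D_(delta_mx ord0 j) f x.

(* [:: j1; ...; jm] stands for the derivative d_j1 ... d_jm *)
Definition iter_partial (s : seq 'I_n) f : E -> R := foldr partial f s.

Definition smooth f : Prop := forall s : seq 'I_n,
  continuous (iter_partial s f) /\
  forall (j : 'I_n) x, derivable (iter_partial s f) x (delta_mx ord0 j).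

Definition test_function phi : Prop :=
  smooth phi /\ compact (closure [set x | phi x != 0]).

Definition inL1 f : Prop := f \in Lfun mu 1.
Definition inL2 f : Prop := f \in Lfun mu 2%:E.
Definition L1norm f : \bar R := 'N[mu]_1[EFin \o f].
Definition L2norm f : \bar R := 'N[mu]_2%:E[EFin \o f].

Definition weighted f : E -> R := fun x => (1 + enorm x) * f x.

Definition inL11 f : Prop := inL1 f /\ inL1 (weighted f).

Definition total_mass f : R := \int[mu]_x f x.

Definition weak_partial (j : 'I_n) f g : Prop := forall phi, test_function phi ->
  \int[mu]_x (f x * partial j phi x) = - \int[mu]_x (g x * phi x).

Definition inH1 f : Prop :=
  inL2 f /\ forall j, exists g, inL2 g /\ weak_partial j f g.

(* A representative of the weak derivative, when there is one in L^2; it is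
   unique up to a null set. *)
Definition wpartial (j : 'I_n) f : E -> R :=
  xget (cst 0) [set g | inL2 g /\ weak_partial j f g].

Definition H1norm f : \bar R :=
  ((L2norm f `^ 2 + \sum_(j < n) L2norm (wpartial j f) `^ 2) `^ 2^-1)%E.

Definition rotation_free w : Prop :=
  forall (j k : 'I_n) phi, test_function phi ->
  \int[mu]_x (component w k x * partial j phi x) =
  \int[mu]_x (component w j x * partial k phi x).

End function_spaces.

Section fourier.
Context (R : realType) (n : nat).
Local Notation E := 'rV[R]_n.
Local Notation mu := (lebesgue_rV R n).
Implicit Types (f : E -> R) (g : E -> R[i]).

Definition fourierL1 f (xi : E) : R[i] :=
  (\int[mu]_x (cos (dotrV x xi) * f x)) -i* (\int[mu]_x (sin (dotrV x xi) * f x)).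

Definition inL2C g : Prop :=
  inL2 (fun xi => complex.Re (g xi)) /\ inL2 (fun xi => complex.Im (g xi)).

Definition L2normC g : \bar R := L2norm (fun xi => complex.Re `|g xi|).

(* The continuous extension of the Fourier transform from L^1 /\ L^2 to L^2;
   [g] is determined up to a null set, hence a relation. *)
Definition is_fourier f g : Prop :=
  [/\ inL2 f, inL2C g &
    exists f_ : nat -> E -> R,
      [/\ forall k, inL1 (f_ k) /\ inL2 (f_ k),
          L2norm (fun x => f_ k x - f x) @[k --> \oo] --> 0%E &
          L2normC (fun xi => fourierL1 (f_ k) xi - g xi) @[k --> \oo] --> 0%E]].

End fourier.

Section system.
Context (R : realType) (n : nat) (b kappa gamma : R).
Local Notation E := 'rV[R]_n.
Local Notation mu := (lebesgue_rV R n).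
Implicit Types (h : R -> R[i]) (c : R[i]).

Definition is_deriveC h (t : R) c : Prop :=
  is_derive t 1 (fun s => complex.Re (h s)) (complex.Re c) /\
  is_derive t 1 (fun s => complex.Im (h s)) (complex.Im c).

Definition right_cvgC h c : Prop :=
  complex.Re (h s) @[s --> 0^'+] --> complex.Re c /\
  complex.Im (h s) @[s --> 0^'+] --> complex.Im c.

(* The Cauchy problem at the frequency [xi], on [0, +oo[. *)
Definition ode_solution (xi : E) (U0 U1 : 'rV[R[i]]_n) (Th0 Th1 : R[i])
    (U : R -> 'rV[R[i]]_n) (Th : R -> R[i]) : Prop :=
  exists (Ut Utt : R -> 'rV[R[i]]_n) (Tht Thtt : R -> R[i]),
  [/\ forall t : R, 0 < t ->
        [/\ forall k, is_deriveC (fun s => U s ord0 k) t (Ut t ord0 k),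
            forall k, is_deriveC (fun s => Ut s ord0 k) t (Utt t ord0 k),
            is_deriveC Th t (Tht t) & is_deriveC Tht t (Thtt t)],
      forall t : R, 0 < t ->
        (forall k, Utt t ord0 k + (b ^+ 2 * enorm xi ^+ 2)%:C * U t ord0 k
           + 'i * (gamma * xi ord0 k)%:C * Th t = 0) /\
        Thtt t + (kappa * enorm xi ^+ 2)%:C * Th t
          + 'i * gamma%:C * (\sum_k (xi ord0 k)%:C * Utt t ord0 k) = 0,
      U 0 = U0 /\ Th 0 = Th0 &
      [/\ forall k, right_cvgC (fun s => U s ord0 k) (U0 ord0 k),
          forall k, right_cvgC (fun s => Ut s ord0 k) (U1 ord0 k),
          right_cvgC Th Th0 & right_cvgC Tht Th1]].

Definition admissible_data (u0 u1 : E -> E) (th0 th1 : E -> R) : Prop :=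
  [/\ (forall k, inH1 (component u0 k)) /\ rotation_free u0,
      (forall k, inL2 (component u1 k)) /\ rotation_free u1,
      inL2 th0 & inL2 th1 /\ inL1 th1].

Definition data_norm (u0 u1 : E -> E) (th0 th1 : E -> R) : \bar R :=
  ((\sum_(k < n) H1norm (component u0 k) + \sum_(k < n) L2norm (component u1 k))
   + (L2norm th0 + (L2norm th1 + L1norm th1)))%E.

(* Solution of
     u_tt - b^2 Delta u + gamma grad th = 0,
     th_tt - kappa Delta th + gamma div u_tt = 0
   through the partial Fourier transform. *)
Definition is_solution (u0 u1 : E -> E) (th0 th1 : E -> R)
    (u : R -> E -> E) (th : R -> E -> R) : Prop :=
  exists (U0 U1 : E -> 'rV[R[i]]_n) (Th0 Th1 : E -> R[i])
         (U : R -> E -> 'rV[R[i]]_n) (Th : R -> E -> R[i]),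
  [/\ forall k, is_fourier (component u0 k) (fun xi => U0 xi ord0 k) /\
                is_fourier (component u1 k) (fun xi => U1 xi ord0 k),
      is_fourier th0 Th0 /\ is_fourier th1 Th1,
      forall t : R, 0 <= t ->
        (forall k, is_fourier (component (u t) k) (fun xi => U t xi ord0 k)) /\
        is_fourier (th t) (Th t) &
      {ae mu, forall xi, ode_solution xi (U0 xi) (U1 xi) (Th0 xi) (Th1 xi)
                           (fun t => U t xi) (fun t => Th t xi)}].

Definition C0_L2 (th : R -> E -> R) : Prop :=
  forall t : R, 0 <= t -> inL2 (th t) /\
  L2norm (fun x => th s x - th t x) @[s --> within [set s | 0 <= s] (nbhs t)]
    --> 0%E.

Definition alpha0 : R := b ^+ 2 - kappa - gamma ^+ 2.
Definition alpha1 : R := b ^+ 2 + kappa + gamma ^+ 2.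
Definition alpha2 : R := Num.sqrt (alpha1 ^+ 2 - 4 * b ^+ 2 * kappa).

End system.

(* [rate n t] is E_n(1 + t), for n = 1, 2 *)
Definition rate (R : realType) (n : nat) (t : R) : R :=
  if n == 1%N then Num.sqrt (1 + t) else Num.sqrt (ln (expR 1 + t)).

(* Main.v *)
Require Import Defs.
From mathcomp Require Import all_boot all_order all_algebra.
From mathcomp Require Import all_classical all_reals all_analysis.
From mathcomp Require Import measurable_realfun complex ring lra.

Set Implicit Arguments.
Unset Strict Implicit.
Unset Printing Implicit Defensive.

Import Order.TTheory GRing.Theory Num.Theory.
Import numFieldNormedType.Exports.

Local Open Scope classical_set_scope.
Local Open Scope ring_scope.

(** Plancherel moves every L^2 question about [th t] to the frequency side. For almost every [xi],
    put [r = |xi|], let [Q] be the real or imaginary part of the transform of the temperature, and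
    let [v = xi . X], where [X] is the matching part of the transform of the displacement up to
    sign. Then [(Q, v)'' = - r^2 M (Q, v)] for a constant 2x2 matrix [M], whose eigenvalues [lam i]
    are the roots of [l^2 - alpha1 l + b^2 kappa]: real, positive and distinct. So [Q] is an
    explicit sum of two oscillations of frequencies [om i * r], with [om i] the square root of
    [lam i] ([scalar_unique], [ode_unique]).

    In this formula the initial values [Q0] and [v0] come with cosines. Both are square integrable,
    [v0] because it is the transform of the divergence of an H^1 field. The initial velocities come
    with [sin (om r t) / (om r)]. For [v1 = xi . X1] the factor [xi] compensates [1 / r], but for
    [Q1], the transform of [th1], nothing does. Hence [Q = Rf + Gf * Q1] ([Qf_split]), where [Rf] is
    bounded in L^2 uniformly in time and [|Gf|] is at most a constant times [min(t, 1/r)].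

    Upper bound: for [r >= 1] the multiplier [Gf] is bounded. For [r < 1] the values of [Q1] are
    bounded by the L^1 norm of [th1], and the integral of [min(t, 1/r)^2] over the unit ball is of
    order [1 + t] in dimension 1 and [ln (e + t)] in dimension 2, as the decomposition into shells
    [k <= t r < k + 1] shows ([radial_upper]).

    Lower bound: the first moment of [th1] makes its transform Lipschitz, so near the origin the
    real part of [Q1] stays above half the total mass in modulus ([cosT_near0]). There
    [Gf = waves (r t) / r], where [waves] superposes two sines of distinct frequencies and has slope
    1 at 0. In dimension 1 the region [r] of order [1 / t] already contributes [t^2 / t]. In
    dimension 2 the two sines cannot cancel for long: every interval of a fixed length contains a
    window of a fixed length on which [waves] stays away from 0 ([waves_window]), and these windows
    contribute a harmonic sum of length of order [t], that is [ln t] ([radial_lower]). Since the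
    rate tends to infinity, the bounded part [Rf] is eventually absorbed.

    The rest is Fourier analysis built for this purpose: the Plancherel identity, computed on boxes
    ([box_parseval]) and extended to step functions and to L^2; the L^2 bound on [xi_i] times a
    transform given by a weak derivative ([isF_weak_partial]); and the surjectivity of the transform
    on pairs of the right parity ([isF_surj]), deduced from the self-adjoint Hartley transform,
    which turns the explicit frequency solution into an actual one ([solution_exists]). *)

Module L2Space.

(** * The space L^2 of real functions over a measure *)

Lemma cvg_toE (R : realType) (I : Type) (F : set_system I) (FF : Filter F)
    (u : I -> R) (l : R) :
  u i @[i --> F] --> l -> ((u i)%:E @[i --> F] --> l%:E)%E.
Proof. by move=> ul; apply: cvg_EFin => //; exact: nearW. Qed.
Arguments cvg_toE {R I F FF u l}.

Section L2.
Context d (T : measurableType d) (R : realType) (mu : {measure set T -> \bar R}).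
Implicit Types f g h : T -> R.

(** [sq] is extended-real valued and decides membership in [L2]; [ip] and [nrm] are plain reals,
    meaningful on [L2] only, so that norm estimates become real arithmetic. *)
Definition sq f : \bar R := (\int[mu]_x (f x ^+ 2)%:E)%E.
Definition L2 f := measurable_fun setT f /\ (sq f < +oo)%E.
Definition ip f g : R := \int[mu]_x (f x * g x).
Definition nrm f : R := Num.sqrt (ip f f).
Definition cvgL2 (f_ : nat -> T -> R) f :=
  nrm (fun x => f_ k x - f x) @[k --> \oo] --> (0 : R).

Lemma sq_ge0 f : (0 <= sq f)%E.
Proof. by apply: integral_ge0 => x _; rewrite lee_fin sqr_ge0. Qed.

Lemma Lnorm2E f : ('N[mu]_2%:E[EFin \o f] = sq f `^ 2^-1)%E.
Proof.
rewrite unlock /sq; congr (_ `^ _)%E; apply: eq_integral => x _ /=.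
by rewrite powR_mulrn// real_normK// num_real.
Qed.

Lemma Lfun2P f : f \in Lfun mu 2%:E <-> L2 f.
Proof.
split=> [/andP[]|[mf sf]].
  rewrite !inE/= /finite_norm => mf; rewrite Lnorm2E => sf; split=> //.
  by rewrite (@lty_poweRy _ _ 2^-1).
by apply/andP; rewrite !inE/= /finite_norm; split=> //; rewrite Lnorm2E poweR_lty.
Qed.

Lemma L2_mf f : L2 f -> measurable_fun setT f. Proof. by case. Qed.

Lemma L2_mul f g : L2 f -> L2 g -> mu.-integrable setT (EFin \o (fun x => f x * g x)).
Proof.
by move=> /Lfun2P f2 /Lfun2P g2; have /Lfun1_integrable := Lfun2_mul_Lfun1 f2 g2.
Qed.

Lemma sqE f : L2 f -> sq f = (ip f f)%:E.
Proof.
move=> f2; rewrite /ip /Rintegral fineK; last exact/integrable_fin_num/(L2_mul f2 f2).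
by apply: eq_integral => x _; rewrite expr2.
Qed.

Lemma ip_ge0 f : 0 <= ip f f.
Proof. by apply: Rintegral_ge0 => x _; rewrite -expr2 sqr_ge0. Qed.

Lemma nrm_ge0 f : 0 <= nrm f. Proof. exact: sqrtr_ge0. Qed.

Lemma nrm2 f : nrm f ^+ 2 = ip f f. Proof. by rewrite sqr_sqrtr// ip_ge0. Qed.

Lemma Lnorm_nrm f : L2 f -> ('N[mu]_2%:E[EFin \o f] = (nrm f)%:E)%E.
Proof.
move=> f2; rewrite Lnorm2E sqE// poweR_EFin; congr EFin.
by rewrite powR12_sqrt// ip_ge0.
Qed.

Lemma L2_le f g c : measurable_fun setT f -> L2 g ->
  (forall x, `|f x| <= c * `|g x|) -> L2 f.
Proof.
move=> mf [mg sg] fg; split=> //.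
have c2 x : f x ^+ 2 <= c ^+ 2 * g x ^+ 2.
  rewrite -(real_normK (num_real (f x))) -(real_normK (num_real (g x))) -exprMn.
  by rewrite lerXn2r ?nnegrE//; exact: le_trans (fg x).
apply: (@le_lt_trans _ _ ((c ^+ 2)%:E * sq g)%E); last first.
  by rewrite lte_mul_pinfty// lee_fin sqr_ge0.
rewrite -ge0_integralZl//; last 3 first.
- by apply/measurable_EFinP; exact: measurable_funX.
- by move=> x _; rewrite lee_fin sqr_ge0.
- by rewrite lee_fin sqr_ge0.
apply: ge0_le_integral => //.
- by move=> x _; rewrite lee_fin sqr_ge0.
- by apply/measurable_EFinP; exact: measurable_funX.
- by apply/measurable_funeM/measurable_EFinP; exact: measurable_funX.
- by move=> x _; rewrite -EFinM lee_fin.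
Qed.


Lemma L2D f g : L2 f -> L2 g -> L2 (fun x => f x + g x).
Proof.
move=> [mf sf] [mg sg]; split; first exact: measurable_funD.
apply: (@le_lt_trans _ _ (2%:E * sq f + 2%:E * sq g)%E); last first.
  by rewrite lte_add_pinfty// lte_mul_pinfty.
have m2 h : measurable_fun setT h -> measurable_fun setT (fun x => (h x ^+ 2)%:E).
  by move=> mh; apply/measurable_EFinP; exact: measurable_funX.
have e h : measurable_fun setT h ->
    (2%:E * sq h = \int[mu]_x (2 * h x ^+ 2)%:E)%E.
  move=> mh; rewrite /sq -ge0_integralZl//; first exact: m2.
  by move=> x _; rewrite lee_fin sqr_ge0.
have mm h : measurable_fun setT h -> measurable_fun setT (fun x => (2 * h x ^+ 2)%:E).
  by move=> mh; apply/measurable_EFinP/measurable_funM => //; exact: measurable_funX.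
rewrite !e// -ge0_integralD//; last 4 first.
- by move=> x _; rewrite lee_fin mulr_ge0// sqr_ge0.
- exact: mm.
- by move=> x _; rewrite lee_fin mulr_ge0// sqr_ge0.
- exact: mm.
apply: ge0_le_integral => //=.
- by move=> x _; rewrite lee_fin sqr_ge0.
- exact/m2/measurable_funD.
- by apply: emeasurable_funD; exact: mm.
- move=> x _; rewrite -EFinD lee_fin -subr_ge0.
  rewrite (_ : _ - _ = (f x - g x) ^+ 2) ?sqr_ge0//; ring.
Qed.

Lemma L2Z (c : R) f : L2 f -> L2 (fun x => c * f x).
Proof.
move=> f2; apply: (@L2_le _ f `|c|) => //.
  by apply: measurable_funM => //; case: f2.
by move=> x; rewrite normrM.
Qed.

Lemma L2N f : L2 f -> L2 (fun x => - f x).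
Proof.
move=> f2; rewrite (_ : (fun _ => _) = (fun x => -1 * f x)); first exact: L2Z.
by apply/funext => x; rewrite mulN1r.
Qed.

Lemma L2B f g : L2 f -> L2 g -> L2 (fun x => f x - g x).
Proof. by move=> f2 g2; apply: L2D => //; exact: L2N. Qed.

Lemma L2_0 : L2 (fun=> 0).
Proof.
split => //; rewrite /sq; under eq_integral do rewrite expr0n/=.
by rewrite integral0.
Qed.

Lemma L2_sum (I : Type) (s : seq I) (F : I -> T -> R) :
  (forall i, L2 (F i)) -> L2 (fun x => \sum_(i <- s) F i x).
Proof.
move=> F2; elim: s => [|i s IH].
  by under eq_fun do rewrite big_nil; exact: L2_0.
by under eq_fun do rewrite big_cons; exact: L2D.
Qed.

Lemma ipC f g : ip f g = ip g f.
Proof. by rewrite /ip; under eq_Rintegral do rewrite mulrC. Qed.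

Lemma ipDl f g h : L2 f -> L2 g -> L2 h -> ip (fun x => f x + g x) h = ip f h + ip g h.
Proof.
move=> f2 g2 h2; rewrite /ip; under eq_Rintegral do rewrite mulrDl.
by rewrite RintegralD//; exact: L2_mul.
Qed.

Lemma ipZl c f h : L2 f -> L2 h -> ip (fun x => c * f x) h = c * ip f h.
Proof.
move=> f2 h2; rewrite /ip; under eq_Rintegral do rewrite -mulrA.
by rewrite RintegralZl//; exact: L2_mul.
Qed.

Lemma ipBl f g h : L2 f -> L2 g -> L2 h -> ip (fun x => f x - g x) h = ip f h - ip g h.
Proof.
move=> f2 g2 h2; rewrite /ip; under eq_Rintegral do rewrite mulrBl.
by rewrite RintegralB//; exact: L2_mul.
Qed.

Lemma ipBr f g h : L2 f -> L2 g -> L2 h -> ip h (fun x => f x - g x) = ip h f - ip h g.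
Proof. by move=> f2 g2 h2; rewrite ipC ipBl// !(ipC h). Qed.

Lemma ipDr f g h : L2 f -> L2 g -> L2 h -> ip h (fun x => f x + g x) = ip h f + ip h g.
Proof. by move=> f2 g2 h2; rewrite ipC ipDl// !(ipC h). Qed.

Lemma ipZr c f h : L2 f -> L2 h -> ip h (fun x => c * f x) = c * ip h f.
Proof. by move=> f2 h2; rewrite ipC ipZl// ipC. Qed.

Lemma cauchy_schwarz f g : L2 f -> L2 g -> `|ip f g| <= nrm f * nrm g.
Proof.
move=> f2 g2.
have H c : 0 <= ip f f - 2 * c * ip f g + c ^+ 2 * ip g g.
  have cg2 := L2Z c g2; have fg2 := L2B f2 cg2.
  rewrite (_ : _ + _ = ip (fun x => f x - c * g x) (fun x => f x - c * g x)) ?ip_ge0//.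
  by rewrite ipBl// !ipBr// !ipZl// !ipZr// (ipC g f); ring.
have [g0|g0] := eqVneq (ip g g) 0.
  have -> : ip f g = 0.
    apply/eqP/negP => /negP n0.
    (* This [c] makes the quadratic in [H] equal to [-1]. *)
    have := H ((ip f f + 1) / (2 * ip f g)); rewrite g0 mulr0 addr0.
    have -> : 2 * ((ip f f + 1) / (2 * ip f g)) * ip f g = ip f f + 1 by field.
    by lra.
  by rewrite normr0 mulr_ge0// nrm_ge0.
have gp : 0 < ip g g by rewrite lt_def g0 ip_ge0.
have := H (ip f g / ip g g).
rewrite (_ : _ + _ = ip f f - ip f g ^+ 2 / ip g g); last by field.
rewrite subr_ge0 ler_pdivrMr// => le.
by rewrite -sqrtr_sqr -sqrtrM ?ip_ge0// ler_wsqrtr.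
Qed.

Lemma nrmD f g : L2 f -> L2 g -> nrm (fun x => f x + g x) <= nrm f + nrm g.
Proof.
move=> f2 g2; have fg2 := L2D f2 g2.
rewrite -(@ler_pXn2r _ 2)// ?nnegrE ?addr_ge0 ?nrm_ge0//.
rewrite nrm2 ipDl// !ipDr// sqrrD !nrm2 (ipC g f).
have := cauchy_schwarz f2 g2; rewrite ler_norml => /andP[_ cs]; lra.
Qed.

Lemma nrmZ c f : L2 f -> nrm (fun x => c * f x) = `|c| * nrm f.
Proof.
move=> f2; rewrite /nrm ipZl//; last exact: L2Z.
by rewrite ipZr// mulrA -expr2 sqrtrM ?sqr_ge0// sqrtr_sqr.
Qed.

Lemma nrmN f : nrm (fun x => - f x) = nrm f.
Proof. by rewrite /nrm /ip; under eq_Rintegral do rewrite mulrNN. Qed.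

Lemma nrmBC f g : nrm (fun x => f x - g x) = nrm (fun x => g x - f x).
Proof. by rewrite -nrmN; congr nrm; apply/funext => x; rewrite opprB. Qed.

Lemma nrm_tri g f h : L2 f -> L2 g -> L2 h ->
  nrm (fun x => f x - h x) <= nrm (fun x => f x - g x) + nrm (fun x => g x - h x).
Proof.
move=> f2 g2 h2; apply: le_trans (nrmD (L2B f2 g2) (L2B g2 h2)).
by rewrite le_eqVlt; apply/orP; left; apply/eqP; congr nrm; apply/funext => x; ring.
Qed.

Lemma nrmD_sq f g : L2 f -> L2 g -> ip (fun x => f x + g x) (fun x => f x + g x) <=
  2 * ip f f + 2 * ip g g.
Proof.
move=> f2 g2; have := ip_ge0 (fun x => f x - g x).
have := L2D f2 g2; have := L2B f2 g2 => ? ?.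
rewrite ipBl// ipBr// ipBr// ipDl// ipDr// ipDr// (ipC g f); lra.
Qed.

Lemma nrm_le f g c : measurable_fun setT f -> L2 g -> 0 <= c ->
  (forall x, `|f x| <= c * `|g x|) -> nrm f <= c * nrm g.
Proof.
move=> mf g2 c0 fg; have f2 := L2_le mf g2 fg.
rewrite -[c]ger0_norm// -nrmZ// ler_wsqrtr// -lee_fin -!sqE//; last exact: L2Z.
apply: ge0_le_integral => //=.
- by move=> x _; rewrite lee_fin sqr_ge0.
- by apply/measurable_EFinP; exact: measurable_funX.
- apply/measurable_EFinP; apply: measurable_funX; apply: measurable_funM => //.
  exact: L2_mf.
- move=> x _; rewrite lee_fin exprMn -(real_normK (num_real (f x))).
  rewrite -(real_normK (num_real (g x))) -exprMn lerXn2r ?nnegrE//.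
  by rewrite mulr_ge0.
Qed.

Lemma eq_ae_sq f g : measurable_fun setT f -> measurable_fun setT g ->
  {ae mu, forall x, f x = g x} -> sq f = sq g.
Proof.
move=> mf mg fg; apply: ge0_ae_eq_integral => //=.
- by apply/measurable_EFinP; exact: measurable_funX.
- by apply/measurable_EFinP; exact: measurable_funX.
- by move=> x _; rewrite lee_fin sqr_ge0.
- by move=> x _; rewrite lee_fin sqr_ge0.
- by move: fg; apply: filterS => x /= -> _.
Qed.

Lemma eq_ae_nrm f g : L2 f -> measurable_fun setT g ->
  {ae mu, forall x, f x = g x} -> L2 g /\ nrm f = nrm g.
Proof.
move=> f2 mg fg; have e := eq_ae_sq (L2_mf f2) mg fg.
have g2 : L2 g by split=> //; rewrite -e; case: f2.
split=> //; rewrite /nrm; congr Num.sqrt; apply: EFin_inj.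
by rewrite -!sqE.
Qed.

Lemma nrm0_ae f : L2 f -> nrm f = 0 -> {ae mu, forall x, f x = 0}.
Proof.
move=> f2 n0.
have : sq f = 0%E by rewrite sqE// -nrm2 n0 expr0n.
have mf : measurable_fun setT (fun x => (f x ^+ 2)%:E).
  by apply/measurable_EFinP/measurable_funX; case: f2.
rewrite /sq (_ : (\int[mu]_x _)%E = (\int[mu]_x `|(f x ^+ 2)%:E|)%E); last first.
  by apply: eq_integral => x _; rewrite /= ger0_norm// sqr_ge0.
move=> /(ae_eq_integral_abs mu measurableT mf).
by apply: filterS => x /= /(_ Logic.I) [] /eqP; rewrite sqrf_eq0 => /eqP.
Qed.

Lemma cvgL2P (f_ : nat -> T -> R) f : (forall k, L2 (f_ k)) -> L2 f ->
  cvgL2 f_ f <-> ('N[mu]_2%:E[EFin \o (fun x => f_ k x - f x)%R] @[k --> \oo] --> 0)%E.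
Proof.
move=> fk2 f2.
rewrite (_ : (fun k => _) = EFin \o (fun k => nrm (fun x => f_ k x - f x))); last first.
  by apply/funext => k; rewrite /= -Lnorm_nrm//; exact: L2B.
split=> [c|/fine_cvgP[_]//].
by apply/fine_cvgP; split=> //; exact: nearW.
Qed.

Lemma cvgL2_cst f : L2 f -> cvgL2 (fun=> f) f.
Proof.
move=> f2; rewrite /cvgL2 (_ : (fun k => _) = cst 0); first exact: cvg_cst.
apply/funext => k; rewrite /nrm /ip; under eq_Rintegral do rewrite subrr mul0r.
by rewrite /Rintegral integral0 sqrtr0.
Qed.

Lemma cvgL2_ip (f_ g_ : nat -> T -> R) f g :
  (forall k, L2 (f_ k)) -> L2 f -> (forall k, L2 (g_ k)) -> L2 g ->
  cvgL2 f_ f -> cvgL2 g_ g -> ip (f_ k) (g_ k) @[k --> \oo] --> ip f g.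
Proof.
move=> fk2 f2 gk2 g2 cf cg; apply/cvgrPdist_le => /= e e0.
have : (fun k => nrm (fun x => f_ k x - f x) * nrm (fun x => g_ k x - g x) +
   nrm f * nrm (fun x => g_ k x - g x) + nrm (fun x => f_ k x - f x) * nrm g)
   @ \oo --> (0 * 0 + nrm f * 0 + 0 * nrm g : R).
  apply: cvgD; first apply: cvgD.
  - exact: cvgM.
  - by apply: cvgM => //; exact: cvg_cst.
  - by apply: cvgM => //; exact: cvg_cst.
rewrite !mul0r mulr0 !addr0 => /cvgrPdist_le /(_ _ e0).
apply: filterS => k; rewrite sub0r normrN => h.
have a2 := L2B (fk2 k) f2; have b2 := L2B (gk2 k) g2.
rewrite ger0_norm in h; last by rewrite !addr_ge0// mulr_ge0// nrm_ge0.
apply: le_trans h.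
have -> : ip f g - ip (f_ k) (g_ k) =
   - (ip (fun x => f_ k x - f x) (fun x => g_ k x - g x) +
      ip f (fun x => g_ k x - g x) + ip (fun x => f_ k x - f x) g).
  by rewrite ipBl// !ipBr// ipBl//; ring.
rewrite normrN; apply: le_trans (ler_normD _ _) _; apply: lerD; last exact: cauchy_schwarz.
apply: le_trans (ler_normD _ _) _; apply: lerD; exact: cauchy_schwarz.
Qed.

Lemma cvg_nrmD (f_ g_ : nat -> T -> R) f g : cvgL2 f_ f -> cvgL2 g_ g ->
  nrm (fun x => f_ k x - f x) + nrm (fun x => g_ k x - g x) @[k --> \oo] --> (0 : R).
Proof. by move=> cf cg; rewrite -[0]addr0; exact: cvgD. Qed.

Lemma cvgL2D (f_ g_ : nat -> T -> R) f g :
  (forall k, L2 (f_ k)) -> L2 f -> (forall k, L2 (g_ k)) -> L2 g ->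
  cvgL2 f_ f -> cvgL2 g_ g -> cvgL2 (fun k x => f_ k x + g_ k x) (fun x => f x + g x).
Proof.
move=> fk2 f2 gk2 g2 cf cg.
apply: (squeeze_cvgr _ (cvg_cst 0) (cvg_nrmD cf cg)); apply: nearW => k; rewrite nrm_ge0/=.
rewrite (_ : (fun x => _) = (fun x => (f_ k x - f x) + (g_ k x - g x))).
  exact: nrmD (L2B _ _) (L2B _ _).
by apply/funext => x; ring.
Qed.

Lemma cvgL2Z (c : R) (f_ : nat -> T -> R) f : (forall k, L2 (f_ k)) -> L2 f ->
  cvgL2 f_ f -> cvgL2 (fun k x => c * f_ k x) (fun x => c * f x).
Proof.
move=> fk2 f2 cf.
rewrite /cvgL2 (_ : (fun k => _) = (fun k => `|c| * nrm (fun x => f_ k x - f x))).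
  by rewrite -(mulr0 `|c|); apply: cvgM => //; exact: cvg_cst.
apply/funext => k; rewrite -nrmZ; last exact: L2B.
by congr nrm; apply/funext => x; rewrite mulrBr.
Qed.

Lemma cvgL2_unique (f_ : nat -> T -> R) f g : (forall k, L2 (f_ k)) -> L2 f -> L2 g ->
  cvgL2 f_ f -> cvgL2 f_ g -> {ae mu, forall x, f x = g x}.
Proof.
move=> fk2 f2 g2 cf cg.
have n0 : nrm (fun x => f x - g x) = 0.
  apply/eqP; rewrite eq_le nrm_ge0 andbT.
  apply: (cvgr_to_ge (cvg_nrmD cf cg)); apply: nearW => k; rewrite (nrmBC (f_ k) f); exact: nrm_tri.
by have := nrm0_ae (L2B f2 g2) n0; apply: filterS => x /eqP; rewrite subr_eq0 => /eqP.
Qed.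

(** Fatou's lemma for squared norms. It puts a pointwise limit into L^2 in [L2_complete],
    [transform_cvgL2] and [isF_weak_partial]. *)
Lemma L2_fatou (f_ : nat -> T -> R) f (c : R) : measurable_fun setT f ->
  (forall k, L2 (f_ k)) -> {ae mu, forall x, f_ k x @[k --> \oo] --> f x} ->
  (\forall k \near \oo, ip (f_ k) (f_ k) <= c) -> L2 f /\ ip f f <= c.
Proof.
move=> mf fk2 fkf fkc.
have m2 h : measurable_fun setT h -> measurable_fun setT (fun x => (h x ^+ 2)%:E).
  by move=> mh; apply/measurable_EFinP; exact: measurable_funX.
have sfc : (sq f <= c%:E)%E.
  apply: (@le_trans _ _ (\int[mu]_x limn_einf (fun k => (f_ k x ^+ 2)%:E))%E).
    apply: ae_ge0_le_integral => //=.
    - by move=> x _; rewrite lee_fin sqr_ge0.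
    - exact: m2.
    - move=> x _; rewrite limn_einf_lim; apply: lime_ge.
        exact: is_cvg_einfs.
      by apply: nearW => k; apply: le_ereal_inf_tmp => _ [m _ <-]; rewrite lee_fin sqr_ge0.
    - rewrite (_ : (fun x => _) = (fun x => - limn_esup (fun k => - (f_ k x ^+ 2)%:E))%E).
        apply: measurableT_comp => //; apply: measurable_fun_limn_esup => k.
        by apply: measurableT_comp => //; apply: m2; case: (fk2 k).
      by apply/funext => x; rewrite -limn_einfN; congr limn_einf; apply/funext => k /=; rewrite ?opprK.
    - move: fkf; apply: filterS => x fx _.
      have fx2 : f_ k x ^+ 2 @[k --> \oo] --> f x ^+ 2.
        by rewrite expr2; under eq_fun do rewrite expr2; exact: cvgM.
      by have [->] := cvg_limn_einf_sup (cvg_toE fx2).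
  apply: le_trans.
    apply: fatou => // [k|k x _]; first by apply: m2; case: (fk2 k).
    by rewrite lee_fin sqr_ge0.
  case: fkc => N _ Nc; rewrite limn_einf_lim; apply: lime_le; first exact: is_cvg_einfs.
  apply: nearW => k; apply: le_trans (ereal_inf_lbound _) _.
    by exists (k + N)%N; [rewrite /= leq_addr|reflexivity].
  rewrite [leLHS](sqE (fk2 _)) lee_fin; apply: Nc; exact: leq_addl.
have f2 : L2 f by split=> //; apply: le_lt_trans sfc _; rewrite ltry.
by split=> //; rewrite -lee_fin -sqE.
Qed.

Lemma cvgL2_dominated (f_ : nat -> T -> R) f g : (forall k, measurable_fun setT (f_ k)) ->
  measurable_fun setT f -> L2 g -> (forall x, f_ k x @[k --> \oo] --> f x) ->
  (forall k x, `|f_ k x| <= `|g x|) -> cvgL2 f_ f.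
Proof.
move=> mfk mf g2 fkf fkg.
have fg x : `|f x| <= `|g x|.
  by apply: (cvgr_to_le (cvg_norm (fkf x))); exact: nearW.
have fk2 k : L2 (f_ k) by apply: (@L2_le _ g 1) => // x; rewrite mul1r.
have f2 : L2 f by apply: (@L2_le _ g 1) => // x; rewrite mul1r.
have d2 k : L2 (fun x => f_ k x - f x) by exact: L2B.
have gg2 : L2 (fun x => 2 * g x) by exact: L2Z.
have H : ip (fun x => f_ k x - f x) (fun x => f_ k x - f x) @[k --> \oo] --> (0 : R).
  apply: fine_cvg; rewrite [X in _ --> X](_ : _ = \int[mu]_x (cst 0 x))%E; last first.
    by rewrite integral0.
  apply: (@dominated_cvg _ _ _ mu _ _ _ _ (fun x => ((2 * g x) * (2 * g x))%:E)) => //.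
  - move=> k; apply/measurable_EFinP; apply: measurable_funM; exact: L2_mf.
  - move=> x _; apply: cvg_EFin; first exact: nearW.
    have c : f_ k x - f x @[k --> \oo] --> 0.
      by rewrite -(subrr (f x)); apply: cvgB => //; exact: cvg_cst.
    by rewrite /comp/= -(mulr0 0); apply: cvgM.
  - exact: L2_mul.
  - move=> k x _ /=; rewrite lee_fin -!expr2 normrX.
    have h : `|f_ k x - f x| <= 2 * `|g x|.
      by apply: le_trans (ler_normB _ _) _; rewrite mulr_natl mulr2n; exact: lerD.
    rewrite exprMn -[g x ^+ 2](real_normK (num_real (g x))) -exprMn.
    by rewrite lerXn2r// nnegrE mulr_ge0.
rewrite /cvgL2 -(@sqrtr0 R).
exact: (cvg_comp _ _ H (@sqrt_continuous R 0)).
Qed.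

(** Riesz-Fischer: a fast subsequence converges almost everywhere by telescoping, and Fatou turns
    this into convergence in norm of the whole sequence. *)
Lemma L2_complete (f_ : nat -> T -> R) : (forall k, L2 (f_ k)) ->
  (forall e, 0 < e -> exists N, forall m n, (N <= m)%N -> (N <= n)%N ->
     nrm (fun x => f_ m x - f_ n x) <= e) ->
  exists2 f, L2 f & cvgL2 f_ f.
Proof.
move=> fk2 cauchy.
have /choice[N0 N0P] : forall k : nat, exists N, forall m n, (N <= m)%N -> (N <= n)%N ->
     nrm (fun x => f_ m x - f_ n x) <= 4^-1 ^+ k.
  by move=> k; apply: cauchy; rewrite exprn_gt0.
(* Taking maxima makes the indices nondecreasing, so that [n k] and [n k.+1] both lie beyond
   [N0 k]. *)
pose n k := (\max_(j < k.+1) N0 j)%N.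
have nN k : (N0 k <= n k)%N by exact: (@leq_bigmax _ (fun j : 'I_k.+1 => N0 j) ord_max).
have nS k : (n k <= n k.+1)%N by rewrite /n [leqRHS]big_ord_recr/= leq_maxl.
have nmono j k : (j <= k)%N -> (n j <= n k)%N.
  by move=> jk; apply: (homo_leq (leqnn) leq_trans nS).
pose h k x := f_ (n k.+1) x - f_ (n k) x.
have h2 k : L2 (h k) by exact: L2B.
(* The increment [h k] has squared norm at most [16^-k], so the weight [4^k] keeps the integral of
   [S] finite; where [S x] is finite, [|h k x|] is at most [2^-k] times the square root of [S x]. *)
pose S x := (\sum_(0 <= k <oo) (4 ^+ k * h k x ^+ 2)%:E)%E.
have mh k : measurable_fun setT (fun x => (4 ^+ k * h k x ^+ 2)%:E).
  by apply/measurable_EFinP/measurable_funM => //; apply: measurable_funX; exact: L2_mf.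
have h0 k x : (0 <= (4 ^+ k * h k x ^+ 2)%:E)%E.
  by rewrite lee_fin mulr_ge0// ?sqr_ge0// exprn_ge0.
have Sfin : (\int[mu]_x S x < +oo)%E.
  rewrite /S integral_nneseries//.
  apply: (@le_lt_trans _ _ (1 / (1 - 4^-1))%:E); last exact: ltry.
  apply: lime_le; first by apply: is_cvg_nneseries => k _ _; exact: integral_ge0.
  apply: nearW => m.
  apply: (@le_trans _ _ (\sum_(0 <= k < m) (4^-1 ^+ k)%:E)%E); last first.
    rewrite sumEFin lee_fin.
    have := @geometric_le_lim R m 1 4^-1 ler01.
    rewrite /series/= => H; under eq_bigr => i _ do rewrite -[4^-1 ^+ i]mul1r.
    by apply: H; rewrite ?invr_gt0// gtr0_norm ?invf_lt1// ltr1n.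
  apply: lee_sum => k _.
  under eq_integral do rewrite EFinM.
  rewrite ge0_integralZl//; last 2 first.
  - by apply/measurable_EFinP; apply: measurable_funX; exact: L2_mf.
  - by move=> x _; rewrite lee_fin sqr_ge0.
  rewrite -/(sq (h k)) sqE// -EFinM lee_fin -nrm2.
  have le : nrm (h k) ^+ 2 <= (4^-1 ^+ k) ^+ 2.
    rewrite lerXn2r// ?nnegrE ?nrm_ge0 ?exprn_ge0//.
    by apply: N0P; rewrite ?nN// (leq_trans (nN k)).
  apply: le_trans (ler_wpM2l _ le) _; first by rewrite exprn_ge0.
  by rewrite -exprM mulnC exprM expr2 exprMn mulrA -exprMn mulfV// expr1n mul1r.
have iS : mu.-integrable setT S.
  apply/integrableP; split.
    by apply: ge0_emeasurable_sum => // k x _ _; exact: h0.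
  rewrite (eq_integral S)// => x _; rewrite gee0_abs//.
  by apply: nneseries_ge0 => k _ _; exact: h0.
(* An upper limit is measurable whether or not the subsequence converges at [x]. *)
pose f x := fine (limn_esup (fun k => (f_ (n k) x)%:E)).
have mf : measurable_fun setT f.
  apply: measurableT_comp => //; apply: measurable_fun_limn_esup => k.
  by apply/measurable_EFinP; exact: L2_mf.
have cf : {ae mu, forall x, f_ (n k) x @[k --> \oo] --> f x}.
  have := integrable_ae measurableT iS; apply: filterS => x /= /(_ Logic.I) Sx.
  have hb k : `|h k x| <= Num.sqrt (fine (S x)) * 2^-1 ^+ k.
    have : 4 ^+ k * h k x ^+ 2 <= fine (S x).
      rewrite -lee_fin fineK//; apply: le_trans (nneseries_lim_ge k.+1 _); last first.
        by move=> j _ _; exact: h0.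
      by rewrite big_nat_recr//= leeDr// sume_ge0.
    rewrite mulrC -ler_pdivlMr ?exprn_gt0// => le.
    rewrite -sqrtr_sqr; apply: le_trans (ler_wsqrtr le) _.
    rewrite sqrtrM; last by rewrite fine_ge0// nneseries_ge0.
    rewrite -exprVn -[X in Num.sqrt (X ^+ k)](_ : 2^-1 ^+ 2 = 4^-1); last by field.
    by rewrite -exprM mulnC exprM sqrtr_sqr ger0_norm// exprn_ge0.
  have ch : cvgn (series (h ^~ x)).
    apply: normed_cvg; apply: (series_le_cvg _ _ hb).
    - by move=> k.
    - by move=> k; rewrite mulr_ge0// ?sqrtr_ge0// exprn_ge0.
    - by apply: is_cvg_geometric_series; rewrite gtr0_norm ?invf_lt1// ltr1n.
  have cn : cvgn (fun k => f_ (n k) x).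
    rewrite (_ : (fun k => _) = (fun k => f_ (n 0%N) x + series (h ^~ x) k)).
      by apply: is_cvgD => //; exact: is_cvg_cst.
    by apply/funext => k; rewrite (eq_sum_telescope (fun k => f_ (n k) x) k).
  have e : limn_esup (fun k => (f_ (n k) x)%:E) = (limn (fun k => f_ (n k) x))%:E.
    by have [_ ->] := cvg_limn_einf_sup (cvg_toE cn).
  by rewrite /f e.
have H k0 m : (N0 k0 <= m)%N ->
    L2 (fun x => f_ m x - f x) /\
    ip (fun x => f_ m x - f x) (fun x => f_ m x - f x) <= (4^-1 ^+ k0) ^+ 2.
  move=> km; apply: (@L2_fatou (fun k x => f_ m x - f_ (n k) x)) => //.
  - by apply: measurable_funB => //; exact: L2_mf.
  - by move=> k; exact: L2B.
  - move: cf; apply: filterS => x fx; apply: cvgB => //; exact: cvg_cst.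
  - exists k0 => // k /= kk0; rewrite -nrm2 lerXn2r// ?nnegrE ?nrm_ge0 ?exprn_ge0//.
    by apply: N0P => //; apply: leq_trans (nN _) (nmono _ _ kk0).
have f2 : L2 f.
  have [d2 _] := H 0%N _ (leqnn _).
  rewrite (_ : f = (fun x => f_ (N0 0%N) x - (f_ (N0 0%N) x - f x))); first exact: L2B.
  by apply/funext => x; rewrite opprB addrC subrK.
exists f => //; apply/cvgrPdist_le => e e0.
have : (GRing.exp (4^-1 : R) : R^nat) @ \oo --> 0.
  by apply: cvg_expr; rewrite gtr0_norm ?invf_lt1// ltr1n.
move=> /cvgrPdist_le /(_ _ e0) [k0 _ /(_ _ (leqnn _)) /=].
rewrite sub0r normrN ger0_norm ?exprn_ge0// => ke.
exists (N0 k0) => // m /= km; rewrite sub0r normrN ger0_norm ?nrm_ge0//.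
apply: le_trans ke; have [_] := H _ _ km.
by rewrite -nrm2 ler_pXn2r// ?nnegrE ?nrm_ge0// exprn_ge0.
Qed.

End L2.

End L2Space.
Export L2Space.

(** * Boxes of R^n and coordinatewise changes of variables *)

Section boxes.
Context (R : realType) (n : nat).
Local Notation E := 'rV[R]_n.
Local Notation mu := (lebesgue_rV R n).

(** Half-open sides give a family that is stable under intersection and generates the sigma-algebra,
    as both the uniqueness of measures and Dynkin's induction require. *)
Definition box (a b : 'I_n -> R) : set E :=
  [set x | forall i, `]a i, b i]%classic (x ord0 i)].

Definition cube (N : nat) : set E := box (fun=> - N%:R) (fun=> N%:R).

Lemma measurable_box a b : measurable (box a b).
Proof.
rewrite (_ : box a b = \bigcap_(i in [set: 'I_n]) (rV_coord i @^-1` `]a i, b i])).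
  apply: fin_bigcap_measurable => [|i _]; first exact: finite_finset.
  rewrite -[X in measurable X]setTI.
  by apply: measurable_rV_coord => //; exact: measurable_itv.
by apply/seteqP; split => x /= H i => [_|]; exact: H.
Qed.

Definition itv_len (a b : R) : R := if a < b then b - a else 0.

Lemma itv_len_ge0 a b : 0 <= itv_len a b.
Proof. by rewrite /itv_len; case: ifP => // /ltW; rewrite subr_ge0. Qed.

Lemma lebesgue_itv_len a b : lebesgue_measure `]a, b]%classic = (itv_len a b)%:E.
Proof. by rewrite lebesgue_measure_itv/= lte_fin /itv_len; case: ifP; rewrite ?EFinB. Qed.

Lemma prodEFin (I : Type) (s : seq I) (F : I -> R) :
  (\prod_(i <- s) (F i)%:E = (\prod_(i <- s) F i)%:E)%E.
Proof. by elim/big_ind2 : _ => // x y x' y' -> ->; rewrite EFinM. Qed.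

Lemma box_measure a b : mu (box a b) = (\prod_(i < n) itv_len (a i) (b i))%:E.
Proof.
have := @lebesgue_rV_box R n (fun i => `]a i, b i]%classic).
move=> ->; last by move=> i; exact: measurable_itv.
by rewrite -prodEFin; apply: eq_bigr => i _; rewrite lebesgue_itv_len.
Qed.

Lemma box_lty a b : (mu (box a b) < +oo)%E.
Proof. by rewrite box_measure ltry. Qed.

Lemma boxI : setI_closed [set A | exists a b, A = box a b].
Proof.
move=> _ _ [a [b ->]] [a' [b' ->]].
exists (fun i => Num.max (a i) (a' i)), (fun i => Num.min (b i) (b' i)).
apply/seteqP; split => x /=.
  move=> [H H'] i; have := H i; have := H' i; rewrite /= !in_itv/=.
  by move=> /andP[h1 h2] /andP[h3 h4]; rewrite gt_max le_min h1 h2 h3 h4.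
move=> H; split => i; have := H i; rewrite /= !in_itv/= gt_max le_min.
  by move=> /andP[/andP[-> _] /andP[-> _]].
by move=> /andP[/andP[_ ->] /andP[_ ->]].
Qed.

Lemma mem_cube (x : E) : exists N, cube N x.
Proof.
pose M := \sum_(i < n) `|x ord0 i|.
exists (Num.truncn M).+1 => i; rewrite /= in_itv/=.
have h : `|x ord0 i| < (Num.truncn M).+1%:R.
  apply: le_lt_trans (truncnS_gt _).
  by rewrite /M (bigD1 i)//= lerDl sumr_ge0.
by move: h; rewrite ltr_norml => /andP[-> /ltW].
Qed.

Lemma cube_nd (M N : nat) : (M <= N)%N -> cube M `<=` cube N.
Proof.
move=> MN x H i; have := H i; rewrite /= !in_itv/= => /andP[h1 h2]; apply/andP; split.
  by apply: le_lt_trans h1; rewrite lerN2 ler_nat.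
by apply: le_trans h2 _; rewrite ler_nat.
Qed.

Lemma bigcup_cube : \bigcup_N cube N = setT.
Proof. by apply/seteqP; split=> // x _; have [N] := mem_cube x; exists N. Qed.

(** The preimage of []a, b]] under one coordinate is the union of the boxes whose other sides are
    []-N, N]]. *)
Lemma box_generates :
  @measurable _ E = <<s [set A | exists a b, A = box a b] >>.
Proof.
apply/seteqP; split; last first.
  apply: smallest_sub; first exact: sigma_algebra_measurable.
  by move=> _ [a [b ->]]; exact: measurable_box.
apply: smallest_sub; first exact: smallest_sigma_algebra.
rewrite -bigcup_seq; apply: bigcup_sub => i _.
rewrite (_ : preimage_set_system _ _ _ =
    <<s preimage_set_system setT (rV_coord i) (@ocitv R) >>); last first.
  by rewrite g_sigma_preimageE.
apply: smallest_sub; first exact: smallest_sigma_algebra.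
move=> _ [_ [[a b] _ <-] <-]; rewrite setTI /=.
rewrite (_ : _ @^-1` _ = \bigcup_N box (fun j => if j == i then a else - N%:R)
   (fun j => if j == i then b else N%:R)).
  apply: sigma_algebra_bigcup => N; apply: sub_sigma_algebra.
  by do 2 eexists.
apply/seteqP; split=> [x xab|x [N _] /(_ i)]; last by rewrite eqxx.
have [N xN] := mem_cube x; exists N => // j; have := xN j.
by have [->|] := eqVneq j i.
Qed.

(* A coordinatewise map that multiplies lengths by [c i] along the i-th axis *)
Section coordinatewise.
Context (phi : 'I_n -> R -> R) (c : R).
Hypothesis mphi : forall i, measurable_fun [set: measurableTypeR R] (phi i : measurableTypeR R -> measurableTypeR R).
Hypothesis c0 : 0 <= c.
Hypothesis phiE : forall i (A : set (measurableTypeR R)), measurable A ->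
  lebesgue_measure (phi i @^-1` A) = (c%:E * lebesgue_measure A)%E.

Definition cwise (x : E) : E := \row_i phi i (x ord0 i).

Lemma measurable_cwise : measurable_fun setT cwise.
Proof.
apply: measurable_fun_rVP => i.
rewrite (_ : _ \o _ = phi i \o rV_coord i); last by apply/funext => x; rewrite /= /rV_coord mxE.
exact: (measurableT_comp (mphi i) (@measurable_rV_coord R n i)).
Qed.

(** Both sides are measures in [A] that agree on boxes and are finite on the cubes, which exhaust
    the space; such measures coincide. *)
Lemma cwise_measure A : measurable A -> mu (cwise @^-1` A) = ((c ^+ n)%:E * mu A)%E.
Proof.
move=> mA.
have cn0 : 0 <= c ^+ n by rewrite exprn_ge0.
have bE a b : mu (cwise @^-1` box a b) = ((c ^+ n)%:E * mu (box a b))%E.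
  rewrite (_ : _ @^-1` _ = [set x : E | forall i, (phi i @^-1` `]a i, b i]%classic) (x ord0 i)]).
    have := @lebesgue_rV_box R n (fun i => phi i @^-1` `]a i, b i]%classic).
    move=> ->; last first.
      move=> i; rewrite -[X in measurable X]setTI.
      exact: (mphi i measurableT (measurable_itv _)).
    rewrite box_measure -EFinM.
    rewrite (eq_bigr (fun i => (c * itv_len (a i) (b i))%:E)); last first.
      move=> i _; have := phiE i (measurable_itv `]a i, b i]) => ->.
      by rewrite lebesgue_itv_len EFinM.
    by rewrite prodEFin big_split/= prodr_const card_ord.
  by apply/seteqP; split=> x /= H' i; have := H' i; rewrite /= mxE.
have mw := measurable_cwise.
pose m1 := [the {measure set E -> \bar R} of pushforward mu cwise].
pose m2 := [the {measure set E -> \bar R} of mscale (NngNum cn0) mu].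
have cb N : [set A | exists a b, A = box a b] (cube N) by do 2 eexists.
have m12 B : [set A | exists a b, A = box a b] B -> m1 mw B = m2 B.
  by move=> [a [b ->]]; exact: bE.
have m1y N : (m1 mw (cube N) < +oo)%E.
  by rewrite /m1/= /pushforward bE box_measure -EFinM ltry.
have H := measure_unique _ _ box_generates boxI cb bigcup_cube (m1 mw) m2 m12 m1y _ mA.
by rewrite /m1 /m2 /= /pushforward /mscale/= in H.
Qed.

Lemma ge0_integral_cwise (f : E -> \bar R) : measurable_fun setT f ->
  (forall x, 0 <= f x)%E ->
  (\int[mu]_x f (cwise x) = (c ^+ n)%:E * \int[mu]_x f x)%E.
Proof.
move=> mf f0; have cn0 : 0 <= c ^+ n by rewrite exprn_ge0.
have := ge0_integral_pushforward measurable_cwise mu measurableT mf (fun x _ => f0 x).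
rewrite preimage_setT => <-.
rewrite -[in RHS](_ : (NngNum cn0)%:num = c ^+ n)//.
rewrite -ge0_integral_mscale//; apply: eq_measure_integral => [|mw A mA _]; first exact: measurable_cwise.
by rewrite /= /pushforward /mscale/= cwise_measure.
Qed.

End coordinatewise.

End boxes.

(** * Affine changes of variables: translation, reflection, dilation *)

Section affine.
Context (R : realType).

Lemma measurable_affine (s a : R) :
  measurable_fun [set: measurableTypeR R] ((fun x => s * x + a) : measurableTypeR R -> measurableTypeR R).
Proof. by apply: measurable_funD => //; apply: measurable_funM. Qed.

(** The image measure multiplied by [s] gives half-open intervals their length, hence is Lebesgue
    measure. *)
Lemma lebesgue_affine (s a : R) (A : set (measurableTypeR R)) : 0 < s -> measurable A ->
  lebesgue_measure ((fun x : R => s * x + a) @^-1` A) = (s^-1%:E * lebesgue_measure A)%E.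
Proof.
move=> s0 mA.
pose m0 := [the {measure set (measurableTypeR R) -> \bar R} of
  pushforward lebesgue_measure (fun x : R => s * x + a : measurableTypeR R)].
pose m1 := m0 (measurable_affine s a).
pose m2 := [the {measure set (measurableTypeR R) -> \bar R} of mscale (NngNum (ltW s0)) m1].
have H X : ocitv X -> lebesgue_measure X = m2 X.
  move=> [[u v] _ <-]; rewrite /m2 /m1 /= /mscale /pushforward/=.
  rewrite /m0 /= /pushforward/=.
  rewrite (_ : _ @^-1` _ = `](u - a) / s, (v - a) / s]%classic); last first.
    by apply/seteqP; split=> x /=; rewrite !in_itv/= ltr_pdivrMr// ler_pdivlMr//
      ltrBlDr lerBrDr (mulrC x).
  rewrite !lebesgue_measure_itv/= !lte_fin ltr_pM2r ?invr_gt0// ltrD2r.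
  case: ifP => _; last by rewrite mule0.
  by rewrite -!EFinB -EFinM; congr EFin; field; exact: lt0r_neq0.
have := lebesgue_measure_unique H mA; rewrite /m2 /m1 /m0 /= /mscale /= /pushforward/= => ->.
by rewrite muleA -EFinM mulVf ?lt0r_neq0// mul1e.
Qed.

Lemma lebesgue_opp (A : set (measurableTypeR R)) : measurable A ->
  lebesgue_measure ((fun x : R => - x) @^-1` A) = (1%:E * lebesgue_measure A)%E.
Proof. by move=> mA; rewrite mul1e; exact: lebesgue_measureN. Qed.

Lemma lebesgue_shift (a : R) (A : set (measurableTypeR R)) : measurable A ->
  lebesgue_measure ((fun x : R => x + a) @^-1` A) = (1%:E * lebesgue_measure A)%E.
Proof.
move=> mA; have := lebesgue_affine a ltr01 mA; rewrite invr1.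
by under [X in lebesgue_measure (X @^-1` _)]eq_fun do rewrite mul1r.
Qed.

Lemma lebesgue_scale (s : R) (A : set (measurableTypeR R)) : 0 < s -> measurable A ->
  lebesgue_measure ((fun x : R => s * x) @^-1` A) = (s^-1%:E * lebesgue_measure A)%E.
Proof.
move=> s0 mA; have := lebesgue_affine 0 s0 mA.
by under [X in lebesgue_measure (X @^-1` _)]eq_fun do rewrite addr0.
Qed.

Lemma ge0_integral_scale1 (s : R) (f : R -> \bar R) : 0 < s ->
  measurable_fun setT f -> (forall x, 0 <= f x)%E ->
  (\int[@lebesgue_measure R]_x f (s * x)%R = s^-1%:E * \int[@lebesgue_measure R]_x f x)%E.
Proof.
move=> s0 mf f0; have s0' : 0 <= s^-1 by rewrite invr_ge0 ltW.
have ms : measurable_fun [set: measurableTypeR R]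
    ((fun x => s * x) : measurableTypeR R -> measurableTypeR R).
  by apply: measurable_funM.
have := ge0_integral_pushforward ms lebesgue_measure measurableT mf (fun x _ => f0 x).
rewrite preimage_setT => <-.
rewrite -[in RHS](_ : (NngNum s0')%:num = s^-1)//.
rewrite -ge0_integral_mscale//; apply: eq_measure_integral => A mA _.
by rewrite /= /pushforward /mscale/= lebesgue_scale.
Qed.

Section invariant.
Context d (T : measurableType d) (mu : {measure set T -> \bar R}) (phi : T -> T).
Hypothesis mphi : measurable_fun setT phi.
Hypothesis phiE : forall A, measurable A -> mu (phi @^-1` A) = mu A.

Lemma ge0_integral_invariant (f : T -> \bar R) : measurable_fun setT f ->
  (forall x, 0 <= f x)%E -> (\int[mu]_x f (phi x) = \int[mu]_x f x)%E.
Proof.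
move=> mf f0.
have := ge0_integral_pushforward mphi mu measurableT mf (fun x _ => f0 x).
rewrite preimage_setT => <-; apply: eq_measure_integral => A mA _.
exact: phiE.
Qed.

Lemma integral_invariant (f : T -> \bar R) : measurable_fun setT f ->
  (\int[mu]_x f (phi x) = \int[mu]_x f x)%E.
Proof.
move=> mf; rewrite integralE [RHS]integralE; congr (_ - _)%E.
  transitivity (\int[mu]_x (f^\+ (phi x)))%E; first by apply: eq_integral => x _; rewrite !funeposE.
  by rewrite ge0_integral_invariant//; exact: measurable_funepos.
transitivity (\int[mu]_x (f^\- (phi x)))%E; first by apply: eq_integral => x _; rewrite !funenegE.
by rewrite ge0_integral_invariant//; exact: measurable_funeneg.
Qed.

Lemma Rintegral_invariant (f : T -> R) : measurable_fun setT f ->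
  \int[mu]_x f (phi x) = \int[mu]_x f x.
Proof.
move=> mf; congr fine; apply: (integral_invariant (f := EFin \o f)).
exact/measurable_EFinP.
Qed.

Lemma integrable_invariant (f : T -> R) : mu.-integrable setT (EFin \o f) ->
  mu.-integrable setT (EFin \o (f \o phi)).
Proof.
move=> /integrableP[mf fi]; apply/integrableP; split.
  by apply/measurable_EFinP/measurableT_comp => //; exact/measurable_EFinP.
rewrite (integral_invariant (f := fun x => `|(f x)%:E|%E))//.
exact: measurableT_comp.
Qed.

Lemma L2_invariant (f : T -> R) : L2 mu f -> L2 mu (f \o phi).
Proof.
move=> [mf sf]; split; first exact: measurableT_comp.
rewrite /sq (integral_invariant (f := fun x => (f x ^+ 2)%:E))//.
by apply/measurable_EFinP; exact: measurable_funX.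
Qed.

Lemma ip_invariant (f g : T -> R) : L2 mu f -> L2 mu g ->
  ip mu (f \o phi) (g \o phi) = ip mu f g.
Proof.
move=> f2 g2; rewrite /ip (Rintegral_invariant (f := fun x => f x * g x))//.
by apply: measurable_funM; [exact: L2_mf f2|exact: L2_mf g2].
Qed.

End invariant.

Context (n : nat).
Local Notation E := 'rV[R]_n.
Local Notation mu := (lebesgue_rV R n).

Lemma shift_cwise (a x : E) : x + a = cwise (fun i y => y + a ord0 i) x.
Proof. by apply/rowP => i; rewrite !mxE. Qed.

Lemma opp_cwise (x : E) : - x = cwise (fun i y => - y) x.
Proof. by apply/rowP => i; rewrite !mxE. Qed.

Lemma scale_cwise s (x : E) : s *: x = cwise (fun i y => s * y) x.
Proof. by apply/rowP => i; rewrite !mxE. Qed.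

Lemma measurable_shift (a : E) : measurable_fun setT (fun x : E => x + a).
Proof.
under eq_fun do rewrite shift_cwise.
by apply: measurable_cwise => i; exact: measurable_funD.
Qed.

Lemma measurable_opp : measurable_fun setT (fun x : E => - x).
Proof.
under eq_fun do rewrite opp_cwise.
by apply: measurable_cwise => i; exact: measurableT_comp.
Qed.

Lemma lebesgue_rV_shift (a : E) (A : set E) : measurable A ->
  mu ((fun x : E => x + a) @^-1` A) = mu A.
Proof.
move=> mA; under [X in mu (X @^-1` _)]eq_fun do rewrite shift_cwise.
rewrite (@cwise_measure _ _ _ 1)// ?expr1n ?mul1e// => i.
  exact: measurable_funD.
by move=> B mB; exact: lebesgue_shift.
Qed.

Lemma lebesgue_rV_opp (A : set E) : measurable A -> mu ((fun x : E => - x) @^-1` A) = mu A.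
Proof.
move=> mA; under [X in mu (X @^-1` _)]eq_fun do rewrite opp_cwise.
rewrite (@cwise_measure _ _ _ 1)// ?expr1n ?mul1e// => i.
  exact: measurableT_comp.
by move=> B mB; exact: lebesgue_opp.
Qed.

Lemma lebesgue_rV_scale s (A : set E) : 0 < s -> measurable A ->
  mu ((fun x : E => s *: x) @^-1` A) = ((s^-1 ^+ n)%:E * mu A)%E.
Proof.
move=> s0 mA; under [X in mu (X @^-1` _)]eq_fun do rewrite scale_cwise.
rewrite (@cwise_measure _ _ _ s^-1)// => [i||i B mB].
- exact: measurable_funM.
- by rewrite invr_ge0 ltW.
- exact: lebesgue_scale.
Qed.

End affine.

(** * Density of step functions over boxes in L^1 and L^2 simultaneously *)

Lemma cvge0_near_le (R : realType) (u : nat -> \bar R) (e : R) :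
  (u k @[k --> \oo] --> 0)%E -> 0 < e -> \forall k \near \oo, (u k <= e%:E)%E.
Proof.
move=> /fine_cvgP[fn /cvgrPdist_le h] /h; apply: filterS2 fn => k fk.
rewrite sub0r normrN /= => le; rewrite -(fineK fk) lee_fin.
exact: le_trans (ler_norm _) le.
Qed.

Section step_density.
Context (R : realType) (n : nat).
Local Notation E := 'rV[R]_n.
Local Notation mu := (lebesgue_rV R n).
Implicit Types (f g : E -> R) (s : seq (R * (('I_n -> R) * ('I_n -> R)))).

Definition stepf s : E -> R := fun x => \sum_(p <- s) p.1 * \1_(box p.2.1 p.2.2) x.

(* The integral of |f| + f^2 controls both the L^1 and the L^2 norm. *)
Definition wgt f : \bar R := (\int[mu]_x (`|f x| + f x ^+ 2)%:E)%E.

Lemma measurable_wgt f : measurable_fun setT f ->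
  measurable_fun setT (fun x => (`|f x| + f x ^+ 2)%:E).
Proof.
move=> mf; apply/measurable_EFinP; apply: measurable_funD; first exact: measurableT_comp.
exact: measurable_funX.
Qed.

Lemma wgt_pt_ge0 (y : R) : 0 <= `|y| + y ^+ 2.
Proof. by rewrite addr_ge0// sqr_ge0. Qed.

Lemma wgt_lty f : inL1 f -> inL2 f -> (wgt f < +oo)%E.
Proof.
move=> /Lfun1_integrable/integrableP[/measurable_EFinP mf f1] /Lfun2P[_ f2].
rewrite /wgt; under eq_integral do rewrite EFinD.
rewrite ge0_integralD//.
- by rewrite lte_add_pinfty.
- by apply/measurable_EFinP; exact: measurableT_comp.
- by move=> x _; rewrite lee_fin sqr_ge0.
- by apply/measurable_EFinP; exact: measurable_funX.
Qed.

Lemma wgtD f g : measurable_fun setT f -> measurable_fun setT g ->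
  (wgt (fun x => f x + g x)%R <= 2%:E * wgt f + 2%:E * wgt g)%E.
Proof.
move=> mf mg; have mwf := measurable_wgt mf; have mwg := measurable_wgt mg.
rewrite /wgt -!ge0_integralZl//; try by move=> x _; rewrite lee_fin wgt_pt_ge0.
rewrite -ge0_integralD//; last 4 first.
- by move=> x _; rewrite -EFinM lee_fin mulr_ge0// wgt_pt_ge0.
- exact: measurable_funeM.
- by move=> x _; rewrite -EFinM lee_fin mulr_ge0// wgt_pt_ge0.
- exact: measurable_funeM.
apply: ge0_le_integral => //.
- by move=> x _; rewrite lee_fin wgt_pt_ge0.
- by apply: measurable_wgt; exact: measurable_funD.
- by apply: emeasurable_funD; exact: measurable_funeM.
- move=> x _; rewrite -!EFinM -EFinD lee_fin.
  have h1 := ler_normD (f x) (g x); have h2 := normr_ge0 (f x); have h3 := normr_ge0 (g x).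
  have h4 := sqr_ge0 (f x - g x); nra.
Qed.

Lemma wgtZ c f : measurable_fun setT f ->
  (wgt (fun x => c * f x)%R <= (`|c| + c ^+ 2)%:E * wgt f)%E.
Proof.
move=> mf; have mwf := measurable_wgt mf.
rewrite /wgt -!ge0_integralZl//; last 2 first.
- by move=> x _; rewrite lee_fin wgt_pt_ge0.
- by rewrite lee_fin wgt_pt_ge0.
apply: ge0_le_integral => //.
- by move=> x _; rewrite lee_fin wgt_pt_ge0.
- by apply: measurable_wgt; exact: measurable_funM.
- exact: measurable_funeM.
- move=> x _; rewrite -!EFinM lee_fin normrM exprMn.
  have h2 := normr_ge0 (f x); have h3 := normr_ge0 c.
  have h4 := sqr_ge0 (f x); have h5 := sqr_ge0 c; nra.
Qed.

Lemma measurable_stepf s : measurable_fun setT (stepf s).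
Proof.
apply: measurable_sum => p; apply: measurable_funM => //.
by apply: measurable_indic; exact: measurable_box.
Qed.

(** This class is stable under linear combinations and dominated limits, which carries it from
    indicators of boxes to every function in L^1 and L^2. *)
Definition approximable f := measurable_fun setT f /\
  forall e : R, 0 < e -> exists s, (wgt (fun x => f x - stepf s x)%R <= e%:E)%E.

Lemma approximable_wgt f : measurable_fun setT f ->
  (forall e : R, 0 < e -> exists2 g, approximable g & (wgt (fun x => f x - g x)%R <= e%:E)%E) ->
  approximable f.
Proof.
move=> mf H; split=> // e e0.
have e4 : 0 < e / 4 by rewrite divr_gt0.
have [g [mg ag] fg] := H _ e4; have [s gs] := ag _ e4; exists s.
rewrite (_ : (fun x => _) = (fun x => (f x - g x) + (g x - stepf s x))); last first.
  by apply/funext => x; ring.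
apply: le_trans (wgtD _ _) _.
- exact: measurable_funB.
- by apply: measurable_funB => //; exact: measurable_stepf.
apply: (@le_trans _ _ (2%:E * (e / 4)%:E + 2%:E * (e / 4)%:E)%E).
  by apply: leeD; apply: lee_wpmul2l.
by rewrite -!EFinM -EFinD lee_fin; lra.
Qed.

Lemma approximable0 : approximable (fun=> 0).
Proof.
split=> // e e0; exists [::]; rewrite /wgt.
under eq_integral do rewrite /stepf big_nil subrr normr0 expr0n/= addr0.
by rewrite integral0 lee_fin ltW.
Qed.

Lemma stepf_cat s t x : stepf (s ++ t) x = stepf s x + stepf t x.
Proof. by rewrite /stepf big_cat. Qed.

Lemma stepf_scale c s x :
  stepf [seq (c * p.1, p.2) | p <- s] x = c * stepf s x.
Proof. by rewrite /stepf big_map mulr_sumr; apply: eq_bigr => p _; rewrite mulrA. Qed.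

Lemma approximableD f g : approximable f -> approximable g -> approximable (fun x => f x + g x).
Proof.
move=> [mf af] [mg ag]; split; first exact: measurable_funD.
move=> e e0; have e4 : 0 < e / 4 by rewrite divr_gt0.
have [s fs] := af _ e4; have [t gt] := ag _ e4; exists (s ++ t).
rewrite (_ : (fun x => _) = (fun x => (f x - stepf s x) + (g x - stepf t x))); last first.
  by apply/funext => x; rewrite stepf_cat; ring.
have := measurable_stepf s; have := measurable_stepf t => ? ?.
apply: le_trans (wgtD _ _) _; [exact: measurable_funB|exact: measurable_funB|].
apply: (@le_trans _ _ (2%:E * (e / 4)%:E + 2%:E * (e / 4)%:E)%E).
  by apply: leeD; apply: lee_wpmul2l.
by rewrite -!EFinM -EFinD lee_fin; lra.
Qed.

Lemma approximableZ c f : approximable f -> approximable (fun x => c * f x).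
Proof.
move=> [mf af]; split; first exact: measurable_funM.
move=> e e0; have c0 : 0 < `|c| + c ^+ 2 + 1 by rewrite ltr_wpDl// wgt_pt_ge0.
have [s fs] := af _ (divr_gt0 e0 c0); exists [seq (c * p.1, p.2) | p <- s].
rewrite (_ : (fun x => _) = (fun x => c * (f x - stepf s x))); last first.
  by apply/funext => x; rewrite stepf_scale; ring.
have := measurable_stepf s => ?.
apply: le_trans (wgtZ _ _) _; first exact: measurable_funB.
apply: (@le_trans _ _ ((`|c| + c ^+ 2)%:E * (e / (`|c| + c ^+ 2 + 1))%:E)%E).
  by apply: lee_wpmul2l => //; rewrite lee_fin wgt_pt_ge0.
rewrite -EFinM lee_fin mulrA ler_pdivrMr// mulrC ler_pM2l//; lra.
Qed.

Lemma approximable_sum (I : Type) (r : seq I) (F : I -> E -> R) :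
  (forall i, approximable (F i)) -> approximable (fun x => \sum_(i <- r) F i x).
Proof.
move=> aF; elim: r => [|i r IH].
  by under eq_fun do rewrite big_nil; exact: approximable0.
by under eq_fun do rewrite big_cons; exact: approximableD.
Qed.

Lemma approximable_dominated (f_ : nat -> E -> R) f g :
  (forall k, approximable (f_ k)) -> (forall x, f_ k x @[k --> \oo] --> f x) ->
  measurable_fun setT g -> (wgt g < +oo)%E -> (forall k x, `|f_ k x| <= `|g x|) ->
  approximable f.
Proof.
move=> afk fkf mg gy fkg.
have mfk k : measurable_fun setT (f_ k) by case: (afk k).
have mf : measurable_fun setT f.
  by apply: (measurable_fun_cvg (h := f_)) => // x _; exact: fkf.
have fg x : `|f x| <= `|g x|.
  by apply: (cvgr_to_le (cvg_norm (fkf x))); exact: nearW.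
have H : wgt (fun x => f x - f_ k x) @[k --> \oo] --> 0%E.
  rewrite /wgt [X in _ --> X](_ : _ = (\int[mu]_x (cst 0%E x))%E); last by rewrite integral0.
  (* As [|f - f_ k| <= 2 |g|], the integrand is at most [2 |g| + 4 g^2]. *)
  apply: (@dominated_cvg _ _ _ mu _ _ _ _ (fun x => 4%:E * (`|g x| + g x ^+ 2)%:E)%E) => //.
  - by move=> k; apply: measurable_wgt; exact: measurable_funB.
  - move=> x _; apply: cvg_toE.
    have c : f x - f_ k x @[k --> \oo] --> 0.
      by rewrite -(subrr (f x)); apply: cvgB => //; exact: cvg_cst.
    rewrite -(addr0 0); apply: cvgD; first by rewrite -(normr0 R); exact: cvg_norm.
    by under eq_fun do rewrite expr2; rewrite -(mulr0 0); apply: cvgM.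
  - apply: integrableZl => //; apply/integrableP; split; first exact: measurable_wgt.
    rewrite (eq_integral (fun x => (`|g x| + g x ^+ 2)%:E))// => x _.
    by rewrite gee0_abs// lee_fin wgt_pt_ge0.
  - move=> k x _; rewrite gee0_abs ?lee_fin ?wgt_pt_ge0//.
    have h1 := ler_normB (f x) (f_ k x); have h2 := fkg k x; have h3 := fg x.
    have h : `|f x - f_ k x| <= 2 * `|g x| by lra.
    have h4 := normr_ge0 (f x - f_ k x); have h5 := normr_ge0 (g x).
    rewrite -(real_normK (num_real (f x - f_ k x))) -(real_normK (num_real (g x))); nra.
apply: approximable_wgt => // e e0.
have [N _ /(_ _ (leqnn _)) le] := cvge0_near_le H e0.
by exists (f_ N).
Qed.

Lemma wgt_cube (N : nat) : (wgt (fun x => \1_(cube N) x) < +oo)%E.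
Proof.
apply: (@le_lt_trans _ _ (\int[mu]_x (2%:E * (\1_(cube N) x)%:E))%E).
  rewrite /wgt; apply: ge0_le_integral => //.
  - by apply: measurable_wgt; apply: measurable_indic; exact: measurable_box.
  - apply/measurable_funeM/measurable_EFinP/measurable_indic; exact: measurable_box.
  - by move=> x _; rewrite -EFinM lee_fin indicE; case: (_ \in _); rewrite /= ?normr1 ?normr0 ?expr1n ?expr0n/=; lra.
rewrite ge0_integralZl//; last first.
  by apply/measurable_EFinP/measurable_indic; exact: measurable_box.
rewrite integral_indic//; last exact: measurable_box.
by rewrite setIT lte_mul_pinfty//; exact: box_lty.
Qed.

(** Dynkin's induction starting from boxes. The cube keeps every indicator integrable and replaces
    the whole space when complements are taken. *)
Lemma approximable_indic A (N : nat) : measurable A -> approximable (\1_(A `&` cube N)).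
Proof.
move=> mA.
have {}mA : <<s [set A : set E | exists a b, A = box a b] >> A by rewrite -box_generates.
move: A mA; apply: (@dynkin_induction _ _ _ (fun A => approximable (\1_(A `&` cube N)))).
- exact: box_generates.
- exact: boxI.
- rewrite setTI; split; first by apply: measurable_indic; exact: measurable_box.
  move=> e e0; exists [:: (1, (fun=> - N%:R, fun=> N%:R))].
  rewrite /wgt (eq_integral (fun=> 0%E)) ?integral0 ?lee_fin ?(ltW e0)// => x _.
  by rewrite /stepf big_seq1/= mul1r subrr normr0 expr0n/= addr0.
- move=> _ [a [b ->]].
  have [a' [b' ->]] : exists a' b', box a b `&` cube N = box a' b'.
    by apply: boxI; [exists a, b|do 2 eexists].
  split; first by apply: measurable_indic; exact: measurable_box.
  move=> e e0; exists [:: (1, (a', b'))].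
  rewrite /wgt (eq_integral (fun=> 0%E)) ?integral0 ?lee_fin ?(ltW e0)// => x _.
  by rewrite /stepf big_seq1/= mul1r subrr normr0 expr0n/= addr0.
- move=> S mS aS.
  have acube : approximable (\1_(cube N)).
    split; first by apply: measurable_indic; exact: measurable_box.
    move=> e e0; exists [:: (1, (fun=> - N%:R, fun=> N%:R))].
    rewrite /wgt (eq_integral (fun=> 0%E)) ?integral0 ?lee_fin ?(ltW e0)// => x _.
    by rewrite /stepf big_seq1/= mul1r subrr normr0 expr0n/= addr0.
  rewrite (_ : \1_(_ `&` _) = (fun x => \1_(cube N) x + -1 * \1_(S `&` cube N) x)).
    by apply: approximableD => //; exact: approximableZ.
  apply/funext => x; rewrite !indicE !in_setI in_setC.
  by case: (x \in S); case: (x \in cube N); rewrite /=; lra.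
- move=> F mF tF aF.
  (* By disjointness, the partial sums of the indicators at [x] jump from 0 to 1 just after the only
     index [j] with [x] in [F j], or stay 0. *)
  have indE x : (exists j, forall k, \sum_(0 <= i < k) \1_(F i `&` cube N) x = (j < k)%N%:R :> R /\
      \1_((\bigcup_i F i) `&` cube N) x = 1 :> R /\ \1_(cube N) x = 1 :> R) \/
    (forall k, \sum_(0 <= i < k) \1_(F i `&` cube N) x = 0 :> R /\
      \1_((\bigcup_i F i) `&` cube N) x = 0 :> R).
    have [[[j _ Fjx] Nx]|Fx] := pselect (((\bigcup_i F i) `&` cube N) x); [left|right].
      exists j => k; split; last by rewrite !indicE !mem_set//; split=> //; exists j.
      elim: k => [|k IH]; first by rewrite big_nil.
      rewrite big_nat_recr//= IH indicE ltnS.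
      have [kj|kj|->] := ltngtP k j.
      - rewrite memNset ?addr0// => -[Fkx _].
        have := tF k j I I; move=> H; have : k = j by apply: H; exists x.
        by move=> e; rewrite e ltnn in kj.
      - rewrite memNset ?addr0// => -[Fkx _].
        have := tF k j I I; move=> H; have : k = j by apply: H; exists x.
        by move=> e; rewrite e ltnn in kj.
      - by rewrite mem_set// add0r.
    move=> k; rewrite indicE memNset//; split=> //.
    rewrite big1// => i _; rewrite indicE memNset// => -[Fix Nx].
    by apply: Fx; split=> //; exists i.
  apply: (@approximable_dominated (fun k x => \sum_(0 <= i < k) \1_(F i `&` cube N) x)
    _ (\1_(cube N))).
  + by move=> k; exact: approximable_sum.
  + move=> x; apply: (@cvg_near_cst _ R^o); have [[j jP]|jP] := indE x.
      by exists j.+1 => // k /= jk; have [-> [-> _]] := jP k; rewrite jk.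
    by apply: nearW => k; have [-> ->] := jP k.
  + by apply: measurable_indic; exact: measurable_box.
  + exact: wgt_cube.
  + move=> k x; have [[j jP]|jP] := indE x.
      by have [-> [_ ->]] := jP k; rewrite normr1 ger0_norm// lern1 leq_b1.
    by have [-> _] := jP k; rewrite normr0.
Qed.

Import HBNNSimple.

(** Increasing simple functions are cut off by growing cubes, so that each of their level sets falls
    under [approximable_indic]; [f] itself dominates them. *)
Lemma approximable_ge0 f : (forall x, 0 <= f x) -> measurable_fun setT f ->
  (wgt f < +oo)%E -> approximable f.
Proof.
move=> f0 mf fy.
have mEf : measurable_fun setT (EFin \o f) by exact/measurable_EFinP.
pose g := nnsfun_approx measurableT mEf.
apply: (@approximable_dominated (fun k x => g k x * \1_(cube k) x) _ f) => //.
- move=> k.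
  rewrite (_ : (fun x => _) = (fun x => \sum_(y <- finmap.enum_fset (fset_set (range (g k))))
      y * \1_(g k @^-1` [set y] `&` cube k) x)).
    apply: approximable_sum => y; apply: approximableZ; exact: approximable_indic.
  apply/funext => x; rewrite {1}(fimfunE (g k)) fsbig_finite//= mulr_suml.
  by apply: eq_bigr => y _; rewrite indicI mulrA.
- move=> x.
  have gx : g k x @[k --> \oo] --> f x.
    have := cvg_nnsfun_approx measurableT mEf (fun x _ => f0 x) (x := x) I.
    by move=> /fine_cvgP[].
  have cx : \1_(cube k) x @[k --> \oo] --> (1 : R).
    have [N Nx] := mem_cube x.
    apply: (@cvg_near_cst _ R^o); exists N => // k /= Nk.
    by rewrite indicE mem_set//; exact: (cube_nd Nk).
  by rewrite -[f x]mulr1; apply: cvgM.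
- move=> k x.
  have h1 : g k x <= f x.
    rewrite -lee_fin /g nnsfun_approxE.
    by apply: (@le_approx _ _ _ setT (EFin \o f)) => // y _; rewrite lee_fin.
  have h0 : 0 <= g k x by [].
  by rewrite indicE; case: (_ \in _); rewrite ?mulr1 ?mulr0 ?normr0 ?ger0_norm// (le_trans h0).
Qed.

Lemma approximableP f : inL1 f -> inL2 f -> approximable f.
Proof.
move=> f1 f2; have fy := wgt_lty f1 f2.
have mf : measurable_fun setT f by move: f2 => /Lfun2P[].
rewrite (_ : f = (fun x => f^\+ x + -1 * f^\- x)); last first.
  by apply/funext => x; rewrite mulN1r -[LHS](congr1 (fun h => h x) (funrposBneg f)).
have leW (g : E -> R) : (forall x, 0 <= g x <= `|f x|) -> measurable_fun setT g -> (wgt g < +oo)%E.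
  move=> gf mg; apply: le_lt_trans fy; apply: ge0_le_integral => //.
  - by move=> x _; rewrite lee_fin wgt_pt_ge0.
  - exact: measurable_wgt.
  - exact: measurable_wgt.
  - move=> x _; rewrite lee_fin; have /andP[g0 gx] := gf x.
    rewrite (ger0_norm g0) lerD// -[f x ^+ 2]real_normK ?num_real//.
    by rewrite lerXn2r ?nnegrE.
have mp := measurable_funrpos mf; have mn := measurable_funrneg mf.
apply: approximableD; last apply: approximableZ; apply: approximable_ge0 => //.
- by apply: leW => // x; rewrite funrpos_ge0 -[`|f x|](congr1 (fun h => h x) (funrposDneg f)) lerDl funrneg_ge0.
- by apply: leW => // x; rewrite funrneg_ge0 -[`|f x|](congr1 (fun h => h x) (funrposDneg f)) lerDr funrpos_ge0.
Qed.

Lemma stepf_dense f : inL1 f -> inL2 f -> exists s : nat -> seq (R * (('I_n -> R) * ('I_n -> R))),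
  cvgL2 mu (fun k => stepf (s k)) f /\
  (\int[mu]_x `|stepf (s k) x - f x|%:E @[k --> \oo] --> 0)%E.
Proof.
move=> f1 f2; have [mf af] := approximableP f1 f2.
have /choice[s sP] : forall k : nat, exists s, (wgt (fun x => f x - stepf s x)%R <= (k.+1%:R^-1 : R)%:E)%E.
  by move=> k; exact: af.
exists s.
have mfs k : measurable_fun setT (fun x => stepf (s k) x - f x).
  by apply: measurable_funB => //; exact: measurable_stepf.
have wC k : (wgt (fun x => stepf (s k) x - f x)%R <= (k.+1%:R^-1 : R)%:E)%E.
  apply: le_trans (sP k); rewrite le_eqVlt; apply/orP; left; apply/eqP.
  by apply: eq_integral => x _; rewrite distrC -(sqrrN (f x - _)) opprB.
have i1 k : (\int[mu]_x `|stepf (s k) x - f x|%:E <= (k.+1%:R^-1 : R)%:E)%E.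
  apply: le_trans (wC k); apply: ge0_le_integral => //.
  - by apply/measurable_EFinP; exact: measurableT_comp.
  - exact: measurable_wgt.
  - by move=> x _; rewrite lee_fin lerDl sqr_ge0.
have i2 k : (sq mu (fun x => stepf (s k) x - f x)%R <= (k.+1%:R^-1 : R)%:E)%E.
  apply: le_trans (wC k); apply: ge0_le_integral => //.
  - by move=> x _; rewrite lee_fin sqr_ge0.
  - by apply/measurable_EFinP; exact: measurable_funX.
  - exact: measurable_wgt.
  - by move=> x _; rewrite lee_fin lerDr.
have H2 k : L2 mu (fun x => stepf (s k) x - f x).
  by split=> //; apply: le_lt_trans (i2 k) (ltry _).
have h : (fun k => k.+1%:R^-1 : R) @ \oo --> (0 : R) by exact: cvg_harmonic.
split.
- have c : ip mu (fun x => stepf (s k) x - f x) (fun x => stepf (s k) x - f x) @[k --> \oo] --> (0 : R).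
    apply: (squeeze_cvgr _ (cvg_cst 0) h); apply: nearW => k; rewrite ip_ge0/=.
    by rewrite -lee_fin -sqE.
  rewrite /cvgL2 -(@sqrtr0 R).
  exact: (cvg_comp _ _ c (@sqrt_continuous R 0)).
- apply: (squeeze_cvge _ (cvg_cst 0%E) (cvg_toE h)); apply: nearW => k.
  by rewrite i1 andbT; apply: integral_ge0 => x _.
Qed.

End step_density.

(** * Mean value estimates for sine and cosine; the fundamental theorem of calculus *)

Section calculus.
Context (R : realType).
Implicit Types (f df : R -> R).

Lemma derive_continuous f df : (forall x : R, is_derive x 1 f (df x)) -> continuous f.
Proof.
move=> fd x; apply: differentiable_continuous; apply/derivable1_diffP.
by have [] := fd x.
Qed.

Lemma mean_value f df a b : (forall x : R, is_derive x 1 f (df x)) ->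
  exists2 c, `|c - a| <= `|b - a| & f b - f a = df c * (b - a).
Proof.
move=> fd; have cf := derive_continuous fd.
have [ab|ba] := leP a b.
  have [c] := MVT_segment ab (fun x _ => fd x) (continuous_subspaceT cf).
  rewrite in_itv/= => /andP[ac cb] e; exists c => //.
  by rewrite !ger0_norm ?subr_ge0// lerD2r.
have [c] := MVT_segment (ltW ba) (fun x _ => fd x) (continuous_subspaceT cf).
rewrite in_itv/= => /andP[bc ca] e; exists c.
  by rewrite distrC (distrC b) !ger0_norm ?subr_ge0 ?lerD2l ?lerN2// ltW.
by rewrite -opprB e -mulrN opprB.
Qed.

Lemma derive_lipschitz f df M : (forall x : R, is_derive x 1 f (df x)) -> (forall x, `|df x| <= M) ->
  forall a b, `|f b - f a| <= M * `|b - a|.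
Proof.
by move=> fd dM a b; have [c _ ->] := mean_value a b fd; rewrite normrM ler_wpM2r.
Qed.

Lemma norm_sin_le (x : R) : `|sin x| <= `|x|.
Proof.
have := @derive_lipschitz (@sin R) cos 1 (fun x => is_derive_sin x) (@cos_max R) 0 x.
by rewrite sin0 !subr0 mul1r.
Qed.

Lemma cos_lipschitz (x y : R) : `|cos x - cos y| <= `|x - y|.
Proof.
have := @derive_lipschitz (@cos R) (fun x => - sin x) 1 (fun x => is_derive_cos x) _ y x.
by rewrite mul1r; apply => z; rewrite normrN sin_max.
Qed.

Lemma sin_lipschitz (x y : R) : `|sin x - sin y| <= `|x - y|.
Proof.
by have := @derive_lipschitz (@sin R) cos 1 (fun x => is_derive_sin x) (@cos_max R) y x; rewrite mul1r.
Qed.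

(** The mean value theorem gives [(cos c - 1) x] with [|c| <= |x|]. A quadratic remainder is enough
    for the multiplier estimates below. *)
Lemma sin_sub_id_le (x : R) : `|sin x - x| <= x ^+ 2.
Proof.
have fd (y : R) : is_derive y 1 (fun z : R => sin z - z) (cos y - 1).
  by apply: is_deriveB.
have [c h] := mean_value 0 x fd; rewrite sin0 !subr0 in h * => ->.
rewrite normrM -[x ^+ 2](real_normK (num_real x)) expr2 ler_wpM2r//.
apply: le_trans h.
by have := cos_lipschitz c 0; rewrite cos0 subr0.
Qed.

Lemma one_sub_cosE (x : R) : 1 - cos x = 2 * sin (x / 2) ^+ 2.
Proof.
have -> : cos x = cos ((x / 2) *+ 2) by rewrite -mulr_natr divfK.
by rewrite cos_mulr2n sin2cos2; ring.
Qed.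

Lemma one_sub_cos_ge0 (x : R) : 0 <= 1 - cos x.
Proof. by rewrite subr_ge0 cos_le1. Qed.

Lemma one_sub_cos_le (x : R) : 1 - cos x <= x ^+ 2 / 2.
Proof.
rewrite one_sub_cosE -(real_normK (num_real (sin _))).
have := norm_sin_le (x / 2).
rewrite -(@ler_pXn2r _ 2)// ?nnegrE// [X in _ <= X](real_normK (num_real _)).
by rewrite exprMn => h; lra.
Qed.

Lemma FTC_everywhere f df a b : a <= b -> (forall x : R, is_derive x 1 f (df x)) ->
  continuous df -> \int[lebesgue_measure]_(x in `]a, b]) df x = f b - f a.
Proof.
rewrite le_eqVlt => /predU1P[->|ab] fd cdf.
  by rewrite set_itv_ge ?bnd_simp// Rintegral_set0 subrr.
have cf := derive_continuous fd.
rewrite Rintegral_itv_obnd_cbnd; last first.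
  have : lebesgue_measure.-integrable `[a, b] (EFin \o df).
    apply: continuous_compact_integrable; first exact: segment_compact.
    exact: continuous_subspaceT.
  by apply: integrableS => //; apply: subset_itvr; rewrite bnd_simp.
rewrite /Rintegral (continuous_FTC2 (F := f))//.
- exact: continuous_subspaceT.
- split.
  + by move=> x _; have [] := fd x.
  + by apply: cvg_at_right_filter; exact: cf.
  + by apply: cvg_at_left_filter; exact: cf.
- by move=> x _; rewrite derive1E; have [_] := fd x.
Qed.

End calculus.

(** * Fourier transforms of intervals in dimension one *)

Section dirichlet.
Context (R : realType).
Local Notation la := (@lebesgue_measure R).

(** The Fejer kernel up to normalisation; at 0 the division convention gives it the value 0.
    Products of transforms of intervals reduce to it. *)
Definition fejer (x : R) : R := (1 - cos x) / x ^+ 2.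

Lemma fejer_ge0 x : 0 <= fejer x.
Proof. by rewrite divr_ge0 ?one_sub_cos_ge0 ?sqr_ge0. Qed.

Lemma measurable_cos : measurable_fun setT (@cos R).
Proof. by apply: continuous_measurable_fun; exact: continuous_cos. Qed.

Lemma measurable_sin : measurable_fun setT (@sin R).
Proof. by apply: continuous_measurable_fun; exact: continuous_sin. Qed.

Lemma measurable_inv : measurable_fun setT (fun x : R => x^-1).
Proof.
have h : measurable_fun [set x : R | x != 0] (fun x : R => x^-1).
  apply: open_continuous_measurable_fun; first exact: open_neq.
  by move=> x; rewrite inE => /inv_continuous.
rewrite (_ : setT = [set x : R | x != 0] `|` [set 0]); last first.
  apply/seteqP; split=> // x _; have [->|] := eqVneq x 0; by [right|left].
apply/measurable_funU.
- by apply: open_measurable; exact: open_neq.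
- exact: measurable_set1.
- by split=> //; exact: measurable_fun_set1.
Qed.

Lemma measurable_funV d (T : measurableType d) (f : T -> R) :
  measurable_fun setT f -> measurable_fun setT (fun x => (f x)^-1).
Proof. by move=> mf; apply: (measurableT_comp measurable_inv). Qed.

Lemma measurable_fejer : measurable_fun setT fejer.
Proof.
apply: measurable_funM; first by apply: measurable_funB => //; exact: measurable_cos.
by apply: measurable_funV; exact: measurable_funX.
Qed.

(** [1 - cos x] is at most [x^2 / 2] and at most 2, whence the integrable majorant
    [4 / (1 + x^2)]. *)
Lemma fejer_lty : (\int[la]_x (fejer x)%:E < +oo)%E.
Proof.
apply: (@le_lt_trans _ _ (\int[la]_x (4 * (oneDsqr x)^-1)%:E)%E).
  apply: ge0_le_integral => //=.
  - by move=> x _; rewrite lee_fin fejer_ge0.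
  - by apply/measurable_EFinP; exact: measurable_fejer.
  - apply/measurable_EFinP/measurable_funM => //.
    by apply: continuous_measurable_fun; exact: continuous_oneDsqrV.
  - move=> x _; rewrite lee_fin /fejer /oneDsqr.
    have [->|x0] := eqVneq x 0; first by rewrite expr0n/= invr0 mulr0 mulr_ge0.
    have x2 : 0 < x ^+ 2 by rewrite exprn_even_gt0.
    rewrite ler_pdivrMr// mulrAC ler_pdivlMr; last by lra.
    have h1 := one_sub_cos_le x; have h2 := cos_geN1 x; have h3 := cos_le1 x.
    nra.
rewrite ge0_symfun_integralT//.
- rewrite (_ : [set x : R | 0 <= x] = `[0, +oo[%classic); last first.
    by apply/seteqP; split=> x /=; rewrite in_itv/= andbT.
  under eq_integral do rewrite EFinM.
  rewrite ge0_integralZl//; last first.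
    apply/measurable_EFinP; apply: measurable_funTS.
    by apply: continuous_measurable_fun; exact: continuous_oneDsqrV.
  by rewrite integral0y_oneDsqr -!EFinM ltry.
- by move=> x; apply: cvgM; [exact: cvg_cst|exact: continuous_oneDsqrV].
- by move=> x /=; rewrite /oneDsqr sqrrN.
Qed.

Lemma fejer_gt0 : (0 < \int[la]_x (fejer x)%:E)%E.
Proof.
pose c : R := (1 - cos 1) / 4.
have c1 : cos (1 : R) < 1.
  have p2 := @pi_ge2 R; rewrite -[X in _ < X]cos0.
  by rewrite ltr_cos ?ltr01// in_itv/=; apply/andP; split; lra.
have c0 : 0 < c by rewrite divr_gt0// subr_gt0.
suff h : (c%:E <= \int[la]_x (fejer x)%:E)%E by apply: lt_le_trans h; rewrite lte_fin.
rewrite (_ : c%:E = \int[la]_(x in `]1%R, 2%R]) (cst c%:E x))%E; last first.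
  rewrite integral_cst//= lebesgue_measure_itv/= lte_fin ltr1n -EFinD -EFinM.
  by congr EFin; lra.
apply: (@le_trans _ _ (\int[la]_(x in `]1%R, 2%R]) (fejer x)%:E)%E); last first.
  apply: ge0_subset_integral => //.
  - by apply/measurable_EFinP; exact: measurable_fejer.
  - by move=> x _; rewrite lee_fin fejer_ge0.
apply: ge0_le_integral => //.
- by move=> x _; rewrite lee_fin ltW.
- by apply/measurable_EFinP; apply: measurable_funTS; exact: measurable_fejer.
- move=> x /=; rewrite in_itv/= => /andP[x1 x2]; rewrite lee_fin /c /fejer.
  have x22 : 0 < x ^+ 2 by rewrite exprn_gt0//; lra.
  rewrite ler_pdivlMr// mulrAC ler_pdivrMr//.
  have h : cos x <= cos 1.
    by have := @pi_ge2 R => p2; rewrite ltW// ltr_cos// in_itv/=; apply/andP; split; lra.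
  have h0 : (0 : R) <= 1 - cos 1 by lra.
  have x4 : x ^+ 2 <= 4 by nra.
  by apply: le_trans (ler_wpM2l h0 x4) _; lra.
Qed.

(** Classically this number is pi, which makes the Plancherel constant [(2 pi)^n]; only its
    positivity enters the estimates. *)
Definition fejer_cst : R := fine (\int[la]_x (fejer x)%:E)%E.

Lemma fejer_cst_gt0 : 0 < fejer_cst.
Proof. by rewrite fine_gt0// fejer_gt0 fejer_lty. Qed.

Definition fejer_at (c x : R) : R := (1 - cos (c * x)) / x ^+ 2.

Lemma fejer_at_norm c x : fejer_at `|c| x = fejer_at c x.
Proof.
rewrite /fejer_at; have [c0|c0] := leP 0 c; first by rewrite ger0_norm.
by rewrite ltr0_norm// mulNr cosN.
Qed.

(** For [d > 0], [fejer_at d] at [x] is [d^2] times [fejer] at [d x], so the integral scales like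
    [d^2 / d]; evenness of the cosine brings in [|c|]. *)
Lemma fejer_atP c : la.-integrable setT (EFin \o fejer_at c) /\
  \int[la]_x fejer_at c x = fejer_cst * `|c|.
Proof.
suff H d : 0 <= d -> la.-integrable setT (EFin \o fejer_at d) /\
    \int[la]_x fejer_at d x = fejer_cst * d.
  have [+ <-] := H _ (normr_ge0 c).
  by rewrite (_ : fejer_at `|c| = fejer_at c)//; apply/funext => x; exact: fejer_at_norm.
rewrite le_eqVlt => /predU1P[<-|d0].
  rewrite mulr0 (_ : fejer_at 0 = cst 0); last first.
    by apply/funext => x; rewrite /fejer_at mul0r cos0 subrr mul0r.
  by split; [exact: integrable0|rewrite /Rintegral integral0].
have mEf : measurable_fun setT (EFin \o fejer).
  by apply/measurable_EFinP; exact: measurable_fejer.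
have e x : fejer_at d x = d ^+ 2 * fejer (d * x).
  rewrite /fejer_at /fejer; have [->|x0] := eqVneq x 0.
    by rewrite !mulr0 expr0n/= invr0 !mulr0.
  by field; rewrite x0 lt0r_neq0.
have I : (\int[la]_x (fejer_at d x)%:E = (fejer_cst * d)%:E)%E.
  under eq_integral do rewrite e EFinM.
  rewrite ge0_integralZl//.
  - rewrite (ge0_integral_scale1 (f := EFin \o fejer) d0)//=.
      rewrite -[X in (_ * (_ * X))%E]fineK; last first.
        by rewrite ge0_fin_numE ?fejer_lty// integral_ge0// => x _; rewrite lee_fin fejer_ge0.
      rewrite -!EFinM -/fejer_cst; congr EFin; field; exact: lt0r_neq0.
    by move=> x; rewrite lee_fin fejer_ge0.
  - apply/measurable_EFinP; apply: (measurableT_comp measurable_fejer).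
    exact: measurable_funM.
  - by move=> x _; rewrite lee_fin fejer_ge0.
  - by rewrite lee_fin sqr_ge0.
split; last by rewrite /Rintegral I.
apply/integrableP; split.
  apply/measurable_EFinP; apply: measurable_funM.
    apply: measurable_funB => //; apply: (measurableT_comp measurable_cos).
    exact: measurable_funM.
  by apply: measurable_funV; exact: measurable_funX.
have Iy : (\int[la]_x (fejer_at d x)%:E < +oo)%E by rewrite I ltry.
under eq_integral => x _.
  rewrite gee0_abs; last by rewrite /= lee_fin /fejer_at divr_ge0 ?one_sub_cos_ge0 ?sqr_ge0.
  over.
exact: Iy.
Qed.

(* Transforms of the indicator of ]a, b]; at 0 they have the junk value 0. *)
Definition cos_itv (a b s : R) : R := if a < b then (sin (b * s) - sin (a * s)) / s else 0.
Definition sin_itv (a b s : R) : R := if a < b then (cos (a * s) - cos (b * s)) / s else 0.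

Lemma cos_itvE a b s : s != 0 ->
  \int[la]_x (cos (x * s) * \1_`]a, b] x) = cos_itv a b s.
Proof.
move=> s0; rewrite /cos_itv.
rewrite (_ : \int[la]_x _ = \int[la]_(x in `]a, b]) cos (x * s)); last first.
  rewrite [RHS]Rintegral_mkcond; apply: eq_Rintegral => x _.
  by rewrite patchE indicE; case: ifP => _; rewrite ?mulr1 ?mulr0.
case: ltP => ab; last by rewrite set_itv_ge ?Rintegral_set0// bnd_simp -leNgt.
have fd (x : R) : is_derive x 1 (fun x => sin (x * s) / s) (cos (x * s)).
  by apply: is_derive_eq; rewrite /GRing.scale/=; field.
have cf : continuous (fun x : R => cos (x * s)).
  apply: (@derive_continuous _ _ (fun x : R => - sin (x * s) * s)) => x.
  by apply: is_derive_eq; rewrite /GRing.scale/=; ring.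
by rewrite (FTC_everywhere (ltW ab) fd cf) -mulrBl.
Qed.

Lemma sin_itvE a b s : s != 0 ->
  \int[la]_x (sin (x * s) * \1_`]a, b] x) = sin_itv a b s.
Proof.
move=> s0; rewrite /sin_itv.
rewrite (_ : \int[la]_x _ = \int[la]_(x in `]a, b]) sin (x * s)); last first.
  rewrite [RHS]Rintegral_mkcond; apply: eq_Rintegral => x _.
  by rewrite patchE indicE; case: ifP => _; rewrite ?mulr1 ?mulr0.
case: ltP => ab; last by rewrite set_itv_ge ?Rintegral_set0// bnd_simp -leNgt.
have fd (x : R) : is_derive x 1 (fun x => - cos (x * s) / s) (sin (x * s)).
  by apply: is_derive_eq; rewrite /GRing.scale/=; field.
have cf : continuous (fun x : R => sin (x * s)).
  apply: (@derive_continuous _ _ (fun x : R => cos (x * s) * s)) => x.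
  by apply: is_derive_eq; rewrite /GRing.scale/=; ring.
by rewrite (FTC_everywhere (ltW ab) fd cf) -mulrBl opprK addrC.
Qed.

Lemma measurable_cos_itv a b : measurable_fun setT (cos_itv a b).
Proof.
rewrite /cos_itv; case: (a < b) => //.
apply: measurable_funM; last by apply: measurable_funV.
by apply: measurable_funB; apply: (measurableT_comp measurable_sin); exact: measurable_funM.
Qed.

Lemma measurable_sin_itv a b : measurable_fun setT (sin_itv a b).
Proof.
rewrite /sin_itv; case: (a < b) => //.
apply: measurable_funM; last by apply: measurable_funV.
by apply: measurable_funB; apply: (measurableT_comp measurable_cos); exact: measurable_funM.
Qed.

(** With [F = cos_itv - i sin_itv] for each of the two intervals, [itv_re] and [itv_im] are the real
    and imaginary parts of [F] times the conjugate of [F']. *)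
Definition itv_re (a b a' b' s : R) : R :=
  cos_itv a b s * cos_itv a' b' s + sin_itv a b s * sin_itv a' b' s.
Definition itv_im (a b a' b' s : R) : R :=
  cos_itv a b s * sin_itv a' b' s - sin_itv a b s * cos_itv a' b' s.

(** The addition formulas write the integrand as a signed sum of four [fejer_at], one per difference
    of endpoints, and [|b - a'| + |a - b'| - |b - b'| - |a - a'|] is twice the length of the
    overlap. *)
Lemma itv_reP a b a' b' : la.-integrable setT (EFin \o itv_re a b a' b') /\
  \int[la]_x itv_re a b a' b' x =
  2 * fejer_cst * itv_len (Num.max a a') (Num.min b b').
Proof.
have z (f : R -> R) : f = cst 0 -> la.-integrable setT (EFin \o f) /\
    \int[la]_x f x = 2 * fejer_cst * 0.
  by move=> ->; split; [exact: integrable0|rewrite mulr0 /Rintegral integral0].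
have [ab|ba] := ltP a b; last first.
  have -> : itv_len (Num.max a a') (Num.min b b') = 0.
    by rewrite /itv_len gt_max lt_min !lt_min (ltNge a b) ba.
  apply: z; apply/funext => x; rewrite /itv_re /cos_itv /sin_itv ltNge ba/=.
  by rewrite !mul0r addr0.
have [ab'|ba'] := ltP a' b'; last first.
  have -> : itv_len (Num.max a a') (Num.min b b') = 0.
    by rewrite /itv_len gt_max lt_min !lt_min (ltNge a' b') ba'/= !andbF.
  apply: z; apply/funext => x; rewrite /itv_re /cos_itv /sin_itv [X in if X then _ else 0]ltNge.
  by rewrite ?(ltNge a' b') ba'/= !mulr0 addr0.
have e : itv_re a b a' b' = (fun x => (fejer_at (b - a') x + fejer_at (a - b') x) -
    (fejer_at (b - b') x + fejer_at (a - a') x)).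
  apply/funext => x; rewrite /itv_re /cos_itv /sin_itv ab ab' /fejer_at.
  have [->|x0] := eqVneq x 0; first by rewrite expr0n/= !invr0 !mulr0 !addr0 subrr.
  rewrite !mulrBl !cosB; field; exact: x0.
have [i1 e1] := fejer_atP (b - a'); have [i2 e2] := fejer_atP (a - b').
have [i3 e3] := fejer_atP (b - b'); have [i4 e4] := fejer_atP (a - a').
have i12 := integrableD measurableT i1 i2; have i34 := integrableD measurableT i3 i4.
split; rewrite e.
  exact: (integrableB measurableT i12 i34).
rewrite RintegralB// !RintegralD// e1 e2 e3 e4 -!mulrDr -mulrBr [2 * _]mulrC -mulrA.
congr (_ * _).
case: (leP a a') => h1; case: (leP b b') => h2; rewrite /itv_len; case: ltP => h3;
  case: (ger0P (b - a')) => h4; case: (ger0P (a - b')) => h5;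
  case: (ger0P (b - b')) => h6; case: (ger0P (a - a')) => h7; lra.
Qed.

Lemma Rintegral_opp1 (f : R -> R) : measurable_fun setT f ->
  \int[la]_x f (- x) = \int[la]_x f x.
Proof.
move=> mf.
have mphi : measurable_fun [set: measurableTypeR R]
    (fun x : measurableTypeR R => - x : measurableTypeR R).
  exact: (@oppr_measurable R setT).
have inv (A : set (measurableTypeR R)) : measurable A ->
    lebesgue_measure ((fun x : measurableTypeR R => - x : measurableTypeR R) @^-1` A) =
    lebesgue_measure A.
  by move=> mA; exact: lebesgue_measureN.
exact: (Rintegral_invariant mphi inv mf).
Qed.

(** The integrand is odd, and it is dominated by the sum of the squared moduli of the two
    transforms, which [itv_reP] integrates. *)
Lemma itv_imP a b a' b' : la.-integrable setT (EFin \o itv_im a b a' b') /\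
  \int[la]_x itv_im a b a' b' x = 0.
Proof.
have mC := measurable_cos_itv; have mS := measurable_sin_itv.
have mim : measurable_fun setT (itv_im a b a' b').
  by apply: measurable_funB; apply: measurable_funM.
have iim : la.-integrable setT (EFin \o itv_im a b a' b').
  have [i1 _] := itv_reP a b a b; have [i2 _] := itv_reP a' b' a' b'.
  apply: le_integrable (integrableD measurableT i1 i2) => //.
    exact/measurable_EFinP.
  move=> x _ /=; rewrite lee_fin /itv_im /itv_re.
  set c := cos_itv _ _ _; set c' := cos_itv _ _ _; set s := sin_itv _ _ _; set s' := sin_itv _ _ _.
  rewrite [X in _ <= X]ger0_norm; last by have := sqr_ge0 c; have := sqr_ge0 c';
    have := sqr_ge0 s; have := sqr_ge0 s'; rewrite !expr2; lra.
  have h1 := sqr_ge0 (c + s'); have h2 := sqr_ge0 (s - c'); have h3 := sqr_ge0 (c - s').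
  have h4 := sqr_ge0 (s + c'); have h5 := sqr_ge0 c; have h6 := sqr_ge0 c'.
  have h7 := sqr_ge0 s; have h8 := sqr_ge0 s'.
  by rewrite ler_norml; apply/andP; split; nra.
split=> //.
have h : \int[la]_x itv_im a b a' b' x = \int[la]_x itv_im a b a' b' (- x).
  by rewrite Rintegral_opp1.
have odd x : itv_im a b a' b' (- x) = - itv_im a b a' b' x.
  rewrite /itv_im /cos_itv /sin_itv !mulrN !cosN !sinN invrN.
  by case: ifP => _; case: ifP => _; ring.
have : \int[la]_x itv_im a b a' b' (- x) = - \int[la]_x itv_im a b a' b' x.
  under eq_Rintegral do rewrite odd -mulN1r.
  by rewrite RintegralZl// mulN1r.
by rewrite -h => e; lra.
Qed.

End dirichlet.

(** * Fubini for products, and integration over R^(n+1) one coordinate at a time *)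

Section product_integrals.
Context d1 d2 (T1 : measurableType d1) (T2 : measurableType d2) (R : realType).
Variables (m1 : {sigma_finite_measure set T1 -> \bar R})
          (m2 : {sigma_finite_measure set T2 -> \bar R}).

Lemma measurable_Rintegral_param (F : T1 * T2 -> R) : measurable_fun setT F ->
  measurable_fun setT (fun y => \int[m1]_x F (x, y)).
Proof.
move=> mF; have mEF : measurable_fun setT (EFin \o F) by exact/measurable_EFinP.
apply: (measurableT_comp (f := fine)) => //.
under eq_fun do rewrite integralE.
have mp := @measurable_fun_fubini_tonelli_G _ _ _ _ _ m1 _
  (measurable_funepos mEF) (funepos_ge0 _).
have mn := @measurable_fun_fubini_tonelli_G _ _ _ _ _ m1 _
  (measurable_funeneg mEF) (funeneg_ge0 _).
rewrite (_ : (fun y => _) = (fun y => fubini_G m1 (EFin \o F)^\+ y - fubini_G m1 (EFin \o F)^\- y)%E).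
  exact: emeasurable_funB.
apply/funext => y; rewrite /fubini_G; congr (_ - _)%E; apply: eq_integral => x _.
  by rewrite !funeposE.
by rewrite !funenegE.
Qed.

Lemma integrable_prod_mul (f : T1 -> R) (g : T2 -> R) :
  m1.-integrable setT (EFin \o f) -> m2.-integrable setT (EFin \o g) ->
  (m1 \x m2)%E.-integrable setT (EFin \o (fun z : T1 * T2 => f z.1 * g z.2)) /\
  \int[(m1 \x m2)%E]_z (f z.1 * g z.2) = (\int[m1]_x f x) * \int[m2]_y g y.
Proof.
move=> fi gi.
have mf : measurable_fun setT f by apply/measurable_EFinP; exact: measurable_int fi.
have mg : measurable_fun setT g by apply/measurable_EFinP; exact: measurable_int gi.
have mF : measurable_fun setT (EFin \o (fun z : T1 * T2 => f z.1 * g z.2)).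
  apply/measurable_EFinP; apply: measurable_funM.
    exact: (measurableT_comp mf measurable_fst).
  exact: (measurableT_comp mg measurable_snd).
have I : (m1 \x m2)%E.-integrable setT (EFin \o (fun z : T1 * T2 => f z.1 * g z.2)).
  apply/(integrable12ltyP m1 m2 mF).
  have -> : (\int[m1]_x \int[m2]_y `|(EFin \o (fun z : T1 * T2 => (f z.1 * g z.2)%R)) (x, y)| =
      \int[m1]_x (`|f x|%:E * \int[m2]_y `|g y|%:E))%E.
    apply: eq_integral => x _; rewrite -ge0_integralZl//.
      by apply: eq_integral => y _ /=; rewrite normrM EFinM.
    by apply/measurable_EFinP; exact: measurableT_comp.
  move/integrableP : fi => [_ fy]; move/integrableP : gi => [_ gy].
  rewrite ge0_integralZr//.
  - by rewrite lte_mul_pinfty// ?ge0_fin_numE ?integral_ge0.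
  - by apply/measurable_EFinP; exact: measurableT_comp.
  - exact: integral_ge0.
split=> //.
rewrite /Rintegral -(integral12_prod_meas1 I) /fubini_F -fineM; last 2 first.
- exact: integrable_fin_num.
- exact: integrable_fin_num.
congr fine; rewrite /=.
have -> : (\int[m2]_y (g y)%:E = (\int[m2]_y g y)%:E)%E.
  by rewrite /Rintegral fineK//; exact: integrable_fin_num.
rewrite -integralZr//; apply: eq_integral => x _.
under eq_integral do rewrite EFinM.
by rewrite integralZl// /Rintegral fineK//; exact: integrable_fin_num.
Qed.

End product_integrals.

Section rV_recursion.
Context (R : realType) (n : nat).
Local Notation la := (@lebesgue_measure R).
Local Notation pm := (la \x lebesgue_rV R n)%E.

Lemma integral_rV_cons (F : 'rV[R]_n.+1 -> R) : measurable_fun setT F ->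
  pm.-integrable setT (EFin \o (F \o @rV_cons R n)) ->
  (lebesgue_rV R n.+1).-integrable setT (EFin \o F) /\
  \int[lebesgue_rV R n.+1]_x F x = \int[pm]_z F (rV_cons z).
Proof.
move=> mF iF.
have mEF : measurable_fun setT (EFin \o F) by exact/measurable_EFinP.
have mc := @measurable_rV_cons R n.
have iF' : pm.-integrable (@rV_cons R n @^-1` setT) ((EFin \o F) \o @rV_cons R n).
  by rewrite preimage_setT.
split.
  exact: (integrable_pushforward mc mEF iF' measurableT).
have := integral_pushforward mc mEF iF' measurableT.
by rewrite preimage_setT /Rintegral => <-.
Qed.

Lemma dotrV_cons (s : R) (y : 'rV[R]_n) (t : R) (z : 'rV[R]_n) :
  dotrV (rV_cons (s, y)) (rV_cons (t, z)) = s * t + dotrV y z.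
Proof.
rewrite /dotrV big_ord_recl !rV_consE0 /=; congr (_ + _).
by apply: eq_bigr => i _; rewrite !rV_consES.
Qed.

Lemma rV_unconsK : cancel (@rV_uncons R n) (@rV_cons R n).
Proof.
move=> x; apply/rowP => i; have [j ->|->] := unliftP ord0 i.
  by rewrite rV_consES /= mxE.
by rewrite rV_consE0.
Qed.

Lemma indic_box_cons (a b : 'I_n.+1 -> R) (s : R) (y : 'rV[R]_n) :
  \1_(box a b) (rV_cons (s, y)) = \1_`]a ord0, b ord0] s *
    \1_(box (fun i => a (lift ord0 i)) (fun i => b (lift ord0 i))) y :> R.
Proof.
rewrite !indicE -natrM mulnb; congr (_%:R); congr nat_of_bool.
apply/idP/andP => [|[]]; rewrite !inE.
  move=> H; split; first by have := H ord0; rewrite rV_consE0.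
  by move=> i; have := H (lift ord0 i); rewrite rV_consES.
move=> H1 H2 i; have [j ->|->] := unliftP ord0 i; first by rewrite rV_consES; exact: H2.
by rewrite rV_consE0.
Qed.

End rV_recursion.

(** * Cosine and sine transforms *)

Section transforms.
Context (R : realType).
Local Notation la := (@lebesgue_measure R).

Lemma measurable_dotrV n : measurable_fun setT (fun z : 'rV[R]_n * 'rV[R]_n => dotrV z.1 z.2).
Proof.
apply: measurable_sum => i; apply: measurable_funM.
  exact: (measurableT_comp (@measurable_rV_coord R n i) measurable_fst).
exact: (measurableT_comp (@measurable_rV_coord R n i) measurable_snd).
Qed.

Lemma measurable_dotrVl n (xi : 'rV[R]_n) : measurable_fun setT (fun x : 'rV[R]_n => dotrV x xi).
Proof.
apply: measurable_sum => i; apply: measurable_funM => //.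
exact: (@measurable_rV_coord R n i).
Qed.

Section def.
Context (n : nat).
Local Notation E := 'rV[R]_n.
Local Notation mu := (lebesgue_rV R n).
Implicit Types (f g : E -> R).

Definition cosT f (xi : E) : R := \int[mu]_x (cos (dotrV x xi) * f x).
Definition sinT f (xi : E) : R := \int[mu]_x (sin (dotrV x xi) * f x).

Lemma fourierL1E f xi : fourierL1 f xi = Complex (cosT f xi) (- sinT f xi).
Proof. by []. Qed.

Lemma measurable_cosT f : measurable_fun setT f -> measurable_fun setT (cosT f).
Proof.
move=> mf; apply: (measurable_Rintegral_param mu (F := fun z : E * E => cos (dotrV z.1 z.2) * f z.1)).
apply: measurable_funM; first exact: (measurableT_comp (@measurable_cos R) (@measurable_dotrV n)).
exact: (measurableT_comp mf measurable_fst).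
Qed.

Lemma measurable_sinT f : measurable_fun setT f -> measurable_fun setT (sinT f).
Proof.
move=> mf; apply: (measurable_Rintegral_param mu (F := fun z : E * E => sin (dotrV z.1 z.2) * f z.1)).
apply: measurable_funM; first exact: (measurableT_comp (@measurable_sin R) (@measurable_dotrV n)).
exact: (measurableT_comp mf measurable_fst).
Qed.

Lemma integrable_bounded_mul (h f : E -> R) M : measurable_fun setT h -> (forall x, `|h x| <= M) ->
  inL1 f -> mu.-integrable setT (EFin \o (fun x => h x * f x)).
Proof.
move=> mh hM /Lfun1_integrable fi.
have mf : measurable_fun setT f by apply/measurable_EFinP; exact: measurable_int fi.
apply: le_integrable (integrableZl measurableT M fi) => //.
  by apply/measurable_EFinP; exact: measurable_funM.
move=> x _ /=; rewrite lee_fin !normrM ler_wpM2r//.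
by apply: le_trans (hM x) _; exact: ler_norm.
Qed.

Lemma integrable_cosT f xi : inL1 f -> mu.-integrable setT (EFin \o (fun x => cos (dotrV x xi) * f x)).
Proof.
apply: (@integrable_bounded_mul _ _ 1) => [|x]; last exact: cos_max.
exact: (measurableT_comp (@measurable_cos R) (@measurable_dotrVl n xi)).
Qed.

Lemma integrable_sinT f xi : inL1 f -> mu.-integrable setT (EFin \o (fun x => sin (dotrV x xi) * f x)).
Proof.
apply: (@integrable_bounded_mul _ _ 1) => [|x]; last exact: sin_max.
exact: (measurableT_comp (@measurable_sin R) (@measurable_dotrVl n xi)).
Qed.

Lemma cosTD f g xi : inL1 f -> inL1 g -> cosT (fun x => f x + g x) xi = cosT f xi + cosT g xi.
Proof.
move=> f1 g1; rewrite /cosT; under eq_Rintegral do rewrite mulrDr.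
by rewrite RintegralD//; exact: integrable_cosT.
Qed.

Lemma sinTD f g xi : inL1 f -> inL1 g -> sinT (fun x => f x + g x) xi = sinT f xi + sinT g xi.
Proof.
move=> f1 g1; rewrite /sinT; under eq_Rintegral do rewrite mulrDr.
by rewrite RintegralD//; exact: integrable_sinT.
Qed.

Lemma cosTZ c f xi : inL1 f -> cosT (fun x => c * f x) xi = c * cosT f xi.
Proof.
move=> f1; rewrite /cosT; under eq_Rintegral do rewrite mulrCA.
by rewrite RintegralZl//; exact: integrable_cosT.
Qed.

Lemma sinTZ c f xi : inL1 f -> sinT (fun x => c * f x) xi = c * sinT f xi.
Proof.
move=> f1; rewrite /sinT; under eq_Rintegral do rewrite mulrCA.
by rewrite RintegralZl//; exact: integrable_sinT.
Qed.

Lemma dotrVN (x xi : E) : dotrV x (- xi) = - dotrV x xi.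
Proof. by rewrite /dotrV -sumrN; apply: eq_bigr => i _; rewrite mxE mulrN. Qed.

Lemma cosTN f xi : cosT f (- xi) = cosT f xi.
Proof. by apply: eq_Rintegral => x _; rewrite dotrVN cosN. Qed.

Lemma sinTN f xi : inL1 f -> sinT f (- xi) = - sinT f xi.
Proof.
move=> f1; rewrite /sinT -mulN1r -RintegralZl//; last exact: integrable_sinT.
by apply: eq_Rintegral => x _; rewrite dotrVN sinN mulN1r mulNr.
Qed.

Lemma inL1_box (a b : 'I_n -> R) : inL1 (\1_(box a b) : E -> R).
Proof.
apply/Lfun1_integrable/integrableP; split.
  by apply/measurable_EFinP/measurable_indic; exact: measurable_box.
rewrite (eq_integral (fun x => (\1_(box a b) x)%:E)); last first.
  by move=> x _; rewrite gee0_abs// lee_fin.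
by rewrite integral_indic ?setIT ?box_lty//; exact: measurable_box.
Qed.

End def.

(** These integrals are meaningful for every [s], while the closed forms [cos_itv] and [sin_itv]
    match them for [s != 0]; [itvT_parseval] therefore transfers its identities almost
    everywhere. *)
Definition cos_itvT (a b s : R) : R := \int[la]_x (cos (x * s) * \1_`]a, b] x).
Definition sin_itvT (a b s : R) : R := \int[la]_x (sin (x * s) * \1_`]a, b] x).

Lemma integrable_itvT (h : R -> R) (a b : R) : measurable_fun setT h -> (forall x, `|h x| <= 1) ->
  la.-integrable setT (EFin \o (fun x => h x * \1_`]a, b] x)).
Proof.
move=> mh h1.
apply: le_integrable (integrable_indic_itv a b false false) => //.
  apply/measurable_EFinP; apply: measurable_funM => //; exact: measurable_indic.
by move=> x _ /=; rewrite lee_fin normrM ler_piMl.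
Qed.

(** The indicator of a box is a tensor product and the exponential of a sum is a product: these are
    the real and imaginary parts of the resulting complex product. *)
Lemma cosT_box_cons n (a b : 'I_n.+1 -> R) (s : R) (y : 'rV[R]_n) :
  let a' := fun i => a (lift ord0 i) in let b' := fun i => b (lift ord0 i) in
  cosT (\1_(box a b)) (rV_cons (s, y)) =
    cos_itvT (a ord0) (b ord0) s * cosT (\1_(box a' b')) y -
    sin_itvT (a ord0) (b ord0) s * sinT (\1_(box a' b')) y /\
  sinT (\1_(box a b)) (rV_cons (s, y)) =
    sin_itvT (a ord0) (b ord0) s * cosT (\1_(box a' b')) y +
    cos_itvT (a ord0) (b ord0) s * sinT (\1_(box a' b')) y.
Proof.
move=> a' b'.
have ms : measurable_fun setT (fun x : R => x * s) by exact: measurable_funM.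
have ic : la.-integrable setT (EFin \o (fun x => cos (x * s) * \1_`]a ord0, b ord0] x)).
  apply: (integrable_itvT (h := fun x => cos (x * s))) => [|x]; last exact: cos_max.
  exact: (measurableT_comp (@measurable_cos R) ms).
have is' : la.-integrable setT (EFin \o (fun x => sin (x * s) * \1_`]a ord0, b ord0] x)).
  apply: (integrable_itvT (h := fun x => sin (x * s))) => [|x]; last exact: sin_max.
  exact: (measurableT_comp (@measurable_sin R) ms).
have jc := integrable_cosT y (@inL1_box n a' b').
have js := integrable_sinT y (@inL1_box n a' b').
have [icc ecc] := integrable_prod_mul ic jc.
have [iss ess] := integrable_prod_mul is' js.
have [isc esc] := integrable_prod_mul is' jc.
have [ics ecs] := integrable_prod_mul ic js.
have mbox : measurable_fun setT (\1_(box a b) : 'rV[R]_n.+1 -> R).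
  by apply: measurable_indic; exact: measurable_box.
split.
- have e z : (fun x => cos (dotrV x (rV_cons (s, y))) * \1_(box a b) x) (rV_cons z) =
     cos (z.1 * s) * \1_`]a ord0, b ord0] z.1 * (cos (dotrV z.2 y) * \1_(box a' b') z.2) -
     sin (z.1 * s) * \1_`]a ord0, b ord0] z.1 * (sin (dotrV z.2 y) * \1_(box a' b') z.2).
    by case: z => u v; rewrite dotrV_cons indic_box_cons cosD/=; ring.
  have [] := @integral_rV_cons R n (fun x => cos (dotrV x (rV_cons (s, y))) * \1_(box a b) x).
  + apply: measurable_funM => //.
    exact: (measurableT_comp (@measurable_cos R) (@measurable_dotrVl _ (rV_cons (s, y)))).
  + apply: eq_integrable (integrableB measurableT icc iss) => //.
    by move=> z _; rewrite /comp e.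
  + move=> _; rewrite /cosT => ->.
    under eq_Rintegral do rewrite e.
    by rewrite RintegralB// ecc ess.
- have e z : (fun x => sin (dotrV x (rV_cons (s, y))) * \1_(box a b) x) (rV_cons z) =
     sin (z.1 * s) * \1_`]a ord0, b ord0] z.1 * (cos (dotrV z.2 y) * \1_(box a' b') z.2) +
     cos (z.1 * s) * \1_`]a ord0, b ord0] z.1 * (sin (dotrV z.2 y) * \1_(box a' b') z.2).
    by case: z => u v; rewrite dotrV_cons indic_box_cons sinD/=; ring.
  have [] := @integral_rV_cons R n (fun x => sin (dotrV x (rV_cons (s, y))) * \1_(box a b) x).
  + apply: measurable_funM => //.
    exact: (measurableT_comp (@measurable_sin R) (@measurable_dotrVl _ (rV_cons (s, y)))).
  + apply: eq_integrable (integrableD measurableT isc ics) => //.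
    by move=> z _; rewrite /comp e.
  + move=> _; rewrite /sinT => ->.
    under eq_Rintegral do rewrite e.
    by rewrite RintegralD// esc ecs.
Qed.

End transforms.

(** * Parseval's identity for indicators of boxes *)

Section box_parseval.
Context (R : realType).
Local Notation la := (@lebesgue_measure R).

Lemma measurable_cos_itvT a b : measurable_fun [set: measurableTypeR R] (cos_itvT a b : measurableTypeR R -> R).
Proof.
apply: (measurable_Rintegral_param la (F := fun z : measurableTypeR R * measurableTypeR R => cos (z.1 * z.2) * \1_`]a, b] z.1)).
apply: measurable_funM.
  apply: (measurableT_comp (@measurable_cos R)); apply: measurable_funM.
    exact: measurable_fst.
  exact: measurable_snd.
have m1 : measurable_fun [set: measurableTypeR R] (\1_`]a, b] : measurableTypeR R -> R).
  by apply: measurable_indic; exact: measurable_itv.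
exact: (measurableT_comp m1 measurable_fst).
Qed.

Lemma measurable_sin_itvT a b : measurable_fun [set: measurableTypeR R] (sin_itvT a b : measurableTypeR R -> R).
Proof.
apply: (measurable_Rintegral_param la (F := fun z : measurableTypeR R * measurableTypeR R => sin (z.1 * z.2) * \1_`]a, b] z.1)).
apply: measurable_funM.
  apply: (measurableT_comp (@measurable_sin R)); apply: measurable_funM.
    exact: measurable_fst.
  exact: measurable_snd.
have m1 : measurable_fun [set: measurableTypeR R] (\1_`]a, b] : measurableTypeR R -> R).
  by apply: measurable_indic; exact: measurable_itv.
exact: (measurableT_comp m1 measurable_fst).
Qed.

Lemma ae_neq0 : {ae la, forall s : R, s != 0}.
Proof.
exists [set 0]; split; first exact: measurable_set1.
  exact: lebesgue_measure_set1.
by move=> s /= /negP; rewrite negbK => /eqP.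
Qed.

Lemma ae_integrable_Rintegral d (T : measurableType d) (mu : {measure set T -> \bar R}) (f g : T -> R) :
  mu.-integrable setT (EFin \o f) -> measurable_fun setT g -> {ae mu, forall x, f x = g x} ->
  mu.-integrable setT (EFin \o g) /\ \int[mu]_x g x = \int[mu]_x f x.
Proof.
move=> fi mg fg; have mf : measurable_fun setT (EFin \o f) by exact: measurable_int fi.
have mEg : measurable_fun setT (EFin \o g) by exact/measurable_EFinP.
have e : (\int[mu]_x `|(EFin \o g) x| = \int[mu]_x `|(EFin \o f) x|)%E.
  apply: ge0_ae_eq_integral => //; [exact: measurableT_comp|exact: measurableT_comp|].
  by move: fg; apply: filterS => x /= -> _.
split.
  by apply/integrableP; split=> //; rewrite e; case/integrableP : fi.
congr fine; apply: ae_eq_integral => //.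
by move: fg; apply: filterS => x /= -> _.
Qed.

Lemma itvT_parseval (a b a' b' : R) :
  [/\ la.-integrable setT (EFin \o (fun s => cos_itvT a b s * cos_itvT a' b' s + sin_itvT a b s * sin_itvT a' b' s)),
      \int[la]_s (cos_itvT a b s * cos_itvT a' b' s + sin_itvT a b s * sin_itvT a' b' s) =
        2 * fejer_cst R * itv_len (Num.max a a') (Num.min b b'),
      la.-integrable setT (EFin \o (fun s => cos_itvT a b s * sin_itvT a' b' s - sin_itvT a b s * cos_itvT a' b' s)) &
      \int[la]_s (cos_itvT a b s * sin_itvT a' b' s - sin_itvT a b s * cos_itvT a' b' s) = 0].
Proof.
have mC := measurable_cos_itvT; have mS := measurable_sin_itvT.
have [i1 e1] := itv_reP a b a' b'; have [i2 e2] := itv_imP a b a' b'.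
have [] := @ae_integrable_Rintegral _ (measurableTypeR R) la _
  (fun s => cos_itvT a b s * cos_itvT a' b' s + sin_itvT a b s * sin_itvT a' b' s) i1.
- by apply: measurable_funD; apply: measurable_funM.
- have [N [mN N0 NP]] := ae_neq0; exists N; split=> // s /= h; apply: NP => /= s0; apply: h.
  by rewrite /itv_re /cos_itvT /sin_itvT !cos_itvE// !sin_itvE.
move=> j1 f1.
have [] := @ae_integrable_Rintegral _ (measurableTypeR R) la _
  (fun s => cos_itvT a b s * sin_itvT a' b' s - sin_itvT a b s * cos_itvT a' b' s) i2.
- by apply: measurable_funB; apply: measurable_funM.
- have [N [mN N0 NP]] := ae_neq0; exists N; split=> // s /= h; apply: NP => /= s0; apply: h.
  by rewrite /itv_im /cos_itvT /sin_itvT !cos_itvE// !sin_itvE.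
by move=> j2 f2; split=> //; rewrite ?f1 ?f2.
Qed.

Lemma integral_rV0 (f : 'rV[R]_0 -> \bar R) : measurable_fun setT f ->
  (\int[lebesgue_rV R 0]_x f x = f 0%R)%E.
Proof.
move=> mf; transitivity (\d_(0%R : 'rV[R]_0) setT * f 0%R)%E; first exact: integral_dirac.
by rewrite diracT mul1e.
Qed.

(** Induction on the dimension, where the complex product of two box transforms factors. The real
    part of a product involves the imaginary parts of the factors, so the vanishing of the imaginary
    integrals has to be carried along. *)
Lemma box_parseval n (a b a' b' : 'I_n -> R) :
  let C := cosT (\1_(box a b)) in let S := sinT (\1_(box a b)) in
  let C' := cosT (\1_(box a' b')) in let S' := sinT (\1_(box a' b')) in
  [/\ (lebesgue_rV R n).-integrable setT (EFin \o (fun xi => C xi * C' xi + S xi * S' xi)),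
      \int[lebesgue_rV R n]_xi (C xi * C' xi + S xi * S' xi) =
        (2 * fejer_cst R) ^+ n * \prod_(i < n) itv_len (Num.max (a i) (a' i)) (Num.min (b i) (b' i)),
      (lebesgue_rV R n).-integrable setT (EFin \o (fun xi => C xi * S' xi - S xi * C' xi)) &
      \int[lebesgue_rV R n]_xi (C xi * S' xi - S xi * C' xi) = 0].
Proof.
elim: n a b a' b' => [|n IH] a b a' b' C S C' S'.
  have one (u v : 'I_0 -> R) (x : 'rV[R]_0) : \1_(box u v) x = 1 :> R.
    by rewrite indicE mem_set// => -[].
  have CE (u v : 'I_0 -> R) xi : cosT (\1_(box u v)) xi = 1.
    rewrite /cosT /Rintegral integral_rV0; last first.
      apply/measurable_EFinP; apply: measurable_funM.
        exact: (measurableT_comp (@measurable_cos R) (@measurable_dotrVl R 0 xi)).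
      by apply: measurable_indic; exact: measurable_box.
    by rewrite /dotrV big_ord0 cos0 mul1r one.
  have SE (u v : 'I_0 -> R) xi : sinT (\1_(box u v)) xi = 0.
    rewrite /sinT /Rintegral integral_rV0; last first.
      apply/measurable_EFinP; apply: measurable_funM.
        exact: (measurableT_comp (@measurable_sin R) (@measurable_dotrVl R 0 xi)).
      by apply: measurable_indic; exact: measurable_box.
    by rewrite /dotrV big_ord0 sin0 mul0r.
  have e1 : (fun xi => C xi * C' xi + S xi * S' xi) = cst 1.
    by apply/funext => xi; rewrite /C /S /C' /S' !CE !SE mul0r addr0 mulr1.
  have e2 : (fun xi => C xi * S' xi - S xi * C' xi) = cst 0.
    by apply/funext => xi; rewrite /C /S /C' /S' !CE !SE mul0r mulr0 subr0.
  rewrite e1 e2; split.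
  - apply/integrableP; split; first exact/measurable_EFinP.
    by rewrite integral_rV0//= normr1 ltry.
  - rewrite /Rintegral integral_rV0; last exact/measurable_EFinP.
    by rewrite big_ord0 mulr1 expr0.
  - exact: integrable0.
  - by rewrite /Rintegral integral0.
have [i1 e1 i2 e2] := itvT_parseval (a ord0) (b ord0) (a' ord0) (b' ord0).
have [j1 f1 j2 f2] := IH (fun i => a (lift ord0 i)) (fun i => b (lift ord0 i))
  (fun i => a' (lift ord0 i)) (fun i => b' (lift ord0 i)).
have [i11 e11] := integrable_prod_mul i1 j1.
have [i22 e22] := integrable_prod_mul i2 j2.
have [i12 e12] := integrable_prod_mul i1 j2.
have [i21 e21] := integrable_prod_mul i2 j1.
have mb (u v : 'I_n.+1 -> R) : measurable_fun setT (\1_(box u v) : 'rV[R]_n.+1 -> R).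
  by apply: measurable_indic; exact: measurable_box.
have mC u v := measurable_cosT (mb u v); have mS u v := measurable_sinT (mb u v).
have E1 z : C (rV_cons z) * C' (rV_cons z) + S (rV_cons z) * S' (rV_cons z) =
   (cos_itvT (a ord0) (b ord0) z.1 * cos_itvT (a' ord0) (b' ord0) z.1 +
    sin_itvT (a ord0) (b ord0) z.1 * sin_itvT (a' ord0) (b' ord0) z.1) *
   (cosT (\1_(box (fun i => a (lift ord0 i)) (fun i => b (lift ord0 i)))) z.2 *
    cosT (\1_(box (fun i => a' (lift ord0 i)) (fun i => b' (lift ord0 i)))) z.2 +
    sinT (\1_(box (fun i => a (lift ord0 i)) (fun i => b (lift ord0 i)))) z.2 *
    sinT (\1_(box (fun i => a' (lift ord0 i)) (fun i => b' (lift ord0 i)))) z.2) -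
   (cos_itvT (a ord0) (b ord0) z.1 * sin_itvT (a' ord0) (b' ord0) z.1 -
    sin_itvT (a ord0) (b ord0) z.1 * cos_itvT (a' ord0) (b' ord0) z.1) *
   (cosT (\1_(box (fun i => a (lift ord0 i)) (fun i => b (lift ord0 i)))) z.2 *
    sinT (\1_(box (fun i => a' (lift ord0 i)) (fun i => b' (lift ord0 i)))) z.2 -
    sinT (\1_(box (fun i => a (lift ord0 i)) (fun i => b (lift ord0 i)))) z.2 *
    cosT (\1_(box (fun i => a' (lift ord0 i)) (fun i => b' (lift ord0 i)))) z.2).
  case: z => s y; rewrite /C /S /C' /S' /=.
  have [-> ->] := cosT_box_cons a b s y; have [-> ->] := cosT_box_cons a' b' s y; ring.
have E2 z : C (rV_cons z) * S' (rV_cons z) - S (rV_cons z) * C' (rV_cons z) =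
   (cos_itvT (a ord0) (b ord0) z.1 * cos_itvT (a' ord0) (b' ord0) z.1 +
    sin_itvT (a ord0) (b ord0) z.1 * sin_itvT (a' ord0) (b' ord0) z.1) *
   (cosT (\1_(box (fun i => a (lift ord0 i)) (fun i => b (lift ord0 i)))) z.2 *
    sinT (\1_(box (fun i => a' (lift ord0 i)) (fun i => b' (lift ord0 i)))) z.2 -
    sinT (\1_(box (fun i => a (lift ord0 i)) (fun i => b (lift ord0 i)))) z.2 *
    cosT (\1_(box (fun i => a' (lift ord0 i)) (fun i => b' (lift ord0 i)))) z.2) +
   (cos_itvT (a ord0) (b ord0) z.1 * sin_itvT (a' ord0) (b' ord0) z.1 -
    sin_itvT (a ord0) (b ord0) z.1 * cos_itvT (a' ord0) (b' ord0) z.1) *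
   (cosT (\1_(box (fun i => a (lift ord0 i)) (fun i => b (lift ord0 i)))) z.2 *
    cosT (\1_(box (fun i => a' (lift ord0 i)) (fun i => b' (lift ord0 i)))) z.2 +
    sinT (\1_(box (fun i => a (lift ord0 i)) (fun i => b (lift ord0 i)))) z.2 *
    sinT (\1_(box (fun i => a' (lift ord0 i)) (fun i => b' (lift ord0 i)))) z.2).
  case: z => s y; rewrite /C /S /C' /S' /=.
  have [-> ->] := cosT_box_cons a b s y; have [-> ->] := cosT_box_cons a' b' s y; ring.
have I1 : (la \x lebesgue_rV R n)%E.-integrable setT
    (EFin \o ((fun xi => C xi * C' xi + S xi * S' xi) \o @rV_cons R n)).
  by apply: eq_integrable (integrableB measurableT i11 i22) => // z _; rewrite /comp E1.
have I2 : (la \x lebesgue_rV R n)%E.-integrable setT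
    (EFin \o ((fun xi => C xi * S' xi - S xi * C' xi) \o @rV_cons R n)).
  by apply: eq_integrable (integrableD measurableT i12 i21) => // z _; rewrite /comp E2.
have [k1 g1] := @integral_rV_cons R n (fun xi => C xi * C' xi + S xi * S' xi)
  (measurable_funD (measurable_funM (mC _ _) (mC _ _)) (measurable_funM (mS _ _) (mS _ _))) I1.
have [k2 g2] := @integral_rV_cons R n (fun xi => C xi * S' xi - S xi * C' xi)
  (measurable_funB (measurable_funM (mC _ _) (mS _ _)) (measurable_funM (mS _ _) (mC _ _))) I2.
split=> //.
- rewrite g1; under eq_Rintegral do rewrite E1.
  rewrite RintegralB// e11 e22 e1 f1 e2 mul0r subr0 exprS big_ord_recl; ring.
- rewrite g2; under eq_Rintegral do rewrite E2.
  by rewrite RintegralD// e12 e21 e2 f2 mul0r mulr0 addr0.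
Qed.

End box_parseval.

(** * Plancherel's identity for functions both in L^1 and in L^2 *)

Section plancherel.
Context (R : realType) (n : nat).
Local Notation E := 'rV[R]_n.
Local Notation mu := (lebesgue_rV R n).
Local Notation L2 := (L2 mu).
Local Notation ip := (ip mu).
Local Notation nrm := (nrm mu).
Local Notation cvgL2 := (cvgL2 mu).
Implicit Types (f g h : E -> R).

Definition plancherel_cst : R := (2 * fejer_cst R) ^+ n.
Local Notation K := plancherel_cst.

Lemma plancherel_cst_gt0 : 0 < K.
Proof. by rewrite exprn_gt0// mulr_gt0// fejer_cst_gt0. Qed.

Lemma ip_suml (I : Type) (s : seq I) (c : I -> R) (F : I -> E -> R) g :
  (forall i, L2 (F i)) -> L2 g ->
  ip (fun x => \sum_(i <- s) c i * F i x) g = \sum_(i <- s) c i * ip (F i) g.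
Proof.
move=> F2 g2; elim: s => [|i s IH].
  under [X in ip X]eq_fun do rewrite big_nil.
  rewrite big_nil /ip; under eq_Rintegral do rewrite mul0r.
  by rewrite /Rintegral integral0.
under [X in ip X]eq_fun do rewrite big_cons.
rewrite big_cons -IH ipDl ?ipZl//; first exact: L2Z.
by apply: L2_sum => j; exact: L2Z.
Qed.

Lemma ip_sumr (I : Type) (s : seq I) (c : I -> R) (F : I -> E -> R) g :
  (forall i, L2 (F i)) -> L2 g ->
  ip g (fun x => \sum_(i <- s) c i * F i x) = \sum_(i <- s) c i * ip g (F i).
Proof.
by move=> F2 g2; rewrite ipC ip_suml//; apply: eq_bigr => i _; rewrite ipC.
Qed.

Lemma L2_box (a b : 'I_n -> R) : L2 (\1_(box a b)).
Proof.
split; first by apply: measurable_indic; exact: measurable_box.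
rewrite /sq (eq_integral (fun x => (\1_(box a b) x)%:E)); last first.
  by move=> x _; rewrite indicE -natrX; case: (_ \in _).
by rewrite integral_indic ?setIT ?box_lty//; exact: measurable_box.
Qed.

Lemma ip_box (a b a' b' : 'I_n -> R) : ip (\1_(box a b)) (\1_(box a' b')) =
  \prod_(i < n) itv_len (Num.max (a i) (a' i)) (Num.min (b i) (b' i)).
Proof.
rewrite /ip /Rintegral.
rewrite (eq_integral (fun x => (\1_(box (fun i => Num.max (a i) (a' i)) (fun i => Num.min (b i) (b' i))) x)%:E)).
  rewrite integral_indic//; last exact: measurable_box.
  by rewrite setIT [X in fine X](@box_measure R n).
move=> x _; congr EFin; rewrite !indicE -natrM mulnb; congr (nat_of_bool _)%:R.
apply/andP/idP; rewrite !inE.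
  move=> [H H'] i; have := H i; have := H' i; rewrite /= !in_itv/=.
  by move=> /andP[h1 h2] /andP[h3 h4]; rewrite gt_max le_min h1 h2 h3 h4.
move=> H; split => i; have := H i; rewrite /= !in_itv/= gt_max le_min.
  by move=> /andP[/andP[-> _] /andP[-> _]].
by move=> /andP[/andP[_ ->] /andP[_ ->]].
Qed.

Lemma L2_of_sum_sq f g : measurable_fun setT f -> measurable_fun setT g ->
  mu.-integrable setT (EFin \o (fun x => f x * f x + g x * g x)) -> L2 f /\ L2 g.
Proof.
move=> mf mg /integrableP[_].
have W h : measurable_fun setT h -> (forall x, h x ^+ 2 <= f x * f x + g x * g x) ->
    (\int[mu]_x `|(EFin \o (fun x => f x * f x + g x * g x)%R) x| < +oo)%E -> L2 h.
  move=> mh hle lt; split=> //; apply: le_lt_trans lt.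
  apply: ge0_le_integral => //.
  - by move=> x _; rewrite lee_fin sqr_ge0.
  - by apply/measurable_EFinP; exact: measurable_funX.
  - apply: measurableT_comp => //; apply/measurable_EFinP.
    by apply: measurable_funD; apply: measurable_funM.
  - by move=> x _ /=; rewrite lee_fin (le_trans (hle x))// ler_norm.
by move=> lt; split; apply: W => // x; rewrite -!expr2 ?lerDl ?lerDr sqr_ge0.
Qed.

Lemma L2_transform_box (a b : 'I_n -> R) : L2 (cosT (\1_(box a b))) /\ L2 (sinT (\1_(box a b))).
Proof.
have [i _ _ _] := box_parseval a b a b.
by apply: L2_of_sum_sq => //; [apply: measurable_cosT|apply: measurable_sinT];
  apply: measurable_indic; exact: measurable_box.
Qed.

Notation sdata := (seq (R * (('I_n -> R) * ('I_n -> R)))).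

Lemma inL1D f g : inL1 f -> inL1 g -> inL1 (fun x => f x + g x).
Proof.
move=> /Lfun1_integrable i /Lfun1_integrable j; apply/Lfun1_integrable.
exact: (integrableD measurableT i j).
Qed.

Lemma inL1_sum (I : Type) (s : seq I) (F : I -> E -> R) :
  (forall i, inL1 (F i)) -> inL1 (fun x => \sum_(i <- s) F i x).
Proof.
move=> F1; elim: s => [|i s IH].
  under eq_fun do rewrite big_nil; apply/Lfun1_integrable; exact: integrable0.
by under eq_fun do rewrite big_cons; exact: inL1D.
Qed.

Lemma inL1Z c f : inL1 f -> inL1 (fun x => c * f x).
Proof.
by move=> /Lfun1_integrable i; apply/Lfun1_integrable; exact: (integrableZl measurableT c i).
Qed.

Lemma inL1B f g : inL1 f -> inL1 g -> inL1 (fun x => f x - g x).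
Proof.
move=> /Lfun1_integrable i /Lfun1_integrable j; apply/Lfun1_integrable.
exact: (integrableB measurableT i j).
Qed.

Lemma inL1_stepf (s : sdata) : inL1 (stepf s).
Proof. by apply: inL1_sum => p; apply: inL1Z; exact: inL1_box. Qed.

Lemma L2_stepf (s : sdata) : L2 (stepf s).
Proof. by apply: L2_sum => p; apply: L2Z; exact: L2_box. Qed.

Lemma cosT_stepf (s : sdata) : cosT (stepf s) = fun xi => \sum_(p <- s) p.1 * cosT (\1_(box p.2.1 p.2.2)) xi.
Proof.
apply/funext => xi; elim: s => [|p s IH].
  rewrite big_nil /cosT /stepf; under eq_Rintegral do rewrite big_nil mulr0.
  by rewrite /Rintegral integral0.
rewrite big_cons -IH -cosTZ; last exact: inL1_box.
rewrite -cosTD; last 2 first.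
- by apply: inL1Z; exact: inL1_box.
- exact: inL1_stepf.
by congr (cosT _ _); apply/funext => x; rewrite /stepf big_cons.
Qed.

Lemma sinT_stepf (s : sdata) : sinT (stepf s) = fun xi => \sum_(p <- s) p.1 * sinT (\1_(box p.2.1 p.2.2)) xi.
Proof.
apply/funext => xi; elim: s => [|p s IH].
  rewrite big_nil /sinT /stepf; under eq_Rintegral do rewrite big_nil mulr0.
  by rewrite /Rintegral integral0.
rewrite big_cons -IH -sinTZ; last exact: inL1_box.
rewrite -sinTD; last 2 first.
- by apply: inL1Z; exact: inL1_box.
- exact: inL1_stepf.
by congr (sinT _ _); apply/funext => x; rewrite /stepf big_cons.
Qed.

(** Both sides are quadratic in the step function, so bilinear expansion reduces the identity to
    pairs of boxes. *)
Lemma plancherel_stepf (s : sdata) : [/\ L2 (cosT (stepf s)), L2 (sinT (stepf s)) &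
  ip (cosT (stepf s)) (cosT (stepf s)) + ip (sinT (stepf s)) (sinT (stepf s)) =
  K * ip (stepf s) (stepf s)].
Proof.
have c2 (p : R * (('I_n -> R) * ('I_n -> R))) : L2 (cosT (\1_(box p.2.1 p.2.2))).
  by have [] := L2_transform_box p.2.1 p.2.2.
have s2 (p : R * (('I_n -> R) * ('I_n -> R))) : L2 (sinT (\1_(box p.2.1 p.2.2))).
  by have [] := L2_transform_box p.2.1 p.2.2.
have b2 (p : R * (('I_n -> R) * ('I_n -> R))) : L2 (\1_(box p.2.1 p.2.2)) by exact: L2_box.
have C2 : L2 (fun xi => \sum_(p <- s) p.1 * cosT (\1_(box p.2.1 p.2.2)) xi).
  by apply: L2_sum => p; exact: L2Z.
have S2 : L2 (fun xi => \sum_(p <- s) p.1 * sinT (\1_(box p.2.1 p.2.2)) xi).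
  by apply: L2_sum => p; exact: L2Z.
rewrite cosT_stepf sinT_stepf; split=> //.
have e (F : R * (('I_n -> R) * ('I_n -> R)) -> E -> R) : (forall p, L2 (F p)) ->
    ip (fun x => \sum_(p <- s) p.1 * F p x) (fun x => \sum_(p <- s) p.1 * F p x) =
    \sum_(p <- s) p.1 * \sum_(q <- s) q.1 * ip (F p) (F q).
  move=> F2; rewrite ip_suml//; last by apply: L2_sum => p; exact: L2Z.
  by apply: eq_bigr => p _; rewrite ip_sumr.
rewrite -[stepf s]/(fun x => \sum_(p <- s) p.1 * \1_(box p.2.1 p.2.2) x).
rewrite (e _ c2) (e _ s2) (e _ b2) mulr_sumr -big_split/=; apply: eq_bigr => p _.
rewrite -mulrDr mulrCA; congr (_ * _); rewrite -big_split/= mulr_sumr.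
apply: eq_bigr => q _; rewrite -mulrDr mulrCA; congr (_ * _).
have [i eq _ _] := box_parseval p.2.1 p.2.2 q.2.1 q.2.2.
by rewrite ip_box -eq RintegralD//; exact: L2_mul.
Qed.

Lemma pointwise_transform (h : R -> R) (f_ : nat -> E -> R) f xi :
  measurable_fun setT h -> (forall x, `|h x| <= 1) ->
  (forall k, inL1 (f_ k)) -> inL1 f ->
  (\int[mu]_x `|f_ k x - f x|%:E @[k --> \oo] --> 0)%E ->
  \int[mu]_x (h (dotrV x xi) * f_ k x) @[k --> \oo] --> \int[mu]_x (h (dotrV x xi) * f x).
Proof.
move=> mh h1 f1k f1 cf; apply/cvgrPdist_le => e e0.
have md := measurableT_comp mh (@measurable_dotrVl R n xi).
apply: filterS (cvge0_near_le cf e0) => k.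
have d1 := inL1B (f1k k) f1; have /Lfun1_integrable di := d1.
rewrite distrC -RintegralB//; last 2 first.
- exact: (integrable_bounded_mul md (fun x => h1 _)).
- exact: (integrable_bounded_mul md (fun x => h1 _)).
move=> H.
have -> : \int[mu]_x (h (dotrV x xi) * f_ k x - h (dotrV x xi) * f x) =
   \int[mu]_x (h (dotrV x xi) * (f_ k x - f x)).
  by apply: eq_Rintegral => x _; rewrite mulrBr.
have iM := integrable_bounded_mul md (fun x => h1 _) d1.
apply: le_trans (le_normr_Rintegral measurableT iM) _.
apply: (@le_trans _ _ (\int[mu]_x `|f_ k x - f x|)).
  apply: (le_Rintegral measurableT (integrable_norm iM) (integrable_norm di)).
  by move=> x _ /=; rewrite normrM ler_piMl.
rewrite -lee_fin /Rintegral fineK//.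
exact: (integrable_fin_num measurableT (integrable_norm di)).
Qed.

(* [T] stands for the cosine or the sine transform. *)
Lemma transform_cvgL2 (T : (E -> R) -> E -> R) (s : nat -> sdata) f :
  (forall s : sdata, L2 (T (stepf s))) ->
  (forall s : sdata, ip (T (stepf s)) (T (stepf s)) <= K * ip (stepf s) (stepf s)) ->
  (forall (s t : sdata) xi, T (fun x => stepf s x - stepf t x) xi = T (stepf s) xi - T (stepf t) xi) ->
  measurable_fun setT (T f) ->
  (forall xi, T (stepf (s k)) xi @[k --> \oo] --> T f xi) ->
  L2 f -> cvgL2 (fun k => stepf (s k)) f ->
  L2 (T f) /\ cvgL2 (fun k => T (stepf (s k))) (T f).
Proof.
move=> T2 TK TB mT Tpt f2 sf.
have K0 := plancherel_cst_gt0.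
have TBK (u v : sdata) : ip (fun x => T (stepf u) x - T (stepf v) x) (fun x => T (stepf u) x - T (stepf v) x) <=
    K * ip (fun x => stepf u x - stepf v x) (fun x => stepf u x - stepf v x).
  have e : (fun x => stepf u x - stepf v x) = stepf (u ++ [seq (-1 * p.1, p.2) | p <- v]).
    by apply/funext => x; rewrite stepf_cat stepf_scale mulN1r.
  have e' : (fun x => T (stepf u) x - T (stepf v) x) = T (stepf (u ++ [seq (-1 * p.1, p.2) | p <- v])).
    by rewrite -e; apply/funext => x; rewrite TB.
  by rewrite e' e.
(* Fatou in the index [j]: the difference of the transforms of [s k] and [s j] tends pointwise to
   the one with [T f], and the norms of [s k - s j] are at most [2 e]. *)
have near e : 0 < e -> \forall k \near \oo, L2 (fun x => T (stepf (s k)) x - T f x) /\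
    ip (fun x => T (stepf (s k)) x - T f x) (fun x => T (stepf (s k)) x - T f x) <= K * (2 * e) ^+ 2.
  move=> e0; have /cvgrPdist_le /(_ _ e0) [N _ HN] := sf.
  exists N => // k /= Nk.
  apply: (@L2_fatou _ _ _ mu (fun j x => T (stepf (s k)) x - T (stepf (s j)) x)).
  - by apply: measurable_funB => //; case: (T2 (s k)).
  - by move=> j; exact: L2B.
  - by apply: aeW => x; apply: cvgB => //; exact: cvg_cst.
  - exists N => // j /= Nj; apply: le_trans (TBK _ _) _; apply: ler_wpM2l; first exact: ltW.
    rewrite -nrm2 lerXn2r// ?nnegrE ?nrm_ge0 ?mulr_ge0 ?(ltW e0)//.
    apply: le_trans (nrm_tri (L2_stepf _) f2 (L2_stepf _)) _.
    have := HN k Nk; have := HN j Nj; rewrite !sub0r !normrN /= !ger0_norm ?nrm_ge0// (nrmBC _ f).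
    by move=> ? ?; lra.
have [N _ /(_ N (leqnn _)) [d2 _]] := near 1 ltr01.
have Tf2 : L2 (T f).
  rewrite (_ : T f = (fun x => T (stepf (s N)) x - (T (stepf (s N)) x - T f x))); first exact: L2B.
  by apply/funext => x; rewrite opprB addrC subrK.
split=> //; apply/cvgrPdist_le => /= e e0.
pose e' := e / (2 * Num.sqrt K).
have sK : 0 < Num.sqrt K by rewrite sqrtr_gt0.
have e'0 : 0 < e' by rewrite divr_gt0// mulr_gt0.
apply: filterS (near _ e'0) => k [_ h].
rewrite sub0r normrN ger0_norm ?nrm_ge0// -(@ler_pXn2r _ 2)// ?nnegrE ?nrm_ge0 ?(ltW e0)//.
rewrite nrm2; apply: le_trans h _; rewrite le_eqVlt; apply/orP; left; apply/eqP.
have := sqr_sqrtr (ltW K0); rewrite /e'; set q := Num.sqrt K in sK * => hq.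
by rewrite -hq; field; exact: lt0r_neq0.
Qed.

(** The step functions converge in L^1 and in L^2 at once: the first makes their transforms converge
    pointwise, the second makes them Cauchy in L^2. The identity then passes to the limit. *)
Lemma plancherel_L1L2 f : inL1 f -> inL2 f ->
  [/\ L2 (cosT f), L2 (sinT f) & ip (cosT f) (cosT f) + ip (sinT f) (sinT f) = K * ip f f].
Proof.
move=> f1 f2; have [s [sf sf1]] := stepf_dense f1 f2.
have /Lfun2P f2' := f2; have mf := L2_mf f2'.
have s1 k : inL1 (stepf (s k)) by exact: inL1_stepf.
have [c2 cc] : L2 (cosT f) /\ cvgL2 (fun k => cosT (stepf (s k))) (cosT f).
  apply: transform_cvgL2 => //.
  - by move=> t; have [] := plancherel_stepf t.
  - by move=> t; have [? ? <-] := plancherel_stepf t; rewrite lerDl ip_ge0.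
  - move=> t u xi; rewrite -mulN1r -cosTZ -?cosTD; try exact: inL1_stepf.
      by congr (cosT _ _); apply/funext => x; rewrite mulN1r.
    by apply: inL1Z; exact: inL1_stepf.
  - exact: measurable_cosT.
  - by move=> xi; apply: pointwise_transform => //; [exact: measurable_cos|exact: cos_max].
have [s2 cs] : L2 (sinT f) /\ cvgL2 (fun k => sinT (stepf (s k))) (sinT f).
  apply: transform_cvgL2 => //.
  - by move=> t; have [] := plancherel_stepf t.
  - by move=> t; have [? ? <-] := plancherel_stepf t; rewrite lerDr ip_ge0.
  - move=> t u xi; rewrite -mulN1r -sinTZ -?sinTD; try exact: inL1_stepf.
      by congr (sinT _ _); apply/funext => x; rewrite mulN1r.
    by apply: inL1Z; exact: inL1_stepf.
  - exact: measurable_sinT.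
  - by move=> xi; apply: pointwise_transform => //; [exact: measurable_sin|exact: sin_max].
split=> //.
have cs2 k : L2 (cosT (stepf (s k))) by have [] := plancherel_stepf (s k).
have ss2 k : L2 (sinT (stepf (s k))) by have [] := plancherel_stepf (s k).
have l1 : ip (cosT (stepf (s k))) (cosT (stepf (s k))) + ip (sinT (stepf (s k))) (sinT (stepf (s k)))
    @[k --> \oo] --> ip (cosT f) (cosT f) + ip (sinT f) (sinT f).
  by apply: cvgD; exact: cvgL2_ip.
have l2 : K * ip (stepf (s k)) (stepf (s k)) @[k --> \oo] --> K * ip f f.
  apply: cvgM; first exact: cvg_cst.
  by apply: cvgL2_ip => // k; exact: L2_stepf.
have e : (fun k => ip (cosT (stepf (s k))) (cosT (stepf (s k))) + ip (sinT (stepf (s k))) (sinT (stepf (s k)))) =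
    (fun k => K * ip (stepf (s k)) (stepf (s k))).
  by apply/funext => k; have [] := plancherel_stepf (s k).
by rewrite e in l1; exact: (cvg_unique _ l1 l2).
Qed.

End plancherel.

(** * The Hartley transform and its inversion on L^2 *)

Section hartley.
Context (R : realType) (n : nat).
Local Notation E := 'rV[R]_n.
Local Notation mu := (lebesgue_rV R n).
Local Notation L2 := (L2 mu).
Local Notation ip := (ip mu).
Local Notation nrm := (nrm mu).
Local Notation cvgL2 := (cvgL2 mu).
Local Notation K := (plancherel_cst R n).
Implicit Types (f g h : E -> R).

Definition L12 f := inL1 f /\ L2 f.

Lemma L12D f g : L12 f -> L12 g -> L12 (fun x => f x + g x).
Proof. by move=> [f1 f2] [g1 g2]; split; [exact: inL1D|exact: L2D]. Qed.

Lemma L12Z c f : L12 f -> L12 (fun x => c * f x).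
Proof. by move=> [f1 f2]; split; [exact: inL1Z|exact: L2Z]. Qed.

Lemma plancherel f : L12 f ->
  [/\ L2 (cosT f), L2 (sinT f) & ip (cosT f) (cosT f) + ip (sinT f) (sinT f) = K * ip f f].
Proof. by move=> [f1 /Lfun2P f2]; exact: plancherel_L1L2. Qed.

Definition refl f : E -> R := fun x => f (- x).

Lemma L2_refl f : L2 f -> L2 (refl f).
Proof. exact: (L2_invariant (@measurable_opp R n) (@lebesgue_rV_opp R n)). Qed.

Lemma ip_refl f g : L2 f -> L2 g -> ip (refl f) (refl g) = ip f g.
Proof. exact: (ip_invariant (@measurable_opp R n) (@lebesgue_rV_opp R n)). Qed.

Lemma ip_even_odd f g : L2 f -> L2 g -> (forall x, f (- x) = f x) -> (forall x, g (- x) = - g x) ->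
  ip f g = 0.
Proof.
move=> f2 g2 ef og; have := ip_refl f2 g2.
rewrite (_ : refl f = f); last by apply/funext => x; rewrite /refl ef.
rewrite (_ : refl g = (fun x => -1 * g x)); last by apply/funext => x; rewrite /refl og mulN1r.
by rewrite ipZr// mulN1r => h; lra.
Qed.

(** The Hartley transform: a real substitute for the Fourier transform with the symmetric kernel
    [cos + sin]. It is self-adjoint and an isometry up to the square root of [K], hence invertible
    on L^2, which yields surjectivity without any pointwise inversion formula. *)
Definition hart f : E -> R := fun xi => cosT f xi + sinT f xi.

Lemma L2_hart f : L12 f -> L2 (hart f).
Proof. by move=> /plancherel[c s _]; exact: L2D. Qed.

(** The cross terms vanish because [cosT f] is even and [sinT f] is odd; what is left is
    Plancherel. *)
Lemma hart_isometry f : L12 f -> ip (hart f) (hart f) = K * ip f f.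
Proof.
move=> f12; have [c s <-] := plancherel f12; have [f1 _] := f12.
rewrite ipDl// ?ipDr//; last exact: L2D.
have -> : ip (cosT f) (sinT f) = 0.
  by apply: ip_even_odd => // x; [exact: cosTN|exact: sinTN].
by rewrite (ipC _ (sinT f)) (ip_even_odd c s) ?addr0 ?add0r// => x; [exact: cosTN|exact: sinTN].
Qed.

Lemma hartE f xi : inL1 f -> hart f xi = \int[mu]_x ((cos (dotrV x xi) + sin (dotrV x xi)) * f x).
Proof.
move=> f1; rewrite /hart /cosT /sinT -RintegralD//; last 2 first.
- exact: integrable_cosT.
- exact: integrable_sinT.
by apply: eq_Rintegral => x _; rewrite mulrDl.
Qed.

Lemma dotrVC (x y : E) : dotrV x y = dotrV y x.
Proof. by apply: eq_bigr => i _; rewrite mulrC. Qed.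

(** Fubini, since the kernel [cos (x . xi) + sin (x . xi)] is bounded and symmetric in [x] and
    [xi]. *)
Lemma hart_adjoint f g : inL1 f -> inL1 g -> ip (hart f) g = ip f (hart g).
Proof.
move=> f1 g1.
have /Lfun1_integrable fi := f1; have /Lfun1_integrable gi := g1.
have mf : measurable_fun setT f by apply/measurable_EFinP; exact: measurable_int fi.
have mg : measurable_fun setT g by apply/measurable_EFinP; exact: measurable_int gi.
pose F (z : E * E) := (cos (dotrV z.1 z.2) + sin (dotrV z.1 z.2)) * (f z.1 * g z.2).
have mF : measurable_fun setT F.
  apply: measurable_funM.
    apply: measurable_funD.
      exact: (measurableT_comp (@measurable_cos R) (@measurable_dotrV R n)).
    exact: (measurableT_comp (@measurable_sin R) (@measurable_dotrV R n)).
  apply: measurable_funM; first exact: (measurableT_comp mf measurable_fst).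
  exact: (measurableT_comp mg measurable_snd).
have [ifg _] := integrable_prod_mul fi gi.
have iF : (mu \x mu)%E.-integrable setT (EFin \o F).
  apply: le_integrable (integrableZl measurableT 2 ifg) => //; first exact/measurable_EFinP.
  move=> z _ /=; rewrite lee_fin normrM (normrM 2) (ger0_norm (ler0n _ 2)) ler_wpM2r//.
  by apply: le_trans (ler_normD _ _) _; rewrite -[2]/(1 + 1) lerD// ?cos_max ?sin_max.
have icas (u : E -> R) xi : inL1 u ->
    mu.-integrable setT (EFin \o (fun x => (cos (dotrV x xi) + sin (dotrV x xi)) * u x)).
  apply: (@integrable_bounded_mul R n (fun x => cos (dotrV x xi) + sin (dotrV x xi)) u 2).
    apply: measurable_funD.
      exact: (measurableT_comp (@measurable_cos R) (@measurable_dotrVl R n xi)).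
    exact: (measurableT_comp (@measurable_sin R) (@measurable_dotrVl R n xi)).
  move=> x; apply: le_trans (ler_normD _ _) _; rewrite -[2]/(1 + 1).
  by rewrite lerD// ?cos_max ?sin_max.
have e1 xi : (\int[mu]_x (F (x, xi))%:E = (hart f xi * g xi)%:E)%E.
  rewrite hartE// /Rintegral EFinM fineK; last first.
    by apply: integrable_fin_num => //; exact: icas.
  rewrite -integralZr//; last exact: icas.
  by apply: eq_integral => x _; rewrite /F/= mulrA.
have e2 x : (\int[mu]_xi (F (x, xi))%:E = (f x * hart g x)%:E)%E.
  rewrite hartE// /Rintegral EFinM fineK; last first.
    by apply: integrable_fin_num => //; exact: icas.
  rewrite -integralZl//; last exact: icas.
  by apply: eq_integral => xi _; rewrite /F/= (dotrVC xi) -EFinM mulrCA.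
have := Fubini iF; rewrite /comp/=.
under eq_integral do rewrite e2.
under [X in _ = X -> _]eq_integral do rewrite e1.
by move=> H; rewrite /L2Space.ip /Rintegral H.
Qed.

Definition isH f h := [/\ L2 f, L2 h & exists f_ : nat -> E -> R,
  [/\ forall k, L12 (f_ k), cvgL2 f_ f & cvgL2 (fun k => hart (f_ k)) h]].

Lemma isH_isometry f h : isH f h -> ip h h = K * ip f f.
Proof.
move=> [f2 h2 [f_ [f12 cf ch]]].
have H2 k := L2_hart (f12 k); have F2 k : L2 (f_ k) by case: (f12 k).
have l1 := cvgL2_ip H2 h2 H2 h2 ch ch.
have l2 : K * ip (f_ k) (f_ k) @[k --> \oo] --> K * ip f f.
  by apply: cvgM; [exact: cvg_cst|exact: cvgL2_ip].
have e : (fun k => ip (hart (f_ k)) (hart (f_ k))) = (fun k => K * ip (f_ k) (f_ k)).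
  by apply/funext => k; exact: hart_isometry.
by rewrite e in l1; exact: (cvg_unique _ l1 l2).
Qed.

Lemma hartD f g xi : inL1 f -> inL1 g -> hart (fun x => f x + g x) xi = hart f xi + hart g xi.
Proof. by move=> f1 g1; rewrite /hart cosTD// sinTD//; ring. Qed.

Lemma hartZ c f xi : inL1 f -> hart (fun x => c * f x) xi = c * hart f xi.
Proof. by move=> f1; rewrite /hart cosTZ// sinTZ//; ring. Qed.

Lemma isHD f h g k : isH f h -> isH g k -> isH (fun x => f x + g x) (fun x => h x + k x).
Proof.
move=> [f2 h2 [f_ [f12 cf ch]]] [g2 k2 [g_ [g12 cg ck]]].
split; [exact: L2D|exact: L2D|].
exists (fun i x => f_ i x + g_ i x); split.
- by move=> i; exact: L12D.
- by apply: cvgL2D => // i; [case: (f12 i)|case: (g12 i)].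
- rewrite (_ : (fun i => _) = (fun i x => hart (f_ i) x + hart (g_ i) x)).
    by apply: cvgL2D => // i; exact: L2_hart.
  by apply/funext => i; apply/funext => x; rewrite hartD//; [case: (f12 i)|case: (g12 i)].
Qed.

Lemma isHZ c f h : isH f h -> isH (fun x => c * f x) (fun x => c * h x).
Proof.
move=> [f2 h2 [f_ [f12 cf ch]]].
split; [exact: L2Z|exact: L2Z|].
exists (fun i x => c * f_ i x); split.
- by move=> i; exact: L12Z.
- by apply: cvgL2Z => // i; case: (f12 i).
- rewrite (_ : (fun i => _) = (fun i x => c * hart (f_ i) x)).
    by apply: cvgL2Z => // i; exact: L2_hart.
  by apply/funext => i; apply/funext => x; rewrite hartZ//; case: (f12 i).
Qed.

(** Polarisation of [isH_isometry]. *)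
Lemma isH_ip f h g k : isH f h -> isH g k -> ip h k = K * ip f g.
Proof.
move=> Hf Hg; have := isH_isometry (isHD Hf Hg).
have e1 := isH_isometry Hf; have e2 := isH_isometry Hg.
move: Hf Hg => [f2 h2 _] [g2 k2 _].
have sqD u v : L2 u -> L2 v ->
    ip (fun x => u x + v x) (fun x => u x + v x) = ip u u + 2 * ip u v + ip v v.
  move=> u2 v2; have uv2 := L2D u2 v2.
  by rewrite ipDl// !ipDr// (ipC _ v u); ring.
by rewrite !sqD// e1 e2 => H; lra.
Qed.

Lemma isH_adjoint f h g k : isH f h -> isH g k -> ip h g = ip f k.
Proof.
move=> [f2 h2 [f_ [f12 cf ch]]] [g2 k2 [g_ [g12 cg ck]]].
have F2 i : L2 (f_ i) by case: (f12 i).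
have G2 i : L2 (g_ i) by case: (g12 i).
have HF2 i := L2_hart (f12 i); have HG2 i := L2_hart (g12 i).
have l1 := cvgL2_ip HF2 h2 G2 g2 ch cg.
have l2 := cvgL2_ip F2 f2 HG2 k2 cf ck.
have e : (fun i => ip (hart (f_ i)) (g_ i)) = (fun i => ip (f_ i) (hart (g_ i))).
  by apply/funext => i; apply: hart_adjoint; [case: (f12 i)|case: (g12 i)].
by rewrite e in l1; exact: (cvg_unique _ l1 l2).
Qed.

Lemma L12_dense f : L2 f -> exists2 f_ : nat -> E -> R, forall k, L12 (f_ k) & cvgL2 f_ f.
Proof.
move=> f2; have mf := L2_mf f2.
pose f_ (k : nat) x := \1_(cube k) x * f x.
have fle k x : `|f_ k x| <= `|f x|.
  by rewrite /f_ indicE; case: (_ \in _); rewrite ?mul1r// mul0r normr0.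
have mfk k : measurable_fun setT (f_ k).
  by apply: measurable_funM => //; apply: measurable_indic; exact: measurable_box.
have fk2 k : L2 (f_ k) by apply: (@L2_le _ _ _ mu _ f 1) => // x; rewrite mul1r.
have f12 k : L12 (f_ k).
  split=> //; apply: (@Lfun2_mul_Lfun1 _ _ _ mu (\1_(cube k)) f); apply/Lfun2P => //.
  exact: L2_box.
exists f_ => //; apply: (@cvgL2_dominated _ _ _ mu _ _ f) => // x.
apply: (@cvg_near_cst _ R^o); have [N Nx] := mem_cube x; exists N => // k /= Nk.
by rewrite /f_ indicE mem_set ?mul1r//; exact: (cube_nd Nk).
Qed.

(** [hart] multiplies distances by the square root of [K] on a dense subspace, so it maps an
    approximating sequence to a Cauchy one, and L^2 is complete. *)
Lemma isH_exists f : L2 f -> exists h, isH f h.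
Proof.
move=> f2; have [f_ f12 cf] := L12_dense f2.
have fk2 k : L2 (f_ k) by case: (f12 k).
have H2 k := L2_hart (f12 k).
have [h h2 ch] : exists2 h, L2 h & cvgL2 (fun k => hart (f_ k)) h.
  apply: L2_complete => // e e0.
  have K0 := plancherel_cst_gt0 R n.
  have sK : 0 < Num.sqrt K by rewrite sqrtr_gt0.
  have e'0 : 0 < e / (2 * Num.sqrt K) by rewrite divr_gt0// mulr_gt0.
  have /cvgrPdist_le /(_ _ e'0) [N _ HN] := cf.
  exists N => i j Ni Nj.
  have d12 : L12 (fun x => f_ i x + -1 * f_ j x) by apply: L12D => //; exact: L12Z.
  have -> : nrm (fun x => hart (f_ i) x - hart (f_ j) x) = Num.sqrt K * nrm (fun x => f_ i x - f_ j x).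
    rewrite /L2Space.nrm -sqrtrM ?(ltW K0)//; congr Num.sqrt.
    have e1 : (fun x => f_ i x - f_ j x) = (fun x => f_ i x + -1 * f_ j x).
      by apply/funext => x; rewrite mulN1r.
    have e2 : (fun x => hart (f_ i) x - hart (f_ j) x) = hart (fun x => f_ i x + -1 * f_ j x).
      have [fi1 _] := f12 i; have [fj1 _] := f12 j.
      by apply/funext => x; rewrite hartD ?hartZ ?mulN1r//; exact: inL1Z.
    by rewrite e1 e2 hart_isometry.
  have h1 := HN i Ni; have h2 := HN j Nj.
  rewrite /= !sub0r !normrN !ger0_norm ?nrm_ge0// in h1 h2.
  apply: (@le_trans _ _ (Num.sqrt K * (2 * (e / (2 * Num.sqrt K))))); last first.
    by rewrite le_eqVlt; apply/orP; left; apply/eqP; field; exact: lt0r_neq0.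
  rewrite ler_wpM2l ?(ltW sK)//; apply: le_trans (nrm_tri (fk2 i) f2 (fk2 j)) _.
  by rewrite (nrmBC _ f); lra.
by exists h; split=> //; exists f_.
Qed.

Lemma isH_ae_eq f h k : isH f h -> L2 k -> {ae mu, forall x, h x = k x} -> isH f k.
Proof.
move=> [f2 h2 [f_ [f12 cf ch]]] k2 hk; split=> //; exists f_; split=> //.
have H2 i := L2_hart (f12 i).
rewrite /L2Space.cvgL2 (_ : (fun i => _) = (fun i => nrm (fun x => hart (f_ i) x - h x)))//.
apply/funext => i; symmetry.
have [] // := @eq_ae_nrm _ _ _ mu (fun x => hart (f_ i) x - h x) (fun x => hart (f_ i) x - k x).
- exact: L2B.
- by apply: measurable_funB; [exact: L2_mf (H2 i)|exact: L2_mf k2].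
- by move: hk; apply: filterS => x ->.
Qed.

(** For [d] with Hartley transform [p], [<k, d> = <h, p> = K <f, d>] by self-adjointness and
    isometry; take [d = k - K f]. *)
Lemma isH_inv f h k : isH f h -> isH h k -> {ae mu, forall x, k x = K * f x}.
Proof.
move=> Hf Hh; have [f2 h2 _] := Hf; have [_ k2 _] := Hh.
have d2 : L2 (fun x => k x - K * f x) by apply: L2B => //; exact: L2Z.
have [p Hp] := isH_exists d2.
have n0 : nrm (fun x => k x - K * f x) = 0.
  apply/eqP; rewrite sqrtr_eq0 le_eqVlt; apply/orP; left; apply/eqP.
  rewrite {1}ipBl ?ipZl//; last exact: L2Z.
  by rewrite (ipC _ k) -(isH_adjoint Hp Hh) (ipC _ p) (isH_ip Hf Hp) subrr.
by have := nrm0_ae d2 n0; apply: filterS => x /eqP; rewrite subr_eq0 => /eqP.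
Qed.

(** By [isH_inv] the transform is its own inverse up to the factor [K]: transforming [h] and
    dividing by [K] gives a preimage. *)
Lemma isH_surj h : L2 h -> exists f, isH f h.
Proof.
move=> h2; have [f Hf] := isH_exists h2.
have [k Hk] : exists k, isH f k by apply: isH_exists; case: Hf.
have K0 := lt0r_neq0 (plancherel_cst_gt0 R n).
exists (fun x => K^-1 * f x).
apply: isH_ae_eq (isHZ K^-1 Hk) h2 _.
have := isH_inv Hf Hk; apply: filterS => x ->.
by rewrite mulrA mulVf// mul1r.
Qed.

End hartley.

(** * The Fourier transform on L^2 through its real and imaginary parts *)

Section fourier_L2.
Context (R : realType) (n : nat).
Local Notation E := 'rV[R]_n.
Local Notation mu := (lebesgue_rV R n).
Local Notation L2 := (L2 mu).
Local Notation ip := (ip mu).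
Local Notation nrm := (nrm mu).
Local Notation cvgL2 := (cvgL2 mu).
Local Notation K := (plancherel_cst R n).
Implicit Types (f c s : E -> R) (g : E -> R[i]).

(* [c] and [s] are the real and imaginary parts of the transform of [f]. *)
Definition isF f c s := [/\ L2 f, L2 c, L2 s & exists f_ : nat -> E -> R,
  [/\ forall k, L12 (f_ k), cvgL2 f_ f, cvgL2 (fun k => cosT (f_ k)) c &
      cvgL2 (fun k xi => - sinT (f_ k) xi) s]].

Lemma Re_normc_sq (z : R[i]) : complex.Re `|z| ^+ 2 = complex.Re z ^+ 2 + complex.Im z ^+ 2.
Proof. by case: z => a b; rewrite /= sqr_sqrtr// addr_ge0// sqr_ge0. Qed.

Lemma measurable_Re_normc g : measurable_fun setT (fun xi => complex.Re (g xi)) ->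
  measurable_fun setT (fun xi => complex.Im (g xi)) ->
  measurable_fun setT (fun xi => complex.Re `|g xi|).
Proof.
move=> mr mi.
have -> : (fun xi => complex.Re `|g xi|) =
    (fun xi => Num.sqrt (complex.Re (g xi) ^+ 2 + complex.Im (g xi) ^+ 2)).
  by apply/funext => xi; case: (g xi).
have ms : measurable_fun setT (@Num.sqrt R).
  by apply: continuous_measurable_fun; exact: sqrt_continuous.
by apply: (measurableT_comp ms); apply: measurable_funD; exact: measurable_funX.
Qed.

Lemma L2_normc g : L2 (fun xi => complex.Re (g xi)) -> L2 (fun xi => complex.Im (g xi)) ->
  L2 (fun xi => complex.Re `|g xi|) /\
  nrm (fun xi => complex.Re `|g xi|) ^+ 2 =
    nrm (fun xi => complex.Re (g xi)) ^+ 2 + nrm (fun xi => complex.Im (g xi)) ^+ 2.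
Proof.
move=> r2 i2.
have e : sq mu (fun xi => complex.Re `|g xi|) =
    (sq mu (fun xi => complex.Re (g xi)) + sq mu (fun xi => complex.Im (g xi)))%E.
  rewrite /sq -ge0_integralD//.
  - by apply: eq_integral => xi _; rewrite Re_normc_sq EFinD.
  - by move=> xi _; rewrite lee_fin sqr_ge0.
  - by apply/measurable_EFinP; apply: measurable_funX; exact: L2_mf r2.
  - by move=> xi _; rewrite lee_fin sqr_ge0.
  - by apply/measurable_EFinP; apply: measurable_funX; exact: L2_mf i2.
have n2 : L2 (fun xi => complex.Re `|g xi|).
  split; first by apply: measurable_Re_normc; [exact: L2_mf r2|exact: L2_mf i2].
  by rewrite e lte_add_pinfty//; [case: r2|case: i2].
split=> //; rewrite !nrm2; apply: EFin_inj; rewrite EFinD -!sqE//.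
Qed.

Lemma fourierL1_dist f g : L12 f -> L2 (fun xi => complex.Re (g xi)) ->
  L2 (fun xi => complex.Im (g xi)) ->
  L2 (fun xi => complex.Re `|fourierL1 f xi - g xi|) /\
  nrm (fun xi => complex.Re `|fourierL1 f xi - g xi|) ^+ 2 =
    nrm (fun xi => cosT f xi - complex.Re (g xi)) ^+ 2 +
    nrm (fun xi => - sinT f xi - complex.Im (g xi)) ^+ 2.
Proof.
move=> f12 r2 i2; have [c2 s2 _] := plancherel f12.
have e1 : (fun xi => complex.Re (fourierL1 f xi - g xi)) = (fun xi => cosT f xi - complex.Re (g xi)).
  by apply/funext => xi; rewrite fourierL1E; case: (g xi).
have e2 : (fun xi => complex.Im (fourierL1 f xi - g xi)) = (fun xi => - sinT f xi - complex.Im (g xi)).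
  by apply/funext => xi; rewrite fourierL1E; case: (g xi).
rewrite -e1 -e2; apply: (@L2_normc (fun xi => fourierL1 f xi - g xi)).
  by rewrite e1; exact: L2B.
by rewrite e2; apply: L2B => //; exact: L2N.
Qed.

(** The squared modulus of the error is the sum of the squared errors of the real and imaginary
    parts, so one complex limit is the same as two real ones. *)
Lemma is_fourierP f g : is_fourier f g <->
  isF f (fun xi => complex.Re (g xi)) (fun xi => complex.Im (g xi)).
Proof.
split.
- move=> [/Lfun2P f2 [/Lfun2P r2 /Lfun2P i2] [f_ [f12 cf cg]]]; split=> //.
  have F12 k : L12 (f_ k) by have [? /Lfun2P ?] := f12 k; split.
  have C2 k : L2 (cosT (f_ k)) by have [] := plancherel (F12 k).
  have S2 k : L2 (fun x => - sinT (f_ k) x).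
    by apply: L2N; have [] := plancherel (F12 k).
  exists f_; split=> //; first by apply/cvgL2P => // k; case: (F12 k).
  + have N k := fourierL1_dist (F12 k) r2 i2.
    have cn : nrm (fun xi => complex.Re `|fourierL1 (f_ k) xi - g xi|) @[k --> \oo] --> (0 : R).
      move: cg; rewrite /L2normC /L2norm (_ : (fun k => _) =
        EFin \o (fun k => nrm (fun xi => complex.Re `|fourierL1 (f_ k) xi - g xi|))).
        by move=> /fine_cvgP[_].
      by apply/funext => k; rewrite Lnorm_nrm//; case: (N k).
    apply: (squeeze_cvgr _ (cvg_cst 0) cn); apply: nearW => k; rewrite nrm_ge0/=.
    rewrite -(@ler_pXn2r _ 2)// ?nnegrE ?nrm_ge0//; have [_ ->] := N k.
    by rewrite lerDl sqr_ge0.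
  + have N k := fourierL1_dist (F12 k) r2 i2.
    have cn : nrm (fun xi => complex.Re `|fourierL1 (f_ k) xi - g xi|) @[k --> \oo] --> (0 : R).
      move: cg; rewrite /L2normC /L2norm (_ : (fun k => _) =
        EFin \o (fun k => nrm (fun xi => complex.Re `|fourierL1 (f_ k) xi - g xi|))).
        by move=> /fine_cvgP[_].
      by apply/funext => k; rewrite Lnorm_nrm//; case: (N k).
    apply: (squeeze_cvgr _ (cvg_cst 0) cn); apply: nearW => k; rewrite nrm_ge0/=.
    rewrite -(@ler_pXn2r _ 2)// ?nnegrE ?nrm_ge0//; have [_ ->] := N k.
    by rewrite lerDr sqr_ge0.
- move=> [f2 r2 i2 [f_ [F12 cf cc cs]]]; split; [exact/Lfun2P|by split; exact/Lfun2P|].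
  have C2 k : L2 (cosT (f_ k)) by have [] := plancherel (F12 k).
  have S2 k : L2 (fun x => - sinT (f_ k) x).
    by apply: L2N; have [] := plancherel (F12 k).
  have N k := fourierL1_dist (F12 k) r2 i2.
  exists f_; split.
  + by move=> k; have [? ?] := F12 k; split=> //; exact/Lfun2P.
  + by apply/cvgL2P => // k; case: (F12 k).
  + rewrite /L2normC /L2norm (_ : (fun k => _) =
        EFin \o (fun k => nrm (fun xi => complex.Re `|fourierL1 (f_ k) xi - g xi|))); last first.
      by apply/funext => k; rewrite Lnorm_nrm//; case: (N k).
    apply: cvg_toE; apply: (squeeze_cvgr _ (cvg_cst 0) (cvg_nrmD cc cs)).
    apply: nearW => k; rewrite nrm_ge0/=.
    rewrite -(@ler_pXn2r _ 2)// ?nnegrE ?addr_ge0 ?nrm_ge0//; have [_ ->] := N k.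
    by rewrite sqrrD lerD2r lerDl mulrn_wge0// mulr_ge0 ?nrm_ge0.
Qed.

Lemma isF_norm f c s : isF f c s -> ip c c + ip s s = K * ip f f.
Proof.
move=> [f2 c2 s2 [f_ [F12 cf cc cs]]].
have C2 k : L2 (cosT (f_ k)) by have [] := plancherel (F12 k).
have S2' k : L2 (sinT (f_ k)) by have [] := plancherel (F12 k).
have S2 k : L2 (fun x => - sinT (f_ k) x) by exact: L2N.
have F2 k : L2 (f_ k) by case: (F12 k).
have l1 : ip (cosT (f_ k)) (cosT (f_ k)) + ip (fun x => - sinT (f_ k) x) (fun x => - sinT (f_ k) x)
    @[k --> \oo] --> ip c c + ip s s by apply: cvgD; exact: cvgL2_ip.
have l2 : K * ip (f_ k) (f_ k) @[k --> \oo] --> K * ip f f.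
  by apply: cvgM; [exact: cvg_cst|exact: cvgL2_ip].
have e : (fun k => ip (cosT (f_ k)) (cosT (f_ k)) + ip (fun x => - sinT (f_ k) x) (fun x => - sinT (f_ k) x)) =
    (fun k => K * ip (f_ k) (f_ k)).
  apply/funext => k; have [_ _ <-] := plancherel (F12 k); congr (_ + _).
  by apply: eq_Rintegral => x _; rewrite mulrNN.
by rewrite e in l1; exact: (cvg_unique _ l1 l2).
Qed.

Lemma isFD f c s f' c' s' : isF f c s -> isF f' c' s' ->
  isF (fun x => f x + f' x) (fun x => c x + c' x) (fun x => s x + s' x).
Proof.
move=> [f2 c2 s2 [f_ [F12 cf cc cs]]] [g2 c2' s2' [g_ [G12 cg cc' cs']]].
have C2 k : L2 (cosT (f_ k)) by have [] := plancherel (F12 k).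
have S2 k : L2 (fun x => - sinT (f_ k) x) by apply: L2N; have [] := plancherel (F12 k).
have C2' k : L2 (cosT (g_ k)) by have [] := plancherel (G12 k).
have S2' k : L2 (fun x => - sinT (g_ k) x) by apply: L2N; have [] := plancherel (G12 k).
split; [exact: L2D|exact: L2D|exact: L2D|].
exists (fun k x => f_ k x + g_ k x); split.
- by move=> k; exact: L12D.
- by apply: cvgL2D => // k; [case: (F12 k)|case: (G12 k)].
- rewrite (_ : (fun k => _) = (fun k x => cosT (f_ k) x + cosT (g_ k) x)); first exact: cvgL2D.
  by apply/funext => k; apply/funext => x; rewrite cosTD//; [case: (F12 k)|case: (G12 k)].
- rewrite (_ : (fun k => _) = (fun k x => - sinT (f_ k) x + - sinT (g_ k) x)); first exact: cvgL2D.
  by apply/funext => k; apply/funext => x; rewrite sinTD ?opprD//; [case: (F12 k)|case: (G12 k)].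
Qed.

Lemma isFZ a f c s : isF f c s -> isF (fun x => a * f x) (fun x => a * c x) (fun x => a * s x).
Proof.
move=> [f2 c2 s2 [f_ [F12 cf cc cs]]].
have C2 k : L2 (cosT (f_ k)) by have [] := plancherel (F12 k).
have S2 k : L2 (fun x => - sinT (f_ k) x) by apply: L2N; have [] := plancherel (F12 k).
split; [exact: L2Z|exact: L2Z|exact: L2Z|].
exists (fun k x => a * f_ k x); split.
- by move=> k; exact: L12Z.
- by apply: cvgL2Z => // k; case: (F12 k).
- rewrite (_ : (fun k => _) = (fun k x => a * cosT (f_ k) x)); first exact: cvgL2Z.
  by apply/funext => k; apply/funext => x; rewrite cosTZ//; case: (F12 k).
- rewrite (_ : (fun k => _) = (fun k x => a * - sinT (f_ k) x)); first exact: cvgL2Z.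
  by apply/funext => k; apply/funext => x; rewrite sinTZ ?mulrN//; case: (F12 k).
Qed.

Lemma isFB f c s f' c' s' : isF f c s -> isF f' c' s' ->
  isF (fun x => f x - f' x) (fun x => c x - c' x) (fun x => s x - s' x).
Proof.
move=> F F'; have := isFD F (isFZ (-1) F').
have e (h h' : E -> R) : (fun x => h x + -1 * h' x) = (fun x => h x - h' x).
  by apply/funext => x; rewrite mulN1r.
by rewrite !e.
Qed.

Lemma isF_L12 f : L12 f -> isF f (cosT f) (fun xi => - sinT f xi).
Proof.
move=> F12; have [c2 s2 _] := plancherel F12; have [_ f2] := F12.
have s2' : L2 (fun x => - sinT f x) by exact: L2N.
split=> //; exists (fun=> f); split=> //; exact: cvgL2_cst.
Qed.

Lemma isF_unique f c s c' s' : isF f c s -> isF f c' s' ->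
  {ae mu, forall xi, c xi = c' xi} /\ {ae mu, forall xi, s xi = s' xi}.
Proof.
move=> F F'; have := isF_norm (isFB F F').
move: F F' => [f2 c2 s2 _] [_ c2' s2' _].
rewrite [X in K * X](_ : _ = 0); last first.
  by rewrite /L2Space.ip; under eq_Rintegral do rewrite subrr mul0r; rewrite /Rintegral integral0.
rewrite mulr0 => e.
have h1 := ip_ge0 mu (fun x => c x - c' x); have h2 := ip_ge0 mu (fun x => s x - s' x).
have n1 : nrm (fun x => c x - c' x) = 0.
  by apply/eqP; rewrite sqrtr_eq0; lra.
have n2 : nrm (fun x => s x - s' x) = 0.
  by apply/eqP; rewrite sqrtr_eq0; lra.
split.
  by have := nrm0_ae (L2B c2 c2') n1; apply: filterS => x /eqP; rewrite subr_eq0 => /eqP.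
by have := nrm0_ae (L2B s2 s2') n2; apply: filterS => x /eqP; rewrite subr_eq0 => /eqP.
Qed.

Lemma cvgL2_refl (f_ : nat -> E -> R) f : (forall k, L2 (f_ k)) -> L2 f -> cvgL2 f_ f ->
  cvgL2 (fun k => refl (f_ k)) (refl f).
Proof.
move=> f2k f2; rewrite /L2Space.cvgL2 (_ : (fun k => nrm _) = (fun k => nrm (fun x => f_ k x - f x)))//.
apply/funext => k; rewrite /L2Space.nrm; congr Num.sqrt.
by rewrite -[RHS]ip_refl//; exact: L2B.
Qed.

(** The even part of the Hartley transform is the cosine transform and its odd part is the sine
    transform; the Fourier transform has imaginary part minus the latter. *)
Lemma isF_of_isH f h : isH f h ->
  isF f (fun x => 2^-1 * (h x + h (- x))) (fun x => 2^-1 * (h (- x) - h x)).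
Proof.
move=> [f2 h2 [f_ [F12 cf ch]]].
have H2 k := L2_hart (F12 k); have rh2 := L2_refl h2; have rH2 k := L2_refl (H2 k).
have cr := cvgL2_refl H2 h2 ch.
split; [by []|by apply: L2Z; exact: L2D|by apply: L2Z; exact: L2B|].
have sN k x : sinT (f_ k) (- x) = - sinT (f_ k) x by apply: sinTN; case: (F12 k).
exists f_; split=> //.
- rewrite (_ : (fun k => _) = (fun k x => 2^-1 * (hart (f_ k) x + refl (hart (f_ k)) x))).
    by apply: cvgL2Z; [move=> k; exact: L2D|exact: L2D|exact: cvgL2D].
  by apply/funext => k; apply/funext => x; rewrite /refl /hart cosTN sN; field.
- rewrite (_ : (fun k => _) = (fun k x => 2^-1 * (refl (hart (f_ k)) x + -1 * hart (f_ k) x))).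
    rewrite (_ : (fun x => _) = (fun x => 2^-1 * (refl h x + -1 * h x))).
      apply: cvgL2Z; [by move=> k; apply: L2D => //; exact: L2Z|by apply: L2D => //; exact: L2Z|].
      by apply: cvgL2D => //; [move=> k; exact: L2Z|exact: L2Z|exact: cvgL2Z].
    by apply/funext => x; rewrite mulN1r.
  by apply/funext => k; apply/funext => x; rewrite /refl /hart cosTN sN; field.
Qed.

Lemma isF_exists f : L2 f -> exists c s, [/\ isF f c s, forall x, c (- x) = c x &
  forall x, s (- x) = - s x].
Proof.
move=> f2; have [h Hh] := isH_exists f2.
exists (fun x => 2^-1 * (h x + h (- x))), (fun x => 2^-1 * (h (- x) - h x)).
split; first exact: isF_of_isH.
- by move=> x; rewrite opprK addrC.
- by move=> x; rewrite opprK -mulrN opprB.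
Qed.

(** Even real part and odd imaginary part is the symmetry of transforms of real functions. The
    function sought is the one whose Hartley transform is [c - s]. *)
Lemma isF_surj c s : L2 c -> L2 s -> (forall x, c (- x) = c x) -> (forall x, s (- x) = - s x) ->
  exists f, isF f c s.
Proof.
move=> c2 s2 ec os; have [f Hf] := isH_surj (L2B c2 s2).
exists f; have := isF_of_isH Hf.
rewrite (_ : (fun x => _) = c); last by apply/funext => x; rewrite ec os; field.
by rewrite (_ : (fun x => _) = s)//; apply/funext => x; rewrite ec os; field.
Qed.

Section shift.
Variable a : E.

Definition translate f : E -> R := fun x => f (x + a).

Lemma L12_shift f : L12 f -> L12 (translate f).
Proof.
move=> [/Lfun1_integrable f1 f2]; split.
  apply/Lfun1_integrable.
  exact: (integrable_invariant (@measurable_shift R n a) (@lebesgue_rV_shift R n a) f1).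
exact: (L2_invariant (@measurable_shift R n a) (@lebesgue_rV_shift R n a)).
Qed.

Lemma L2_shift f : L2 f -> L2 (translate f).
Proof. exact: (L2_invariant (@measurable_shift R n a) (@lebesgue_rV_shift R n a)). Qed.

Lemma ip_shift f c : L2 f -> L2 c -> ip (translate f) (translate c) = ip f c.
Proof. exact: (ip_invariant (@measurable_shift R n a) (@lebesgue_rV_shift R n a)). Qed.

Lemma dotrVD (x y xi : E) : dotrV (x + y) xi = dotrV x xi + dotrV y xi.
Proof. by rewrite /dotrV -big_split; apply: eq_bigr => i _; rewrite mxE mulrDl. Qed.

Lemma cosT_shift f xi : inL1 f ->
  cosT (translate f) xi = cos (dotrV a xi) * cosT f xi + sin (dotrV a xi) * sinT f xi.
Proof.
move=> f1; have /Lfun1_integrable fi := f1.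
have mf : measurable_fun setT f by apply/measurable_EFinP; exact: measurable_int fi.
have ic := integrable_cosT xi f1; have is' := integrable_sinT xi f1.
have mc := measurableT_comp (@measurable_cos R) (@measurable_dotrVl R n xi).
have ms := measurableT_comp (@measurable_sin R) (@measurable_dotrVl R n xi).
pose F x := cos (dotrV a xi) * (cos (dotrV x xi) * f x) + sin (dotrV a xi) * (sin (dotrV x xi) * f x).
have -> : cosT (translate f) xi = \int[mu]_x F (x + a).
  apply: eq_Rintegral => x _; rewrite /F /translate dotrVD cosD sinD.
  have := cos2Dsin2 (dotrV a xi); set u := cos _; set v := sin _; set p := cos _; set q := sin _.
  by move=> e; transitivity ((u ^+ 2 + v ^+ 2) * (p * f (x + a))); [rewrite e mul1r|ring].
rewrite (Rintegral_invariant (@measurable_shift R n a) (@lebesgue_rV_shift R n a)).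
  rewrite /F RintegralD//; last 2 first.
  - exact: (integrableZl measurableT (cos (dotrV a xi)) ic).
  - exact: (integrableZl measurableT (sin (dotrV a xi)) is').
  by rewrite !RintegralZl.
by apply: measurable_funD; apply: measurable_funM => //; apply: measurable_funM.
Qed.

Lemma sinT_shift f xi : inL1 f ->
  sinT (translate f) xi = cos (dotrV a xi) * sinT f xi - sin (dotrV a xi) * cosT f xi.
Proof.
move=> f1; have /Lfun1_integrable fi := f1.
have mf : measurable_fun setT f by apply/measurable_EFinP; exact: measurable_int fi.
have ic := integrable_cosT xi f1; have is' := integrable_sinT xi f1.
have mc := measurableT_comp (@measurable_cos R) (@measurable_dotrVl R n xi).
have ms := measurableT_comp (@measurable_sin R) (@measurable_dotrVl R n xi).
pose F x := cos (dotrV a xi) * (sin (dotrV x xi) * f x) - sin (dotrV a xi) * (cos (dotrV x xi) * f x).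
have -> : sinT (translate f) xi = \int[mu]_x F (x + a).
  apply: eq_Rintegral => x _; rewrite /F /translate dotrVD cosD sinD.
  have := cos2Dsin2 (dotrV a xi); set u := cos _; set v := sin _; set p := cos _; set q := sin _.
  by move=> e; transitivity ((u ^+ 2 + v ^+ 2) * (q * f (x + a))); [rewrite e mul1r|ring].
rewrite (Rintegral_invariant (@measurable_shift R n a) (@lebesgue_rV_shift R n a)).
  rewrite /F RintegralB//; last 2 first.
  - exact: (integrableZl measurableT (cos (dotrV a xi)) is').
  - exact: (integrableZl measurableT (sin (dotrV a xi)) ic).
  by rewrite !RintegralZl.
by apply: measurable_funB; apply: measurable_funM => //; apply: measurable_funM.
Qed.

(* Multiplication by a bounded factor preserves L^2 convergence. *)
Lemma cvgL2_bounded_mul (h : E -> R) (f_ : nat -> E -> R) f : measurable_fun setT h ->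
  (forall x, `|h x| <= 1) -> (forall k, L2 (f_ k)) -> L2 f -> cvgL2 f_ f ->
  cvgL2 (fun k x => h x * f_ k x) (fun x => h x * f x).
Proof.
move=> mh h1 f2k f2 cf; apply: (squeeze_cvgr _ (cvg_cst 0) cf); apply: nearW => k.
rewrite nrm_ge0/= -[X in _ <= X]mul1r; apply: nrm_le => //; last 2 first.
- exact: L2B.
- by move=> x; rewrite -mulrBr normrM mul1r ler_piMl.
by apply: measurable_funB; apply: measurable_funM => //; [exact: L2_mf (f2k k)|exact: L2_mf f2].
Qed.

Lemma L2_bounded_mul (h : E -> R) f : measurable_fun setT h ->
  (forall x, `|h x| <= 1) -> L2 f -> L2 (fun x => h x * f x).
Proof.
move=> mh h1 f2; apply: (@L2_le _ _ _ mu _ f 1) => //.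
  by apply: measurable_funM => //; exact: L2_mf f2.
by move=> x; rewrite normrM ler_wpM2r.
Qed.

(** Translation by [a] multiplies the transform by [exp (i a . xi)]; the two formulas are the real
    and imaginary parts of that product. *)
Lemma isF_shift f c s : isF f c s ->
  isF (translate f) (fun xi => cos (dotrV a xi) * c xi - sin (dotrV a xi) * s xi)
                (fun xi => cos (dotrV a xi) * s xi + sin (dotrV a xi) * c xi).
Proof.
move=> [f2 c2 s2 [f_ [F12 cf cc cs]]].
have C2 k : L2 (cosT (f_ k)) by have [] := plancherel (F12 k).
have S2 k : L2 (fun x => - sinT (f_ k) x) by apply: L2N; have [] := plancherel (F12 k).
have mc : measurable_fun setT (fun xi => cos (dotrV a xi)).
  under eq_fun do rewrite dotrVC.
  exact: (measurableT_comp (@measurable_cos R) (@measurable_dotrVl R n a)).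
have ms : measurable_fun setT (fun xi => sin (dotrV a xi)).
  under eq_fun do rewrite dotrVC.
  exact: (measurableT_comp (@measurable_sin R) (@measurable_dotrVl R n a)).
have mms : measurable_fun setT (fun xi => - sin (dotrV a xi)) by exact: measurableT_comp.
have bc xi : `|cos (dotrV a xi)| <= 1 by exact: cos_max.
have bs xi : `|sin (dotrV a xi)| <= 1 by exact: sin_max.
have bms xi : `|- sin (dotrV a xi)| <= 1 by rewrite normrN sin_max.
have e1 : (fun xi => cos (dotrV a xi) * c xi - sin (dotrV a xi) * s xi) =
    (fun xi => cos (dotrV a xi) * c xi + - sin (dotrV a xi) * s xi).
  by apply/funext => xi; rewrite mulNr.
rewrite e1; split.
- exact: L2_shift.
- by apply: L2D; exact: L2_bounded_mul.
- by apply: L2D; exact: L2_bounded_mul.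
exists (fun k => translate (f_ k)); split.
- by move=> k; exact: L12_shift.
- rewrite /L2Space.cvgL2 (_ : (fun k => nrm _) = (fun k => nrm (fun x => f_ k x - f x)))//.
  apply/funext => k; rewrite /L2Space.nrm; congr Num.sqrt.
  by rewrite -[RHS]ip_shift//; apply: L2B => //; case: (F12 k).
- rewrite (_ : (fun k => _) = (fun k xi => cos (dotrV a xi) * cosT (f_ k) xi +
      - sin (dotrV a xi) * - sinT (f_ k) xi)).
    apply: cvgL2D; try (by move=> *; exact: L2_bounded_mul); exact: cvgL2_bounded_mul.
  by apply/funext => k; apply/funext => x; rewrite cosT_shift ?mulrNN//; case: (F12 k).
- rewrite (_ : (fun k => _) = (fun k xi => cos (dotrV a xi) * - sinT (f_ k) xi +
      sin (dotrV a xi) * cosT (f_ k) xi)).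
    apply: cvgL2D; try (by move=> *; exact: L2_bounded_mul); exact: cvgL2_bounded_mul.
  apply/funext => k; apply/funext => x; rewrite sinT_shift; last by case: (F12 k).
  by ring.
Qed.

End shift.

End fourier_L2.

(** * Functions flat at the origin, the source of smooth cutoffs *)

Section flat.
Context (R : realType).
Implicit Types (p : {poly R}) (x : R).

Definition flat p x : R := if 0 < x then p.[x^-1] * expR (- x^-1) else 0.

(** The chain rule for [p(y) exp(-y)] with [y = 1 / x]: the inner derivative is [- y^2] and the
    outer one is [(p' - p) exp(-y)]. So the family [flat] is stable under differentiation. *)
Definition flatD p : {poly R} := 'X^2 * (p - p^`()).

Lemma flat_le0 p x : x <= 0 -> flat p x = 0.
Proof. by rewrite /flat ltNge => ->. Qed.

(** [exp y] is the [i]-th power of [exp (y / i)], which is at least [y / i]. *)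
Lemma exprn_expRN_le (i : nat) (y : R) : 0 <= y -> y ^+ i * expR (- y) <= i%:R ^+ i.
Proof.
move=> y0; rewrite expRN ler_pdivrMr ?expR_gt0//; case: i => [|i].
  by rewrite !expr0 mul1r; have := expR_ge1Dx y; lra.
have -> : expR y = expR (y / i.+1%:R) ^+ i.+1.
  by rewrite -expRM_natl mulrC divfK// pnatr_eq0.
rewrite -exprMn lerXn2r// ?nnegrE ?mulr_ge0 ?expR_ge0//.
rewrite mulrC -ler_pdivrMr ?ltr0n//.
by apply: le_trans (expR_ge1Dx _); rewrite lerDr.
Qed.

Lemma flat_bounded p : exists M, forall x, `|flat p x| <= M.
Proof.
exists (\sum_(i < size p) `|p`_i| * i%:R ^+ i) => x.
have S0 : 0 <= \sum_(i < size p) `|p`_i| * i%:R ^+ i :> R.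
  by apply: sumr_ge0 => i _; rewrite mulr_ge0// exprn_ge0.
have [x0|x0] := ltP 0 x; last by rewrite flat_le0// normr0.
have y0 : 0 <= x^-1 by rewrite invr_ge0 ltW.
rewrite /flat x0 horner_coef normrM (ger0_norm (expR_ge0 _)).
apply: (@le_trans _ _ ((\sum_(i < size p) `|p`_i| * x^-1 ^+ i) * expR (- x^-1))).
  rewrite ler_wpM2r ?expR_ge0//; apply: le_trans (ler_norm_sum _ _ _) _.
  by apply: ler_sum => i _; rewrite normrM (ger0_norm (exprn_ge0 _ _)).
rewrite mulr_suml; apply: ler_sum => i _; rewrite -mulrA ler_wpM2l//.
exact: exprn_expRN_le.
Qed.

Lemma cvg_is_derive (V : normedModType R) (f : V -> R) (x v : V) (d : R) :
  h^-1 *: (f (h *: v + x) - f x) @[h --> 0^'] --> d -> is_derive x v f d.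
Proof.
move=> fd; have cd : derivable f x v by apply/cvg_ex; exists d.
by apply: DeriveDef => //; exact: cvg_lim.
Qed.

Lemma is_derive_flat p x : is_derive x 1 (flat p) (flat (flatD p) x).
Proof.
have [x0|x0|->] := ltgtP x 0.
- rewrite (flat_le0 _ (ltW x0)); apply: (@near_eq_is_derive R R R (cst 0) (flat p) x 1 0 _ (is_derive_cst 0 x 1)).
  by near=> y; rewrite flat_le0//; apply: ltW; near: y; exact: lt_nbhsl.
- apply: (@near_eq_is_derive R R R (fun y => p.[y^-1] * expR (- y^-1))).
    by near=> y; rewrite /flat ifT//; near: y; exact: lt_nbhsr.
  have xn0 : x != 0 by rewrite gt_eqF.
  have dV : is_derive x 1 (fun y : R => y^-1) (- x ^- 2).
    by apply: is_derive_eq; [exact: is_deriveV|rewrite /GRing.scale/= mulr1].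
  have dP : is_derive x 1 (fun y : R => p.[y^-1]) (p^`().[x^-1] * (- x ^- 2)).
    exact: (@is_derive1_comp _ (horner p) (fun y => y^-1)).
  apply: is_derive_eq; rewrite /GRing.scale/= /flat x0 /flatD hornerM hornerXn hornerD hornerN; field.
  by [].
(* At 0 the difference quotient with step [h > 0] is [h] times the value at [h] of the flat function
   of [X^2 p], which is bounded; so it tends to 0. *)
- rewrite [X in is_derive _ _ _ X]flat_le0//; apply: cvg_is_derive.
  have [M HM] := flat_bounded ('X^2 * p).
  have b (h : R) : `|h^-1 *: (flat p (h *: 1 + 0) - flat p 0)| <= M * `|h|.
    rewrite addr0 [flat p 0]flat_le0// subr0 /GRing.scale/= mulr1.
    have [h0|h0] := ltP 0 h; last first.
      by rewrite flat_le0// mulr0 normr0 mulr_ge0// (le_trans _ (HM 0)).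
    have := HM h; rewrite /flat h0 hornerM hornerXn.
    have -> : h^-1 * (p.[h^-1] * expR (- h^-1)) = (h^-1 ^+ 2 * p.[h^-1] * expR (- h^-1)) * h.
      by field; rewrite gt_eqF.
    by move=> H; rewrite normrM ler_wpM2r.
  have M0 : 0 < M + 1 by have := le_trans (normr_ge0 _) (HM 0); lra.
  apply/cvgr0Pnorm_le => e e0; near=> h; apply: le_trans (b h) _.
  apply: (@le_trans _ _ ((M + 1) * `|h|)); first by rewrite ler_wpM2r// lerDl.
  rewrite -ler_pdivlMl//; apply: ltW; near: h.
  by apply: dnbhs0_lt; rewrite mulr_gt0 ?invr_gt0.
Unshelve. all: by end_near. Qed.

Lemma continuous_flat p : continuous (flat p).
Proof. exact: (derive_continuous (is_derive_flat p)). Qed.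

(* [flat 1 y] is exp(-1/y), which tends to 1 at infinity. *)
Lemma cvg_flat1 : flat 1 y @[y --> +oo] --> (1 : R).
Proof.
apply/cvgrPdist_le => e e0; near=> y.
have y0 : 0 < y by near: y; exact: nbhs_pinfty_gt.
have : e^-1 <= y by near: y; apply: nbhs_pinfty_ge; rewrite num_real.
rewrite -[e in X in X -> _]invrK /flat y0 hornerC mul1r => ye.
have h1 : expR (- y^-1) <= 1 by rewrite -expR0 ler_expR oppr_le0 invr_ge0 ltW.
have h2 := expR_ge1Dx (- y^-1).
have h3 : y^-1 <= e by rewrite -[e]invrK lef_pV2 // posrE invr_gt0.
by rewrite ger0_norm ?subr_ge0//; lra.
Unshelve. all: by end_near. Qed.

Lemma flat1_itv x : 0 <= flat 1 x <= 1.
Proof.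
rewrite /flat; case: ltP => [x0|_]; last by rewrite lexx ler01.
by rewrite hornerC mul1r expR_ge0/= -expR0 ler_expR oppr_le0 invr_ge0 ltW.
Qed.

End flat.

(** * Directional derivatives as derivatives along lines *)

Section lines.
Context (R : realType) (V : normedModType R).
Implicit Types (f df : V -> R) (x v : V).

Lemma is_derive_ofline f x v (d : R) :
  is_derive (0 : R) 1 (fun t => f (t *: v + x)) d -> is_derive x v f d.
Proof.
move=> [fd <-]; apply: cvg_is_derive.
rewrite (_ : (fun h => _) = (fun h : R => h^-1 *:
    (((fun t => f (t *: v + x)) \o shift 0) (h *: 1) - f (0 *: v + x)))); first exact: fd.
by apply/funext => h /=; rewrite addr0 scale0r add0r /GRing.scale/= mulr1.
Qed.

Lemma derive_shift f x v a : 'D_v (fun y => f (y + a)) x = 'D_v f (x + a).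
Proof.
rewrite /derive; set F := fun h : R => _; set G := fun h : R => _.
by have -> : F = G by apply/funext => h; rewrite /F /G /= addrA.
Qed.

Lemma is_derive_online f df v : (forall x, is_derive x v f (df x)) ->
  forall x (t : R), is_derive t 1 (fun t => f (x + t *: v)) (df (x + t *: v)).
Proof.
move=> fd x t; have [d <-] := fd (x + t *: v); apply: cvg_is_derive.
rewrite (_ : (fun h => _) = (fun h : R => h^-1 *:
    ((f \o shift (x + t *: v)) (h *: v) - f (x + t *: v)))); first exact: d.
apply/funext => h /=; congr (_ *: (f _ - _)).
by rewrite scalerDl addrCA /GRing.scale/= mulr1.
Qed.

End lines.

(** * Test functions, and weak derivatives on the Fourier side *)

Section test_functions.
Context (R : realType) (n : nat).
Local Notation E := 'rV[R]_n.
Local Notation mu := (lebesgue_rV R n).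
Local Notation L2 := (L2 mu).
Local Notation ip := (ip mu).
Local Notation nrm := (nrm mu).
Local Notation cvgL2 := (cvgL2 mu).
Implicit Types (f g phi : E -> R) (x : E).
Local Notation e_ i := (delta_mx ord0 i : E).

(* The algebra generated by the functions [flat p (s * x_j + c)] is stable
   under partial derivatives. *)
Inductive gen : (E -> R) -> Prop :=
| gen_flat (p : {poly R}) j (s c : R) : gen (fun x => flat p (s * x ord0 j + c))
| gen_cst (a : R) : gen (fun=> a)
| gen_D f g : gen f -> gen g -> gen (fun x => f x + g x)
| gen_M f g : gen f -> gen g -> gen (fun x => f x * g x).

Lemma gen_measurable f : gen f -> measurable_fun setT f.
Proof.
elim=> {f} [p j s c|a|f g _ mf _ mg|f g _ mf _ mg].
- apply: (measurableT_comp (continuous_measurable_fun (@continuous_flat R p))).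
  apply: measurable_funD => //; apply: measurable_funM => //; exact: measurable_rV_coord.
- exact: measurable_cst.
- exact: measurable_funD.
- exact: measurable_funM.
Qed.

Lemma gen_continuous f : gen f -> continuous f.
Proof.
elim=> {f} [p j s c|a|f g _ cf _ cg|f g _ cf _ cg] x.
- apply: (@continuous_comp _ _ _ (fun x : E => s * x ord0 j + c) (flat p)); last exact: continuous_flat.
  have h : {for x, continuous (fun y : E => s * y ord0 j)}.
    exact: (cvgM (@cvg_cst _ s _ _ _) (@coord_continuous _ _ _ ord0 j x)).
  exact: (cvgD h (@cvg_cst _ c _ _ _)).
- exact: cst_continuous.
- exact: (cvgD (cf x) (cg x)).
- exact: (cvgM (cf x) (cg x)).
Qed.

Lemma gen_bounded f : gen f -> exists M, forall x, `|f x| <= M.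
Proof.
elim=> {f} [p j s c|a|f g _ [M HM] _ [N HN]|f g _ [M HM] _ [N HN]].
- by have [M HM] := flat_bounded p; exists M.
- by exists `|a|.
- by exists (M + N) => x; apply: le_trans (ler_normD _ _) _; exact: lerD.
- by exists (M * N) => x; rewrite normrM ler_pM.
Qed.

Lemma gen_derive f i : gen f -> exists g, gen g /\ forall x, is_derive x (e_ i) f (g x).
Proof.
elim=> {f} [p j s c|a|f g gf [f' [gf' fd]] gg [g' [gg' gd]]|f g gf [f' [gf' fd]] gg [g' [gg' gd]]].
- exists (fun x => (s * (j == i)%:R) * flat (flatD p) (s * x ord0 j + c)); split.
    by apply: (@gen_M (fun=> s * (j == i)%:R)); [exact: gen_cst|exact: gen_flat].
  move=> x; apply: is_derive_ofline.
  rewrite (_ : (fun t => _) = flat p \o (fun t => s * (j == i)%:R * t + (s * x ord0 j + c))); last first.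
    by apply/funext => t /=; rewrite !mxE eqxx/=; congr flat; ring.
  rewrite [X in is_derive _ _ _ X]mulrC; apply: is_derive1_comp.
    by rewrite mulr0 add0r; exact: is_derive_flat.
  by apply: is_derive_eq; rewrite /GRing.scale/=; ring.
- by exists (fun=> 0); split; [exact: gen_cst|move=> x; exact: is_derive_cst].
- by exists (fun x => f' x + g' x); split; [exact: gen_D|move=> x; exact: is_deriveD].
- exists (fun x => f x * g' x + g x * f' x); split; first by apply: gen_D; exact: gen_M.
  by move=> x; exact: is_deriveM.
Qed.

Lemma gen_partial f i : gen f -> gen (partial i f) /\ forall x, is_derive x (e_ i) f (partial i f x).
Proof.
move=> gf; have [g [gg fd]] := gen_derive i gf.
by have -> : partial i f = g by apply/funext => x; exact: (@derive_val _ _ _ _ _ _ _ (fd x)).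
Qed.

Lemma gen_smooth f : gen f -> smooth f.
Proof.
move=> gf s; suff gs : gen (iter_partial s f).
  split; first exact: gen_continuous.
  by move=> j x; have [_ /(_ x) []] := gen_partial j gs.
by elim: s => //= i s gs; have [] := gen_partial i gs.
Qed.

Lemma gen_shift f a : gen f -> gen (fun x => f (x + a)).
Proof.
elim=> {f} [p j s c|b|f g _ gf _ gg|f g _ gf _ gg].
- rewrite (_ : (fun x => _) = (fun x => flat p (s * x ord0 j + (s * a ord0 j + c)))).
    exact: gen_flat.
  by apply/funext => x; rewrite mxE; congr flat; ring.
- exact: gen_cst.
- exact: gen_D.
- exact: gen_M.
Qed.

Lemma gen_prod (I : Type) (s : seq I) (F : I -> E -> R) : (forall i, gen (F i)) ->
  gen (fun x => \prod_(i <- s) F i x).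
Proof.
move=> gF; elim: s => [|i s IH].
  by under eq_fun do rewrite big_nil; exact: gen_cst.
by under eq_fun do rewrite big_cons; exact: gen_M.
Qed.

Definition bsupp f := exists N : nat, forall x i, N%:R < `|x ord0 i| -> f x = 0.

(** A concrete class of test functions, dense in L^2 and stable under translation and partial
    derivatives; weak derivatives are tested on it. *)
Definition tst f := gen f /\ bsupp f.

Lemma bsupp_cube f (N : nat) : (forall x i, N%:R < `|x ord0 i| -> f x = 0) ->
  forall x, ~ cube N.+1 x -> f x = 0.
Proof.
move=> HN x xN.
have [[i hi]|H] := pselect (exists i, N%:R < `|x ord0 i|); first exact: HN hi.
exfalso; apply: xN => i; rewrite /= in_itv/=.
have : `|x ord0 i| <= N%:R by rewrite leNgt; apply/negP => h; apply: H; exists i.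
by rewrite ler_norml -natr1 => /andP[h1 h2]; apply/andP; split; lra.
Qed.

Lemma tst_le f : tst f -> exists M N, 0 <= M /\ forall x, `|f x| <= M * \1_(cube N) x.
Proof.
move=> [gf [N HN]]; have [M HM] := gen_bounded gf.
have M0 : 0 <= M by exact: le_trans (HM 0).
exists M, N.+1; split=> // x; rewrite indicE; case: (boolP (x \in _)) => [_|]; first by rewrite mulr1.
move=> /negP xN; rewrite mulr0 normr_le0; apply/eqP; apply: (bsupp_cube HN).
by move=> h; apply: xN; exact/mem_set.
Qed.

Lemma tst_L2 f : tst f -> L2 f.
Proof.
move=> tf; have [M [N [M0 H]]] := tst_le tf; have [gf _] := tf.
apply: (@L2_le _ _ _ mu f (\1_(cube N)) M); [exact: gen_measurable|exact: L2_box|].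
by move=> x; rewrite (ger0_norm (_ : 0 <= \1_(cube N) x))// indicE.
Qed.

Lemma tst_partial f i : tst f -> tst (partial i f).
Proof.
move=> [gf [N HN]]; split; first by have [] := gen_partial i gf.
exists N => x j hj; rewrite /partial (@near_eq_derive R E R f (cst 0)).
  exact: derive_cst.
have : \forall y \near nbhs x, N%:R < `|(y : E) ord0 j|.
  exact: (@cvgr_norm_gt _ _ _ _ _ _ (x ord0 j) (@coord_continuous _ _ _ ord0 j x) _ hj).
by apply: filterS => y; exact: HN.
Qed.

Lemma tst_test f : tst f -> test_function f.
Proof.
move=> [gf [N HN]]; split; first exact: gen_smooth.
have cB := @rV_compact R n (fun=> `[- N%:R, N%:R]%classic) (fun=> @segment_compact R _ _).
apply: (@subclosed_compact _ _ _ (@closed_closure _ _) cB).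
have /closure_id -> := compact_closed (@norm_hausdorff _ _) cB.
apply: closureS => x /= fx i; rewrite in_itv/= -ler_norml leNgt; apply/negP => h.
by move/eqP : fx; apply; exact: HN h.
Qed.

Lemma tst_shift f a : tst f -> tst (fun x => f (x + a)).
Proof.
move=> [gf [N HN]]; split; first exact: gen_shift.
pose A := \sum_i `|a ord0 i|.
exists (N + (Num.truncn A).+1)%N => x i hi; apply: (HN _ i); rewrite mxE.
have h1 : `|a ord0 i| <= A by rewrite /A (bigD1 i)//= lerDl sumr_ge0.
have h2 := truncnS_gt A.
have h3 : `|x ord0 i| <= `|x ord0 i + a ord0 i| + `|a ord0 i|.
  by rewrite -[X in `|X| <= _](addrK (a ord0 i)) ler_normB.
by rewrite natrD in hi; lra.
Qed.

Lemma tst0 : tst (fun=> 0).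
Proof. by split; [exact: gen_cst|exists 0%N]. Qed.

Lemma tstD f g : tst f -> tst g -> tst (fun x => f x + g x).
Proof.
move=> [gf [N HN]] [gg [M HM]]; split; first exact: gen_D.
exists (maxn N M) => x i hi.
rewrite (HN x i) ?(HM x i) ?addr0//; apply: le_lt_trans hi; rewrite ler_nat.
  exact: leq_maxr.
exact: leq_maxl.
Qed.

Lemma tstZ a f : tst f -> tst (fun x => a * f x).
Proof.
move=> [gf [N HN]]; split; first by apply: (@gen_M (fun=> a)); first exact: gen_cst.
by exists N => x i hi; rewrite (HN x i hi) mulr0.
Qed.

Lemma tst_box (a b : 'I_n -> R) : exists2 phi : nat -> E -> R,
  forall k, tst (phi k) & cvgL2 phi (\1_(box a b)).
Proof.
(* With [m = k.+1], the first argument is [m (x_i - a_i)] and the second [m^2 (b_i - x_i) + m]. The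
   extra [m] makes the second factor tend to 1 also at the included endpoint [x_i = b_i], while it
   vanishes as soon as [x_i >= b_i + 1 / m]. *)
pose phi (k : nat) (x : E) := \prod_(i < n) (flat 1 (k.+1%:R * x ord0 i + - (k.+1%:R * a i)) *
  flat 1 (- k.+1%:R ^+ 2 * x ord0 i + (k.+1%:R ^+ 2 * b i + k.+1%:R))) : R.
pose A := \sum_i (`|a i| + `|b i| + 1).
have aA i : `|a i| + `|b i| + 1 <= A.
  by rewrite /A (bigD1 i)//= lerDl sumr_ge0// => j _; rewrite !addr_ge0.
pose N := (Num.truncn A).+1.
have NA : A < N%:R by exact: truncnS_gt.
have phi0 k x i : N%:R < `|x ord0 i| -> phi k x = 0.
  move=> hi; have h := aA i.
  have := ler_norm (a i); have := ler_norm (- a i); have := ler_norm (b i); have := ler_norm (- b i).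
  rewrite !normrN => b1 b2 a1 a2.
  rewrite /phi (bigD1 i)//=; have [x0|x0] := leP 0 (x ord0 i).
    rewrite [X in _ * X * _]flat_le0 ?mulr0 ?mul0r//.
    have k1 : 1 <= k.+1%:R :> R by rewrite ler1n.
    by rewrite ger0_norm// in hi; nra.
  rewrite flat_le0 ?mul0r//.
  have k1 : 0 <= k.+1%:R :> R by [].
  by rewrite ltr0_norm// in hi; nra.
have phi1 k x : 0 <= phi k x <= 1.
  have h (y z : R) : 0 <= flat 1 y * flat 1 z <= 1.
    have /andP[y0 y1] := flat1_itv y; have /andP[z0 z1] := flat1_itv z.
    by rewrite mulr_ge0//= mulr_ile1.
  apply/andP; split; first by apply: prodr_ge0 => i _; have /andP[] := h (k.+1%:R * x ord0 i + - (k.+1%:R * a i))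
      (- k.+1%:R ^+ 2 * x ord0 i + (k.+1%:R ^+ 2 * b i + k.+1%:R)).
  by rewrite /phi; apply: prodr_ile1 => i _; exact: h.
have tphi k : tst (phi k).
  split; last by exists N => x i; exact: phi0.
  by apply: gen_prod => i; apply: gen_M; exact: gen_flat.
exists phi => //.
apply: (@cvgL2_dominated _ _ _ mu _ _ (\1_(cube N.+1))) => //.
- by move=> k; have [/gen_measurable] := tphi k.
- by apply: measurable_indic; exact: measurable_box.
- exact: L2_box.
- move=> x; rewrite indicE; have kge (B : R) : \forall k \near \oo, B <= (k.+1%:R : R).
    near=> k; rewrite -natr1 ler_wpDr//; near: k; exact: nbhs_infty_ger.
  have lim1 (u : nat -> R) (d : R) : 0 < d -> (forall k, d * k.+1%:R <= u k) -> flat 1 (u k) @[k --> \oo] --> (1 : R).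
    move=> d0 du; apply: (cvg_comp _ _ _ (@cvg_flat1 R)).
    apply/cvgryPge => B; near=> k; apply: le_trans (du k).
    rewrite -ler_pdivrMl//; near: k; exact: kge.
  case: (boolP (x \in _)) => [/set_mem xab|/negP xab]; last first.
    apply: (@cvg_near_cst _ R^o).
    have [[i xa]|H] := pselect (exists i, x ord0 i <= a i).
      near=> k; rewrite /phi (bigD1 i)//= flat_le0 ?mul0r//.
      by rewrite subr_le0 ler_wpM2l.
    have [[i xb]|H'] := pselect (exists i, b i < x ord0 i); last first.
      exfalso; apply: xab; apply/mem_set => i; rewrite /= in_itv/=; apply/andP; split.
        by rewrite ltNge; apply/negP => h; apply: H; exists i.
      by rewrite leNgt; apply/negP => h; apply: H'; exists i.
    near=> k; rewrite /phi (bigD1 i)//= [X in _ * X * _]flat_le0 ?mulr0 ?mul0r//.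
    have xb0 : 0 < x ord0 i - b i by rewrite subr_gt0.
    have k1 : (x ord0 i - b i)^-1 <= k.+1%:R by near: k; exact: kge.
    have k2 : 1 <= (x ord0 i - b i) * k.+1%:R by rewrite -ler_pdivrMl// mulr1.
    have k0 : 0 <= k.+1%:R :> R by [].
    by nra.
  rewrite (_ : (fun k => _) = (fun k => \prod_(i < n) (flat 1 (k.+1%:R * x ord0 i + - (k.+1%:R * a i)) *
      flat 1 (- k.+1%:R ^+ 2 * x ord0 i + (k.+1%:R ^+ 2 * b i + k.+1%:R))) : R))//.
  rewrite [X in _ --> X](_ : _ = \prod_(i < n) (1 : R)); last by rewrite big1.
  apply: cvg_big => [|i _]; first exact: mul_continuous.
  rewrite -[X in _ --> X](mulr1 1); have := xab i; rewrite /= in_itv/= => /andP[xa xb].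
  apply: cvgM.
    by apply: (lim1 _ (x ord0 i - a i)) => [|k]; [rewrite subr_gt0|rewrite -mulrBr mulrC].
  apply: (lim1 _ 1) => // k; rewrite mul1r.
  have k0 : 0 <= k.+1%:R ^+ 2 :> R by rewrite exprn_ge0.
  by nra.
- move=> k x.
  have [xN|xN] := pselect (cube N.+1 x).
    rewrite indicE mem_set// normr1 ger0_norm; first by case/andP: (phi1 k x).
    by case/andP: (phi1 k x).
  by rewrite (bsupp_cube (phi0 k) xN) normr0.
Unshelve. all: by end_near. Qed.

Lemma tst_stepf (s : seq (R * (('I_n -> R) * ('I_n -> R)))) : exists2 phi : nat -> E -> R,
  forall k, tst (phi k) & cvgL2 phi (stepf s).
Proof.
elim: s => [|p s [phi tphi cphi]].
  exists (fun _ _ => 0); first by move=> _; exact: tst0.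
  rewrite (_ : stepf [::] = (fun=> 0)); first by apply: cvgL2_cst; exact: L2_0.
  by apply/funext => x; rewrite /stepf big_nil.
have [psi tpsi cpsi] := tst_box p.2.1 p.2.2.
exists (fun k x => p.1 * psi k x + phi k x); first by move=> k; apply: tstD => //; exact: tstZ.
rewrite (_ : stepf (p :: s) = (fun x => p.1 * \1_(box p.2.1 p.2.2) x + stepf s x)).
  apply: cvgL2D => //.
  - by move=> k; apply: L2Z; exact: tst_L2.
  - by apply: L2Z; exact: L2_box.
  - by move=> k; exact: tst_L2.
  - exact: L2_stepf.
  - by apply: cvgL2Z => //; [move=> k; exact: tst_L2|exact: L2_box].
by apply/funext => x; rewrite /stepf big_cons.
Qed.

Lemma cvgL2_ex (f_ : nat -> E -> R) f (e : R) : cvgL2 f_ f -> 0 < e ->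
  exists k, nrm (fun x => f_ k x - f x) <= e.
Proof.
move=> cf e0; have /cvgrPdist_le /(_ _ e0) [N _ HN] := cf.
by exists N; have := HN N (leqnn N); rewrite /= sub0r normrN ger0_norm ?nrm_ge0.
Qed.

Lemma tst_dense f e : L2 f -> 0 < e -> exists2 phi, tst phi & nrm (fun x => phi x - f x) <= e.
Proof.
move=> f2 e0; have e3 : 0 < e / 3 by rewrite divr_gt0.
have [f_ f12 cf] := L12_dense f2.
have [k hk] := cvgL2_ex cf e3; have [fk1 fk2] := f12 k.
have [s [cs _]] := stepf_dense fk1 ((Lfun2P mu (f_ k)).2 fk2).
have [l hl] := cvgL2_ex cs e3.
have [phi tphi cphi] := tst_stepf (s l).
have [m hm] := cvgL2_ex cphi e3.
exists (phi m) => //; have p2 := tst_L2 (tphi m).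
have h1 := nrm_tri p2 (L2_stepf (s l)) f2; have h2 := nrm_tri (L2_stepf (s l)) fk2 f2.
by lra.
Qed.

(** By density, a test function close to [f] itself can be inserted, which gives the square of the
    norm up to a small error. *)
Lemma nrm_le_dual f (C : R) : L2 f -> 0 <= C ->
  (forall phi, tst phi -> `|ip f phi| <= C * nrm phi) -> nrm f <= C.
Proof.
move=> f2 C0 H.
suff h : nrm f * nrm f <= C * nrm f.
  have [e|f0] := eqVneq (nrm f) 0; first by rewrite e.
  by rewrite -(ler_pM2r (_ : 0 < nrm f))// lt_def f0 nrm_ge0.
apply/ler_addgt0Pr => e e0; have n0 := nrm_ge0 mu f.
pose d := e / (C + nrm f + 1).
have d0 : 0 < d by rewrite divr_gt0//; lra.
have [phi tphi hphi] := tst_dense f2 d0.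
have p2 := tst_L2 tphi.
have h1 := H _ tphi.
have h2 := cauchy_schwarz f2 (L2B p2 f2).
have h3 : nrm phi <= nrm f + d.
  have := nrmD (L2B p2 f2) f2.
  by under [X in nrm X <= _]eq_fun do rewrite subrK; lra.
have h4 : ip f phi = ip f (fun x => phi x - f x) + ip f f by rewrite ipBr// subrK.
have h5 : nrm f * nrm f = ip f f by rewrite -nrm2 expr2.
have h6 : d * (C + nrm f + 1) = e by rewrite divfK// gt_eqF//; lra.
move: h1 h2; rewrite !ler_norml => /andP[_ h1] /andP[h2 _].
by rewrite h5; nra.
Qed.

(** While [s] stays within distance 1 of [t], the translated support stays in one fixed cube; this
    is the majorant needed to differentiate under the integral. *)
Lemma tst_mul_bound f phi (v : E) (t : R) : L2 f -> tst phi -> exists G : E -> R,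
  [/\ forall x, 0 <= G x, mu.-integrable setT (EFin \o G) &
  forall s x, `|s - t| <= 1 -> `|f x * phi (x + s *: v)| <= G x].
Proof.
move=> f2 tphi; have [M [N [M0 HM]]] := tst_le tphi.
pose A := \sum_i ((`|t| + 1) * `|v ord0 i|).
pose N' := (N + (Num.truncn A).+1)%N.
have mf := L2_mf f2.
exists (fun x => `|f x| * (M * \1_(cube N') x)); split.
- by move=> x; rewrite mulr_ge0// mulr_ge0// indicE.
- apply: L2_mul.
    apply: (@L2_le _ _ _ mu _ f 1) => [|//|x]; last by rewrite normr_id mul1r.
    exact: measurableT_comp.
  by apply: L2Z; exact: L2_box.
move=> s x hs; rewrite normrM ler_wpM2l//; apply: le_trans (HM _) _; rewrite ler_wpM2l//.
rewrite !indicE; case: (boolP (_ \in cube N)) => // /set_mem H; rewrite mem_set// => i.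
have h1 : (`|t| + 1) * `|v ord0 i| <= A.
  by rewrite /A (bigD1 i)//= lerDl sumr_ge0// => j _; rewrite mulr_ge0// addr_ge0.
have h2 := truncnS_gt A.
have h3 : `|s * v ord0 i| <= A.
  apply: le_trans h1; rewrite normrM ler_wpM2r//.
  have := ler_normD (s - t) t; rewrite subrK; lra.
have := H i; rewrite /= !in_itv/= !mxE natrD => /andP[h4 h5].
by move: h3; rewrite ler_norml => /andP[h6 h7]; apply/andP; split; lra.
Qed.

Lemma is_derive_ip_shift f phi i (t : R) : L2 f -> tst phi ->
  is_derive t 1 (fun s => \int[mu]_x (f x * phi (x + s *: e_ i)))
    (\int[mu]_x (f x * partial i phi (x + t *: e_ i))).
Proof.
move=> f2 tphi; have [gphi _] := tphi; have [_ dphi] := gen_partial i gphi.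
have dF x (s : R) : is_derive s 1 (fun s => f x * phi (x + s *: e_ i)) (f x * partial i phi (x + s *: e_ i)).
  have h := is_derive_online dphi x s.
  by apply: is_derive_eq; rewrite /GRing.scale/= ?mulr0 ?addr0.
have [G [G0 Gi HG]] := tst_mul_bound (e_ i) t f2 (tst_partial i tphi).
have d1 s x : partial1of2 (fun s x => f x * phi (x + s *: e_ i)) s x = f x * partial i phi (x + s *: e_ i).
  by rewrite partial1of2E; exact: (@derive_val _ _ _ _ _ _ _ (dF x s)).
have hI s : `]t - 1, t + 1[%classic s -> `|s - t| <= 1.
  by rewrite /= in_itv/= => /andP[h1 h2]; rewrite ler_norml; apply/andP; split; lra.
have it : `]t - 1, t + 1[%classic t by rewrite /= in_itv/=; apply/andP; split; lra.
have ii s : mu.-integrable setT (EFin \o (fun x => f x * phi (x + s *: e_ i))).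
  by apply: L2_mul => //; apply: tst_L2; exact: tst_shift.
have := @cvg_differentiation_under_integral R _ E mu (fun s x => f x * phi (x + s *: e_ i)) setT
  measurableT t _ _ it (fun s _ => ii s) (fun s y _ _ => @ex_derive _ _ _ _ _ _ _ (dF y s)) G G0 Gi _.
move=> H; apply: cvg_is_derive.
rewrite -(eq_Rintegral _ (fun x _ => d1 t x)).
under eq_fun => h do rewrite /GRing.scale/= mulr1.
by apply: H => s x hs _; rewrite d1; exact: HG (hI _ hs).
Qed.

(** Duality: against a test function [phi], the pairing of the translates of [f] is a function [m]
    of the shift, whose derivative is minus the pairing of [g] with a translate of [phi]. So [m] is
    Lipschitz with constant [|g| |phi|] in L^2 norms. *)
Lemma nrm_shift_sub f g i (h : R) : L2 f -> L2 g -> weak_partial i f g ->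
  nrm (fun x => translate (h *: e_ i) f x - f x) <= `|h| * nrm g.
Proof.
move=> f2 g2 wfg; have s2 := L2_shift (h *: e_ i) f2.
apply: nrm_le_dual; [exact: L2B|by rewrite mulr_ge0 ?nrm_ge0|move=> phi tphi].
have p2 := tst_L2 tphi.
pose m s := \int[mu]_x (f x * phi (x + s *: e_ i)).
have dm s := is_derive_ip_shift i s f2 tphi.
have m0 : ip f phi = m 0 by apply: eq_Rintegral => x _; rewrite scale0r addr0.
have mh : ip (translate (h *: e_ i) f) phi = m (- h).
  rewrite -(ip_shift (- (h *: e_ i)) s2 p2); apply: eq_Rintegral => x _.
  by rewrite /translate subrK scaleNr.
have bound s : `|\int[mu]_x (f x * partial i phi (x + s *: e_ i))| <= nrm g * nrm phi.
  have ts := tst_shift (s *: e_ i) tphi; have [gphi _] := tphi; have [gs _] := ts.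
  have := wfg _ (tst_test ts).
  rewrite (_ : partial i (fun x => phi (x + s *: e_ i)) = (fun x => partial i phi (x + s *: e_ i))); last first.
    by apply/funext => x; exact: derive_shift.
  move=> ->; rewrite normrN; apply: le_trans (cauchy_schwarz g2 (tst_L2 ts)) _.
  rewrite ler_wpM2l ?nrm_ge0// /L2Space.nrm le_eqVlt; apply/orP; left; apply/eqP; congr Num.sqrt.
  exact: (ip_shift (s *: e_ i) p2 p2).
have := @derive_lipschitz _ m _ _ dm bound 0 (- h).
by rewrite subr0 normrN ipBl// m0 mh mulrC mulrA.
Qed.

Local Notation K := (plancherel_cst R n).

Lemma dotrVZ_delta (h : R) i xi : dotrV (h *: e_ i) xi = h * xi ord0 i.
Proof.
rewrite /dotrV (bigD1 i)//= big1 ?addr0 ?mxE ?eqxx ?mulr1// => j ji.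
by rewrite !mxE eqxx/= (negbTE ji) mulr0 mul0r.
Qed.

(** Plancherel applied to the difference quotients of [f], which [nrm_shift_sub] bounds by [g]
    uniformly in the step; their multipliers tend to [xi_i] in modulus, and Fatou concludes. *)
Lemma isF_weak_partial f g i c s : isF f c s -> L2 g -> weak_partial i f g ->
  [/\ L2 (fun xi => xi ord0 i * c xi), L2 (fun xi => xi ord0 i * s xi),
    ip (fun xi => xi ord0 i * c xi) (fun xi => xi ord0 i * c xi) <= K * ip g g &
    ip (fun xi => xi ord0 i * s xi) (fun xi => xi ord0 i * s xi) <= K * ip g g].
Proof.
move=> F g2 wfg; have [f2 c2 s2 _] := F.
have K0 := ltW (plancherel_cst_gt0 R n).
pose h k : R := k.+1%:R^-1.
have h0 k : 0 < h k by rewrite invr_gt0.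
(* A real multiplier with [w^2 = |exp (i h xi_i) - 1|^2 / h^2], because [|exp (i a) - 1|^2 = 2 (1 -
   cos a) = 4 sin^2 (a / 2)]; it tends to [xi_i] with [h]. *)
pose w k (xi : E) := 2 * sin (h k * xi ord0 i / 2) / h k.
have ms k : measurable_fun setT (w k).
  apply: measurable_funM => //; apply: measurable_funM => //.
  apply: (measurableT_comp (@measurable_sin R)); apply: measurable_funM => //.
  by apply: measurable_funM => //; exact: measurable_rV_coord.
have wle k xi : `|w k xi| <= 2 / h k.
  rewrite /w normrM normfV (gtr0_norm (h0 k)) ler_wpM2r ?invr_ge0 ?(ltW (h0 k))//.
  by rewrite normrM ger0_norm// -[leRHS]mulr1 ler_wpM2l// sin_max.
have L2w k u : L2 u -> L2 (fun xi => w k xi * u xi).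
  move=> u2; apply: (@L2_le _ _ _ mu _ u (2 / h k)) => // [|xi].
    by apply: measurable_funM => //; exact: L2_mf u2.
  by rewrite normrM ler_wpM2r.
have bnd k : ip (fun xi => w k xi * c xi) (fun xi => w k xi * c xi) +
    ip (fun xi => w k xi * s xi) (fun xi => w k xi * s xi) <= K * ip g g.
  have FD := isFB (isF_shift (h k *: e_ i) F) F.
  have := isF_norm FD; have [_ C2 S2 _] := FD => e1.
  have e2 : ip (fun xi => w k xi * c xi) (fun xi => w k xi * c xi) +
    ip (fun xi => w k xi * s xi) (fun xi => w k xi * s xi) =
    h k ^- 2 * (K * ip (fun x => translate (h k *: e_ i) f x - f x) (fun x => translate (h k *: e_ i) f x - f x)).
    rewrite -e1; rewrite /L2Space.ip.
    rewrite -RintegralD//; [|exact: (L2_mul (L2w k c c2) (L2w k c c2))|exact: (L2_mul (L2w k s s2) (L2w k s s2))].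
    rewrite -RintegralD//; [|exact: (L2_mul C2 C2)|exact: (L2_mul S2 S2)].
    rewrite -RintegralZl//; last first.
      exact: (integrableD measurableT (L2_mul C2 C2) (L2_mul S2 S2)).
    apply: eq_Rintegral => xi _; rewrite dotrVZ_delta /w.
    have hk : h k != 0 by rewrite gt_eqF.
    have := one_sub_cosE (h k * xi ord0 i); set S := sin (_ / 2) => ec.
    have := cos2Dsin2 (h k * xi ord0 i).
    set co := cos _ in ec *; set si := sin _ => e3.
    transitivity (h k ^- 2 * ((2 * (1 - co)) * (c xi ^+ 2 + s xi ^+ 2))).
      by rewrite ec; field.
    congr (_ * _).
    transitivity ((1 - 2 * co + (co ^+ 2 + si ^+ 2)) * (c xi ^+ 2 + s xi ^+ 2)); first by rewrite e3; ring.
    by ring.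
  rewrite e2 mulrCA ler_wpM2l// ler_pdivrMl ?exprn_gt0//.
  have := nrm_shift_sub (h k) f2 g2 wfg; rewrite (gtr0_norm (h0 k)) => H.
  by rewrite -!nrm2 -exprMn lerXn2r// ?nnegrE ?mulr_ge0 ?nrm_ge0// ltW.
have cw xi : w k xi @[k --> \oo] --> xi ord0 i.
  apply/cvgrPdist_le => e e0; near=> k.
  have hk := h0 k; have hkn : h k != 0 by rewrite gt_eqF.
  have h1 := sin_sub_id_le (h k * xi ord0 i / 2).
  have -> : xi ord0 i - w k xi = - (2 / h k) * (sin (h k * xi ord0 i / 2) - h k * xi ord0 i / 2).
    by rewrite /w; field.
  rewrite normrM normrN (gtr0_norm (_ : 0 < 2 / h k)) ?divr_gt0//.
  apply: (@le_trans _ _ (2 / h k * (h k * xi ord0 i / 2) ^+ 2)).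
    by rewrite ler_wpM2l// ltW// divr_gt0.
  have -> : 2 / h k * (h k * xi ord0 i / 2) ^+ 2 = (xi ord0 i ^+ 2 / 2) * h k by field.
  rewrite /h ler_pdivrMr//.
  have : xi ord0 i ^+ 2 / 2 / e <= k%:R by near: k; exact: nbhs_infty_ger.
  rewrite ler_pdivrMr// => h2; apply: le_trans h2 _.
  by rewrite mulrC ler_pM2l// ler_nat.
have fat u : L2 u -> (forall k, ip (fun xi => w k xi * u xi) (fun xi => w k xi * u xi) <= K * ip g g) ->
    L2 (fun xi => xi ord0 i * u xi) /\ ip (fun xi => xi ord0 i * u xi) (fun xi => xi ord0 i * u xi) <= K * ip g g.
  move=> u2 Hu; apply: (@L2_fatou _ _ _ mu (fun k xi => w k xi * u xi)).
  - apply: measurable_funM => //; [exact: measurable_rV_coord|exact: L2_mf u2].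
  - by move=> k; exact: L2w.
  - by apply: aeW => xi; apply: cvgM; [exact: cw|exact: cvg_cst].
  - exact: nearW.
have [//|a1 a2] := fat c c2.
  by move=> k; have := bnd k; have := ip_ge0 mu (fun xi => w k xi * s xi); lra.
have [//|b1 b2] := fat s s2.
  by move=> k; have := bnd k; have := ip_ge0 mu (fun xi => w k xi * c xi); lra.
by split.
Unshelve. all: by end_near. Qed.

End test_functions.

(** * Harmonic oscillators and the decoupling of the frequency system *)

Module Modal.

Section mode.
Context (R : realType).
Implicit Types (w t A B : R).

(** For [w != 0], the solution of [y'' = - w^2 y] with [y(0) = A] and [y'(0) = B]. *)
Definition mode w t A B : R := cos (w * t) * A + sin (w * t) / w * B.

Definition modeD w t A B : R := - (w * sin (w * t)) * A + cos (w * t) * B.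

Lemma is_derive_mode w t A B : w != 0 ->
  is_derive t 1 (fun s => mode w s A B) (modeD w t A B).
Proof.
by move=> w0; apply: is_derive_eq; rewrite /GRing.scale/= /modeD; field.
Qed.

Lemma is_derive_modeD w t A B : w != 0 ->
  is_derive t 1 (fun s => modeD w s A B) (- w ^+ 2 * mode w t A B).
Proof.
by move=> w0; apply: is_derive_eq; rewrite /GRing.scale/= /mode; field.
Qed.

Lemma mode0 w A B : mode w 0 A B = A.
Proof. by rewrite /mode mulr0 cos0 sin0 mul0r mul0r mul1r addr0. Qed.

Lemma modeD0 w A B : modeD w 0 A B = B.
Proof. by rewrite /modeD mulr0 cos0 sin0 mulr0 oppr0 mul0r mul1r add0r. Qed.

Lemma const_right_cvg (f : R -> R) (l : R) : (forall t, 0 < t -> is_derive t 1 f 0) ->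
  f s @[s --> 0^'+] --> l -> forall t, 0 < t -> f t = l.
Proof.
move=> fd fl t t0.
have cst s : 0 < s -> s < t -> f s = f t.
  move=> s0 st.
  have h1 x : x \in `]s, t[%R -> is_derive x 1 f (cst 0 x).
    by rewrite in_itv/= => /andP[sx _]; apply: fd; exact: lt_trans sx.
  have h2 : {within `[s, t], continuous f}.
    apply: derivable_within_continuous => x; rewrite in_itv/= => /andP[sx _].
    by have [] := fd x (lt_le_trans s0 sx).
  by have [x _] := MVT st h1 h2; rewrite mul0r => /eqP; rewrite subr_eq0 => /eqP.
apply: (@cvg_unique _ _ (f s @[s --> 0^'+])) => //.
apply: cvg_near_cst; near=> s; apply: cst; near: s.
  exact: nbhs_right_gt.
exact: nbhs_right_lt.
Unshelve. all: by end_near. Qed.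

(* [y cos - y' sin / w] and [w y sin + y' cos] are constants of motion. *)
Lemma oscillator_unique w (y y' y'' : R -> R) (y0 y1 : R) : w != 0 ->
  (forall t, 0 < t -> is_derive t 1 y (y' t)) ->
  (forall t, 0 < t -> is_derive t 1 y' (y'' t)) ->
  (forall t, 0 < t -> y'' t = - w ^+ 2 * y t) ->
  y s @[s --> 0^'+] --> y0 -> y' s @[s --> 0^'+] --> y1 ->
  forall t, 0 < t -> y t = mode w t y0 y1.
Proof.
move=> w0 d1 d2 e c0 c1 t t0.
have cc : cos (w * s) @[s --> 0^'+] --> (1 : R).
  have h : continuous (fun s => cos (w * s)).
    by apply: (@derive_continuous R _ (fun s => - (w * sin (w * s)))) => s;
      apply: is_derive_eq; rewrite /GRing.scale/=; ring.
  by apply: cvg_at_right_filter; have := h 0; rewrite /continuous_at mulr0 cos0.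
have cs : sin (w * s) @[s --> 0^'+] --> (0 : R).
  have h : continuous (fun s => sin (w * s)).
    by apply: (@derive_continuous R _ (fun s => w * cos (w * s))) => s;
      apply: is_derive_eq; rewrite /GRing.scale/=; ring.
  by apply: cvg_at_right_filter; have := h 0; rewrite /continuous_at mulr0 sin0.
have A : y t * cos (w * t) - y' t * sin (w * t) / w = y0.
  apply: (@const_right_cvg (fun t => y t * cos (w * t) - y' t * sin (w * t) / w)) => // [s s0|].
    have h1 := d1 s s0; have h2 := d2 s s0.
    by apply: is_derive_eq; rewrite /GRing.scale/= e//; field.
  rewrite (_ : y0 = y0 * 1 - y1 * 0 / w); last by rewrite mulr1 mulr0 mul0r subr0.
  apply: cvgB; first exact: cvgM.
  by apply: cvgM; [exact: cvgM|exact: cvg_cst].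
have B : y t * w * sin (w * t) + y' t * cos (w * t) = y1.
  apply: (@const_right_cvg (fun t => y t * w * sin (w * t) + y' t * cos (w * t))) => // [s s0|].
    have h1 := d1 s s0; have h2 := d2 s s0.
    by apply: is_derive_eq; rewrite /GRing.scale/= e//; ring.
  rewrite (_ : y1 = y0 * w * 0 + y1 * 1); last by rewrite mulr1 mulr0 add0r.
  apply: cvgD; last exact: cvgM.
  by apply: cvgM => //; apply: cvgM => //; exact: cvg_cst.
rewrite /mode -A -B; have := cos2Dsin2 (w * t); set c := cos _; set s := sin _ => cs2.
by transitivity ((c ^+ 2 + s ^+ 2) * y t); [rewrite cs2 mul1r|field].
Qed.

End mode.

Section thermoelastic.
Context (R : realType) (b kappa gamma : R).
Hypotheses (hb : 0 < b) (hkappa : 0 < kappa) (hgamma : gamma != 0).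
Local Notation a1 := (alpha1 b kappa gamma).
Local Notation a2 := (alpha2 b kappa gamma).

(* The squared wave speeds, the roots of [l^2 - alpha1 l + b^2 kappa]. *)
Definition lam (i : bool) : R := (a1 + (-1) ^+ i * a2) / 2.

Definition om (i : bool) : R := Num.sqrt (lam i).

(** Eliminating [v''] from the equation for [Q] gives [(Q, v)'' = - r^2 M (Q, v)], where [M] has
    rows [(kappa + gamma^2, - gamma b^2)] and [(- gamma, b^2)]. The pair [(pc i, qc i)] is the first
    row of the spectral projection of [M] on the eigenvalue [lam i]. *)
Definition pc (i : bool) : R := (kappa + gamma ^+ 2 - lam (~~ i)) / (lam i - lam (~~ i)).

Definition qc (i : bool) : R := - (gamma * b ^+ 2) / (lam i - lam (~~ i)).

Lemma gamma2_gt0 : 0 < gamma ^+ 2. Proof. by rewrite exprn_even_gt0. Qed.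

(** The discriminant is a square plus a positive term in [gamma^2], so the square root defining
    [alpha2] is not truncated. *)
Lemma alpha2_sqr : a2 ^+ 2 = a1 ^+ 2 - 4 * b ^+ 2 * kappa.
Proof.
rewrite /alpha2 sqr_sqrtr//.
have -> : a1 ^+ 2 - 4 * b ^+ 2 * kappa =
    (b ^+ 2 - kappa) ^+ 2 + gamma ^+ 2 * (2 * b ^+ 2 + 2 * kappa + gamma ^+ 2).
  by rewrite /alpha1; ring.
have := gamma2_gt0; have := sqr_ge0 b => h1 h2.
apply: addr_ge0; first exact: sqr_ge0.
apply: mulr_ge0; first exact: ltW.
by have := hkappa; lra.
Qed.

Lemma alpha2_gt0 : 0 < a2.
Proof.
have h : 0 < a2 ^+ 2.
  rewrite alpha2_sqr.
  have -> : a1 ^+ 2 - 4 * b ^+ 2 * kappa =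
    (b ^+ 2 - kappa) ^+ 2 + gamma ^+ 2 * (2 * b ^+ 2 + 2 * kappa + gamma ^+ 2).
    by rewrite /alpha1; ring.
  have := gamma2_gt0; have := sqr_ge0 b => h1 h2.
  apply: ltr_pwDr; last exact: sqr_ge0.
  apply: mulr_gt0 => //.
  by have := hkappa; lra.
by rewrite lt_def sqrtr_ge0 andbT; apply/eqP => e; rewrite e expr0n ltxx in h.
Qed.

Lemma lamD i : lam i + lam (~~ i) = a1.
Proof. by case: i; rewrite /lam/= ?expr0 ?expr1; field. Qed.

Lemma lamM i : lam i * lam (~~ i) = b ^+ 2 * kappa.
Proof.
have h := alpha2_sqr.
by transitivity ((a1 ^+ 2 - a2 ^+ 2) / 4); [case: i; rewrite /lam/= ?expr0 ?expr1; field|rewrite h; field].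
Qed.

Lemma lamB_neq0 i : lam i - lam (~~ i) != 0.
Proof.
have h : a2 != 0 by rewrite gt_eqF// alpha2_gt0.
case: i; rewrite /lam/= ?expr0 ?expr1; [rewrite (_ : _ - _ = - a2)|rewrite (_ : _ - _ = a2)] => //.
- by rewrite oppr_eq0.
- by field.
- by field.
Qed.

Lemma lam_gt0 i : 0 < lam i.
Proof.
have h1 := lamD i; have h2 := lamM i.
have p : 0 < b ^+ 2 * kappa by rewrite mulr_gt0// exprn_gt0.
have a1p : 0 < a1.
  by rewrite /alpha1; have := gamma2_gt0; have := sqr_ge0 b; have := hkappa; lra.
rewrite ltNge; apply/negP => l0.
have l1 : 0 < lam (~~ i) by lra.
by rewrite -h2 in p; nra.
Qed.

Lemma om_gt0 i : 0 < om i. Proof. by rewrite sqrtr_gt0 lam_gt0. Qed.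

Lemma om_neq0 i : om i != 0. Proof. by rewrite gt_eqF// om_gt0. Qed.

Lemma omE i : om i ^+ 2 = lam i. Proof. by rewrite sqr_sqrtr// ltW// lam_gt0. Qed.

(** The characteristic equation of the matrix of the frequency system. Its right-hand side is
    nonzero, which keeps [lam i] away from [b^2]. *)
Lemma charpoly i : (kappa + gamma ^+ 2 - lam i) * (b ^+ 2 - lam i) = gamma ^+ 2 * b ^+ 2.
Proof.
have -> : (kappa + gamma ^+ 2 - lam i) * (b ^+ 2 - lam i) =
  b ^+ 2 * kappa + gamma ^+ 2 * b ^+ 2 - lam i * a1 + lam i ^+ 2 by rewrite /alpha1; ring.
by rewrite -(lamD i) -(lamM i); ring.
Qed.

Lemma b2_lam_neq0 i : b ^+ 2 - lam i != 0.
Proof.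
apply/eqP => e; have := charpoly i; rewrite e mulr0 => /esym/eqP.
by rewrite mulf_eq0 !expf_eq0/= (negbTE hgamma) gt_eqF.
Qed.

Lemma om_neq_b i : om i != b.
Proof. by apply/eqP => e; have := b2_lam_neq0 i; rewrite -omE e subrr eqxx. Qed.

Lemma om_neq : om true != om false.
Proof.
by apply/eqP => e; have := lamB_neq0 true; rewrite /= -!omE e subrr eqxx.
Qed.

(** Abstracting over [m] lets one formula serve the solution and its time derivatives, with [m]
    equal to [mode], [modeD] or [mode2]. *)
Definition Qgen (m : R -> R -> R -> R -> R) (r t Q0 Q1 v0 v1 : R) : R :=
  m (om true * r) t (pc true * Q0 + qc true * v0) (pc true * Q1 + qc true * v1) +
  m (om false * r) t (pc false * Q0 + qc false * v0) (pc false * Q1 + qc false * v1).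

Definition Qsol := Qgen (@mode R).

(* The combinations [(kappa + gamma^2 - lam i) v + gamma Q] decouple the system
   satisfied by [Q] and [v = xi . X]. *)
Lemma scalar_unique (r : R) (Q Q' Q'' v v' v'' : R -> R) (Q0 Q1 v0 v1 : R) : 0 < r ->
  (forall t : R, 0 < t -> [/\ is_derive t 1 Q (Q' t), is_derive t 1 Q' (Q'' t),
    is_derive t 1 v (v' t) & is_derive t 1 v' (v'' t)]) ->
  (forall t : R, 0 < t -> v'' t + b ^+ 2 * r ^+ 2 * v t - gamma * r ^+ 2 * Q t = 0 /\
    Q'' t + kappa * r ^+ 2 * Q t + gamma * v'' t = 0) ->
  [/\ Q s @[s --> 0^'+] --> Q0, Q' s @[s --> 0^'+] --> Q1,
    v s @[s --> 0^'+] --> v0 & v' s @[s --> 0^'+] --> v1] ->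
  forall t : R, 0 < t -> Q t = Qsol r t Q0 Q1 v0 v1.
Proof.
move=> r0 d eq [cQ0 cQ1 cv0 cv1] t t0.
have [l lE] : exists l, forall i, l i = kappa + gamma ^+ 2 - lam i by eexists.
have H i : l i * v t + gamma * Q t =
    mode (om i * r) t (l i * v0 + gamma * Q0) (l i * v1 + gamma * Q1).
  have w0 : om i * r != 0 by rewrite mulf_neq0 ?om_neq0// gt_eqF.
  have h1 (s : R) : 0 < s -> is_derive s 1 (fun t => l i * v t + gamma * Q t) (l i * v' s + gamma * Q' s).
    by move=> s0; have [h1 _ h2 _] := d s s0; apply: is_derive_eq.
  have h2 (s : R) : 0 < s -> is_derive s 1 (fun t => l i * v' t + gamma * Q' t) (l i * v'' s + gamma * Q'' s).
    by move=> s0; have [_ h3 _ h2] := d s s0; apply: is_derive_eq.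
  apply: (oscillator_unique w0 h1 h2 _ _ _ t0).
  - move=> s s0; have [e1 e2] := eq s s0; have e3 := charpoly i; rewrite exprMn omE.
    have -> : Q'' s = - (kappa * r ^+ 2 * Q s + gamma * v'' s).
      by apply/eqP; rewrite -subr_eq0 opprK addrA e2.
    have -> : v'' s = - (b ^+ 2 * r ^+ 2 * v s - gamma * r ^+ 2 * Q s).
      by apply/eqP; rewrite -subr_eq0 opprK addrA e1.
    apply/eqP; rewrite -subr_eq0; apply/eqP.
    (* The terms in [Q] cancel, and the coefficient of [v] is the characteristic equation. *)
    transitivity (r ^+ 2 * v s * (gamma ^+ 2 * b ^+ 2 - (kappa + gamma ^+ 2 - lam i) * (b ^+ 2 - lam i))).
      by rewrite lE; ring.
    by rewrite e3 subrr mulr0.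
  - by apply: cvgD; apply: cvgM => //; exact: cvg_cst.
  - by apply: cvgD; apply: cvgM => //; exact: cvg_cst.
have Ht := H true; have Hf := H false.
have n1 := lamB_neq0 true; have n2 := lamB_neq0 false; rewrite /= in n1 n2.
have e4 : l true * l false = - (gamma ^+ 2 * b ^+ 2).
  have -> : l true * l false = (kappa + gamma ^+ 2) ^+ 2 - (kappa + gamma ^+ 2) * (lam true + lam false) + lam true * lam false.
    by rewrite !lE; ring.
  by rewrite (lamD true) (lamM true) /alpha1; ring.
(* Elimination of [v] between the two decoupled combinations, using
   [l false - l true = lam true - lam false]. *)
have -> : Q t = (l false * (l true * v t + gamma * Q t) - l true * (l false * v t + gamma * Q t)) / (gamma * (lam true - lam false)).
  by rewrite !lE; field; rewrite hgamma n1.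
rewrite Ht Hf /Qsol /Qgen /mode /pc /qc /=.
have -> : - (gamma * b ^+ 2) / (lam true - lam false) = l true * l false / (gamma * (lam true - lam false)).
  by rewrite e4; field; rewrite hgamma n1.
have -> : - (gamma * b ^+ 2) / (lam false - lam true) = - (l true * l false / (gamma * (lam true - lam false))).
  by rewrite e4; field; rewrite hgamma n1 n2.
rewrite -!lE -[lam false - lam true]opprB.
set L1 := l true; set L2 := l false; set D := lam true - lam false.
set w1 := om true * r; set w2 := om false * r.
have D0 : D != 0 by [].
have w10 : w1 != 0 by rewrite mulf_neq0 ?om_neq0// gt_eqF.
have w20 : w2 != 0 by rewrite mulf_neq0 ?om_neq0// gt_eqF.
move: (cos (w1 * t)) (cos (w2 * t)) (sin (w1 * t)) (sin (w2 * t)) w10 w20 D0.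
move: L1 L2 D w1 w2 => L1 L2 D w1 w2 c1 c2 s1 s2 w10 w20 D0.
by field; rewrite hgamma w10 w20 D0.
Qed.

End thermoelastic.

End Modal.
Export Modal.

(** * Explicit solutions of the real system at one frequency *)

Module Explicit.

Section mode2.
Context (R : realType).

Definition mode2 (w t A B : R) : R := - w ^+ 2 * mode w t A B.

Lemma mode2D w t A B A' B' : mode2 w t (A + A') (B + B') = mode2 w t A B + mode2 w t A' B'.
Proof. by rewrite /mode2 /mode; ring. Qed.

Lemma mode2Z w t x A B : mode2 w t (x * A) (x * B) = x * mode2 w t A B.
Proof. by rewrite /mode2 /mode; ring. Qed.

Lemma mode2_sum (I : Type) (s : seq I) (w t : R) (x A B : I -> R) :
  \sum_(k <- s) x k * mode2 w t (A k) (B k) =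
  mode2 w t (\sum_(k <- s) x k * A k) (\sum_(k <- s) x k * B k).
Proof.
elim: s => [|k s IH]; last by rewrite !big_cons mode2D mode2Z IH.
by rewrite !big_nil /mode2 /mode !mulr0 addr0 mulr0.
Qed.

End mode2.

Section thermoelastic_solution.
Context (R : realType) (b kappa gamma : R).
Hypotheses (hb : 0 < b) (hkappa : 0 < kappa) (hgamma : gamma != 0).
Local Notation lam := (lam b kappa gamma).
Local Notation om := (om b kappa gamma).
Local Notation pc := (pc b kappa gamma).
Local Notation qc := (qc b kappa gamma).
Local Notation Qgen := (Qgen b kappa gamma).
Local Notation Qsol := (Qsol b kappa gamma).

(** A source [gamma y], with [y] oscillating at frequency [om i * r], drives the oscillator of
    frequency [b r] to the response [cpl i / r^2] times [y]. *)
Definition cpl (i : bool) : R := gamma / (b ^+ 2 - lam i).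

(* [X = mode_b + xi c], where [c] solves [c'' + b^2 r^2 c = gamma Q] with
   vanishing data. *)
Definition Cgen (m : R -> R -> R -> R -> R) (r t Q0 Q1 v0 v1 : R) : R :=
  cpl true / r ^+ 2 *
    (m (om true * r) t (pc true * Q0 + qc true * v0) (pc true * Q1 + qc true * v1) -
     m (b * r) t (pc true * Q0 + qc true * v0) (pc true * Q1 + qc true * v1)) +
  cpl false / r ^+ 2 *
    (m (om false * r) t (pc false * Q0 + qc false * v0) (pc false * Q1 + qc false * v1) -
     m (b * r) t (pc false * Q0 + qc false * v0) (pc false * Q1 + qc false * v1)).

Definition Xgen (m : R -> R -> R -> R -> R) (x r t x0 x1 Q0 Q1 v0 v1 : R) : R :=
  m (b * r) t x0 x1 + x * Cgen m r t Q0 Q1 v0 v1.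

Definition Xsol := Xgen (@mode R).

Let n0 := @b2_lam_neq0 R b kappa gamma hb hkappa hgamma.

Lemma b2_lamM : (b ^+ 2 - lam true) * (b ^+ 2 - lam false) = - (gamma ^+ 2 * b ^+ 2).
Proof.
have := lamD b kappa gamma true; have := lamM b hkappa hgamma true; rewrite /= => e1 e2.
transitivity (b ^+ 4 - b ^+ 2 * (lam true + lam false) + lam true * lam false); first by ring.
by rewrite e1 e2 /alpha1; ring.
Qed.

(** This and [qc_sum] say that the two spectral projections add up to the identity, read on the row
    of [Q]. *)
Lemma pc_sum : pc true + pc false = 1.
Proof.
have n1 := lamB_neq0 b hkappa hgamma true; have n2 := lamB_neq0 b hkappa hgamma false.
by rewrite /= in n1 n2; rewrite /Modal.pc/=; field; rewrite n1 n2.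
Qed.

Lemma qc_sum : qc true + qc false = 0.
Proof.
have n1 := lamB_neq0 b hkappa hgamma true; have n2 := lamB_neq0 b hkappa hgamma false.
by rewrite /= in n1 n2; rewrite /Modal.qc/=; field; rewrite n1 n2.
Qed.

Lemma kappa_lamE i : kappa + gamma ^+ 2 - lam i = gamma ^+ 2 * b ^+ 2 / (b ^+ 2 - lam i).
Proof. by rewrite -(charpoly b hkappa hgamma i) mulfK// n0. Qed.

(** Multiplication by [cpl i] turns the [Q]-amplitude of the [i]-th mode into its [v]-amplitude; so
    this and [cpl_qc] are the row of the identity for [v]. *)
Lemma cpl_pc : cpl true * pc true + cpl false * pc false = 0.
Proof.
have n1 := lamB_neq0 b hkappa hgamma true; have n2 := lamB_neq0 b hkappa hgamma false.
have m1 := n0 true; have m2 := n0 false.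
rewrite /= in n1 n2; rewrite /cpl /Modal.pc/= !kappa_lamE.
by field; rewrite n1 n2 m1 m2.
Qed.

Lemma cpl_qc : cpl true * qc true + cpl false * qc false = 1.
Proof.
have n1 := lamB_neq0 b hkappa hgamma true; have n2 := lamB_neq0 b hkappa hgamma false.
have m1 := n0 true; have m2 := n0 false.
rewrite /= in n1 n2; rewrite /cpl /Modal.qc/=.
transitivity (- (gamma ^+ 2 * b ^+ 2) / ((b ^+ 2 - lam true) * (b ^+ 2 - lam false))).
  by field; rewrite n1 n2 m1 m2.
by rewrite b2_lamM divff// -b2_lamM mulf_neq0.
Qed.

Lemma X_equation (x r t x0 x1 Q0 Q1 v0 v1 : R) : 0 < r ->
  Xgen (@mode2 R) x r t x0 x1 Q0 Q1 v0 v1 + b ^+ 2 * r ^+ 2 * Xsol x r t x0 x1 Q0 Q1 v0 v1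
    - gamma * x * Qsol r t Q0 Q1 v0 v1 = 0.
Proof.
move=> r0; have m1 := n0 true; have m2 := n0 false; have rn : r != 0 by rewrite gt_eqF.
rewrite /Xsol /Modal.Qsol /Xgen /Cgen /Modal.Qgen /mode2 !exprMn !omE// /cpl.
by field; rewrite rn m1 m2.
Qed.

Lemma Q_equation (I : finType) (x x0 x1 : I -> R) (r t Q0 Q1 : R) : 0 < r ->
  \sum_k x k * x k = r ^+ 2 ->
  let v0 := \sum_k x k * x0 k in let v1 := \sum_k x k * x1 k in
  Qgen (@mode2 R) r t Q0 Q1 v0 v1 + kappa * r ^+ 2 * Qsol r t Q0 Q1 v0 v1 +
    gamma * (\sum_k x k * Xgen (@mode2 R) (x k) r t (x0 k) (x1 k) Q0 Q1 v0 v1) = 0.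
Proof.
move=> r0 xr v0 v1; have m1 := n0 true; have m2 := n0 false; have rn : r != 0 by rewrite gt_eqF.
have -> : \sum_k x k * Xgen (@mode2 R) (x k) r t (x0 k) (x1 k) Q0 Q1 v0 v1 =
    mode2 (b * r) t v0 v1 + r ^+ 2 * Cgen (@mode2 R) r t Q0 Q1 v0 v1.
  rewrite -mode2_sum -xr mulr_suml -big_split; apply: eq_bigr => k _.
  by rewrite /Xgen mulrDr mulrA.
rewrite /Modal.Qsol /Modal.Qgen /Cgen.
set A1 := pc true * Q0 + _; set A2 := pc false * Q0 + _.
set B1 := pc true * Q1 + _; set B2 := pc false * Q1 + _.
(* With [eB], this makes the oscillations of frequency [b r] cancel in [xi . X], leaving the two
   modes [om i * r]. *)
have eA : cpl true * A1 + cpl false * A2 = v0.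
  transitivity ((cpl true * pc true + cpl false * pc false) * Q0 + (cpl true * qc true + cpl false * qc false) * v0).
    by rewrite /A1 /A2; ring.
  by rewrite cpl_pc cpl_qc mul0r mul1r add0r.
have eB : cpl true * B1 + cpl false * B2 = v1.
  transitivity ((cpl true * pc true + cpl false * pc false) * Q1 + (cpl true * qc true + cpl false * qc false) * v1).
    by rewrite /B1 /B2; ring.
  by rewrite cpl_pc cpl_qc mul0r mul1r add0r.
move: A1 A2 B1 B2 eA eB => A1 A2 B1 B2 eA eB.
rewrite -eA -eB mode2D !mode2Z.
rewrite /mode2 !exprMn !omE//.
(* The equation holds mode by mode: after multiplication by [b^2 - lam true] this is the
   characteristic equation. *)
have k1 : kappa - lam true + gamma * cpl true * (- lam true) = 0.
  have e := charpoly b hkappa hgamma true.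
  rewrite /cpl; apply/eqP; rewrite -(inj_eq (mulIf m1)) mul0r; apply/eqP.
  transitivity ((kappa + gamma ^+ 2 - lam true) * (b ^+ 2 - lam true) - gamma ^+ 2 * b ^+ 2); last by rewrite e subrr.
  by field.
have k2 : kappa - lam false + gamma * cpl false * (- lam false) = 0.
  have e := charpoly b hkappa hgamma false.
  rewrite /cpl; apply/eqP; rewrite -(inj_eq (mulIf m2)) mul0r; apply/eqP.
  transitivity ((kappa + gamma ^+ 2 - lam false) * (b ^+ 2 - lam false) - gamma ^+ 2 * b ^+ 2); last by rewrite e subrr.
  by field.
set M1 := mode (om true * r) t A1 B1; set M2 := mode (om false * r) t A2 B2.
transitivity (r ^+ 2 * M1 * (kappa - lam true + gamma * cpl true * (- lam true)) +
  r ^+ 2 * M2 * (kappa - lam false + gamma * cpl false * (- lam false))); last first.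
  by rewrite k1 k2 !mulr0 addr0.
by field.
Qed.

Lemma Q_derive (r Q0 Q1 v0 v1 t : R) : 0 < r ->
  is_derive t 1 (fun s => Qsol r s Q0 Q1 v0 v1) (Qgen (@modeD R) r t Q0 Q1 v0 v1) /\
  is_derive t 1 (fun s => Qgen (@modeD R) r s Q0 Q1 v0 v1) (Qgen (@mode2 R) r t Q0 Q1 v0 v1).
Proof.
move=> r0; have w1 : om true * r != 0 by rewrite mulf_neq0 ?om_neq0// gt_eqF.
have w2 : om false * r != 0 by rewrite mulf_neq0 ?om_neq0// gt_eqF.
have d1 A B := is_derive_mode t A B w1; have d2 A B := is_derive_mode t A B w2.
have e1 A B := is_derive_modeD t A B w1; have e2 A B := is_derive_modeD t A B w2.
by split; apply: is_derive_eq.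
Qed.

Lemma X_derive (x r x0 x1 Q0 Q1 v0 v1 t : R) : 0 < r ->
  is_derive t 1 (fun s => Xsol x r s x0 x1 Q0 Q1 v0 v1) (Xgen (@modeD R) x r t x0 x1 Q0 Q1 v0 v1) /\
  is_derive t 1 (fun s => Xgen (@modeD R) x r s x0 x1 Q0 Q1 v0 v1) (Xgen (@mode2 R) x r t x0 x1 Q0 Q1 v0 v1).
Proof.
move=> r0; have w1 : om true * r != 0 by rewrite mulf_neq0 ?om_neq0// gt_eqF.
have w2 : om false * r != 0 by rewrite mulf_neq0 ?om_neq0// gt_eqF.
have w3 : b * r != 0 by rewrite mulf_neq0// gt_eqF.
have d1 A B := is_derive_mode t A B w1; have d2 A B := is_derive_mode t A B w2.
have e1 A B := is_derive_modeD t A B w1; have e2 A B := is_derive_modeD t A B w2.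
have d3 A B := is_derive_mode t A B w3; have e3 A B := is_derive_modeD t A B w3.
rewrite /Xsol /Xgen /Cgen.
by split; apply: is_derive_eq; rewrite /GRing.scale/= /mode2; ring.
Qed.

Lemma Qsol0 r Q0 Q1 v0 v1 : Qsol r 0 Q0 Q1 v0 v1 = Q0.
Proof.
rewrite /Modal.Qsol /Modal.Qgen !mode0.
transitivity ((pc true + pc false) * Q0 + (qc true + qc false) * v0); first by ring.
by rewrite pc_sum qc_sum mul1r mul0r addr0.
Qed.

Lemma QsolD0 r Q0 Q1 v0 v1 : Qgen (@modeD R) r 0 Q0 Q1 v0 v1 = Q1.
Proof.
rewrite /Modal.Qgen !modeD0.
transitivity ((pc true + pc false) * Q1 + (qc true + qc false) * v1); first by ring.
by rewrite pc_sum qc_sum mul1r mul0r addr0.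
Qed.

Lemma Xsol0 x r x0 x1 Q0 Q1 v0 v1 : Xsol x r 0 x0 x1 Q0 Q1 v0 v1 = x0.
Proof. by rewrite /Xsol /Xgen /Cgen !mode0 !subrr !mulr0 addr0 mulr0 addr0. Qed.

Lemma XsolD0 x r x0 x1 Q0 Q1 v0 v1 : Xgen (@modeD R) x r 0 x0 x1 Q0 Q1 v0 v1 = x1.
Proof. by rewrite /Xgen /Cgen !modeD0 !subrr !mulr0 addr0 mulr0 addr0. Qed.

End thermoelastic_solution.

End Explicit.
Export Explicit.

(** * The complex system at one frequency *)

Section frequency.
Local Open Scope complex_scope.
Context (R : realType) (n : nat) (b kappa gamma : R).
Hypotheses (hb : 0 < b) (hkappa : 0 < kappa) (hgamma : gamma != 0).
Local Notation E := 'rV[R]_n.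
Local Notation Qsol := (Qsol b kappa gamma).
Local Notation Xsol := (Xsol b kappa gamma).
Implicit Types xi : E.

Lemma Re_sum (I : finType) (F : I -> R[i]) : complex.Re (\sum_k F k) = \sum_k complex.Re (F k).
Proof.
by apply: (big_morph (@complex.Re R) (id1 := 0) (op1 := +%R)) => // -[x y] [z w].
Qed.

Lemma Im_sum (I : finType) (F : I -> R[i]) : complex.Im (\sum_k F k) = \sum_k complex.Im (F k).
Proof.
by apply: (big_morph (@complex.Im R) (id1 := 0) (op1 := +%R)) => // -[x y] [z w].
Qed.

Lemma enorm_sqr xi : enorm xi ^+ 2 = \sum_k xi ord0 k * xi ord0 k.
Proof. by rewrite /enorm sqr_sqrtr// sumr_ge0// => j _; rewrite -expr2 sqr_ge0. Qed.

(** The factor [i] crosses real and imaginary parts: the pairs [(Im th, Re u)] and [(Re th, - Im u)]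
    both satisfy the same real equation. *)
Lemma equation_X (u th utt : R[i]) (A G : R) : utt + A%:C * u + 'i * G%:C * th = 0 <->
  complex.Re utt + A * complex.Re u - G * complex.Im th = 0 /\
  - complex.Im utt + A * - complex.Im u - G * complex.Re th = 0.
Proof.
case: u => u1 u2; case: th => t1 t2; case: utt => w1 w2; split.
  by move=> /eqP; rewrite eq_complex /= => /andP[/eqP e1 /eqP e2]; split; lra.
by move=> /= [e1 e2]; apply/eqP; rewrite eq_complex /=; apply/andP; split; apply/eqP; lra.
Qed.

Lemma equation_Th (th thtt : R[i]) (A G : R) (I : finType) (x : I -> R) (w : I -> R[i]) :
  thtt + A%:C * th + 'i * G%:C * (\sum_k (x k)%:C * w k) = 0 <->
  complex.Im thtt + A * complex.Im th + G * (\sum_k x k * complex.Re (w k)) = 0 /\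
  complex.Re thtt + A * complex.Re th + G * (\sum_k x k * - complex.Im (w k)) = 0.
Proof.
set S := \sum_k (x k)%:C * w k.
have e1 : \sum_k x k * complex.Re (w k) = complex.Re S.
  by rewrite /S Re_sum; apply: eq_bigr => k _; case: (w k) => p q /=; rewrite mul0r subr0.
have e2 : \sum_k x k * - complex.Im (w k) = - complex.Im S.
  rewrite /S Im_sum -sumrN; apply: eq_bigr => k _; case: (w k) => p q /=.
  by rewrite mul0r addr0 mulrN.
rewrite e1 e2; case: (S) => s1 s2; case: th => t1 t2; case: thtt => w1 w2; split.
  by move=> /eqP; rewrite eq_complex /= => /andP[/eqP h1 /eqP h2]; split; lra.
by move=> /= [h1 h2]; apply/eqP; rewrite eq_complex /=; apply/andP; split; apply/eqP; lra.
Qed.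

Lemma is_derive_lincomb (I : finType) (x : I -> R) (f : I -> R -> R) (df : I -> R) (t : R) :
  (forall k, is_derive t 1 (f k) (df k)) ->
  is_derive t 1 (fun s => \sum_k x k * f k s) (\sum_k x k * df k).
Proof.
move=> fd; elim: (index_enum I) => [|k s IH].
  rewrite big_nil (_ : (fun _ => _) = cst 0); first exact: is_derive_cst.
  by apply/funext => u; rewrite big_nil.
rewrite big_cons (_ : (fun _ => _) = (fun u => x k * f k u + \sum_(j <- s) x j * f j u)); last first.
  by apply/funext => u; rewrite big_cons.
by have h := fd k; apply: is_derive_eq.
Qed.

Lemma cvg_lincomb (I : finType) (x : I -> R) (f : I -> R -> R) (l : I -> R) :
  (forall k, f k s @[s --> 0^'+] --> l k) ->
  \sum_k x k * f k s @[s --> 0^'+] --> \sum_k x k * l k.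
Proof.
move=> fl; apply: cvg_big => [|k _]; first exact: add_continuous.
by apply: cvgM; [exact: cvg_cst|exact: fl].
Qed.

Lemma is_derive_opp (f : R -> R) (t d : R) : is_derive t 1 f d -> is_derive t 1 (fun s => - f s) (- d).
Proof. by move=> h; exact: is_deriveN. Qed.

(** The scalar product of the vector equation with [xi] gives a system for [Q] and [v = xi . X], to
    which [scalar_unique] applies once for each of the two real pairs. *)
Lemma ode_unique xi (U0 U1 : 'rV[R[i]]_n) (Th0 Th1 : R[i]) U Th : 0 < enorm xi ->
  ode_solution b kappa gamma xi U0 U1 Th0 Th1 U Th -> forall t : R, 0 <= t ->
  complex.Re (Th t) = Qsol (enorm xi) t (complex.Re Th0) (complex.Re Th1)
    (\sum_k xi ord0 k * - complex.Im (U0 ord0 k)) (\sum_k xi ord0 k * - complex.Im (U1 ord0 k)) /\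
  complex.Im (Th t) = Qsol (enorm xi) t (complex.Im Th0) (complex.Im Th1)
    (\sum_k xi ord0 k * complex.Re (U0 ord0 k)) (\sum_k xi ord0 k * complex.Re (U1 ord0 k)).
Proof.
move=> r0 [Ut [Utt [Tht [Thtt [d eq [_ Th00] [cU cUt cTh cTht]]]]]] t.
rewrite le_eqVlt => /predU1P[<-|t0]; first by rewrite Th00 !Qsol0.
have vE (u u2 : 'I_n -> R) (q : R) : (forall k, u2 k + b ^+ 2 * enorm xi ^+ 2 * u k - gamma * xi ord0 k * q = 0) ->
  (\sum_k xi ord0 k * u2 k) + b ^+ 2 * enorm xi ^+ 2 * (\sum_k xi ord0 k * u k) - gamma * enorm xi ^+ 2 * q = 0.
  move=> H; transitivity (\sum_k xi ord0 k * (u2 k + b ^+ 2 * enorm xi ^+ 2 * u k - gamma * xi ord0 k * q)); last first.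
    by apply: big1 => k _; rewrite H mulr0.
  rewrite [X in _ - gamma * X * _]enorm_sqr !mulr_sumr mulr_suml -big_split/= -sumrB.
  by apply: eq_bigr => k _; ring.
split.
- apply: (@scalar_unique _ b kappa gamma hb hkappa hgamma _ (fun s => complex.Re (Th s))
    (fun s => complex.Re (Tht s)) (fun s => complex.Re (Thtt s))
    (fun s => \sum_k xi ord0 k * - complex.Im (U s ord0 k))
    (fun s => \sum_k xi ord0 k * - complex.Im (Ut s ord0 k))
    (fun s => \sum_k xi ord0 k * - complex.Im (Utt s ord0 k))) => //.
  + move=> s s0; have [d1 d2 [d3 _] [d4 _]] := d s s0; split=> //.
      by apply: is_derive_lincomb => k; apply: is_derive_opp; case: (d1 k).
    by apply: is_derive_lincomb => k; apply: is_derive_opp; case: (d2 k).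
  + move=> s s0; have [e1 /equation_Th[_ e2]] := eq s s0; split=> //.
    by apply: vE => k; have /equation_X[] := e1 k.
  + split; [by case: cTh|by case: cTht| |].
      by apply: cvg_lincomb => k; apply: cvgN; case: (cU k).
    by apply: cvg_lincomb => k; apply: cvgN; case: (cUt k).
- apply: (@scalar_unique _ b kappa gamma hb hkappa hgamma _ (fun s => complex.Im (Th s))
    (fun s => complex.Im (Tht s)) (fun s => complex.Im (Thtt s))
    (fun s => \sum_k xi ord0 k * complex.Re (U s ord0 k))
    (fun s => \sum_k xi ord0 k * complex.Re (Ut s ord0 k))
    (fun s => \sum_k xi ord0 k * complex.Re (Utt s ord0 k))) => //.
  + move=> s s0; have [d1 d2 [_ d3] [_ d4]] := d s s0; split=> //.
      by apply: is_derive_lincomb => k; case: (d1 k).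
    by apply: is_derive_lincomb => k; case: (d2 k).
  + move=> s s0; have [e1 /equation_Th[e2 _]] := eq s s0; split=> //.
    by apply: vE => k; have /equation_X[] := e1 k.
  + split; [by case: cTh|by case: cTht| |].
      by apply: cvg_lincomb => k; case: (cU k).
    by apply: cvg_lincomb => k; case: (cUt k).
Qed.

(** The two real pairs glued back: the displacement paired with [Im Th] is the real part, the one
    paired with [Re Th] is minus the imaginary part. *)
Definition Usol xi (U0 U1 : 'rV[R[i]]_n) (Th0 Th1 : R[i]) (t : R) : 'rV[R[i]]_n := \row_k
  ((Xsol (xi ord0 k) (enorm xi) t (complex.Re (U0 ord0 k)) (complex.Re (U1 ord0 k))
     (complex.Im Th0) (complex.Im Th1)
     (\sum_k xi ord0 k * complex.Re (U0 ord0 k)) (\sum_k xi ord0 k * complex.Re (U1 ord0 k))) -i*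
   (Xsol (xi ord0 k) (enorm xi) t (- complex.Im (U0 ord0 k)) (- complex.Im (U1 ord0 k))
     (complex.Re Th0) (complex.Re Th1)
     (\sum_k xi ord0 k * - complex.Im (U0 ord0 k)) (\sum_k xi ord0 k * - complex.Im (U1 ord0 k)))).

Definition Thsol xi (U0 U1 : 'rV[R[i]]_n) (Th0 Th1 : R[i]) (t : R) : R[i] :=
  Qsol (enorm xi) t (complex.Re Th0) (complex.Re Th1)
    (\sum_k xi ord0 k * - complex.Im (U0 ord0 k)) (\sum_k xi ord0 k * - complex.Im (U1 ord0 k)) +i*
  Qsol (enorm xi) t (complex.Im Th0) (complex.Im Th1)
    (\sum_k xi ord0 k * complex.Re (U0 ord0 k)) (\sum_k xi ord0 k * complex.Re (U1 ord0 k)).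

Lemma derive_right_cvg (f df : R -> R) (l : R) : (forall t : R, is_derive t 1 f (df t)) -> f 0 = l ->
  f s @[s --> 0^'+] --> l.
Proof.
by move=> fd <-; apply: cvg_at_right_filter; exact: (derive_continuous fd).
Qed.

Lemma ode_exists xi (U0 U1 : 'rV[R[i]]_n) (Th0 Th1 : R[i]) : 0 < enorm xi ->
  ode_solution b kappa gamma xi U0 U1 Th0 Th1 (Usol xi U0 U1 Th0 Th1) (Thsol xi U0 U1 Th0 Th1).
Proof.
move=> r0; set r := enorm xi.
set v0 := \sum_k xi ord0 k * complex.Re (U0 ord0 k).
set v1 := \sum_k xi ord0 k * complex.Re (U1 ord0 k).
set w0 := \sum_k xi ord0 k * - complex.Im (U0 ord0 k).
set w1 := \sum_k xi ord0 k * - complex.Im (U1 ord0 k).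
pose UU m t : 'rV[R[i]]_n := \row_k
  ((Xgen b kappa gamma m (xi ord0 k) r t (complex.Re (U0 ord0 k)) (complex.Re (U1 ord0 k))
     (complex.Im Th0) (complex.Im Th1) v0 v1) -i*
   (Xgen b kappa gamma m (xi ord0 k) r t (- complex.Im (U0 ord0 k)) (- complex.Im (U1 ord0 k))
     (complex.Re Th0) (complex.Re Th1) w0 w1)).
pose TT m t : R[i] := Qgen b kappa gamma m r t (complex.Re Th0) (complex.Re Th1) w0 w1 +i*
  Qgen b kappa gamma m r t (complex.Im Th0) (complex.Im Th1) v0 v1.
have dX x x0 x1 Q0 Q1 v v' t := @X_derive R b kappa gamma hb hkappa hgamma x r x0 x1 Q0 Q1 v v' t r0.
have dQ Q0 Q1 v v' t := @Q_derive R b kappa gamma hb hkappa hgamma r Q0 Q1 v v' t r0.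
exists (UU (@modeD R)), (UU (@mode2 R)), (TT (@modeD R)), (TT (@mode2 R)); split.
- move=> t t0; split.
  + move=> k; split; rewrite /Usol /UU; under eq_fun do rewrite mxE; rewrite !mxE /=.
      by have [] := dX (xi ord0 k) (complex.Re (U0 ord0 k)) (complex.Re (U1 ord0 k)) (complex.Im Th0) (complex.Im Th1) v0 v1 t.
    apply: is_derive_opp.
    by have [] := dX (xi ord0 k) (- complex.Im (U0 ord0 k)) (- complex.Im (U1 ord0 k)) (complex.Re Th0) (complex.Re Th1) w0 w1 t.
  + move=> k; split; rewrite /UU; under eq_fun do rewrite mxE; rewrite !mxE /=.
      by have [] := dX (xi ord0 k) (complex.Re (U0 ord0 k)) (complex.Re (U1 ord0 k)) (complex.Im Th0) (complex.Im Th1) v0 v1 t.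
    apply: is_derive_opp.
    by have [] := dX (xi ord0 k) (- complex.Im (U0 ord0 k)) (- complex.Im (U1 ord0 k)) (complex.Re Th0) (complex.Re Th1) w0 w1 t.
  + split.
      by have [] := dQ (complex.Re Th0) (complex.Re Th1) w0 w1 t.
    by have [] := dQ (complex.Im Th0) (complex.Im Th1) v0 v1 t.
  + split.
      by have [] := dQ (complex.Re Th0) (complex.Re Th1) w0 w1 t.
    by have [] := dQ (complex.Im Th0) (complex.Im Th1) v0 v1 t.
- move=> t t0; split.
    move=> k; apply/equation_X; rewrite !mxE /= !opprK; split; exact: X_equation.
  apply/equation_Th; have xr : \sum_k xi ord0 k * xi ord0 k = r ^+ 2 by rewrite enorm_sqr.
  have e1 := @Q_equation R b kappa gamma hb hkappa hgamma _ (fun k => xi ord0 k) (fun k => complex.Re (U0 ord0 k))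
    (fun k => complex.Re (U1 ord0 k)) r t (complex.Im Th0) (complex.Im Th1) r0 xr.
  have e2 := @Q_equation R b kappa gamma hb hkappa hgamma _ (fun k => xi ord0 k) (fun k => - complex.Im (U0 ord0 k))
    (fun k => - complex.Im (U1 ord0 k)) r t (complex.Re Th0) (complex.Re Th1) r0 xr.
  split; rewrite /=.
    by rewrite -[RHS]e1; congr (_ + _ * _); apply: eq_bigr => k _; rewrite mxE.
  by rewrite -[RHS]e2; congr (_ + _ * _); apply: eq_bigr => k _; rewrite mxE /= opprK.
- split; last by rewrite /Thsol !Qsol0//; case: (Th0).
  apply/rowP => k; rewrite mxE !Xsol0// opprK; by case: (U0 ord0 k).
- have cX x x0 x1 Q0 Q1 v v' : Xsol x r s x0 x1 Q0 Q1 v v' @[s --> 0^'+] --> x0.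
    exact: (derive_right_cvg (fun t => (dX x x0 x1 Q0 Q1 v v' t).1) (Xsol0 _ _ _ _ _ _ _ _ _ _ _)).
  have cXD x x0 x1 Q0 Q1 v v' : Xgen b kappa gamma (@modeD R) x r s x0 x1 Q0 Q1 v v' @[s --> 0^'+] --> x1.
    exact: (derive_right_cvg (fun t => (dX x x0 x1 Q0 Q1 v v' t).2) (XsolD0 _ _ _ _ _ _ _ _ _ _ _)).
  have cQ Q0 Q1 v v' : Qsol r s Q0 Q1 v v' @[s --> 0^'+] --> Q0.
    exact: (derive_right_cvg (fun t => (dQ Q0 Q1 v v' t).1) (Qsol0 _ hkappa hgamma _ _ _ _ _)).
  have cQD Q0 Q1 v v' : Qgen b kappa gamma (@modeD R) r s Q0 Q1 v v' @[s --> 0^'+] --> Q1.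
    exact: (derive_right_cvg (fun t => (dQ Q0 Q1 v v' t).2) (QsolD0 _ hkappa hgamma _ _ _ _ _)).
  split.
  + move=> k; split; rewrite /Usol; under eq_fun do rewrite mxE; first exact: cX.
    by have /cvgN := cX (xi ord0 k) (- complex.Im (U0 ord0 k)) (- complex.Im (U1 ord0 k)) (complex.Re Th0) (complex.Re Th1) w0 w1; rewrite opprK.
  + move=> k; split; rewrite /UU; under eq_fun do rewrite mxE; first exact: cXD.
    by have /cvgN := cXD (xi ord0 k) (- complex.Im (U0 ord0 k)) (- complex.Im (U1 ord0 k)) (complex.Re Th0) (complex.Re Th1) w0 w1; rewrite opprK.
  + by split; exact: cQ.
  + by split; exact: cQD.
Qed.

End frequency.

(** * Harmonic sums *)

Section sums.
Context (R : realType).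

(** Induction on the sharper bound [2 - 1/N], whose increments exceed [1 / (N + 1)^2]. *)
Lemma sum_inv_sqr_le N : \sum_(k < N) (k.+1%:R ^- 2) <= 2 :> R.
Proof.
case: N => [|N]; first by rewrite big_ord0.
suff : \sum_(k < N.+1) (k.+1%:R ^- 2) <= 2 - N.+1%:R^-1 :> R.
  by move=> h; apply: le_trans h _; rewrite gerBl invr_ge0.
elim: N => [|N IH]; first by rewrite big_ord1 expr1n invr1; lra.
rewrite big_ord_recr /=; apply: le_trans (lerD IH (lexx _)) _.
have p1 : 0 < N.+1%:R :> R by rewrite ltr0n.
have e : N.+2%:R = N.+1%:R + 1 :> R by rewrite -natr1.
rewrite e; move: (N.+1%:R : R) p1 => y y0.
have y1 : y + 1 != 0 by rewrite gt_eqF// addr_gt0.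
have yn : y != 0 by rewrite gt_eqF.
rewrite -subr_ge0.
have -> : 2 - (y + 1)^-1 - (2 - y^-1 + (y + 1) ^- 2) = (y * (y + 1) ^+ 2)^-1.
  by field; rewrite y1 yn.
by rewrite invr_ge0 mulr_ge0 ?(ltW y0)// sqr_ge0.
Qed.

Lemma ln_succ_ge N : N.+2%:R^-1 <= ln N.+2%:R - ln N.+1%:R :> R.
Proof.
have p1 : 0 < N.+1%:R :> R by rewrite ltr0n.
have p2 : 0 < N.+2%:R :> R by rewrite ltr0n.
have e : N.+2%:R = N.+1%:R + 1 :> R by rewrite -natr1.
have : ln (1 + - N.+2%:R^-1) <= - N.+2%:R^-1 :> R.
  by apply: le_ln1Dx; rewrite ltrN2 invf_lt1// ltr1n.
have -> : 1 + - N.+2%:R^-1 = N.+1%:R / N.+2%:R :> R.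
  rewrite e; move: (N.+1%:R : R) p1 => y y0; field.
  by rewrite gt_eqF// addr_gt0.
by rewrite ln_div ?posrE// -lerN2 opprB opprK.
Qed.

Lemma ln_succ_le N : ln N.+2%:R - ln N.+1%:R <= N.+1%:R^-1 :> R.
Proof.
have p1 : 0 < N.+1%:R :> R by rewrite ltr0n.
have p2 : 0 < N.+2%:R :> R by rewrite ltr0n.
have e : N.+2%:R = N.+1%:R + 1 :> R by rewrite -natr1.
rewrite -ln_div ?posrE//.
have -> : N.+2%:R / N.+1%:R = 1 + N.+1%:R^-1 :> R.
  rewrite e; move: (N.+1%:R : R) p1 => y y0; field.
  by rewrite gt_eqF.
by apply: le_ln1Dx; apply: lt_le_trans (_ : 0 <= _); rewrite ?ltrN10// invr_ge0.
Qed.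

Lemma harmonic_le N : \sum_(k < N.+1) k.+1%:R^-1 <= 1 + ln N.+1%:R :> R.
Proof.
elim: N => [|N IH]; first by rewrite big_ord1 invr1 ln1 addr0.
rewrite big_ord_recr /=; have := ln_succ_ge N; move: IH.
by move: (\sum_(i < N.+1) _) (ln _) (ln _) (_^-1) => a b c d; lra.
Qed.

Lemma harmonic_ge N : ln N.+1%:R <= \sum_(k < N) k.+1%:R^-1 :> R.
Proof.
elim: N => [|N IH]; first by rewrite big_ord0 ln1.
rewrite big_ord_recr /=; have := ln_succ_le N; move: IH.
by move: (\sum_(i < N) _) (ln _) (ln _) (_^-1) => a b c d; lra.
Qed.

End sums.

(** * Balls and annuli in R^n *)

Section radial.
Context (R : realType) (n : nat).
Local Notation E := 'rV[R]_n.
Local Notation mu := (lebesgue_rV R n).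

Lemma dotrV_ge0 (x : E) : 0 <= dotrV x x.
Proof. by rewrite sumr_ge0// => j _; rewrite -expr2 sqr_ge0. Qed.

Lemma enorm_ge0 (x : E) : 0 <= enorm x. Proof. exact: sqrtr_ge0. Qed.

Lemma measurable_enorm : measurable_fun setT (@enorm R n).
Proof.
have ms : measurable_fun setT (@Num.sqrt R).
  by apply: continuous_measurable_fun; exact: sqrt_continuous.
apply: (measurableT_comp ms).
rewrite /dotrV; apply: measurable_sum => j.
by apply: measurable_funM; exact: measurable_rV_coord.
Qed.

Lemma enormZ (s : R) (x : E) : 0 < s -> enorm (s *: x) = s * enorm x.
Proof.
move=> s0; rewrite /enorm.
have -> : dotrV (s *: x) (s *: x) = s ^+ 2 * dotrV x x.
  by rewrite /dotrV mulr_sumr; apply: eq_bigr => j _; rewrite !mxE; ring.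
by rewrite sqrtrM ?sqr_ge0// sqrtr_sqr gtr0_norm.
Qed.

Lemma enormN (x : E) : enorm (- x) = enorm x.
Proof. by congr Num.sqrt; apply: eq_bigr => j _; rewrite !mxE mulrNN. Qed.

Lemma coord_le_enorm (x : E) i : `|x ord0 i| <= enorm x.
Proof.
rewrite -sqrtr_sqr ler_wsqrtr// /dotrV (bigD1 i)//= -expr2 lerDl.
by rewrite sumr_ge0// => j _; rewrite -expr2 sqr_ge0.
Qed.

Definition ball_measure : R := fine (mu [set x | enorm x < 1]).
Local Notation beta := ball_measure.

Lemma measurable_enorm_lt (s : R) : measurable [set x : E | enorm x < s].
Proof.
have := measurable_enorm measurableT (measurable_itv `]-oo, s[%R).
by rewrite setTI; congr measurable; apply/seteqP; split => x; rewrite /= ?in_itv/=.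
Qed.

Lemma ball_measureE : mu [set x | enorm x < 1] = beta%:E.
Proof.
rewrite /ball_measure fineK//; rewrite ge0_fin_numE//.
apply: le_lt_trans (box_lty (fun=> -2) (fun=> 2)).
apply: le_measure; rewrite ?inE; [exact: measurable_enorm_lt|exact: measurable_box|].
move=> x /= h i; rewrite /= in_itv/=.
have := le_lt_trans (coord_le_enorm x i) h; rewrite ltr_norml => /andP[h1 h2].
by apply/andP; split; lra.
Qed.

Lemma ball_measure_gt0 : 0 < beta.
Proof.
rewrite -lte_fin -ball_measureE.
(* A coordinate of a point of this box contributes at most [e^2 <= e] to [|x|^2], and [n e < 1]. *)
pose e : R := (2 * n.+1%:R)^-1.
have e0 : 0 < e by rewrite invr_gt0 mulr_gt0.
apply: (@lt_le_trans _ _ (mu (box (fun=> - e) (fun=> e)))).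
  by rewrite box_measure lte_fin; apply: prodr_gt0 => i _; rewrite /itv_len ifT; lra.
apply: le_measure; rewrite ?inE; [exact: measurable_box|exact: measurable_enorm_lt|].
move=> x /= h; rewrite -[X in _ < X]sqrtr1 ltr_sqrt// /dotrV.
apply: (@le_lt_trans _ _ (\sum_(j < n) e)).
  apply: ler_sum => j _; have := h j; rewrite /= in_itv/= => /andP[h1 h2].
  have e1 : e <= 1.
    by rewrite invf_le1 ?mulr_gt0// -natrM ler1n.
  have : `|x ord0 j| <= e by rewrite ler_norml; apply/andP; split; lra.
  rewrite -expr2 -real_normK ?num_real// => h3; have := normr_ge0 (x ord0 j).
  by nra.
rewrite sumr_const card_ord -mulr_natr /e.
rewrite mulrC ltr_pdivrMr ?mulr_gt0// mul1r -natrM ltr_nat.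
by rewrite mul2n -addnn; exact: ltn_addl.
Qed.

Lemma measure_enorm_lt (s : R) : 0 < s -> mu [set x | enorm x < s] = (s ^+ n * beta)%:E.
Proof.
move=> s0; have := @lebesgue_rV_scale R n (s^-1) [set x | enorm x < 1].
rewrite invr_gt0 invrK => /(_ s0 (measurable_enorm_lt 1)).
rewrite ball_measureE -EFinM => <-; congr (mu _); apply/seteqP.
by split => x; rewrite /= enormZ ?invr_gt0// mulrC ltr_pdivrMr// mul1r.
Qed.

Definition annulus (a c : R) : set E := [set x | a <= enorm x < c].

Lemma measurable_annulus a c : measurable (annulus a c).
Proof.
have := measurable_enorm measurableT (measurable_itv `[a, c[%R).
by rewrite setTI; congr measurable; apply/seteqP; split => x; rewrite /= ?in_itv/=.
Qed.

Lemma measure_annulus a c : 0 <= a -> a < c -> (0 < n)%N ->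
  mu (annulus a c) = (beta * (c ^+ n - a ^+ n))%:E.
Proof.
move=> a0 ac n0; have c0 : 0 < c by exact: le_lt_trans ac.
move: a0; rewrite le_eqVlt => /predU1P[<-|a0].
  rewrite expr0n gtn_eqF//= subr0 mulrC -measure_enorm_lt//; congr (mu _); apply/seteqP.
  by split => x; rewrite /annulus /= enorm_ge0.
have -> : annulus a c = [set x | enorm x < c] `\` [set x | enorm x < a].
  apply/seteqP; split => x /=.
    by move=> /andP[h1 h2]; split=> //; apply/negP; rewrite -leNgt.
  by move=> [h1 /negP]; rewrite -leNgt => h2; rewrite /annulus /= h2.
rewrite measureD/=; [|exact: measurable_enorm_lt..|]; last by rewrite measure_enorm_lt// ltry.
rewrite (_ : _ `&` _ = [set x | enorm x < a]); last first.
  by apply/seteqP; split => x /= => [[]//|h]; split=> //; exact: lt_trans ac.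
by rewrite !measure_enorm_lt// -EFinB; congr EFin; ring.
Qed.

Lemma ae_enorm_gt0 : (0 < n)%N -> {ae mu, forall x, 0 < enorm x}.
Proof.
move=> n0; exists [set x | enorm x <= 0]; split.
- have := measurable_enorm measurableT (measurable_itv `]-oo, 0]%R).
  by rewrite setTI; congr measurable; apply/seteqP; split => x; rewrite /= ?in_itv/=.
- apply/eqP; rewrite eq_le measure_ge0 andbT.
  apply/lee_addgt0Pr => e e0; rewrite add0e.
  have b0 := ball_measure_gt0.
  (* As [s <= 1], the ball of radius [s] has measure [s^n beta <= s beta <= e]. *)
  pose s := Num.min 1 (e / beta).
  have s0 : 0 < s by rewrite lt_min ltr01 divr_gt0.
  apply: (@le_trans _ _ (mu [set x | enorm x < s])).
    apply: le_measure; rewrite ?inE.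
    + have := measurable_enorm measurableT (measurable_itv `]-oo, 0]%R).
      by rewrite setTI; congr measurable; apply/seteqP; split => x; rewrite /= ?in_itv/=.
    + exact: measurable_enorm_lt.
    + by move=> x /= h; exact: le_lt_trans s0.
  rewrite measure_enorm_lt// lee_fin.
  have s1 : s <= 1 by rewrite ge_min lexx.
  have s2 : s <= e / beta by rewrite ge_min lexx orbT.
  apply: (@le_trans _ _ (s * beta)); last by rewrite -ler_pdivlMr.
  rewrite ler_wpM2r ?(ltW b0)// -[X in _ <= X]expr1.
  by rewrite ler_wiXn2l ?(ltW s0).
- by move=> x /= /negP; rewrite -leNgt.
Qed.

Lemma integral_indic_sum N (c a : nat -> R) (A : nat -> set E) :
  (forall k, 0 <= c k) -> (forall k, measurable (A k)) -> (forall k, mu (A k) = (a k)%:E) ->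
  (\int[mu]_x (\sum_(k < N) c k * \1_(A k) x)%:E)%E = (\sum_(k < N) c k * a k)%:E.
Proof.
move=> c0 mA Aa; under eq_integral do rewrite -sumEFin.
rewrite (@ge0_integral_sum _ _ _ mu setT measurableT _ (fun (k : 'I_N) x => (c k * \1_(A k) x)%:E)).
- rewrite -sumEFin; apply: eq_bigr => k _.
  under eq_integral do rewrite EFinM.
  rewrite ge0_integralZl//.
  + by rewrite integral_indic// setIT EFinM; congr (_ * _)%E; exact: Aa.
  + by apply/measurable_EFinP; exact: measurable_indic.
  + by rewrite lee_fin.
- by move=> k; apply/measurable_EFinP; apply: measurable_funM => //; exact: measurable_indic.
- by move=> k x _; rewrite lee_fin mulr_ge0// indicE.
Qed.

End radial.

(** * Growth of the integral of [min(t, 1/|x|)^2] over the unit ball *)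

Section radial_upper.
Context (R : realType) (n : nat).
Hypothesis hn : n = 1%N \/ n = 2%N.
Local Notation E := 'rV[R]_n.
Local Notation mu := (lebesgue_rV R n).
Local Notation beta := (ball_measure R n).

Let n_gt0 : (0 < n)%N. Proof. by case: hn => ->. Qed.

Lemma expR1_ge2 : 2 <= expR 1 :> R.
Proof. by have := expR_ge1Dx (1 : R); lra. Qed.

Lemma rate_sqr (t : R) : 0 <= t -> rate n t ^+ 2 = if n == 1%N then 1 + t else ln (expR 1 + t).
Proof.
move=> t0; have e2 := expR1_ge2.
rewrite /rate; case: ifP => _; rewrite sqr_sqrtr//; first by lra.
by apply: ln_ge0; lra.
Qed.

Lemma rate_sqr_ge1 (t : R) : 0 <= t -> 1 <= rate n t ^+ 2.
Proof.
move=> t0; rewrite rate_sqr//; case: ifP => _; first by lra.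
have e0 : 0 < expR 1 :> R by exact: expR_gt0.
by rewrite -[X in X <= _](@expRK R) ler_ln ?posrE//; lra.
Qed.

Lemma rate_ge0 (t : R) : 0 <= rate n t :> R.
Proof. by rewrite /rate; case: ifP => _; exact: sqrtr_ge0. Qed.

Lemma rate_ge1 (t : R) : 0 <= t -> 1 <= rate n t.
Proof.
move=> t0; have := rate_sqr_ge1 t0; rewrite -[X in X <= _](@expr1n _ 2).
by rewrite ler_pXn2r// ?nnegrE// rate_ge0.
Qed.

(** With [y = k + 1], the [k]-th term is [t / y^2] in dimension 1, for a total of at most [3 t]. In
    dimension 2 it is [(2 y + 1) / y^2 <= 3 / y], for a total of at most [4 + 3 ln (e + t)], and the
    logarithm is at least 1. *)
Lemma shell_sum_le (t : R) : 0 < t ->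
  t ^+ 2 * (t^-1 ^+ n) +
    \sum_(k < Num.truncn t) (t / k.+1%:R) ^+ 2 * ((k.+2%:R / t) ^+ n - (k.+1%:R / t) ^+ n)
  <= 7 * rate n t ^+ 2.
Proof.
move=> t0; have tn : t != 0 by rewrite gt_eqF.
rewrite rate_sqr ?(ltW t0)//; case: hn => nE; rewrite nE /=.
  rewrite (_ : \sum_(k < _) _ = t * \sum_(k < Num.truncn t) k.+1%:R ^- 2); last first.
    rewrite mulr_sumr; apply: eq_bigr => k _; rewrite !expr1 -[k.+2%:R]natr1.
    have : k.+1%:R != 0 :> R by rewrite pnatr_eq0.
    by move: (k.+1%:R : R) => y yn; field; rewrite tn yn.
  have -> : t ^+ 2 * t^-1 ^+ 1 = t by rewrite expr1; field.
  have := sum_inv_sqr_le R (Num.truncn t); set S := \sum_(k < _) _ => hS.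
  by have := ler_wpM2l (ltW t0) hS; lra.
have -> : t ^+ 2 * t^-1 ^+ 2 = 1 by field.
apply: (@le_trans _ _ (1 + 3 * \sum_(k < Num.truncn t) k.+1%:R^-1)).
  rewrite lerD2l mulr_sumr; apply: ler_sum => k _.
  rewrite -[k.+2%:R]natr1; have : 1 <= k.+1%:R :> R by rewrite ler1n.
  move: (k.+1%:R : R) => y y1; have yn : y != 0 by rewrite gt_eqF//; lra.
  have -> : (t / y) ^+ 2 * (((y + 1) / t) ^+ 2 - (y / t) ^+ 2) = (2 * y + 1) / y ^+ 2.
    by field; rewrite tn yn.
  rewrite ler_pdivrMr ?exprn_gt0//; last by lra.
  by have -> : 3 / y * y ^+ 2 = 3 * y by [field]; lra.
have e2 := expR1_ge2.
have l1 : 1 <= ln (expR 1 + t).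
  by rewrite -[X in X <= _](@expRK R) ler_ln ?posrE ?expR_gt0//; lra.
have := truncn_itv (ltW t0); case: (Num.truncn t) => [|N] /andP[tN _].
  by rewrite big_ord0; lra.
have := harmonic_le R N.
have : ln N.+1%:R <= ln (expR 1 + t).
  by rewrite ler_ln ?posrE//; move: (N.+1%:R : R) tN => y yt; lra.
by move: (ln _) (ln _) (\sum_(k < _) _) l1 => a c d; lra.
Qed.

(* Splitting the unit ball into the shells [k <= t |x| < k + 1]. *)
Lemma radial_upper (t : R) (w : E -> R) : 0 < t -> measurable_fun setT w ->
  (forall x, 0 <= w x) -> (forall x, w x <= t ^+ 2) ->
  (forall x, w x * enorm x ^+ 2 <= 1) -> (forall x, 1 <= enorm x -> w x = 0) ->
  (\int[mu]_x (w x)%:E <= (7 * beta * rate n t ^+ 2)%:E)%E.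
Proof.
move=> t0 mw w0 wt wr w1; have tn : t != 0 by rewrite gt_eqF.
have b0 := ball_measure_gt0 R n.
(* On the shell [k <= t |x| < k + 1] the bound [1 / |x|^2] is at most [(t / k)^2]; on the innermost
   shell, where it is useless, [t^2] takes over. *)
pose c (k : nat) : R := if k is k'.+1 then (t / k'.+1%:R) ^+ 2 else t ^+ 2.
pose A k : set E := annulus (k%:R / t) (k.+1%:R / t).
pose a k : R := beta * ((k.+1%:R / t) ^+ n - (k%:R / t) ^+ n).
have c0 k : 0 <= c k by case: k => [|k]; rewrite /c sqr_ge0.
have mA k : measurable (A k) by exact: measurable_annulus.
have Aa k : mu (A k) = (a k)%:E.
  apply: measure_annulus => //; first by rewrite divr_ge0// ltW.
  by rewrite ltr_pM2r ?invr_gt0// ltr_nat.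
have le1 : (\int[mu]_x (w x)%:E <= \int[mu]_x (\sum_(k < (Num.truncn t).+1) c k * \1_(A k) x)%:E)%E.
  apply: ge0_le_integral => //.
  - by move=> x _; rewrite lee_fin.
  - exact/measurable_EFinP.
  - apply/measurable_EFinP; apply: measurable_sum => k.
    by apply: measurable_funM => //; exact: measurable_indic.
  move=> x _; rewrite lee_fin.
  have S0 : 0 <= \sum_(k < (Num.truncn t).+1) c k * \1_(A k) x.
    by rewrite sumr_ge0// => k _; rewrite mulr_ge0// indicE.
  have [x1|x1] := leP 1 (enorm x); first by rewrite w1.
  have tx0 : 0 <= t * enorm x by rewrite mulr_ge0 ?enorm_ge0// ltW.
  have /andP[k1 k2] := truncn_itv tx0; set k := Num.truncn (t * enorm x) in k1 k2.
  have kt : (k < (Num.truncn t).+1)%N.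
    have h : t * enorm x <= t by rewrite ler_piMr ?(ltW t0)// ltW.
    by rewrite ltnS; exact: le_truncn.
  rewrite (bigD1 (Ordinal kt))//= indicE mem_set; last first.
    by rewrite /A /annulus /= ler_pdivrMr// ltr_pdivlMr// ![enorm x * t]mulrC k1.
  rewrite mulr1; apply: le_trans (_ : c k <= _); last first.
    by rewrite lerDl sumr_ge0// => j _; rewrite mulr_ge0// indicE.
  case: k k1 {k2 kt} => [|k] k1; rewrite /c//.
  have kp : 0 < k.+1%:R :> R by rewrite ltr0n.
  have r0 : 0 < enorm x.
    rewrite lt_def enorm_ge0 andbT; apply/eqP => e; rewrite e mulr0 in k1.
    by rewrite leNgt kp in k1.
  have h := wr x; rewrite -(ler_pM2r (_ : 0 < enorm x ^+ 2)) ?exprn_gt0//.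
  apply: le_trans h _; rewrite -exprMn -[X in X <= _](@expr1n _ 2) lerXn2r// ?nnegrE//.
    by rewrite mulr_ge0 ?enorm_ge0// divr_ge0// ltW.
  by rewrite mulrAC ler_pdivlMr// mul1r.
apply: le_trans le1 _; rewrite (integral_indic_sum _ c0 mA Aa) lee_fin.
rewrite big_ord_recl /= /a /bump /=.
have h := ler_wpM2l (ltW b0) (shell_sum_le t0).
rewrite [leRHS](_ : _ = beta * (7 * rate n t ^+ 2)); last by ring.
apply: le_trans h; rewrite [leRHS]mulrDr [in leRHS]mulr_sumr lerD//.
  rewrite mul0r expr0n gtn_eqF// subr0 div1r.
  by rewrite mulrCA.
by apply: ler_sum => k _; rewrite /c add1n; rewrite mulrCA.
Qed.

End radial_upper.

(** * Superposition of two sine waves *)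

Section waves.
Context (R : realType) (A1 A2 w1 w2 : R).
Hypotheses (w10 : 0 < w1) (w20 : 0 < w2).

Definition waves (s : R) : R := A1 * sin (w1 * s) + A2 * sin (w2 * s).

Lemma is_derive_waves (s : R) : is_derive s 1 waves (A1 * w1 * cos (w1 * s) + A2 * w2 * cos (w2 * s)).
Proof. by apply: is_derive_eq; rewrite /GRing.scale/=; ring. Qed.

Lemma measurable_waves : measurable_fun setT waves.
Proof. exact: (continuous_measurable_fun (derive_continuous is_derive_waves)). Qed.

Lemma waves_lipschitz (s s' : R) : `|waves s' - waves s| <= (`|A1 * w1| + `|A2 * w2|) * `|s' - s|.
Proof.
apply: (derive_lipschitz is_derive_waves) => x; apply: le_trans (ler_normD _ _) _.
by rewrite !(normrM _ (cos _)) lerD// ler_piMr// cos_max.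
Qed.

(** The slope at 0 is 1 and the error is at most [M s^2], which is below [s / 2] as long as
    [s <= d]. *)
Lemma waves_near0 : A1 * w1 + A2 * w2 = 1 ->
  exists2 d : R, 0 < d & forall s : R, 0 <= s -> s <= d -> s / 2 <= waves s.
Proof.
move=> e; pose M := `|A1| * w1 ^+ 2 + `|A2| * w2 ^+ 2.
have M0 : 0 <= M by rewrite addr_ge0// mulr_ge0// sqr_ge0.
exists (2 * (M + 1))^-1; first by rewrite invr_gt0; lra.
move=> s s0 sd.
have h1 : `|A1 * (sin (w1 * s) - w1 * s)| <= `|A1| * (w1 * s) ^+ 2.
  by rewrite normrM ler_wpM2l// sin_sub_id_le.
have h2 : `|A2 * (sin (w2 * s) - w2 * s)| <= `|A2| * (w2 * s) ^+ 2.
  by rewrite normrM ler_wpM2l// sin_sub_id_le.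
have h3 : waves s - s = A1 * (sin (w1 * s) - w1 * s) + A2 * (sin (w2 * s) - w2 * s).
  by rewrite /waves -[X in _ - X]mul1r -e; ring.
have h4 : `|waves s - s| <= M * s ^+ 2.
  rewrite h3; apply: le_trans (ler_normD _ _) _; apply: le_trans (lerD h1 h2) _.
  by rewrite /M le_eqVlt; apply/orP; left; apply/eqP; ring.
have h5 : M * s ^+ 2 <= s / 2.
  have h6 : s * (2 * (M + 1)) <= 1 by rewrite -ler_pdivlMr ?mul1r//; lra.
  by rewrite expr2; nra.
by move: h4; rewrite ler_norml => /andP[h4 _]; lra.
Qed.

Hypotheses (w12 : w1 != w2) (A10 : A1 != 0).

(* [waves (s + h) + waves (s - h) - 2 cos (w2 h) waves s = B sin (w1 s)], and
   [sin^2] takes a value at least 1/2 at [s] or a quarter of a period later. *)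
Lemma waves_large : exists L m : R, [/\ 0 < L, 0 < m &
  forall a : R, exists s : R, [/\ a <= s, s <= a + L & m <= `|waves s|]].
Proof.
(* This step puts [w1 h] and [w2 h] in [[0, pi]], where the cosine is injective; so [w1 != w2] makes
   [B] nonzero. *)
pose h := pi / (w1 + w2).
have pi0 := pi_gt0 R.
have h0 : 0 < h by rewrite divr_gt0// addr_gt0.
have wh w : 0 < w -> w < w1 + w2 -> w * h \in `[0, pi]%R.
  move=> w0 ww; rewrite in_itv/=; apply/andP; split; first by rewrite mulr_ge0// ltW.
  rewrite /h mulrCA ger_pMr//.
  by rewrite ler_pdivrMr ?addr_gt0// mul1r ltW.
pose B := A1 * (2 * cos (w1 * h) - 2 * cos (w2 * h)).
have B0 : B != 0.
  rewrite mulf_neq0// -mulrBr mulf_neq0// subr_eq0; apply/eqP => e.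
  have := cos_inj (wh w1 w10 _) (wh w2 w20 _) e.
  by rewrite ltrDl ltrDr => /(_ w20 w10) /(mulIf (lt0r_neq0 h0)) /eqP; rewrite (negbTE w12).
have key s : waves (s + h) + waves (s - h) - 2 * cos (w2 * h) * waves s = B * sin (w1 * s).
  by rewrite /waves /B !mulrDr !mulrN !sinD !sinN !cosN; ring.
pose q := pi / (2 * w1).
have q0 : 0 < q by rewrite divr_gt0// mulr_gt0.
have qE s : sin (w1 * (s + q)) = cos (w1 * s).
  have -> : w1 * (s + q) = w1 * s + pi / 2 by rewrite /q; field; exact: lt0r_neq0.
  by rewrite sinD cos_pihalf sin_pihalf mulr0 mulr1 add0r.
(* The second difference is at most the sum of the first two moduli plus twice the third; if all
   three were below [|B| / 8] it would be below [|B| / 2]. *)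
have large s : `|B| / 2 <= `|B * sin (w1 * s)| ->
    [\/ `|B| / 8 <= `|waves (s + h)|, `|B| / 8 <= `|waves (s - h)| | `|B| / 8 <= `|waves s|].
  rewrite -key => H.
  have [h1|h1] := leP (`|B| / 8) `|waves (s + h)|; first by constructor 1.
  have [h2|h2] := leP (`|B| / 8) `|waves (s - h)|; first by constructor 2.
  have [h3|h3] := leP (`|B| / 8) `|waves s|; first by constructor 3.
  exfalso; move: H; apply/negP; rewrite -ltNge.
  have t1 := ler_normD (waves (s + h) + waves (s - h)) (- (2 * cos (w2 * h) * waves s)).
  have t2 := ler_normD (waves (s + h)) (waves (s - h)).
  have t3 : `|2 * cos (w2 * h) * waves s| <= 2 * `|waves s|.
    rewrite normrM ler_wpM2r// normrM ger0_norm// -[X in _ <= X]mulr1 ler_wpM2l//.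
    exact: cos_max.
  by rewrite normrN in t1; lra.
(* The search starts at [a + h] and takes at most [q]; then moving by [h] to either side stays in
   [[a, a + 2 h + q]]. *)
exists (2 * h + q), (`|B| / 8); split.
- by rewrite addr_gt0// mulr_gt0.
- by rewrite divr_gt0// normr_gt0.
move=> a; pose u := a + h.
have [s [s1 s2 Hs]] : exists s, [/\ u <= s, s <= u + q & `|B| / 2 <= `|B * sin (w1 * s)|].
  have [c1|c1] := leP (1 / 2) `|sin (w1 * u)|.
    exists u; split; [exact: lexx|by rewrite lerDl ltW|].
    by rewrite (normrM B) ler_wpM2l//; lra.
  exists (u + q); split; [by rewrite lerDl ltW|exact: lexx|].
  rewrite qE (normrM B); have := cos2Dsin2 (w1 * u).
  rewrite -[cos _ ^+ 2]real_normK ?num_real// -[sin _ ^+ 2]real_normK ?num_real//.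
  have := normr_ge0 (cos (w1 * u)); have := normr_ge0 (sin (w1 * u)); have := normr_ge0 B.
  move: c1; move: `|sin _| `|cos _| `|B| => S C b c1 b0 S0 C0 e.
  have hC : 1 / 2 <= C by nra.
  by rewrite ler_wpM2l//; lra.
rewrite /u in s1 s2.
by case: (large s Hs) => H; [exists (s + h)|exists (s - h)|exists s]; split=> //; lra.
Qed.

(** A value of modulus at least [m] persists above [m / 2] for a fixed time [d], because [waves] is
    Lipschitz. *)
Lemma waves_window : exists L d m : R, [/\ 0 < L, 0 < d, 0 < m &
  forall a : R, exists s : R, [/\ a <= s, s + d <= a + L &
    forall s' : R, s <= s' -> s' <= s + d -> m <= waves s' ^+ 2]].
Proof.
have [L [m [L0 m0 H]]] := waves_large.
pose M := `|A1 * w1| + `|A2 * w2|.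
have M0 : 0 <= M by rewrite addr_ge0.
pose d := m / (2 * (M + 1)).
have d0 : 0 < d by rewrite divr_gt0//; lra.
exists (L + d), d, ((m / 2) ^+ 2); split=> //; [lra|by rewrite exprn_gt0// divr_gt0|].
move=> a; have [s [s1 s2 Hs]] := H a; exists s; split=> //; first by lra.
move=> s' h1 h2; have h3 := waves_lipschitz s s'; rewrite -/M in h3.
have h4 : d * (2 * (M + 1)) = m by rewrite divfK// gt_eqF//; lra.
have h5 : `|s' - s| <= d by rewrite ger0_norm; lra.
have h6 : M * `|s' - s| <= m / 2 by nra.
have h7 : `|waves s| <= `|waves s'| + `|waves s' - waves s|.
  by have := ler_normB (waves s') (waves s' - waves s); rewrite subKr.
rewrite -[waves s' ^+ 2]real_normK ?num_real// lerXn2r// ?nnegrE ?divr_ge0 ?(ltW m0)//.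
by lra.
Qed.

End waves.

(** * Lower bounds for the low-frequency integral *)

Section radial_lower.
Context (R : realType) (n : nat).
Hypothesis hn : n = 1%N \/ n = 2%N.
Local Notation E := 'rV[R]_n.
Local Notation mu := (lebesgue_rV R n).
Local Notation beta := (ball_measure R n).

Lemma integral_ge_sum N (c a : nat -> R) (A : nat -> set E) (F : E -> R) :
  (forall k, 0 <= c k) -> (forall k, measurable (A k)) -> (forall k, mu (A k) = (a k)%:E) ->
  measurable_fun setT F -> (forall x, 0 <= F x) ->
  (forall j k x, A j x -> A k x -> j = k) ->
  (forall k x, (k < N)%N -> A k x -> c k <= F x) ->
  ((\sum_(k < N) c k * a k)%:E <= \int[mu]_x (F x)%:E)%E.
Proof.
move=> c0 mA Aa mF F0 tA cF; rewrite -(integral_indic_sum N c0 mA Aa).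
apply: ge0_le_integral => //.
- by move=> x _; rewrite lee_fin sumr_ge0// => k _; rewrite mulr_ge0// indicE.
- apply/measurable_EFinP; apply: measurable_sum => k.
  by apply: measurable_funM => //; exact: measurable_indic.
- exact/measurable_EFinP.
move=> x _; rewrite lee_fin.
have [[k Ak]|H] := pselect (exists k : 'I_N, A k x); last first.
  rewrite big1// => k _; rewrite indicE memNset ?mulr0// => Ak.
  by apply: H; exists k.
rewrite (bigD1 k)//= big1 ?addr0; last first.
  move=> j jk; rewrite indicE memNset ?mulr0// => Aj.
  by move/eqP: jk; apply; apply/val_inj; exact: tA Aj Ak.
by rewrite indicE mem_set// mulr1; exact: cF.
Qed.

Context (A1 A2 w1 w2 : R).
Hypotheses (w10 : 0 < w1) (w20 : 0 < w2) (w12 : w1 != w2) (A10 : A1 != 0).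
Hypothesis A12 : A1 * w1 + A2 * w2 = 1.
Local Notation waves := (waves A1 A2 w1 w2).

(** For amplitudes [pc i / om i] and frequencies [om i], this is the square of the multiplier [Gf]
    cut off to the ball of radius [e]. *)
Definition low (e t : R) (x : E) : R :=
  if enorm x < e then (waves (enorm x * t) / enorm x) ^+ 2 else 0.

Lemma low_ge0 e t x : 0 <= low e t x.
Proof. by rewrite /low; case: ifP => // _; exact: sqr_ge0. Qed.

Lemma measurable_low e t : measurable_fun setT (low e t).
Proof.
apply: measurable_fun_if => //.
- by apply: measurable_fun_ltr => //; exact: measurable_enorm.
- apply: measurable_funS (_ : measurable setT) _ _ => //.
  apply: measurable_funX; apply: measurable_funM; last exact: measurable_funV (@measurable_enorm R n).
  apply: (measurableT_comp (measurable_waves A1 A2 w1 w2)).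
  by apply: measurable_funM => //; exact: measurable_enorm.
Qed.

(** On the annulus [d / 2 <= r t < d] alone the multiplier is at least [t / 2], and in dimension 1
    that annulus has measure of order [1 / t]. *)
Lemma radial_lower1 : n = 1%N -> exists2 c : R, 0 < c & forall e : R, 0 < e -> exists T : R, forall t : R, T <= t ->
  ((c * rate n t ^+ 2)%:E <= \int[mu]_x (low e t x)%:E)%E.
Proof.
move=> n1; have b0 := ball_measure_gt0 R n.
have [d d0 Hd] := waves_near0 A12.
exists (beta * d / 16); first by rewrite divr_gt0// mulr_gt0.
move=> e e0; exists (Num.max 1 (d / e)) => t; rewrite ge_max => /andP[t1 te].
have t0 : 0 < t by lra.
have tn : t != 0 by rewrite gt_eqF.
(* A one-term family, empty beyond index 0, so that [integral_ge_sum] applies with [N = 1]. *)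
pose A (k : nat) : set E := if k == 0%N then annulus (d / (2 * t)) (d / t) else set0.
pose a (k : nat) : R := if k == 0%N then beta * ((d / t) ^+ n - (d / (2 * t)) ^+ n) else 0.
have dt : d / (2 * t) < d / t.
  by rewrite ltr_pM2l// ltf_pV2 ?posrE ?mulr_gt0//; lra.
have dt0 : 0 < d / (2 * t) by rewrite divr_gt0// mulr_gt0.
have := @integral_ge_sum 1 (fun=> t ^+ 2 / 4) a A (low e t) _ _ _ (measurable_low e t) (low_ge0 e t).
rewrite big_ord1 /a eqxx => H.
apply: le_trans (H _ _ _ _ _).
- have rE : rate n t ^+ 2 = 1 + t by rewrite rate_sqr// ?(ltW t0)// n1.
  have pE (y : R) : y ^+ n = y by rewrite n1.
  rewrite lee_fin rE !pE.
  have -> : t ^+ 2 / 4 * (beta * (d / t - d / (2 * t))) = beta * d / 16 * (2 * t) by field.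
  by clear H; rewrite ler_wpM2l ?divr_ge0 ?mulr_ge0 ?(ltW b0) ?(ltW d0)//; lra.
- by move=> _; rewrite divr_ge0// sqr_ge0.
- by move=> k; rewrite /A; case: ifP => // _; exact: measurable_annulus.
- move=> k; rewrite /A; case: ifP => _; last exact: measure0.
  by apply: measure_annulus => //; [exact: ltW|rewrite n1].
- by move=> j k x; rewrite /A; case: eqP => // ->; case: eqP => // ->.
- move=> k x; rewrite ltnS leqn0 => /eqP ->; rewrite /A eqxx /annulus /= => /andP[x1 x2].
  have x0 : 0 < enorm x by exact: lt_le_trans x1.
  have xe : enorm x < e.
    by apply: lt_le_trans x2 _; rewrite ler_pdivrMr// mulrC -ler_pdivrMr.
  rewrite /low xe.
  have h1 : enorm x * t <= d by rewrite -ler_pdivlMr// ltW.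
  have h2 : 0 <= enorm x * t by rewrite mulr_ge0// ltW.
  have h3 := Hd _ h2 h1.
  have -> : t ^+ 2 / 4 = (t / 2) ^+ 2 by field.
  have h4 : t / 2 <= waves (enorm x * t) / enorm x.
    rewrite ler_pdivlMr//; apply: le_trans h3; rewrite le_eqVlt; apply/orP; left.
    by apply/eqP; ring.
  have h5 : 0 <= t / 2 by rewrite divr_ge0// ltW.
  by rewrite lerXn2r// ?nnegrE//; exact: le_trans h4.
Qed.

(** For large [t] the square of [q t / 2] exceeds [e + t], so rescaling [t] costs at most a factor 2
    in the logarithm. *)
Lemma ln_large (q : R) : 0 < q -> exists T : R, forall t : R, T <= t ->
  [/\ 0 < t, 2 <= q * t & ln (expR 1 + t) / 2 <= ln (q * t / 2)].
Proof.
move=> q0; exists (Num.max (expR 1) (Num.max (2 / q) (8 / q ^+ 2))) => t.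
rewrite !ge_max => /and3P[t1 t2 t3].
have e2 := expR1_ge2 R.
have t0 : 0 < t by lra.
have h2 : 2 <= q * t by rewrite mulrC -ler_pdivrMr.
split=> //; rewrite ler_pdivrMr//.
have -> : ln (q * t / 2) * 2 = ln ((q * t / 2) ^+ 2).
  by rewrite lnXn ?mulr_natr// divr_gt0// mulr_gt0.
have h3 : 8 <= q ^+ 2 * t by rewrite mulrC -ler_pdivrMr// exprn_gt0.
have h4 : expR 1 + t <= (q * t / 2) ^+ 2.
  have -> : (q * t / 2) ^+ 2 = q ^+ 2 * t * t / 4 by field.
  by move: (q ^+ 2 * t) h3 => y y8; nra.
by rewrite ler_ln ?posrE//; [lra|apply: lt_le_trans h4; lra].
Qed.

(** In dimension 2 the annulus [s k <= r t < s k + d] has measure of order [s k / t^2], and on it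
    [low] is at least of order [(t / k)^2]; as [s k] is of order [k], the contributions form a
    harmonic sum. *)
Lemma radial_lower2 : n = 2%N -> exists2 c : R, 0 < c & forall e : R, 0 < e -> exists T : R, forall t : R, T <= t ->
  ((c * rate n t ^+ 2)%:E <= \int[mu]_x (low e t x)%:E)%E.
Proof.
move=> n2; have b0 := ball_measure_gt0 R n.
have [L [d [m [L0 d0 m0 HL]]]] := waves_window A2 w10 w20 w12 A10.
(* One window inside each interval from [(k + 1) L] to [(k + 2) L]. Starting at [L] rather than 0
   keeps [s k] positive and comparable to [k + 1]. *)
have [s Hs] := @choice _ _ _ (fun k : nat => HL (k.+1%:R * L)).
exists (m * beta * d / (4 * L)).
  by rewrite divr_gt0 ?mulr_gt0.
move=> e e0; have [T HT] := ln_large (divr_gt0 e0 L0).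
exists T => t Tt; have [t0 h2 hln] := HT t Tt.
have tn : t != 0 by rewrite gt_eqF.
have Ln : L != 0 by rewrite gt_eqF.
pose A (k : nat) : set E := annulus (s k / t) ((s k + d) / t).
pose a (k : nat) : R := beta * (((s k + d) / t) ^+ n - (s k / t) ^+ n).
pose c (k : nat) : R := m * t ^+ 2 / (k.+2%:R * L) ^+ 2.
have s0 k : 0 < s k.
  by have [h _ _] := Hs k; apply: lt_le_trans h; rewrite mulr_gt0// ltr0n.
have A_le k x : A k x -> [/\ 0 < enorm x, s k <= enorm x * t & enorm x * t <= s k + d].
  rewrite /A /annulus /= => /andP[x1 x2]; split.
  - by apply: lt_le_trans x1; rewrite divr_gt0.
  - by rewrite -ler_pdivrMr.
  - by rewrite -ler_pdivlMr// ltW.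
have A_win k x : A k x -> k.+1%:R * L <= enorm x * t < k.+2%:R * L.
  move=> Ax; have [x0 x1 _] := A_le k x Ax.
  have := Ax; rewrite /A /annulus /= => /andP[_ x2].
  have [h1 h3 _] := Hs k; apply/andP; split; first exact: le_trans x1.
  rewrite -[k.+2%:R]natr1 mulrDl mul1r; apply: lt_le_trans h3.
  by rewrite -ltr_pdivlMr.
have qE : e / L * t = e * t / L by field.
rewrite qE in h2 hln.
have q1 : 0 <= e * t / L by lra.
(* The windows of index [k < N] end before [(N + 1) L <= e t], hence stay in the ball of radius [e];
   the value 0 is excluded by [e t / L >= 2]. *)
case NE : (Num.truncn (e * t / L)) => [|N].
  by have := truncn_itv q1; rewrite NE => /andP[_ /(le_lt_trans h2)]; rewrite ltr_nat.
have /andP[N1 N2] : N.+1%:R <= e * t / L < N.+2%:R by rewrite -NE; exact: truncn_itv.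
apply: le_trans (integral_ge_sum (N := N) (c := c) _ _ (a := a) (A := A) _ (measurable_low e t) (low_ge0 e t) _ _).
- have rE : rate n t ^+ 2 = ln (expR 1 + t) by rewrite rate_sqr// ?(ltW t0)// n2.
  have pE (y : R) : y ^+ n = y ^+ 2 by rewrite n2.
  rewrite lee_fin rE.
  have hN : ln (expR 1 + t) / 2 <= ln N.+1%:R.
    apply: le_trans hln _; rewrite ler_ln ?posrE// ?ltr0n//; last by lra.
    by rewrite -natr1 in N2; move: (N.+1%:R : R) N1 N2 => y y1 y2; lra.
  have hsum := harmonic_ge R N.
  have hc : m * beta * d / (2 * L) * \sum_(k < N) k.+1%:R^-1 <= \sum_(k < N) c k * a k.
    rewrite mulr_sumr; apply: ler_sum => k _; rewrite /c /a !pE.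
    have [h3 _ _] := Hs k.
    have -> : m * t ^+ 2 / (k.+2%:R * L) ^+ 2 * (beta * (((s k + d) / t) ^+ 2 - (s k / t) ^+ 2)) =
        m * beta * d * (2 * s k + d) / (k.+2%:R * L) ^+ 2.
      have : k.+2%:R != 0 :> R by rewrite pnatr_eq0.
      by move: (k.+2%:R : R) => z z0; field; rewrite tn Ln z0.
    apply: (@le_trans _ _ (m * beta * d * (2 * (k.+1%:R * L)) / (k.+2%:R * L) ^+ 2)); last first.
      rewrite ler_wpM2r ?invr_ge0 ?sqr_ge0// ler_wpM2l ?mulr_ge0 ?(ltW m0) ?(ltW b0) ?(ltW d0)//.
      lra.
    rewrite -[k.+2%:R]natr1; have y1 : 1 <= k.+1%:R :> R by rewrite ler1n.
    move: (k.+1%:R : R) y1 => y y1.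
    have yn : y != 0 by rewrite gt_eqF//; lra.
    have yn1 : y + 1 != 0 by rewrite gt_eqF//; lra.
    (* With [y = k + 1] it remains to see that [1 / (2 y) <= 2 y / (y + 1)^2], which is
       [y + 1 <= 2 y]. *)
    have -> : m * beta * d / (2 * L) / y = (m * beta * d / L) * (2 * y)^-1.
      by field; rewrite yn Ln.
    have -> : m * beta * d * (2 * (y * L)) / ((y + 1) * L) ^+ 2 = (m * beta * d / L) * (2 * y / (y + 1) ^+ 2).
      by field; rewrite yn1 Ln.
    rewrite ler_wpM2l ?divr_ge0 ?mulr_ge0 ?(ltW m0) ?(ltW b0) ?(ltW d0) ?(ltW L0)//.
    have y2 : 0 < 2 * y by lra.
    have y3 : 0 < (y + 1) ^+ 2 by rewrite exprn_gt0//; lra.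
    rewrite ler_pdivlMr// ler_pdivrMl//; nra.
  apply: le_trans hc.
  have -> : m * beta * d / (4 * L) * ln (expR 1 + t) = m * beta * d / (2 * L) * (ln (expR 1 + t) / 2).
    by field.
  rewrite ler_wpM2l ?divr_ge0 ?mulr_ge0 ?(ltW m0) ?(ltW b0) ?(ltW d0) ?(ltW L0)//.
  exact: le_trans hsum.
- by move=> k; rewrite divr_ge0 ?sqr_ge0// mulr_ge0 ?sqr_ge0// ltW.
- by move=> k; exact: measurable_annulus.
- move=> k; apply: measure_annulus => //; last by rewrite n2.
    by rewrite divr_ge0// ltW.
  by rewrite ltr_pM2r ?invr_gt0// ltrDl.
- move=> j k x /A_win/andP[j1 j2] /A_win/andP[k1 k2].
  have := le_lt_trans j1 k2; have := le_lt_trans k1 j2.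
  rewrite !ltr_pM2r// !ltr_nat !ltnS => h4 h5.
  by apply/eqP; rewrite eqn_leq h4 h5.
- move=> k x kN Ax; have [x0 x1 x2] := A_le k x Ax.
  have /andP[_ x3] := A_win k x Ax.
  have xe : enorm x < e.
    have h3 : k.+2%:R * L <= e * t.
      rewrite -ler_pdivlMr//; apply: le_trans N1; rewrite ler_nat; exact: kN.
    by rewrite -(ltr_pM2r t0); exact: lt_le_trans h3.
  rewrite /low xe /c; have [_ _ /(_ _ x1 x2) hm] := Hs k.
  rewrite expr_div_n ler_pdivlMr ?exprn_gt0// mulrAC ler_pdivrMr ?exprn_gt0 ?mulr_gt0 ?ltr0n//.
  rewrite -mulrA; apply: ler_pM => //; [exact: ltW|by rewrite mulr_ge0// sqr_ge0|].
  rewrite -exprMn lerXn2r// ?nnegrE ?mulr_ge0 ?enorm_ge0 ?(ltW t0) ?(ltW L0)//.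
  by rewrite mulrC ltW.
Qed.

Lemma radial_lower : exists2 c : R, 0 < c & forall e : R, 0 < e -> exists T : R, forall t : R, T <= t ->
  ((c * rate n t ^+ 2)%:E <= \int[mu]_x (low e t x)%:E)%E.
Proof. by case: hn; [exact: radial_lower1|exact: radial_lower2]. Qed.

End radial_lower.

(** * L^2 estimates of the explicit solution in frequency *)

Section solution_norms.
Context (R : realType) (n : nat) (b kappa gamma : R).
Hypothesis hn : n = 1%N \/ n = 2%N.
Hypotheses (hb : 0 < b) (hkappa : 0 < kappa) (hgamma : gamma != 0).
Local Notation E := 'rV[R]_n.
Local Notation mu := (lebesgue_rV R n).
Local Notation L2 := (L2 mu).
Local Notation ip := (ip mu).
Local Notation nrm := (nrm mu).
Local Notation beta := (ball_measure R n).
Local Notation om := (om b kappa gamma).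
Local Notation pc := (pc b kappa gamma).
Local Notation qc := (qc b kappa gamma).
Local Notation cpl := (cpl b kappa gamma).
Local Notation Qsol := (Qsol b kappa gamma).
Local Notation Xsol := (Xsol b kappa gamma).

Let omp i : 0 < om i. Proof. exact: om_gt0. Qed.

Lemma nrm_sum (I : Type) (s : seq I) (F : I -> E -> R) : (forall i, L2 (F i)) ->
  nrm (fun x => \sum_(i <- s) F i x) <= \sum_(i <- s) nrm (F i).
Proof.
move=> F2; elim: s => [|i s IH].
  rewrite big_nil (_ : nrm _ = 0)//; under [X in nrm X]eq_fun do rewrite big_nil.
  by rewrite /L2Space.nrm /L2Space.ip; under eq_Rintegral do rewrite mul0r; rewrite /Rintegral integral0 sqrtr0.
rewrite big_cons; under [X in nrm X <= _]eq_fun do rewrite big_cons.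
by apply: le_trans (nrmD (F2 i) (L2_sum s F2)) _; rewrite lerD2l.
Qed.

(** The multiplier of initial velocities. It is bounded both by [|t|] and by [1 / (w r)]; at [r = 0]
    the division convention gives 0, which respects both bounds. *)
Definition sinc (w t r : R) : R := sin (w * r * t) / (w * r).

Lemma sinc_le (w t r : R) : 0 < w -> 0 <= r -> `|sinc w t r| <= `|t|.
Proof.
move=> w0; rewrite le_eqVlt => /predU1P[<-|r0].
  by rewrite /sinc mulr0 invr0 mulr0 normr0.
have wr : 0 < w * r by rewrite mulr_gt0.
rewrite /sinc normrM normfV (gtr0_norm wr) ler_pdivrMr//.
by apply: le_trans (norm_sin_le _) _; rewrite normrM (gtr0_norm wr) mulrC.
Qed.

Lemma sinc_mul_le (w t r : R) : 0 < w -> 0 <= r -> `|sinc w t r| * r <= w^-1.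
Proof.
move=> w0; rewrite le_eqVlt => /predU1P[<-|r0]; first by rewrite mulr0 invr_ge0 ltW.
have wr : 0 < w * r by rewrite mulr_gt0.
rewrite /sinc normrM normfV (gtr0_norm wr) invfM mulrA mulrVK ?unitf_gt0//.
by rewrite ger_pMl ?invr_gt0// sin_max.
Qed.

Lemma sinc_sub_le (w t r : R) : 0 < w -> 0 < r -> `|sinc w t r - t| <= w * r * t ^+ 2.
Proof.
move=> w0 r0; have wr : 0 < w * r by rewrite mulr_gt0.
have -> : sinc w t r - t = (sin (w * r * t) - w * r * t) / (w * r).
  by rewrite /sinc; field; rewrite !gt_eqF.
rewrite normrM normfV (gtr0_norm wr) ler_pdivrMr//.
apply: le_trans (sin_sub_id_le _) _; rewrite le_eqVlt; apply/orP; left; apply/eqP; ring.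
Qed.

Lemma measurable_mode (w : R) t (A B : E -> R) : measurable_fun setT A -> measurable_fun setT B ->
  measurable_fun setT (fun xi : E => mode (w * enorm xi) t (A xi) (B xi)).
Proof.
move=> mA mB; have mr := @measurable_enorm R n.
have mw : measurable_fun setT (fun xi : E => w * enorm xi) by exact: measurable_funM.
have mwt : measurable_fun setT (fun xi : E => w * enorm xi * t) by exact: measurable_funM.
apply: measurable_funD; apply: measurable_funM => //.
  exact: (measurableT_comp (@measurable_cos R)).
apply: measurable_funM; first exact: (measurableT_comp (@measurable_sin R)).
exact: measurable_funV.
Qed.

Section data.
Context (Q0 Q1 v0 : E -> R) (X0 X1 : 'I_n -> E -> R).
Hypotheses (Q02 : L2 Q0) (Q12 : L2 Q1) (v02 : L2 v0).
Hypotheses (X02 : forall k, L2 (X0 k)) (X12 : forall k, L2 (X1 k)).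

(** Unlike [v0], which is assumed square integrable, [v1] is only controlled after division by
    [|xi|] ([v1_le]), since the initial velocity is merely in L^2. *)
Definition v1 (xi : E) : R := \sum_k xi ord0 k * X1 k xi.

Definition Qf t (xi : E) : R := Qsol (enorm xi) t (Q0 xi) (Q1 xi) (v0 xi) (v1 xi).

Definition Xf k t (xi : E) : R :=
  Xsol (xi ord0 k) (enorm xi) t (X0 k xi) (X1 k xi) (Q0 xi) (Q1 xi) (v0 xi) (v1 xi).

(** The part of the solution bounded in L^2 uniformly in time: cosines of [Q0] and [v0], and the
    terms in [v1], whose factor [xi] compensates the [1 / |xi|] of [sinc]. *)
Definition Rf t (xi : E) : R :=
  cos (om true * enorm xi * t) * (pc true * Q0 xi + qc true * v0 xi) +
  cos (om false * enorm xi * t) * (pc false * Q0 xi + qc false * v0 xi) +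
  (qc true * (sinc (om true) t (enorm xi) * v1 xi) + qc false * (sinc (om false) t (enorm xi) * v1 xi)).

(** The multiplier of [Q1], the only source of growth in time. *)
Definition Gf t (xi : E) : R :=
  pc true * sinc (om true) t (enorm xi) + pc false * sinc (om false) t (enorm xi).

Definition Hf (xi : E) : R := `|Q0 xi| + (`|v0 xi| + \sum_k `|X1 k xi|).

Definition CR : R := \sum_i (`|pc i| + `|qc i| + `|qc i| / om i).
(** The added 1 makes the constant evidently positive; [GfQ1_upper] divides by it. *)
Definition CP : R := \sum_i `|pc i| * (1 + (om i)^-1) + 1.

Lemma Qf_split t xi : Qf t xi = Rf t xi + Gf t xi * Q1 xi.
Proof. by rewrite /Qf /Modal.Qsol /Qgen /mode /Rf /Gf /sinc; ring. Qed.

Lemma measurable_v1 : measurable_fun setT v1.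
Proof.
apply: measurable_sum => k; apply: measurable_funM; first exact: measurable_rV_coord.
exact: L2_mf (X12 k).
Qed.

Let mQ0 := L2_mf Q02. Let mQ1 := L2_mf Q12. Let mv0 := L2_mf v02.

Lemma measurable_Qf t : measurable_fun setT (Qf t).
Proof.
have mv1 := measurable_v1.
by apply: measurable_funD; apply: measurable_mode; apply: measurable_funD; exact: measurable_funM.
Qed.

Lemma measurable_sinc (w t : R) : measurable_fun setT (fun xi : E => sinc w t (enorm xi)).
Proof.
have mr := @measurable_enorm R n.
have mw : measurable_fun setT (fun xi : E => w * enorm xi) by exact: measurable_funM.
have mwt : measurable_fun setT (fun xi : E => w * enorm xi * t) by exact: measurable_funM.
apply: measurable_funM; first exact: (measurableT_comp (@measurable_sin R)).
exact: measurable_funV.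
Qed.

Lemma measurable_Gf t : measurable_fun setT (Gf t).
Proof. by apply: measurable_funD; apply: measurable_funM => //; exact: measurable_sinc. Qed.

Lemma measurable_Rf t : measurable_fun setT (Rf t).
Proof.
rewrite (_ : Rf t = (fun xi => Qf t xi - Gf t xi * Q1 xi)).
  apply: measurable_funB; first exact: measurable_Qf.
  by apply: measurable_funM => //; exact: measurable_Gf.
by apply/funext => xi; rewrite Qf_split addrK.
Qed.

Lemma L2_abs f : L2 f -> L2 (fun x => `|f x|) /\ nrm (fun x => `|f x|) = nrm f.
Proof.
move=> f2; split.
  apply: (@L2_le _ _ _ mu _ f 1) => // [|x]; last by rewrite normr_id mul1r.
  exact: measurableT_comp (L2_mf f2).
rewrite /L2Space.nrm; congr Num.sqrt; apply: eq_Rintegral => x _.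
by rewrite -normrM ger0_norm// -expr2 sqr_ge0.
Qed.

Lemma L2_Hf : L2 Hf.
Proof.
apply: L2D; first by have [] := L2_abs Q02.
apply: L2D; first by have [] := L2_abs v02.
by apply: L2_sum => k; have [] := L2_abs (X12 k).
Qed.

Lemma nrm_Hf : nrm Hf <= nrm Q0 + (nrm v0 + \sum_k nrm (X1 k)).
Proof.
have a1 := L2_abs Q02; have a2 := L2_abs v02; have a3 k := L2_abs (X12 k).
have s2 : L2 (fun x => \sum_k `|X1 k x|) by apply: L2_sum => k; case: (a3 k).
apply: le_trans (nrmD a1.1 (L2D a2.1 s2)) _; rewrite a1.2 lerD2l.
apply: le_trans (nrmD a2.1 s2) _; rewrite a2.2 lerD2l.
apply: le_trans (nrm_sum _ (fun k => (a3 k).1)) _.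
by apply: ler_sum => k _; rewrite (a3 k).2.
Qed.

Lemma v1_le xi : `|v1 xi| <= enorm xi * \sum_k `|X1 k xi|.
Proof.
apply: le_trans (ler_norm_sum _ _ _) _; rewrite mulr_sumr; apply: ler_sum => k _.
by rewrite normrM ler_wpM2r// coord_le_enorm.
Qed.

Lemma CR_ge0 : 0 <= CR.
Proof. by apply: sumr_ge0 => i _; rewrite !addr_ge0// divr_ge0// ltW. Qed.

Lemma CP_gt0 : 0 < CP.
Proof.
rewrite /CP ltr_wpDl// sumr_ge0// => i _; rewrite mulr_ge0// addr_ge0// invr_ge0 ltW//.
Qed.

Lemma Rf_le t xi : `|Rf t xi| <= CR * Hf xi.
Proof.
have r0 := enorm_ge0 xi; set S := \sum_k `|X1 k xi|.
have S0 : 0 <= S by rewrite sumr_ge0.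
have c1 i : `|cos (om i * enorm xi * t) * (pc i * Q0 xi + qc i * v0 xi)| <=
    `|pc i| * `|Q0 xi| + `|qc i| * `|v0 xi|.
  rewrite normrM; apply: le_trans (_ : `|pc i * Q0 xi + qc i * v0 xi| <= _).
    by rewrite ler_piMl// cos_max.
  by apply: le_trans (ler_normD _ _) _; rewrite !normrM.
have c2 i : `|qc i * (sinc (om i) t (enorm xi) * v1 xi)| <= `|qc i| / om i * S.
  rewrite (normrM (qc i)) (normrM (sinc _ _ _)) -[leRHS]mulrA ler_wpM2l//.
  apply: le_trans (_ : `|sinc (om i) t (enorm xi)| * (enorm xi * S) <= _).
    by rewrite ler_wpM2l// v1_le.
  by rewrite mulrA ler_wpM2r// sinc_mul_le.
apply: le_trans (ler_normD _ _) _.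
apply: le_trans (lerD (ler_normD _ _) (ler_normD _ _)) _.
apply: le_trans (lerD (lerD (c1 true) (c1 false)) (lerD (c2 true) (c2 false))) _.
rewrite /CR big_bool /= /Hf -/S; clear c1 c2.
have := normr_ge0 (Q0 xi); have := normr_ge0 (v0 xi).
have p1 := normr_ge0 (pc true); have p2 := normr_ge0 (pc false).
have q1 := normr_ge0 (qc true); have q2 := normr_ge0 (qc false).
have d1 : 0 <= `|qc true| / om true by rewrite divr_ge0// ltW.
have d2 : 0 <= `|qc false| / om false by rewrite divr_ge0// ltW.
move: `|pc true| `|pc false| `|qc true| `|qc false| (_ / _) (_ / _) `|Q0 xi| `|v0 xi| S p1 p2 q1 q2 d1 d2 S0.
by move=> a1 a2 a3 a4 a5 a6 x y z *; nra.
Qed.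

Lemma Gf_le t xi : `|Gf t xi| <= CP * `|t|.
Proof.
have r0 := enorm_ge0 xi; apply: le_trans (ler_normD _ _) _; rewrite !(normrM (pc _)) /CP big_bool /=.
have h1 := sinc_le t (omp true) r0; have h2 := sinc_le t (omp false) r0.
have p1 := normr_ge0 (pc true); have p2 := normr_ge0 (pc false).
have o1 : 0 <= (om true)^-1 by rewrite invr_ge0 ltW.
have o2 : 0 <= (om false)^-1 by rewrite invr_ge0 ltW.
have := ler_wpM2l p1 h1; have := ler_wpM2l p2 h2; have t0 := normr_ge0 t.
have := mulr_ge0 (mulr_ge0 p1 o1) t0; have := mulr_ge0 (mulr_ge0 p2 o2) t0.
by lra.
Qed.

Lemma Gf_mul_le t xi : `|Gf t xi| * enorm xi <= CP.
Proof.
have r0 := enorm_ge0 xi.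
have h1 := sinc_mul_le t (omp true) r0; have h2 := sinc_mul_le t (omp false) r0.
apply: le_trans (_ : (`|pc true| * `|sinc (om true) t (enorm xi)| + `|pc false| * `|sinc (om false) t (enorm xi)|) * enorm xi <= _).
  by rewrite ler_wpM2r//; apply: le_trans (ler_normD _ _) _; rewrite !(normrM (pc _)).
rewrite mulrDl -!mulrA /CP big_bool /=.
have p1 := normr_ge0 (pc true); have p2 := normr_ge0 (pc false).
by have := ler_wpM2l p1 h1; have := ler_wpM2l p2 h2; lra.
Qed.

Lemma L2_Rf t : L2 (Rf t).
Proof.
apply: (@L2_le _ _ _ mu _ Hf CR); [exact: measurable_Rf|exact: L2_Hf|move=> xi].
apply: le_trans (Rf_le t xi) _; rewrite ler_wpM2l ?CR_ge0//; exact: ler_norm.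
Qed.

Lemma nrm_Rf t : nrm (Rf t) <= CR * nrm Hf.
Proof.
apply: nrm_le; [exact: measurable_Rf|exact: L2_Hf|exact: CR_ge0|move=> xi].
apply: le_trans (Rf_le t xi) _; rewrite ler_wpM2l ?CR_ge0//; exact: ler_norm.
Qed.

Lemma L2_GfQ1 t : L2 (fun xi => Gf t xi * Q1 xi).
Proof.
apply: (@L2_le _ _ _ mu _ Q1 (CP * `|t|)) => // [|xi].
  by apply: measurable_funM => //; exact: measurable_Gf.
by rewrite normrM ler_wpM2r// Gf_le.
Qed.

Lemma L2_Qf t : L2 (Qf t).
Proof.
rewrite (_ : Qf t = (fun xi => Rf t xi + Gf t xi * Q1 xi)).
  by apply: L2D; [exact: L2_Rf|exact: L2_GfQ1].
by apply/funext => xi; exact: Qf_split.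
Qed.

(** The frequencies are split at [|xi| = 1]. Outside, [Gf] is bounded and the L^2 norm of [Q1]
    suffices; inside, [Q1] is bounded pointwise and [radial_upper] integrates the square of [Gf]. *)
Lemma GfQ1_upper t (M1 : R) : 0 < t -> 0 <= M1 -> (forall xi, `|Q1 xi| <= M1) ->
  nrm (fun xi => Gf t xi * Q1 xi) <= CP * Num.sqrt (7 * beta) * rate n t * M1 + CP * nrm Q1.
Proof.
move=> t0 M0 HM; have b0 := ball_measure_gt0 R n; have cp0 := CP_gt0.
have mI : measurable_fun setT (fun xi : E => enorm xi < 1).
  by apply: measurable_fun_ltr => //; exact: measurable_enorm.
pose F1 xi := if enorm xi < 1 then Gf t xi * Q1 xi else 0.
pose F2 xi := if enorm xi < 1 then 0 else Gf t xi * Q1 xi.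
have mG := L2_mf (L2_GfQ1 t).
have mF1 : measurable_fun setT F1.
  by apply: measurable_fun_if => //; exact: measurable_funS mG.
have mF2 : measurable_fun setT F2.
  by apply: measurable_fun_if => //; exact: measurable_funS mG.
have F12 : L2 F1.
  apply: (@L2_le _ _ _ mu _ _ 1 mF1 (L2_GfQ1 t)) => xi; rewrite mul1r /F1.
  by case: ifP => // _; rewrite normr0.
have F22 : L2 F2.
  apply: (@L2_le _ _ _ mu _ _ 1 mF2 (L2_GfQ1 t)) => xi; rewrite mul1r /F2.
  by case: ifP => // _; rewrite normr0.
have -> : (fun xi => Gf t xi * Q1 xi) = (fun xi => F1 xi + F2 xi).
  by apply/funext => xi; rewrite /F1 /F2; case: ifP => _; rewrite ?addr0 ?add0r.
apply: le_trans (nrmD F12 F22) _; apply: lerD; last first.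
  apply: nrm_le => //; first exact: ltW.
  move=> xi; rewrite /F2; case: ltP => [_|r1]; first by rewrite normr0 mulr_ge0// ltW.
  rewrite normrM ler_wpM2r//; apply: le_trans (Gf_mul_le t xi).
  by rewrite ler_peMr.
(* Dividing by [CP] normalises the two bounds on [Gf] to those that [radial_upper] asks for. *)
pose w (xi : E) := if enorm xi < 1 then (Gf t xi / CP) ^+ 2 else 0.
have Gc xi : (Gf t xi / CP) ^+ 2 = (`|Gf t xi| / CP) ^+ 2.
  by rewrite -[LHS]real_normK ?num_real// normrM normfV (gtr0_norm cp0).
have := @radial_upper R n hn t w t0 _ _ _ _ _.
have -> : nrm F1 = Num.sqrt (ip F1 F1) by [].
have -> : CP * Num.sqrt (7 * beta) * rate n t * M1 = Num.sqrt ((CP * M1) ^+ 2 * (7 * beta * rate n t ^+ 2)).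
  have r0 := rate_ge0 n t; have s0 : 0 <= 7 * beta by rewrite mulr_ge0// ltW.
  rewrite [RHS]sqrtrM ?sqr_ge0// sqrtr_sqr ger0_norm ?mulr_ge0 ?(ltW cp0)//.
  by rewrite [in RHS]sqrtrM// sqrtr_sqr ger0_norm//; ring.
move=> H; rewrite ler_wsqrtr// -lee_fin -sqE// EFinM.
apply: le_trans (_ : (((CP * M1) ^+ 2)%:E * \int[mu]_x (w x)%:E <= _)%E); last first.
  apply: lee_wpmul2l; first by rewrite lee_fin sqr_ge0.
  apply: H.
  - apply: measurable_fun_if => //; apply: measurable_funS (_ : measurable setT) _ _ => //.
    by apply: measurable_funX; apply: measurable_funM => //; exact: measurable_Gf.
  - by move=> xi; rewrite /w; case: ifP => // _; exact: sqr_ge0.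
  - move=> xi; rewrite /w; case: ifP => _; last exact: sqr_ge0.
    rewrite Gc lerXn2r// ?nnegrE ?divr_ge0 ?(ltW cp0) ?(ltW t0)//.
    by rewrite ler_pdivrMr// mulrC -[X in _ * X](gtr0_norm t0) Gf_le.
  - move=> xi; rewrite /w; case: ifP => _; last by rewrite mul0r.
    rewrite Gc -exprMn -[X in _ <= X](@expr1n _ 2) lerXn2r// ?nnegrE ?mulr_ge0 ?invr_ge0 ?(ltW cp0) ?enorm_ge0//.
    by rewrite mulrAC ler_pdivrMr// mul1r Gf_mul_le.
  - by move=> xi r1; rewrite /w ltNge r1.
rewrite -ge0_integralZl//; last 3 first.
- apply/measurable_EFinP; apply: measurable_fun_if => //; apply: measurable_funS (_ : measurable setT) _ _ => //.
  by apply: measurable_funX; apply: measurable_funM => //; exact: measurable_Gf.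
- by move=> xi _; rewrite lee_fin /w; case: ifP => // _; exact: sqr_ge0.
- by rewrite lee_fin sqr_ge0.
apply: ge0_le_integral => //.
- by move=> xi _; rewrite lee_fin sqr_ge0.
- by apply/measurable_EFinP; exact: measurable_funX.
- apply: measurable_funeM; apply/measurable_EFinP; apply: measurable_fun_if => //.
  apply: measurable_funS (_ : measurable setT) _ _ => //.
  by apply: measurable_funX; apply: measurable_funM => //; exact: measurable_Gf.
move=> xi _; rewrite -EFinM lee_fin /F1 /w; case: ifP => _; last by rewrite expr0n mulr0.
rewrite -exprMn.
have -> : (CP * M1 * (Gf t xi / CP)) ^+ 2 = (M1 * `|Gf t xi|) ^+ 2.
  by rewrite !exprMn real_normK ?num_real// exprVn; field; rewrite gt_eqF.
rewrite -[leLHS]real_normK ?num_real// lerXn2r// ?nnegrE ?mulr_ge0//.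
by rewrite normrM mulrC ler_wpM2r.
Qed.

Lemma Qf_upper t (M1 : R) : 0 < t -> 0 <= M1 -> (forall xi, `|Q1 xi| <= M1) ->
  nrm (Qf t) <= CR * (nrm Q0 + (nrm v0 + \sum_k nrm (X1 k))) +
    (CP * Num.sqrt (7 * beta) * rate n t * M1 + CP * nrm Q1).
Proof.
move=> t0 M0 HM.
have -> : Qf t = (fun xi => Rf t xi + Gf t xi * Q1 xi) by apply/funext => xi; exact: Qf_split.
apply: le_trans (nrmD (L2_Rf t) (L2_GfQ1 t)) _; apply: lerD; last exact: GfQ1_upper.
apply: le_trans (nrm_Rf t) _; rewrite ler_wpM2l ?CR_ge0//; exact: nrm_Hf.
Qed.

Lemma Qf_bound (t T : R) xi : `|t| <= T -> `|Qf t xi| <= CR * Hf xi + CP * T * `|Q1 xi|.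
Proof.
move=> tT; rewrite Qf_split; apply: le_trans (ler_normD _ _) _; apply: lerD; first exact: Rf_le.
rewrite normrM ler_wpM2r//; apply: le_trans (Gf_le t xi) _.
by rewrite ler_wpM2l// ltW// CP_gt0.
Qed.

Lemma Qf_continuous xi : continuous (fun t => Qf t xi).
Proof.
have cm (w A B : R) : continuous (fun t => mode w t A B).
  have [->|w0] := eqVneq w 0; last exact: (derive_continuous (fun t => is_derive_mode t A B w0)).
  rewrite (_ : (fun t => _) = cst A); first exact: cst_continuous.
  by apply/funext => t; rewrite /mode !mul0r cos0 invr0 mulr0 mul0r addr0 mul1r.
move=> t; exact: (cvgD
  (cm (om true * enorm xi) (pc true * Q0 xi + qc true * v0 xi) (pc true * Q1 xi + qc true * v1 xi) t)
  (cm (om false * enorm xi) (pc false * Q0 xi + qc false * v0 xi) (pc false * Q1 xi + qc false * v1 xi) t)).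
Qed.

(** Dominated convergence: for times within 1 of [t], [Qf_bound] provides a square integrable
    majorant independent of time. *)
Lemma Qf_cvg (t : R) : nrm (fun xi => Qf s xi - Qf t xi) @[s --> t] --> (0 : R).
Proof.
have T0 : 0 <= `|t| + 1 by rewrite addr_ge0.
pose G xi := CR * Hf xi + CP * (`|t| + 1) * `|Q1 xi|.
have G0 xi : 0 <= G xi.
  rewrite addr_ge0 ?mulr_ge0 ?CR_ge0 ?(ltW CP_gt0)//.
  by rewrite /Hf !addr_ge0// sumr_ge0.
have G2 : L2 (fun xi => 2 * G xi).
  apply: L2Z; apply: L2D; apply: L2Z; first exact: L2_Hf.
  by have [] := L2_abs Q12.
have D2 s : L2 (fun xi => Qf s xi - Qf t xi) by apply: L2B; exact: L2_Qf.
pose F s := \int[mu]_xi ((Qf s xi - Qf t xi) * (Qf s xi - Qf t xi)).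
have cF : {in `]t - 1, t + 1[%classic, continuous F}.
  apply: (@continuity_under_integral _ _ _ mu _ _ measurableT _ _ _ _ _ (L2_mul G2 G2)).
  - by move=> s _; exact: L2_mul.
  - apply: aeW => xi _ s _.
    have c1 : {for s, continuous (fun s => Qf s xi - Qf t xi)}.
      by apply: continuousB; [exact: Qf_continuous|exact: cst_continuous].
    exact: (cvgM c1 c1).
  - move=> s; rewrite /= in_itv/= => /andP[s1 s2]; apply: aeW => xi _.
    have h1 : `|s| <= `|t| + 1.
      have := ler_normD (s - t) t; rewrite subrK => h; apply: le_trans h _.
      by rewrite addrC lerD2l ler_norml; apply/andP; split; lra.
    have h2 : `|t| <= `|t| + 1 by rewrite lerDl.
    have h3 : `|Qf s xi - Qf t xi| <= 2 * G xi.
      apply: le_trans (ler_normB _ _) _.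
      by have := Qf_bound xi h1; have := Qf_bound xi h2; rewrite -/(G xi); lra.
    by rewrite normrM ler_pM.
have it : t \in `]t - 1, t + 1[%classic by apply/mem_set; rewrite /= in_itv/=; apply/andP; split; lra.
have Ft : F t = 0.
  by rewrite /F; under eq_Rintegral do rewrite subrr mul0r; rewrite /Rintegral integral0.
have cFt : F s @[s --> t] --> F t by exact: cF.
rewrite -(@sqrtr0 R) -Ft; apply: (cvg_comp _ _ cFt); exact: sqrt_continuous.
Qed.

(** [Gf] is [waves (r t) / r], so near the origin the square of [Gf * Q1] is at least [(P / 2)^2]
    times [low]; the triangle inequality then removes [Rf] at the cost of [M]. *)
Lemma Qf_lower t (e c M P : R) : 0 < t -> 0 <= c -> 0 <= P ->
  (forall xi, enorm xi < e -> P / 2 <= `|Q1 xi|) ->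
  ((c * rate n t ^+ 2)%:E <=
    \int[mu]_x (low (pc true / om true) (pc false / om false) (om true) (om false) e t x)%:E)%E ->
  CR * nrm Hf <= M ->
  P / 2 * Num.sqrt c * rate n t - M <= nrm (Qf t).
Proof.
move=> t0 c0 P0 HP hlow HM.
have GE xi : Gf t xi = waves (pc true / om true) (pc false / om false) (om true) (om false) (enorm xi * t) / enorm xi.
  by rewrite /Gf /sinc /waves !invfM !mulrA; ring.
have h1 : P / 2 * Num.sqrt c * rate n t <= nrm (fun xi => Gf t xi * Q1 xi).
  have r0 := rate_ge0 n t.
  have -> : P / 2 * Num.sqrt c * rate n t = Num.sqrt ((P / 2) ^+ 2 * (c * rate n t ^+ 2)).
    rewrite [RHS]sqrtrM ?sqr_ge0// sqrtr_sqr ger0_norm ?divr_ge0//.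
    by rewrite [in RHS]sqrtrM// sqrtr_sqr ger0_norm// mulrA.
  rewrite /L2Space.nrm ler_wsqrtr// -lee_fin -sqE; last exact: L2_GfQ1.
  rewrite EFinM.
  apply: le_trans (lee_wpmul2l _ hlow) _; first by rewrite lee_fin sqr_ge0.
  rewrite -ge0_integralZl//; last 3 first.
  - by apply/measurable_EFinP; exact: measurable_low.
  - by move=> x _; rewrite lee_fin low_ge0.
  - by rewrite lee_fin sqr_ge0.
  apply: ge0_le_integral => //.
  - by move=> x _; rewrite -EFinM lee_fin mulr_ge0 ?sqr_ge0// low_ge0.
  - by apply: measurable_funeM; apply/measurable_EFinP; exact: measurable_low.
  - by apply/measurable_EFinP; apply: measurable_funX; exact: L2_mf (L2_GfQ1 t).
  move=> x _; rewrite -EFinM lee_fin /low -GE; case: ifP => [xe|_]; last first.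
    by rewrite mulr0 sqr_ge0.
  rewrite [leRHS]exprMn [leRHS]mulrC ler_wpM2r ?sqr_ge0// -[leRHS]real_normK ?num_real//.
  by rewrite lerXn2r// ?nnegrE ?divr_ge0//; exact: HP.
have e1 : (fun xi => Gf t xi * Q1 xi) = (fun xi => Qf t xi - Rf t xi).
  by apply/funext => xi; rewrite Qf_split addrC addKr.
have h2 := nrmD (L2_Qf t) (L2N (L2_Rf t)); rewrite nrmN -e1 in h2.
by have := nrm_Rf t; lra.
Qed.

Lemma measurable_Xf k t : measurable_fun setT (Xf k t).
Proof.
have mv1 := measurable_v1; have mx := @measurable_rV_coord R n k.
have mA (p q : R) : measurable_fun setT (fun xi => p * Q0 xi + q * v0 xi).
  by apply: measurable_funD; exact: measurable_funM.
have mB (p q : R) : measurable_fun setT (fun xi => p * Q1 xi + q * v1 xi).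
  by apply: measurable_funD; exact: measurable_funM.
have mr2 (a : R) : measurable_fun setT (fun xi : E => a / enorm xi ^+ 2).
  apply: measurable_funM => //; apply: measurable_funV; apply: measurable_funX.
  exact: measurable_enorm.
apply: measurable_funD; first by apply: measurable_mode; [exact: L2_mf (X02 k)|exact: L2_mf (X12 k)].
apply: measurable_funM => //.
by apply: measurable_funD; apply: measurable_funM => //; apply: measurable_funB; apply: measurable_mode.
Qed.

(* The factor [xi / |xi|^2] is compensated by the cancellations in
   [cos (om r t) - cos (b r t)] and [sinc om - sinc b]. *)
Lemma Xf_mode_le i (x r t A1 B1 A2 B2 S : R) : `|x| <= r -> 0 < r -> 0 <= S -> `|B2| <= r * S ->
  `|x * (cpl i / r ^+ 2 * (mode (om i * r) t (A1 + A2) (B1 + B2) - mode (b * r) t (A1 + A2) (B1 + B2)))|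
  <= `|cpl i| * ((om i + b) * `|t| * `|A1 + A2| + (om i + b) * t ^+ 2 * `|B1| + 2 * `|t| * S).
Proof.
move=> xr r0 S0 BS; have oi := omp i; have rn : r != 0 by rewrite gt_eqF.
have -> : x * (cpl i / r ^+ 2 * (mode (om i * r) t (A1 + A2) (B1 + B2) - mode (b * r) t (A1 + A2) (B1 + B2))) =
  cpl i * (x / r ^+ 2 * ((cos (om i * r * t) - cos (b * r * t)) * (A1 + A2) +
    ((sinc (om i) t r - t) - (sinc b t r - t)) * B1 + (sinc (om i) t r - sinc b t r) * B2)).
  by rewrite /mode /sinc; field; rewrite rn !gt_eqF.
rewrite normrM ler_wpM2l//.
rewrite normrM; set Y := _ + _ * B2.
have xr2 : `|x / r ^+ 2| <= r^-1.
  rewrite normrM normfV [`|r ^+ 2|]gtr0_norm ?exprn_gt0// ler_pdivrMr ?exprn_gt0//.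
  by rewrite expr2 mulKf.
apply: le_trans (ler_wpM2r (normr_ge0 _) xr2) _; rewrite ler_pdivrMl//.
have c1 : `|cos (om i * r * t) - cos (b * r * t)| <= r * ((om i + b) * `|t|).
  apply: le_trans (cos_lipschitz _ _) _.
  have -> : om i * r * t - b * r * t = (om i - b) * (r * t) by ring.
  rewrite normrM [`|r * t|]normrM (gtr0_norm r0) mulrCA ler_wpM2l ?(ltW r0)//.
  rewrite ler_wpM2r//; apply: le_trans (ler_normB _ _) _.
  by rewrite !gtr0_norm.
have c2 : `|(sinc (om i) t r - t) - (sinc b t r - t)| <= r * ((om i + b) * t ^+ 2).
  apply: le_trans (ler_normB _ _) _.
  by have := sinc_sub_le t oi r0; have := sinc_sub_le t hb r0; lra.
have c3 : `|sinc (om i) t r - sinc b t r| <= 2 * `|t|.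
  apply: le_trans (ler_normB _ _) _.
  by have := sinc_le t oi (ltW r0); have := sinc_le t hb (ltW r0); lra.
apply: le_trans (ler_normD _ _) _; apply: le_trans (lerD (ler_normD _ _) (lexx _)) _.
rewrite [leRHS]mulrDr [X in _ <= X + _]mulrDr; apply: lerD; first apply: lerD.
- by rewrite normrM mulrA ler_wpM2r.
- by rewrite normrM mulrA ler_wpM2r.
- by rewrite normrM mulrCA; apply: ler_pM.
Qed.

(** A bound at fixed time, with constants growing in [t]. It serves the existence of solutions,
    where [Xf] has to be the transform of a square integrable displacement. *)
Lemma L2_Xf k t : L2 (Xf k t).
Proof.
pose C i := `|cpl i| * ((om i + b) * `|t|); pose D i := `|cpl i| * ((om i + b) * t ^+ 2).
pose Z xi := `|X0 k xi| + `|t| * `|X1 k xi| +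
  \sum_i (C i * (`|pc i| * `|Q0 xi| + `|qc i| * `|v0 xi|) + D i * (`|pc i| * `|Q1 xi|) +
    `|cpl i| * (2 * `|t|) * (`|qc i| * \sum_k `|X1 k xi|)).
have ZL : L2 Z.
  apply: L2D; first by apply: L2D; [have [] := L2_abs (X02 k)|apply: L2Z; have [] := L2_abs (X12 k)].
  apply: L2_sum => i; apply: L2D; first apply: L2D.
  - by apply: L2Z; apply: L2D; apply: L2Z; [have [] := L2_abs Q02|have [] := L2_abs v02].
  - by do 2 apply: L2Z; have [] := L2_abs Q12.
  - by do 2 apply: L2Z; apply: L2_sum => j; have [] := L2_abs (X12 j).
apply: (@L2_le _ _ _ mu _ Z 1) => // [|xi]; first exact: measurable_Xf.
have oi i := omp i.
have b0 i : 0 <= om i + b by rewrite addr_ge0 ?ltW.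
have S0 : 0 <= \sum_k `|X1 k xi| by rewrite sumr_ge0.
have Ti0 i : 0 <= C i * (`|pc i| * `|Q0 xi| + `|qc i| * `|v0 xi|) + D i * (`|pc i| * `|Q1 xi|) +
    `|cpl i| * (2 * `|t|) * (`|qc i| * \sum_k `|X1 k xi|).
  have Ci : 0 <= C i by rewrite !mulr_ge0.
  have Di : 0 <= D i by rewrite mulr_ge0// mulr_ge0// sqr_ge0.
  have h1 : 0 <= `|pc i| * `|Q0 xi| + `|qc i| * `|v0 xi| by rewrite addr_ge0// mulr_ge0.
  apply: addr_ge0; first by apply: addr_ge0; apply: mulr_ge0 => //; exact: mulr_ge0.
  by apply: mulr_ge0; exact: mulr_ge0.
rewrite mul1r; apply: le_trans (ler_norm _); rewrite /Xf /Explicit.Xsol /Xgen.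
have r0 := enorm_ge0 xi.
apply: le_trans (ler_normD _ _) _; apply: lerD.
  rewrite /mode; apply: le_trans (ler_normD _ _) _; rewrite !(normrM (_ : R) (X0 k xi)) !(normrM _ (X1 k xi)).
  apply: lerD; first by rewrite ler_piMl// cos_max.
  by rewrite ler_wpM2r//; exact: sinc_le.
(* At the origin the coordinate of [xi] is 0 and kills the singular term. *)
move: r0; rewrite le_eqVlt => /predU1P[r0|r0].
  have -> : xi ord0 k = 0.
    by apply/normr0_eq0/eqP; rewrite eq_le normr_ge0 andbT r0 coord_le_enorm.
  by rewrite mul0r normr0 sumr_ge0.
rewrite /Cgen mulrDr big_bool /=; apply: le_trans (ler_normD _ _) _.
have key i : `|xi ord0 k * (cpl i / enorm xi ^+ 2 *
   (mode (om i * enorm xi) t (pc i * Q0 xi + qc i * v0 xi) (pc i * Q1 xi + qc i * v1 xi) -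
    mode (b * enorm xi) t (pc i * Q0 xi + qc i * v0 xi) (pc i * Q1 xi + qc i * v1 xi)))| <=
  C i * (`|pc i| * `|Q0 xi| + `|qc i| * `|v0 xi|) + D i * (`|pc i| * `|Q1 xi|) +
    `|cpl i| * (2 * `|t|) * (`|qc i| * \sum_k `|X1 k xi|).
  apply: le_trans (@Xf_mode_le i _ _ t _ _ _ _ (`|qc i| * \sum_k `|X1 k xi|) (coord_le_enorm xi k) r0 _ _) _.
  - by rewrite mulr_ge0.
  - by rewrite normrM mulrCA ler_wpM2l// v1_le.
  rewrite (normrM (pc i) (Q1 xi)).
  have hA : `|pc i * Q0 xi + qc i * v0 xi| <= `|pc i| * `|Q0 xi| + `|qc i| * `|v0 xi|.
    by apply: le_trans (ler_normD _ _) _; rewrite !normrM.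
  have Ci : 0 <= C i by rewrite !mulr_ge0.
  have := ler_wpM2l Ci hA; rewrite /C /D.
  move: `|pc i * Q0 xi + _| (`|pc i| * `|Q0 xi| + _) `|cpl i| => a1 a2 a3.
  by move: (`|qc i| * _) (`|pc i| * _) => a4 a5; lra.
exact: lerD (key true) (key false).
Qed.

(** Used with [s = 1] for real parts and [s = -1] for imaginary parts: data with the symmetry of
    transforms of real functions keep it in time, as [isF_surj] requires. *)
Lemma Qf_parity (s : R) t xi : (forall xi, Q0 (- xi) = s * Q0 xi) -> (forall xi, Q1 (- xi) = s * Q1 xi) ->
  (forall xi, v0 (- xi) = s * v0 xi) -> (forall k xi, X1 k (- xi) = - s * X1 k xi) ->
  Qf t (- xi) = s * Qf t xi.
Proof.
move=> h1 h2 h3 h4.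
have h5 : v1 (- xi) = s * v1 xi.
  by rewrite /v1 mulr_sumr; apply: eq_bigr => k _; rewrite h4 mxE; ring.
by rewrite /Qf enormN h1 h2 h3 h5 /Modal.Qsol /Qgen /mode; ring.
Qed.

Lemma Xf_parity (s : R) k t xi : (forall xi, Q0 (- xi) = s * Q0 xi) -> (forall xi, Q1 (- xi) = s * Q1 xi) ->
  (forall xi, v0 (- xi) = s * v0 xi) -> (forall k xi, X0 k (- xi) = - s * X0 k xi) ->
  (forall k xi, X1 k (- xi) = - s * X1 k xi) ->
  Xf k t (- xi) = - s * Xf k t xi.
Proof.
move=> h1 h2 h3 h4 h6.
have h5 : v1 (- xi) = s * v1 xi.
  by rewrite /v1 mulr_sumr; apply: eq_bigr => j _; rewrite h6 mxE; ring.
by rewrite /Xf enormN h1 h2 h3 h4 h6 h5 mxE /Explicit.Xsol /Xgen /Cgen /mode; ring.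
Qed.

End data.

End solution_norms.

(** * Fourier transforms of the initial data *)

Section transforms.
Context (R : realType) (n : nat).
Local Notation E := 'rV[R]_n.
Local Notation mu := (lebesgue_rV R n).
Local Notation L2 := (L2 mu).
Local Notation ip := (ip mu).
Local Notation nrm := (nrm mu).
Local Notation cvgL2 := (cvgL2 mu).
Local Notation K := (plancherel_cst R n).
Local Notation sK := (Num.sqrt K).
Implicit Types f c s : E -> R.

Lemma sK_gt0 : 0 < sK. Proof. by rewrite sqrtr_gt0 plancherel_cst_gt0. Qed.

Lemma cvgL2_ae (f_ : nat -> E -> R) f g : (forall k, L2 (f_ k)) -> L2 f -> L2 g ->
  {ae mu, forall x, f x = g x} -> cvgL2 f_ f -> cvgL2 f_ g.
Proof.
move=> fk2 f2 g2 fg; rewrite /L2Space.cvgL2.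
rewrite (_ : (fun k => nrm (fun x => f_ k x - g x)) = (fun k => nrm (fun x => f_ k x - f x)))//.
apply/funext => k.
have H : {ae mu, forall x, f_ k x - f x = f_ k x - g x} by move: fg; apply: filterS => x ->.
by have [_ <-] := eq_ae_nrm (L2B (fk2 k) f2) (L2_mf (L2B (fk2 k) g2)) H.
Qed.

Lemma isF_ae f c s c' s' : isF f c s -> L2 c' -> L2 s' -> {ae mu, forall x, c x = c' x} ->
  {ae mu, forall x, s x = s' x} -> isF f c' s'.
Proof.
move=> [f2 c2 s2 [f_ [f12 cf cc cs]]] c2' s2' cc' ss'; split=> //; exists f_; split=> //.
  by apply: cvgL2_ae cc => // k; have [] := plancherel (f12 k).
by apply: cvgL2_ae cs => // k; apply: L2N; have [] := plancherel (f12 k).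
Qed.

Lemma isF_nrm_le f c s : isF f c s -> nrm c <= sK * nrm f /\ nrm s <= sK * nrm f.
Proof.
move=> F; have := isF_norm F => e; have K0 := ltW (plancherel_cst_gt0 R n).
rewrite /L2Space.nrm -sqrtrM// -e !ler_wsqrtr// ?lerDl ?lerDr ip_ge0//.
Qed.

Lemma isF_nrm_ge f c s : isF f c s -> nrm f <= sK^-1 * (nrm c + nrm s).
Proof.
move=> F; have e := isF_norm F; have s0 := sK_gt0.
rewrite ler_pdivlMl// -(@ler_pXn2r _ 2)// ?nnegrE ?mulr_ge0 ?addr_ge0 ?nrm_ge0 ?(ltW s0)//.
rewrite exprMn nrm2 sqr_sqrtr ?(ltW (plancherel_cst_gt0 R n))// -e sqrrD !nrm2.
by rewrite lerD2r lerDl mulrn_wge0// mulr_ge0 ?nrm_ge0.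
Qed.

Lemma wpartialP j f : inH1 f -> L2 (wpartial j f) /\ weak_partial j f (wpartial j f).
Proof.
move=> [_ /(_ j) H]; have [g1 g2] := xgetPex (cst 0) H.
by split=> //; exact/Lfun2P.
Qed.

Section divergence.
Variables (u0 : E -> E) (c s : 'I_n -> E -> R).
Hypothesis u0H : forall k, inH1 (component u0 k).
Hypothesis u0F : forall k, isF (component u0 k) (c k) (s k).
Local Notation D := (\sum_k nrm (wpartial k (component u0 k))).

(** This is where H^1 regularity enters: by [isF_weak_partial], each [xi_k] times the transform of
    the [k]-th component is bounded in L^2 by a weak derivative. *)
Lemma divergence_L2 :
  [/\ L2 (fun xi => \sum_k xi ord0 k * c k xi), L2 (fun xi => \sum_k xi ord0 k * - s k xi),
    nrm (fun xi => \sum_k xi ord0 k * c k xi) <= sK * D &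
    nrm (fun xi => \sum_k xi ord0 k * - s k xi) <= sK * D].
Proof.
have H k : [/\ L2 (fun xi => xi ord0 k * c k xi), L2 (fun xi => xi ord0 k * - s k xi),
    nrm (fun xi => xi ord0 k * c k xi) <= sK * nrm (wpartial k (component u0 k)) &
    nrm (fun xi => xi ord0 k * - s k xi) <= sK * nrm (wpartial k (component u0 k))].
  have [g2 wg] := wpartialP k (u0H k); have [a1 a2 a3 a4] := isF_weak_partial (u0F k) g2 wg.
  have K0 := ltW (plancherel_cst_gt0 R n).
  have e : (fun xi : E => xi ord0 k * - s k xi) = (fun xi : E => - (xi ord0 k * s k xi)).
    by apply/funext => xi; rewrite mulrN.
  rewrite e; split=> //; first exact: L2N.
    by rewrite /L2Space.nrm -sqrtrM// ler_wsqrtr.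
  by rewrite nrmN /L2Space.nrm -sqrtrM// ler_wsqrtr.
split.
- by apply: L2_sum => k; case: (H k).
- by apply: L2_sum => k; case: (H k).
- apply: le_trans (nrm_sum _ (F := fun k (xi : E) => xi ord0 k * c k xi) _) _; first by move=> k; case: (H k).
  by rewrite mulr_sumr; apply: ler_sum => k _; case: (H k).
- apply: le_trans (nrm_sum _ (F := fun k (xi : E) => xi ord0 k * - s k xi) _) _; first by move=> k; case: (H k).
  by rewrite mulr_sumr; apply: ler_sum => k _; case: (H k).
Qed.

End divergence.

Lemma cosT_le f xi : inL1 f -> `|cosT f xi| <= \int[mu]_x `|f x|.
Proof.
move=> f1; have ii := integrable_cosT xi f1; have /Lfun1_integrable fi := f1.
apply: le_trans (le_normr_Rintegral measurableT ii) _.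
apply: le_Rintegral => //; [exact: integrable_norm ii|exact: integrable_norm fi|move=> x _].
by rewrite normrM ler_piMl// cos_max.
Qed.

Lemma sinT_le f xi : inL1 f -> `|sinT f xi| <= \int[mu]_x `|f x|.
Proof.
move=> f1; have ii := integrable_sinT xi f1; have /Lfun1_integrable fi := f1.
apply: le_trans (le_normr_Rintegral measurableT ii) _.
apply: le_Rintegral => //; [exact: integrable_norm ii|exact: integrable_norm fi|move=> x _].
by rewrite normrM ler_piMl// sin_max.
Qed.

Lemma dotrV_le (x xi : E) : `|dotrV x xi| <= n%:R * (enorm x * enorm xi).
Proof.
apply: le_trans (ler_norm_sum _ _ _) _.
apply: (@le_trans _ _ (\sum_(j < n) enorm x * enorm xi)).
  by apply: ler_sum => j _; rewrite normrM ler_pM// coord_le_enorm.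
by rewrite sumr_const card_ord mulr_natl.
Qed.

(** At the origin [cosT f] is the total mass, and it is Lipschitz in [xi] there, with a constant
    given by the weighted L^1 norm. *)
Lemma cosT_near0 f : inL11 f -> total_mass f != 0 -> exists2 e : R, 0 < e &
  forall xi, enorm xi < e -> `|total_mass f| / 2 <= `|cosT f xi|.
Proof.
move=> [f1 w1] P0; have /Lfun1_integrable fi := f1; have /Lfun1_integrable wi := w1.
have mf : measurable_fun setT f by apply/measurable_EFinP; exact: measurable_int fi.
pose W := \int[mu]_x `|weighted f x|.
have W0 : 0 <= W by apply: Rintegral_ge0.
have P : 0 < `|total_mass f| by rewrite normr_gt0.
have h xi : `|cosT f xi - total_mass f| <= n%:R * enorm xi * W.
  have ii := integrable_cosT xi f1.
  rewrite /cosT /total_mass -RintegralB//.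
  have ib : mu.-integrable setT (EFin \o (fun x => cos (dotrV x xi) * f x - f x)).
    exact: (integrableB measurableT ii fi).
  apply: le_trans (le_normr_Rintegral measurableT ib) _.
  rewrite /W -RintegralZl//; last exact: integrable_norm wi.
  apply: le_Rintegral => //; first exact: integrable_norm ib.
    exact: (integrableZl measurableT (n%:R * enorm xi) (integrable_norm wi)).
  move=> x _; rewrite /weighted normrM mulrA.
  have -> : cos (dotrV x xi) * f x - f x = (cos (dotrV x xi) - cos 0) * f x by rewrite cos0; ring.
  rewrite normrM ler_wpM2r//; apply: le_trans (cos_lipschitz _ _) _; rewrite subr0.
  apply: le_trans (dotrV_le x xi) _; rewrite -mulrA ler_wpM2l// mulrC ler_wpM2l ?enorm_ge0//.
  by rewrite ger0_norm ?addr_ge0 ?enorm_ge0// lerDr.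
(* Within this radius [n |xi| W] stays below half the total mass; the added 1 keeps the denominator
   positive. *)
exists (`|total_mass f| / (2 * (n%:R * W + 1))).
  by rewrite divr_gt0// mulr_gt0// ltr_wpDl// mulr_ge0.
have nW : 0 <= n%:R * W by rewrite mulr_ge0.
move=> xi; rewrite ltr_pdivlMr; last by rewrite mulr_gt0// ltr_wpDl.
have := h xi; have := enorm_ge0 xi => r0.
have := ler_normB (cosT f xi) (cosT f xi - total_mass f); rewrite subKr.
rewrite mulrAC => h1 h2 h3.
have : enorm xi * (n%:R * W + 1) < `|total_mass f| / 2 by lra.
rewrite mulrDr mulr1 => h4.
have : enorm xi * (n%:R * W) = n%:R * W * enorm xi by ring.
by move=> h5; lra.
Qed.

End transforms.

(** * Solutions: explicit form, continuity in time and upper bound *)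

Section solution.
Context (R : realType) (n : nat) (b kappa gamma : R).
Hypothesis hn : n = 1%N \/ n = 2%N.
Hypotheses (hb : 0 < b) (hkappa : 0 < kappa) (hgamma : gamma != 0).
Local Notation E := 'rV[R]_n.
Local Notation mu := (lebesgue_rV R n).
Local Notation L2 := (L2 mu).
Local Notation ip := (ip mu).
Local Notation nrm := (nrm mu).
Local Notation K := (plancherel_cst R n).
Local Notation sK := (Num.sqrt K).
Local Notation Qf := (Qf b kappa gamma).
Local Notation Xf := (Xf b kappa gamma).
Local Notation om := (om b kappa gamma).
Local Notation pc := (pc b kappa gamma).
Local Notation CR := (CR b kappa gamma).
Local Notation CP := (CP b kappa gamma).
Local Notation beta := (ball_measure R n).

Let n_gt0 : (0 < n)%N. Proof. by case: hn => ->. Qed.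

(** The finite quantity in which the estimates are carried out; [dnorm_le] places it below the
    extended-real [data_norm]. *)
Definition dnorm (u0 u1 : E -> E) (th0 th1 : E -> R) : R :=
  \sum_k nrm (wpartial k (component u0 k)) + \sum_k nrm (component u1 k) +
  (nrm th0 + (nrm th1 + \int[mu]_x `|th1 x|)).

Lemma le_euclidean_norm (A : \bar R) (B : 'I_n -> \bar R) k : (forall j, 0 <= B j)%E ->
  (B k <= (A `^ 2 + \sum_(j < n) B j `^ 2) `^ 2^-1)%E.
Proof.
move=> B0; have {1}-> : B k = ((B k `^ 2) `^ 2^-1)%E.
  by rewrite -poweRrM mulfV ?pnatr_eq0// poweRe1.
have pB j : (0 <= B j `^ 2)%E by exact: poweR_ge0.
have pA : (0 <= A `^ 2)%E by exact: poweR_ge0.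
have h0 : (0 <= \sum_(j < n | j != k) B j `^ 2)%E by exact: sume_ge0.
have le1 : (B k `^ 2 <= A `^ 2 + \sum_(j < n) B j `^ 2)%E.
  rewrite (bigD1 k)//= addeCA; apply: leeDl; exact: adde_ge0.
apply: gt0_ler_poweR => //; rewrite in_itv/= ?leey ?andbT//.
exact: le_trans le1.
Qed.

Lemma wpartial_le_H1norm k (f : E -> R) : inH1 f -> ((nrm (wpartial k f))%:E <= H1norm f)%E.
Proof.
move=> fH; have [g2 _] := wpartialP k fH.
have -> : (nrm (wpartial k f))%:E = L2norm (wpartial k f) by rewrite /L2norm Lnorm_nrm.
by apply: (le_euclidean_norm _ (B := fun j => L2norm (wpartial j f))) => j; exact: Lnorm_ge0.
Qed.

Lemma dnorm_le u0 u1 th0 th1 : admissible_data u0 u1 th0 th1 ->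
  ((dnorm u0 u1 th0 th1)%:E <= data_norm u0 u1 th0 th1)%E.
Proof.
move=> [[u0H _] [u12 _] /Lfun2P t02 [/Lfun2P t12 t11]].
rewrite /dnorm /data_norm !EFinD -!sumEFin; apply: leeD; first apply: leeD.
- by apply: lee_sum => k _; exact: wpartial_le_H1norm.
- apply: lee_sum => k _; have u2 : L2 (component u1 k) by apply/Lfun2P; exact: u12.
  by rewrite /L2norm Lnorm_nrm.
- have /Lfun1_integrable ti := t11.
  have -> : L1norm th1 = (\int[mu]_x `|th1 x|)%:E.
    rewrite /L1norm Lnorm1 /Rintegral fineK//.
    by apply: integrable_fin_num => //; exact: integrable_norm ti.
  by rewrite /L2norm !Lnorm_nrm.
Qed.

Lemma rate_large (M : R) : exists T : R, 0 < T /\ forall t, T <= t -> M <= rate n t.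
Proof.
have e0 : 0 < expR (M ^+ 2) by exact: expR_gt0.
exists (M ^+ 2 + expR (M ^+ 2)); split; first by rewrite ltr_wpDl// sqr_ge0.
move=> t Tt; have M2 := sqr_ge0 M; have t0 : 0 <= t by lra.
apply: le_trans (ler_norm M) _.
rewrite -(@ler_pXn2r _ 2)// ?nnegrE ?rate_ge0// real_normK ?num_real// rate_sqr//.
have e2 := expR1_ge2 R.
case: ifP => _; first by lra.
rewrite -[X in X <= _](@expRK R) ler_ln ?posrE//; lra.
Qed.

Section transform_data.
Variables (u0 u1 : E -> E) (th0 th1 : E -> R).
Hypothesis adm : admissible_data u0 u1 th0 th1.
Variables (u : R -> E -> E) (th : R -> E -> R).
Hypothesis sol : is_solution b kappa gamma u0 u1 th0 th1 u th.
Local Notation S0 := (\sum_k nrm (wpartial k (component u0 k))).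
Local Notation S1 := (\sum_k nrm (component u1 k)).

(** Uniqueness at almost every frequency forces the transform of [th t] to be the explicit one. The
    data [q0, w0, y1] belong to its real part and [p0, v0, x1] to its imaginary part, as in
    [ode_unique]. *)
Lemma solution_transform : exists (q0 p0 w0 v0 : E -> R) (y1 x1 : 'I_n -> E -> R),
  [/\ [/\ L2 q0, L2 w0, forall k, L2 (y1 k) & nrm q0 + (nrm w0 + \sum_k nrm (y1 k)) <= sK * (nrm th0 + (S0 + S1))],
      [/\ L2 p0, L2 v0, forall k, L2 (x1 k) & nrm p0 + (nrm v0 + \sum_k nrm (x1 k)) <= sK * (nrm th0 + (S0 + S1))] &
      forall t, 0 <= t -> isF (th t) (Qf q0 (cosT th1) w0 y1 t) (Qf p0 (fun xi => - sinT th1 xi) v0 x1 t)].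
Proof.
have [[u0H _] [u12 _] _ [/Lfun2P t12 t11]] := adm.
have [U0 [U1 [Th0 [Th1 [U [Th [FU [FT0 FT1] FUt ode]]]]]]] := sol.
have F0 k := (is_fourierP _ _).1 (FU k).1; have F1 k := (is_fourierP _ _).1 (FU k).2.
have G0 := (is_fourierP _ _).1 FT0; have G1 := (is_fourierP _ _).1 FT1.
have [d1 d2 d3 d4] := divergence_L2 u0H F0.
have y12 k : L2 (fun xi => - complex.Im (U1 xi ord0 k)) by apply: L2N; case: (F1 k).
have x12 k : L2 (fun xi => complex.Re (U1 xi ord0 k)) by case: (F1 k).
have q02 : L2 (fun xi => complex.Re (Th0 xi)) by case: G0.
have p02 : L2 (fun xi => complex.Im (Th0 xi)) by case: G0.
have t1F := isF_L12 (conj t11 t12).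
have [c12 s12] : L2 (cosT th1) /\ L2 (fun xi => - sinT th1 xi) by case: t1F.
exists (fun xi => complex.Re (Th0 xi)), (fun xi => complex.Im (Th0 xi)),
  (fun xi : E => \sum_k xi ord0 k * - complex.Im (U0 xi ord0 k)),
  (fun xi : E => \sum_k xi ord0 k * complex.Re (U0 xi ord0 k)),
  (fun k xi => - complex.Im (U1 xi ord0 k)), (fun k xi => complex.Re (U1 xi ord0 k)); split.
- split=> //; rewrite !mulrDr; apply: lerD; first by case: (isF_nrm_le G0).
  apply: lerD => //; rewrite mulr_sumr; apply: ler_sum => k _; rewrite nrmN.
  by case: (isF_nrm_le (F1 k)).
- split=> //; rewrite !mulrDr; apply: lerD; first by case: (isF_nrm_le G0).
  apply: lerD => //; rewrite mulr_sumr; apply: ler_sum => k _.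
  by case: (isF_nrm_le (F1 k)).
move=> t t0; have Ft := (is_fourierP _ _).1 (FUt t t0).2.
(* The given transform of [th1] is replaced by the absolutely convergent integral, equal to it
   almost everywhere, because the later bounds on it are pointwise. *)
have [aec aes] := isF_unique G1 t1F.
have H : {ae mu, forall xi, complex.Re (Th t xi) = Qf (fun xi => complex.Re (Th0 xi)) (cosT th1)
      (fun xi : E => \sum_k xi ord0 k * - complex.Im (U0 xi ord0 k)) (fun k xi => - complex.Im (U1 xi ord0 k)) t xi /\
    complex.Im (Th t xi) = Qf (fun xi => complex.Im (Th0 xi)) (fun xi => - sinT th1 xi)
      (fun xi : E => \sum_k xi ord0 k * complex.Re (U0 xi ord0 k)) (fun k xi => complex.Re (U1 xi ord0 k)) t xi}.
  have A1 : {ae mu, forall xi, complex.Re (Th1 xi) = cosT th1 xi /\ complex.Im (Th1 xi) = - sinT th1 xi}.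
    by move: aec aes; apply: filterS2.
  move: ode A1 (ae_enorm_gt0 R n_gt0); apply: filterS3 => xi hode [hc hs] r0.
  have [e1 e2] := ode_unique hb hkappa hgamma r0 hode t0.
  by rewrite e1 e2 hc hs.
apply: (isF_ae Ft).
- by apply: L2_Qf.
- by apply: L2_Qf.
- by move: H; apply: filterS => xi [].
- by move: H; apply: filterS => xi [].
Qed.

Lemma th1_L12 : L12 th1.
Proof. by have [_ _ _ [/Lfun2P t12 t11]] := adm. Qed.

Lemma th1_transform : L2 (cosT th1) /\ L2 (fun xi => - sinT th1 xi).
Proof. by case: (isF_L12 th1_L12). Qed.

(** By Plancherel, the distance between [th s] and [th t] is controlled by that between their
    explicit transforms, which [Qf_cvg] handles. *)
Lemma solution_continuous : C0_L2 th.
Proof.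
have [q0 [p0 [w0 [v0 [y1 [x1 [[q02 w02 y12 _] [p02 v02 x12 _] F]]]]]]] := solution_transform.
have [c12 s12] := th1_transform; have s0 := sK_gt0 R n.
have L2th t : 0 <= t -> L2 (th t) by move=> t0; case: (F t t0).
move=> t t0; split; first by apply/Lfun2P; exact: L2th.
have cr := Qf_cvg hb hkappa hgamma q02 c12 w02 y12 t.
have ci := Qf_cvg hb hkappa hgamma p02 s12 v02 x12 t.
pose h s := sK^-1 * (nrm (fun xi => Qf q0 (cosT th1) w0 y1 s xi - Qf q0 (cosT th1) w0 y1 t xi) +
  nrm (fun xi => Qf p0 (fun xi => - sinT th1 xi) v0 x1 s xi - Qf p0 (fun xi => - sinT th1 xi) v0 x1 t xi)).
have ch : h s @[s --> within [set s | 0 <= s] (nbhs t)] --> (0 : R).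
  have ch0 : h s @[s --> t] --> (0 : R).
    have e : (0 : R) = sK^-1 * (0 + 0) by rewrite addr0 mulr0.
    rewrite [X in _ --> X]e; apply: cvgM; first exact: cvg_cst.
    by apply: cvgD; [exact: cr|exact: ci].
  by apply: cvg_trans ch0; apply: cvg_fmap2; exact: cvg_within.
apply: (@squeeze_cvge _ _ _ _ (fun=> 0%E) _ (EFin \o h)); [|exact: cvg_cst|exact: (cvg_toE ch)].
apply: (@filterS _ (nbhs t) _ setT); last exact: filterT.
move=> s _ /= s0'; rewrite /L2norm Lnorm_nrm; last by apply: L2B; exact: L2th.
rewrite !lee_fin nrm_ge0/=.
by have := isF_nrm_ge (isFB (F s s0') (F t t0)).
Qed.

(** The factor 2 adds up real and imaginary parts. Passing to transforms costs [sK] and passing back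
    gains its inverse, except in the term bounded through the L^1 norm of [th1], which only sees the
    inverse. *)
Definition Cupper : R := 2 * (CR + CP + CP * Num.sqrt (7 * beta) / sK).

Lemma Cupper_gt0 : 0 < Cupper.
Proof.
have cp := CP_gt0 hb hkappa hgamma; have cr := CR_ge0 hb hkappa hgamma.
have h : 0 <= CP * Num.sqrt (7 * beta) / sK by rewrite divr_ge0 ?mulr_ge0 ?sqrtr_ge0// ltW.
by apply: mulr_gt0 => //; rewrite ltr_pwDl// ltr_wpDl.
Qed.

Lemma solution_upper t : 0 < t -> nrm (th t) <= Cupper * rate n t * dnorm u0 u1 th0 th1.
Proof.
move=> t0; have [q0 [p0 [w0 [v0 [y1 [x1 [[q02 w02 y12 hq] [p02 v02 x12 hp] F]]]]]]] := solution_transform.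
have [c12 s12] := th1_transform; have s0 := sK_gt0 R n.
have [t11 t12] := th1_L12.
have [n1 n2] := isF_nrm_le (isF_L12 th1_L12).
pose M1 := \int[mu]_x `|th1 x|.
have M10 : 0 <= M1 by apply: Rintegral_ge0.
have b1 := @Qf_upper _ _ _ _ _ hn hb hkappa hgamma _ _ _ _ q02 c12 w02 y12 t M1 t0 M10 (fun xi => cosT_le xi t11).
have b2 := @Qf_upper _ _ _ _ _ hn hb hkappa hgamma _ _ _ _ p02 s12 v02 x12 t M1 t0 M10
  (fun xi => eq_ind_r (fun z => z <= M1) (sinT_le xi t11) (normrN (sinT th1 xi))).
apply: le_trans (isF_nrm_ge (F t (ltW t0))) _; rewrite ler_pdivrMl//.
have cr0 := CR_ge0 hb hkappa hgamma; have cp0 := CP_gt0 hb hkappa hgamma.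
have r1 := rate_ge1 n (ltW t0).
have bq0 : 0 <= CP * Num.sqrt (7 * beta) by rewrite mulr_ge0 ?sqrtr_ge0// ltW.
have S00 : 0 <= S0 by apply: sumr_ge0 => k _; exact: nrm_ge0.
have S10 : 0 <= S1 by apply: sumr_ge0 => k _; exact: nrm_ge0.
have T0 := nrm_ge0 mu th0; have T1 := nrm_ge0 mu th1.
have e : sK * (Cupper * rate n t * dnorm u0 u1 th0 th1) =
   2 * rate n t * ((sK * CR + sK * CP + CP * Num.sqrt (7 * beta)) * (S0 + S1 + (nrm th0 + (nrm th1 + M1)))).
  by rewrite /Cupper /dnorm -/M1; field; rewrite gt_eqF.
rewrite e; move: b1 b2 n1 n2 hq hp; rewrite -mulrA.
set B := CP * Num.sqrt (7 * beta); rewrite -/B in bq0.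
have D0 : 0 <= S0 + S1 + (nrm th0 + (nrm th1 + M1)) by rewrite !addr_ge0.
set D := S0 + S1 + (nrm th0 + (nrm th1 + M1)).
move=> b1 b2 n1 n2 hq hp.
(* One estimate for both parts: since the rate is at least 1, it also absorbs the terms that do not
   grow. *)
have g (x y z : R) : x <= sK * (nrm th0 + (S0 + S1)) -> y <= sK * nrm th1 -> z <= CR * x + (B * (rate n t * M1) + CP * y) ->
    z <= rate n t * ((sK * CR + sK * CP + B) * D).
  move=> hx hy hz; apply: le_trans hz _.
  have a1 : CR * x <= sK * CR * D.
    rewrite -mulrA mulrCA ler_wpM2l//; apply: le_trans hx _; rewrite ler_wpM2l ?(ltW s0)// /D; lra.
  have a2 : CP * y <= sK * CP * D.
    rewrite -mulrA mulrCA ler_wpM2l ?(ltW cp0)//; apply: le_trans hy _; rewrite ler_wpM2l ?(ltW s0)// /D; lra.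
  have a3 : B * (rate n t * M1) <= rate n t * (B * D).
    rewrite mulrCA ler_wpM2l ?rate_ge0// ler_wpM2l// /D; lra.
  have a4 : 0 <= sK * CR * D + sK * CP * D by rewrite addr_ge0// !mulr_ge0// ltW.
  have a5 : sK * CR * D + sK * CP * D <= rate n t * (sK * CR * D + sK * CP * D) by rewrite ler_peMl.
  have -> : rate n t * ((sK * CR + sK * CP + B) * D) = rate n t * (sK * CR * D + sK * CP * D) + rate n t * (B * D) by ring.
  by lra.
have h1 := g _ _ _ hq n1; have h2 := g _ _ _ hp n2.
have := h1 _ b1; have := h2 _ b2.
by lra.
Qed.

End transform_data.

End solution.

(** * Lower bound and existence of solutions *)

Section bounds.
Context (R : realType) (n : nat) (b kappa gamma : R).
Hypothesis hn : n = 1%N \/ n = 2%N.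
Hypotheses (hb : 0 < b) (hkappa : 0 < kappa) (hgamma : gamma != 0).
Local Notation E := 'rV[R]_n.
Local Notation mu := (lebesgue_rV R n).
Local Notation L2 := (L2 mu).
Local Notation nrm := (nrm mu).
Local Notation K := (plancherel_cst R n).
Local Notation sK := (Num.sqrt K).
Local Notation Qf := (Qf b kappa gamma).
Local Notation Xf := (Xf b kappa gamma).
Local Notation om := (om b kappa gamma).
Local Notation pc := (pc b kappa gamma).
Local Notation CR := (CR b kappa gamma).

Let n_gt0 : (0 < n)%N. Proof. by case: hn => ->. Qed.

(** The numerator is [gamma^2 b^2] divided by a nonzero number, by the characteristic equation.
    Hence both waves are present in the multiplier of [th1], as [waves_large] needs. *)
Lemma pc_neq0 i : pc i != 0.
Proof.
rewrite /Modal.pc mulf_neq0 ?invr_eq0 ?lamB_neq0// kappa_lamE// mulf_neq0//.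
  by rewrite mulf_neq0// expf_neq0// gt_eqF.
by rewrite invr_eq0 b2_lam_neq0.
Qed.

(** The real part of the transform suffices: its norm is at most [sK] times that of [th t], and near
    the origin it is driven by [cosT th1], which stays close to the total mass. *)
Lemma solution_lower : exists2 c : R, 0 < c &
  forall (u0 u1 : E -> E) (th0 th1 : E -> R), admissible_data u0 u1 th0 th1 ->
  inL11 th1 -> total_mass th1 != 0 ->
  forall u th, is_solution b kappa gamma u0 u1 th0 th1 u th ->
  exists T : R, forall t, T <= t -> 0 <= t /\ c * rate n t * `|total_mass th1| <= nrm (th t).
Proof.
have o1 := om_gt0 hb hkappa hgamma true; have o2 := om_gt0 hb hkappa hgamma false.
have A10 : pc true / om true != 0 by rewrite mulf_neq0 ?pc_neq0// invr_eq0 gt_eqF.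
have A12 : pc true / om true * om true + pc false / om false * om false = 1.
  by rewrite !divfK ?gt_eqF// pc_sum.
have [c0 c0p Hc0] := radial_lower hn o1 o2 (om_neq hb hkappa hgamma) A10 A12.
have s0 := sK_gt0 R n; have sc0 : 0 < Num.sqrt c0 by rewrite sqrtr_gt0.
exists (Num.sqrt c0 / (4 * sK)); first by rewrite divr_gt0// mulr_gt0.
move=> u0 u1 th0 th1 adm t11 P0 u th sol.
have [q0 [p0 [w0 [v0 [y1 [x1 [[q02 w02 y12 _] _ F]]]]]]] := solution_transform hn hb hkappa hgamma adm sol.
have [c12 _] := th1_transform adm.
have [e e0 He] := cosT_near0 t11 P0.
have [T1 HT1] := Hc0 e e0.
pose P := `|total_mass th1|; have Pp : 0 < P by rewrite normr_gt0.
pose M := CR * nrm (Hf q0 w0 y1).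
(* From [T2] on, [M] is at most half of the main term [P / 2] times the square root of [c0] times
   the rate, which explains the 4 in the constant. *)
have [T2 [T20 HT2]] := rate_large n (4 * M / (P * Num.sqrt c0)).
exists (Num.max T1 T2) => t; rewrite ge_max => /andP[t1 t2].
have t0 : 0 < t by exact: lt_le_trans t2.
split; first exact: ltW.
have lo := Qf_lower hb hkappa hgamma q02 c12 w02 y12 t0 (ltW c0p) (ltW Pp) He (HT1 t t1) (lexx M).
have [hF _] := isF_nrm_le (F t (ltW t0)).
have r0 := HT2 t t2; rewrite ler_pdivrMr ?mulr_gt0// in r0.
have -> : Num.sqrt c0 / (4 * sK) * rate n t * `|total_mass th1| = sK^-1 * (P / 4 * Num.sqrt c0 * rate n t).
  by rewrite -/P; field; rewrite gt_eqF.
rewrite ler_pdivrMl//; apply: le_trans hF; apply: le_trans lo.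
have -> : P / 4 * Num.sqrt c0 * rate n t = (rate n t * (P * Num.sqrt c0)) / 4 by ring.
have -> : P / 2 * Num.sqrt c0 * rate n t = (rate n t * (P * Num.sqrt c0)) / 2 by field.
by clear HT2; move: r0; move: (rate n t * (P * Num.sqrt c0)) M => z m; lra.
Qed.

(** The explicit frequency solution is square integrable at each time and has the symmetry of
    transforms of real functions, so [isF_surj] produces real fields having it as transform. *)
Lemma solution_exists (u0 u1 : E -> E) (th0 th1 : E -> R) : admissible_data u0 u1 th0 th1 ->
  exists (u : R -> E -> E) (th : R -> E -> R), is_solution b kappa gamma u0 u1 th0 th1 u th.
Proof.
move=> [[u0H _] [u12 _] /Lfun2P t02 [/Lfun2P t12 _]].
have u02 k : L2 (component u0 k) by apply/Lfun2P; case: (u0H k).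
have u12' k : L2 (component u1 k) by apply/Lfun2P; exact: u12.
(* The transforms of the data are chosen with exact parity at every point, so that no null set
   interferes with the parity of the solution. *)
have tr f : L2 f -> exists cs : (E -> R) * (E -> R), [/\ isF f cs.1 cs.2,
    forall x, cs.1 (- x) = cs.1 x & forall x, cs.2 (- x) = - cs.2 x].
  by move=> /isF_exists[c [s H]]; exists (c, s).
have [A HA] := @choice _ _ _ (fun k => tr _ (u02 k)).
have [B HB] := @choice _ _ _ (fun k => tr _ (u12' k)).
have [C [C1 C2 C3]] := tr _ t02; have [D [D1 D2 D3]] := tr _ t12.
have AF k : isF (component u0 k) (A k).1 (A k).2 by case: (HA k).
have [d1 d2 _ _] := divergence_L2 u0H AF.
have [_ Cc Cs _] := C1; have [_ Dc Ds _] := D1.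
have A1 k : L2 (A k).1 by case: (AF k).
have A2 k : L2 (fun xi => - (A k).2 xi) by apply: L2N; case: (AF k).
have B1 k : L2 (B k).1 by case: (HB k) => -[].
have B2 k : L2 (fun xi => - (B k).2 xi) by case: (HB k) => -[_ _ h _ _ _]; exact: L2N.
pose v0 (xi : E) := \sum_k xi ord0 k * (A k).1 xi.
pose w0 (xi : E) := \sum_k xi ord0 k * - (A k).2 xi.
pose A2' k (xi : E) := - (A k).2 xi; pose B2' k (xi : E) := - (B k).2 xi.
have v0N xi : v0 (- xi) = -1 * v0 xi.
  rewrite /v0 mulr_sumr; apply: eq_bigr => k _; rewrite mxE; case: (HA k) => _ -> _; ring.
have w0N xi : w0 (- xi) = 1 * w0 xi.
  rewrite /w0 mulr_sumr; apply: eq_bigr => k _; rewrite mxE; case: (HA k) => _ _ ->; ring.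
have C2' xi : C.1 (- xi) = 1 * C.1 xi by rewrite mul1r.
have D2' xi : D.1 (- xi) = 1 * D.1 xi by rewrite mul1r.
have C3' xi : C.2 (- xi) = -1 * C.2 xi by rewrite mulN1r.
have D3' xi : D.2 (- xi) = -1 * D.2 xi by rewrite mulN1r.
have A1N k xi : (A k).1 (- xi) = - -1 * (A k).1 xi by case: (HA k) => _ -> _; rewrite opprK mul1r.
have B1N k xi : (B k).1 (- xi) = - -1 * (B k).1 xi by case: (HB k) => _ -> _; rewrite opprK mul1r.
have A2N k xi : A2' k (- xi) = - 1 * A2' k xi by rewrite /A2'; case: (HA k) => _ _ ->; ring.
have B2N k xi : B2' k (- xi) = - 1 * B2' k xi by rewrite /B2'; case: (HB k) => _ _ ->; ring.
(* The time and the component are paired so that a single choice yields all components at all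
   times. *)
have sU (p : R * 'I_n) : exists f, isF f
    (Xf C.2 D.2 v0 (fun k => (A k).1) (fun k => (B k).1) p.2 p.1)
    (fun xi => - Xf C.1 D.1 w0 A2' B2' p.2 p.1 xi).
  apply: isF_surj.
  - exact: (L2_Xf hb hkappa hgamma Cs Ds d1 A1 B1).
  - by apply: L2N; exact: (L2_Xf hb hkappa hgamma Cc Dc d2 A2 B2).
  - move=> xi; rewrite (@Xf_parity _ _ b kappa gamma _ _ _ _ _ (-1))//.
    by rewrite opprK mul1r.
  - by move=> xi; rewrite (@Xf_parity _ _ b kappa gamma _ _ _ _ _ 1)// mulN1r.
have sT (t : R) : exists f, isF f (Qf C.1 D.1 w0 B2' t) (Qf C.2 D.2 v0 (fun k => (B k).1) t).
  apply: isF_surj.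
  - exact: (L2_Qf hb hkappa hgamma Cc Dc d2 B2).
  - exact: (L2_Qf hb hkappa hgamma Cs Ds d1 B1).
  - by move=> xi; rewrite (@Qf_parity _ _ b kappa gamma _ _ _ _ 1)// mul1r.
  - by move=> xi; rewrite (@Qf_parity _ _ b kappa gamma _ _ _ _ (-1))// mulN1r.
have [fu Hfu] := choice sU; have [ft Hft] := choice sT.
pose U0 (xi : E) : 'rV[R[i]]_n := \row_k Complex ((A k).1 xi) ((A k).2 xi).
pose U1 (xi : E) : 'rV[R[i]]_n := \row_k Complex ((B k).1 xi) ((B k).2 xi).
pose Th0 (xi : E) : R[i] := Complex (C.1 xi) (C.2 xi).
pose Th1 (xi : E) : R[i] := Complex (D.1 xi) (D.2 xi).
exists (fun t x => \row_k fu (t, k) x), ft, U0, U1, Th0, Th1,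
  (fun t xi => Usol b kappa gamma xi (U0 xi) (U1 xi) (Th0 xi) (Th1 xi) t),
  (fun t xi => Thsol b kappa gamma xi (U0 xi) (U1 xi) (Th0 xi) (Th1 xi) t).
have ReU0 xi k : complex.Re (U0 xi ord0 k) = (A k).1 xi by rewrite mxE.
have ImU0 xi k : complex.Im (U0 xi ord0 k) = (A k).2 xi by rewrite mxE.
have ReU1 xi k : complex.Re (U1 xi ord0 k) = (B k).1 xi by rewrite mxE.
have ImU1 xi k : complex.Im (U1 xi ord0 k) = (B k).2 xi by rewrite mxE.
have ev0 (xi : E) : \sum_k xi ord0 k * complex.Re (U0 xi ord0 k) = v0 xi by apply: eq_bigr => k _; rewrite ReU0.
have ew0 (xi : E) : \sum_k xi ord0 k * - complex.Im (U0 xi ord0 k) = w0 xi by apply: eq_bigr => k _; rewrite ImU0.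
have ev1 (xi : E) : \sum_k xi ord0 k * complex.Re (U1 xi ord0 k) = v1 (fun k => (B k).1) xi.
  by apply: eq_bigr => k _; rewrite ReU1.
have ew1 (xi : E) : \sum_k xi ord0 k * - complex.Im (U1 xi ord0 k) = v1 B2' xi.
  by apply: eq_bigr => k _; rewrite ImU1.
split.
- move=> k; split; apply/is_fourierP.
    rewrite (_ : (fun xi => complex.Re _) = (A k).1); last by apply/funext => xi; exact: ReU0.
    by rewrite (_ : (fun xi => complex.Im _) = (A k).2)//; apply/funext => xi; exact: ImU0.
  rewrite (_ : (fun xi => complex.Re _) = (B k).1); last by apply/funext => xi; exact: ReU1.
  rewrite (_ : (fun xi => complex.Im _) = (B k).2); last by apply/funext => xi; exact: ImU1.
  by case: (HB k).
- by split; apply/is_fourierP.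
- move=> t t0; split.
    move=> k; apply/is_fourierP.
    rewrite (_ : component _ k = fu (t, k)); last by apply/funext => x; rewrite /component mxE.
    have := Hfu (t, k); rewrite /=; congr isF; apply/funext => xi.
      by rewrite /Usol mxE /= ReU0 ReU1 ev0 ev1.
    by rewrite /Usol mxE /= ImU0 ImU1 ew0 ew1.
  apply/is_fourierP; have := Hft t; congr isF; apply/funext => xi.
    by rewrite /Thsol /= ew0 ew1.
  by rewrite /Thsol /= ev0 ev1.
- move: (ae_enorm_gt0 R n_gt0); apply: filterS => xi r0; exact: ode_exists.
Qed.

End bounds.

Theorem theorem2p4 (R : realType) (n : nat) (b kappa gamma : R)
  (hn : n = 1%N \/ n = 2%N) (hb : 0 < b) (hkappa : 0 < kappa)
  (hgamma : gamma != 0) :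
  [/\ forall (u0 u1 : 'rV[R]_n -> 'rV[R]_n) (th0 th1 : 'rV[R]_n -> R),
        admissible_data u0 u1 th0 th1 ->
        exists (u : R -> 'rV[R]_n -> 'rV[R]_n) (th : R -> 'rV[R]_n -> R),
          is_solution b kappa gamma u0 u1 th0 th1 u th,
      exists C : R, 0 < C /\
        forall (u0 u1 : 'rV[R]_n -> 'rV[R]_n) (th0 th1 : 'rV[R]_n -> R),
        admissible_data u0 u1 th0 th1 ->
        forall (u : R -> 'rV[R]_n -> 'rV[R]_n) (th : R -> 'rV[R]_n -> R),
        is_solution b kappa gamma u0 u1 th0 th1 u th ->
        C0_L2 th /\
        forall t : R, 0 < t ->
          (L2norm (th t) <= (C * rate n t)%:E * data_norm u0 u1 th0 th1)%E
    & let a0 := alpha0 b kappa gamma in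
      let a1 := alpha1 b kappa gamma in
      let a2 := alpha2 b kappa gamma in
      (n = 2%N ->
         2 * (a0 + a2) ^+ 2 * (a1 + a2) < (a0 - a2) ^+ 2 * (a1 - a2) \/
         2 * (a0 - a2) ^+ 2 * (a1 - a2) < (a0 + a2) ^+ 2 * (a1 + a2)) ->
      exists c : R, 0 < c /\
        forall (u0 u1 : 'rV[R]_n -> 'rV[R]_n) (th0 th1 : 'rV[R]_n -> R),
        admissible_data u0 u1 th0 th1 -> inL11 th1 -> total_mass th1 != 0 ->
        forall (u : R -> 'rV[R]_n -> 'rV[R]_n) (th : R -> 'rV[R]_n -> R),
        is_solution b kappa gamma u0 u1 th0 th1 u th ->
        exists T : R, forall t : R, T <= t ->
          ((c * rate n t * `|total_mass th1|)%:E <= L2norm (th t))%E].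
Proof.
split.
- by move=> u0 u1 th0 th1; exact: solution_exists.
- exists (Cupper n b kappa gamma); split; first exact: Cupper_gt0.
  move=> u0 u1 th0 th1 adm u th sol; have cont := solution_continuous hn hb hkappa hgamma adm sol.
  split=> // t t0; have [/Lfun2P th2 _] := cont t (ltW t0).
  rewrite /L2norm Lnorm_nrm//.
  have C0 : 0 <= Cupper n b kappa gamma * rate n t.
    by rewrite mulr_ge0 ?rate_ge0// ltW// Cupper_gt0.
  apply: (le_trans _ (lee_wpmul2l _ (dnorm_le adm))); last by rewrite lee_fin.
  by rewrite -EFinM lee_fin; exact: (solution_upper hn hb hkappa hgamma adm sol t0).
move=> a0 a1 a2 _; have [c c0 H] := solution_lower hn hb hkappa hgamma.
exists c; split=> // u0 u1 th0 th1 adm t11 P0 u th sol.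
have [T HT] := H u0 u1 th0 th1 adm t11 P0 u th sol; exists T => t Tt.
have [t0 h] := HT t Tt.
have [/Lfun2P th2 _] := solution_continuous hn hb hkappa hgamma adm sol t0.
by rewrite /L2norm Lnorm_nrm// lee_fin.
Qed.
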